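(* Let $\phi_1,\dots,\phi_n$ be CM Drinfeld modules of ranks $r_1,\dots,r_n\ge2$ defined over $\overline{K}$. Suppose that for each $1\le i\le n$ the endomorphism algebra $\mathcal{K}_i:=\mathbb{F}_q(t)\otimes_{\mathbb{F}_q[t]}\mathrm{End}(\Lambda_{\phi_i})$ is Galois over $\mathbb{F}_q(t)$, and that $\mathcal{K}_i\cap\mathcal{K}_j=\mathbb{F}_q(t)$ for all $i\neq j$. Let $\overline{K}(\cup_{i=1}^nP_{\phi_i})$ be the field generated over $\overline{K}$ by the entries of all the period matrices $P_{\phi_1},\dots,P_{\phi_n}$. Then \[\mathrm{trdeg}_{\overline{K}}\,\overline{K}\big(\cup_{i=1}^nP_{\phi_i}\big)=(r_1+\dots+r_n)-(n-1).\] In particular, if for each $i$ we choose a nonzero $\lambda_i\in\Lambda_{\phi_i}$, then $\mathrm{trdeg}_{\overline{K}}\,\overline{K}(\lambda_1/\widetilde{\pi},\dots,\lambda_n/\widetilde{\pi})=n$.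
   Context: $\mathbb{F}_q$ finite field, $A=\mathbb{F}_q[\theta]$, $K=\mathbb{F}_q(\theta)$, $K_\infty=\mathbb{F}_q((\theta^{-1}))$, $\mathbb{C}_\infty$ completion of an algebraic closure of $K_\infty$, $\overline{K}$ algebraic closure of $K$ in $\mathbb{C}_\infty$; $t$ an indeterminate, $\mathbb{F}_q[t]\cong A$ via $t\mapsto\theta$, $a(\theta)=a|_{t=\theta}$. $\widetilde{\pi}=-(-\theta)^{q/(q-1)}\prod_{i\ge1}(1-\theta^{1-q^i})^{-1}$ (Carlitz period). A Drinfeld module of rank $r$ over $\overline{K}$ is an $\mathbb{F}_q$-algebra homomorphism $\phi:\mathbb{F}_q[t]\to\overline{K}[\tau]$ ($\tau\alpha=\alpha^q\tau$) with $\phi_a=a(\theta)+\dots+g\tau^{r\deg a}$, $g\neq0$. $\exp_\phi$ is the unique entire $\mathbb{F}_q$-linear series $X+\dots$ with $\phi_t(\exp_\phi X)=\exp_\phi(\theta X)$; $\Lambda_\phi=\ker\exp_\phi$ (rank $r$ $A$-lattice). $\mathrm{End}(\Lambda_\phi)=\{c\in\mathbb{C}_\infty:c\Lambda_\phi\subset\Lambda_\phi\}$, an $\mathbb{F}_q[t]$-module with $t$ acting as $\theta$, so $\mathcal{K}_i$ is identified with the subfield of $\mathbb{C}_\infty$ generated by $\mathrm{End}(\Lambda_{\phi_i})$ over $K\cong\mathbb{F}_q(t)$ (intersections taken in $\mathbb{C}_\infty$); $\phi$ is CM if this has rank $r$. Quasi-periodic functions: a $\phi$-biderivation is an $\mathbb{F}_q$-linear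 $\delta:\mathbb{F}_q[t]\to\mathbb{C}_\infty[\tau]\tau$ with $\delta(ab)=a(\theta)\delta(b)+\delta(a)\phi_b$; there is a unique $\mathbb{F}_q$-linear entire $F^\phi_\delta(X)\in X^q\mathbb{C}_\infty[[X]]$ with $F^\phi_\delta(a(\theta)X)-a(\theta)F^\phi_\delta(X)=\delta_a(\exp_\phi X)$ for all $a$. For $1\le i\le r-1$, $F^\phi_{\tau^i}$ is the one for $\delta(t)=\tau^i$. For an $A$-basis $w_1,\dots,w_r$ of $\Lambda_\phi$, the period matrix $P_\phi$ is the $r\times r$ matrix whose $j$-th row is $(-w_j,F^\phi_\tau(w_j),\dots,F^\phi_{\tau^{r-1}}(w_j))$ (the generated field does not depend on the basis). *)

(* Defs.v *)
From HB Require Import structures.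
From mathcomp Require Import all_boot all_order all_algebra all_field.
From mathcomp Require mpoly.

Set Implicit Arguments.
Unset Strict Implicit.
Unset Printing Implicit Defensive.

Import Order.TTheory GRing.Theory Num.Theory.

(* In a module of its own because the notations of mpoly clash with those of
   mathcomp-analysis. *)
Module AlgIndependent.
Import mpoly.
Local Open Scope ring_scope.

Definition alg_independent (C : fieldType) (k : C -> Prop) (d : nat)
    (b : 'I_d -> C) : Prop :=
  forall p : {mpoly C[d]}, (forall m, k p@_m) -> p.@[b] = 0 -> p = 0.

End AlgIndependent.
Export AlgIndependent.

From mathcomp Require Import all_classical all_reals all_analysis.
Import numFieldNormedType.Exports.
Local Open Scope classical_set_scope.
Local Open Scope ring_scope.

Definition is_subfield (C : fieldType) (L : set C) : Prop :=
  GRing.divring_closed (mem L).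

Definition field_adjoin (C : fieldType) (k S : set C) : set C :=
  smallest (@is_subfield C) (k `|` S).

Definition algebraic_over (C : fieldType) (k : set C) (x : C) : Prop :=
  exists p : {poly C}, [/\ p != 0, forall i, k p`_i & root p x].

Definition has_trdeg (C : fieldType) (k L : set C) (d : nat) : Prop :=
  exists b : 'I_d -> C,
    [/\ forall i, L (b i),
        alg_independent k b
      & forall x, L x -> algebraic_over (field_adjoin k (range b)) x].

Definition abs_cvg (R : realType) (V : zmodType) (N : V -> R)
    (u : nat -> V) (l : V) : Prop :=
  (fun n => N (u n - l)) @ \oo --> (0 : R).

Definition abs_cauchy (R : realType) (V : zmodType) (N : V -> R)
    (u : nat -> V) : Prop :=
  forall e : R, 0 < e ->
    exists n0, forall m n, (n0 <= m)%N -> (n0 <= n)%N -> N (u m - u n) < e.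

(* A = F[theta] and F[t] are both {poly F}, and K = F(theta) and F(t) are both
   {fraction {poly F}}: the isomorphism t |-> theta is the identity. *)
Notation ratfun F := {fraction {poly F}}.

(* F((theta^-1)) inside a valued extension (C, N) of K: the sums of the
   convergent series \sum_i a_i theta^(d - i). *)
Definition laurent_sums (F : finFieldType) (R : realType) (C : fieldType)
    (iota : ratfun F -> C) (N : C -> R) : set C :=
  [set x | exists (d : nat) (a : nat -> F),
    abs_cvg N
      (fun n => \sum_(i < n)
         iota (tofrac (a i)%:P) * iota (tofrac 'X) ^+ d
           * iota (tofrac 'X) ^- i)
      x].

(* C_oo is characterised up to isometric K-isomorphism as a complete,
   algebraically closed, non-archimedean valued extension of K, with
   |theta| = q, in which the algebraic closure of K_oo is dense. *)
Record Cinfty (F : finFieldType) (R : realType) := MkCinfty {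
  cfield :> fieldType;
  ofK : {rmorphism ratfun F -> cfield};
  absC : cfield -> R;
  absC_ge0 : forall x, 0 <= absC x;
  absC_eq0 : forall x, absC x = 0 <-> x = 0;
  absC_mul : forall x y, absC (x * y) = absC x * absC y;
  absC_add : forall x y, absC (x + y) <= Num.max (absC x) (absC y);
  absC_theta : absC (ofK (tofrac 'X)) = #|F|%:R;
  absC_complete : forall u, abs_cauchy absC u -> exists l, abs_cvg absC u l;
  cfield_closed : GRing.closed_field_axiom cfield;
  cfield_dense : forall (x : cfield) (e : R), 0 < e ->
    exists2 y, algebraic_over (laurent_sums ofK absC) y & absC (x - y) < e
}.

Definition ofA (F : finFieldType) (R : realType) (C : Cinfty F R)
  (a : {poly F}) : C := ofK C (tofrac a).

Definition ofF (F : finFieldType) (R : realType) (C : Cinfty F R)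
  (c : F) : C := ofA C c%:P.

Definition theta (F : finFieldType) (R : realType) (C : Cinfty F R) : C :=
  ofA C 'X.

Definition Kset (F : finFieldType) (R : realType) (C : Cinfty F R) : set C :=
  range (ofK C).
Arguments Kset {F R} C _.

Definition Kbar (F : finFieldType) (R : realType) (C : Cinfty F R) : set C :=
  [set x | algebraicOver (ofK C) x].
Arguments Kbar {F R} C _.

(* The value depends on a choice of root w = (-theta)^(1/(q-1)). *)
Definition is_carlitz_period (F : finFieldType) (R : realType)
    (C : Cinfty F R) (p : C) : Prop :=
  exists2 w : C, w ^+ (#|F| - 1) = - theta C &
    abs_cvg (@absC F R C)
      (fun n => - w ^+ #|F|
                * \prod_(1 <= i < n.+1) (1 - theta C ^- (#|F| ^ i - 1))^-1)
      p.

(* {poly C} also serves as the underlying F-vector space of C[tau], 'X^i standing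
   for tau^i; the ring product of C[tau] is [tmul], not that of {poly C}. *)
Definition tmul (F : finFieldType) (R : realType) (C : Cinfty F R)
    (P Q : {poly C}) : {poly C} :=
  \sum_(i < size P) \sum_(j < size Q)
    (P`_i * Q`_j ^+ (#|F| ^ i)) *: 'X^(i + j).

Definition teval (F : finFieldType) (R : realType) (C : Cinfty F R)
    (P : {poly C}) (x : C) : C :=
  \sum_(i < size P) P`_i * x ^+ (#|F| ^ i).

Record drinfeld_module (F : finFieldType) (R : realType) (C : Cinfty F R)
    (r : nat) (phi : {poly F} -> {poly C}) : Prop := {
  drinfeld_rank : (0 < r)%N;
  drinfeldD : forall a b, phi (a + b) = phi a + phi b;
  drinfeldZ : forall (c : F) a, phi (c *: a) = ofF C c *: phi a;
  drinfeld1 : phi 1 = 1;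
  drinfeldM : forall a b, phi (a * b) = tmul (phi a) (phi b);
  drinfeld_Kbar : forall a i, Kbar C (phi a)`_i;
  drinfeld_coef0 : forall a, (phi a)`_0 = ofA C a;
  drinfeld_size : forall a, a != 0 -> size (phi a) = (r * (size a).-1).+1
}.

Definition Fq_linear (F : finFieldType) (R : realType) (C : Cinfty F R)
    (f : C -> C) : Prop :=
  (forall x y, f (x + y) = f x + f y) /\
  (forall (c : F) x, f (ofF C c * x) = ofF C c * f x).

Definition entire_sum (F : finFieldType) (R : realType) (C : Cinfty F R)
    (c : nat -> C) (f : C -> C) : Prop :=
  forall x, abs_cvg (@absC F R C) (fun n => \sum_(i < n) c i * x ^+ i) (f x).

Definition is_drinfeld_exp (F : finFieldType) (R : realType) (C : Cinfty F R)
    (phi : {poly F} -> {poly C}) (f : C -> C) : Prop :=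
  [/\ Fq_linear f,
      exists c : nat -> C, [/\ c 0%N = 0, c 1%N = 1 & entire_sum c f]
    & forall x, teval (phi 'X) (f x) = f (theta C * x)].

Definition drinfeld_exp (F : finFieldType) (R : realType) (C : Cinfty F R)
    (phi : {poly F} -> {poly C}) : C -> C :=
  xget (fun=> 0) [set f | is_drinfeld_exp phi f].

Definition period_lattice (F : finFieldType) (R : realType) (C : Cinfty F R)
    (phi : {poly F} -> {poly C}) : set C :=
  [set x | drinfeld_exp phi x = 0].

Definition A_free (F : finFieldType) (R : realType) (C : Cinfty F R)
    (r : nat) (w : 'I_r -> C) : Prop :=
  forall a : 'I_r -> {poly F},
    \sum_j ofA C (a j) * w j = 0 -> forall j, a j = 0.

Definition A_basis (F : finFieldType) (R : realType) (C : Cinfty F R)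
    (M : set C) (r : nat) (w : 'I_r -> C) : Prop :=
  [/\ forall j, M (w j),
      A_free w
    & forall x, M x ->
        exists a : 'I_r -> {poly F}, x = \sum_j ofA C (a j) * w j].

Definition A_rank (F : finFieldType) (R : realType) (C : Cinfty F R)
    (M : set C) (r : nat) : Prop :=
  (exists2 b : 'I_r -> C, (forall j, M (b j)) & A_free b) /\
  (forall b : 'I_r.+1 -> C, (forall j, M (b j)) -> ~ A_free b).

Definition lattice_End (F : finFieldType) (R : realType) (C : Cinfty F R)
    (L : set C) : set C :=
  [set c | forall x, L x -> L (c * x)].

Definition is_CM (F : finFieldType) (R : realType) (C : Cinfty F R)
    (r : nat) (phi : {poly F} -> {poly C}) : Prop :=
  A_rank (lattice_End (period_lattice phi)) r.

Definition endo_field (F : finFieldType) (R : realType) (C : Cinfty F R)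
    (phi : {poly F} -> {poly C}) : set C :=
  field_adjoin (Kset C) (lattice_End (period_lattice phi)).

(* L/K is algebraic, separable and normal: the minimal polynomial over K of
   every element of L is separable and splits in L. *)
Definition galois_over_K (F : finFieldType) (R : realType) (C : Cinfty F R)
    (L : set C) : Prop :=
  [/\ is_subfield L,
      Kset C `<=` L
    & forall x, L x -> exists p : {poly ratfun F},
        [/\ irreducible_poly p,
            root (map_poly (ofK C) p) x,
            separable_poly p
          & exists2 s : seq C, (forall y, y \in s -> L y) &
              map_poly (ofK C) p
                = ofK C (lead_coef p) *: \prod_(y <- s) ('X - y%:P)]].

Definition is_biderivation (F : finFieldType) (R : realType) (C : Cinfty F R)
    (phi delta : {poly F} -> {poly C}) : Prop :=
  [/\ (forall a b, delta (a + b) = delta a + delta b),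
      (forall (c : F) a, delta (c *: a) = ofF C c *: delta a),
      (forall a, (delta a)`_0 = 0)
    & forall a b,
        delta (a * b) = ofA C a *: delta b + tmul (delta a) (phi b)].

Definition is_quasi_periodic (F : finFieldType) (R : realType)
    (C : Cinfty F R) (phi delta : {poly F} -> {poly C}) (f : C -> C) : Prop :=
  [/\ Fq_linear f,
      exists c : nat -> C,
        (forall i, (i < #|F|)%N -> c i = 0) /\ entire_sum c f
    & forall a x,
        f (ofA C a * x) - ofA C a * f x = teval (delta a) (drinfeld_exp phi x)].

Definition quasi_periodic (F : finFieldType) (R : realType) (C : Cinfty F R)
    (phi delta : {poly F} -> {poly C}) : C -> C :=
  xget (fun=> 0) [set f | is_quasi_periodic phi delta f].

Definition biderivation_tau (F : finFieldType) (R : realType) (C : Cinfty F R)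
    (phi : {poly F} -> {poly C}) (i : nat) : {poly F} -> {poly C} :=
  xget (fun=> 0)
    [set delta | is_biderivation phi delta /\ delta 'X = 'X^i].

Definition period_matrix (F : finFieldType) (R : realType) (C : Cinfty F R)
    (phi : {poly F} -> {poly C}) (r : nat) (w : 'I_r -> C) : 'M[C]_r :=
  \matrix_(j < r, k < r)
    if (k : nat) == 0%N then - w j
    else quasi_periodic phi (biderivation_tau phi k) (w j).

(* Main.v *)
Require Import Defs.
From HB Require Import structures.
From mathcomp Require Import all_boot all_order all_algebra all_fingroup.
From mathcomp Require Import all_solvable all_field.
From mathcomp Require Import all_classical all_reals all_analysis.
From mathcomp Require Import ring lra zify.

Set Implicit Arguments.
Unset Strict Implicit.
Unset Printing Implicit Defensive.

Import Order.TTheory GRing.Theory Num.Theory.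
Local Open Scope classical_set_scope.
Local Open Scope ring_scope.

(* The values at [theta] of the Anderson generating functions of a Drinfeld module are, over [Kbar],
   its periods and quasi-periods, and the generating functions solve a Frobenius difference system.
   Complex multiplication diagonalises this system over an extension of the field of constants
   [F(t)]: the eigenvectors are functions [y_{i,k}], indexed by the embeddings of the CM field
   [K_i], that satisfy difference equations of rank one.  A criterion of Anderson, Brownawell and
   Papanikolas lifts a [Kbar]-linear relation between monomials in the values [y_{i,k}(theta)] to a
   relation between functions, and such a relation splits along the isomorphism classes of the
   rank one equations.  Comparing the orders of the multipliers at the twists of the points above
   [theta] bounds these classes: isomorphic monomials have the same weight under every element of
   the Galois group of the compositum.  Since the fields [K_i] are Galois with pairwise intersection
   [F(t)], this leaves only the relations that identify the norms [\prod_k y_{i,k}], all of which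
   are algebraic multiples of the Carlitz period. *)

(** * Formal power series *)

(** The hypothesis on the fields is weaker than linear disjointness: three quadratic fields inside
    one biquadratic field meet pairwise in the base field. What survives is that the subgroups
    fixing two different fields generate the Galois group; averaging the weight identities over one
    such subgroup isolates one field at a time. Algebraic functions need no branches: an element of
    the compositum is a polynomial in a variable modulo the minimal polynomial of a primitive
    element. Over [C(t)] that polynomial may factor, so the quotient need not be a field; but it has
    no proper nonzero Frobenius-stable ideal, and this is enough for minimal support arguments.
    Complex multiplication reaches the functions by conjugating the matrix of multiplication by [c]
    with the matrix of twisted generating functions. The result has power series entries, and its
    compatibility with Frobenius propagates one bound to ever larger discs until almost all
    coefficients vanish. The solution vectors use the twists of index 1 to [r] of a generating
    function, since the untwisted one has a pole at [theta]. *)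

Record fps (K : fieldType) := Fps { fcoef :> nat -> K }.

HB.instance Definition _ (K : fieldType) := gen_eqMixin (fps K).
HB.instance Definition _ (K : fieldType) := gen_choiceMixin (fps K).

Section FpsRing.
Context (K : fieldType).
Implicit Types a b c : fps K.

Lemma fpsP a b : (forall i, a i = b i) <-> a = b.
Proof.
split=> [|-> //]; case: a b => [a] [b] /= ab.
by congr Fps; apply/funext.
Qed.

Definition fadd a b := Fps (fun i => a i + b i).
Definition fopp a := Fps (fun i => - a i).
Definition fzero : fps K := Fps (fun=> 0).
Definition fone : fps K := Fps (fun i => (i == 0%N)%:R).
Definition fmul a b := Fps (fun n => \sum_(j < n.+1) a j * b (n - j)%N).

Fact faddA : associative fadd.
Proof. by move=> a b c; apply/fpsP => i; apply: addrA. Qed.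
Fact faddC : commutative fadd.
Proof. by move=> a b; apply/fpsP => i; apply: addrC. Qed.
Fact fadd0 : left_id fzero fadd.
Proof. by move=> a; apply/fpsP => i; apply: add0r. Qed.
Fact faddN : left_inverse fzero fopp fadd.
Proof. by move=> a; apply/fpsP => i; apply: addNr. Qed.

HB.instance Definition _ := GRing.isZmodule.Build (fps K) faddA faddC fadd0 faddN.

Definition ftrunc n a : {poly K} := \poly_(i < n) a i.

(** An index below [N] only sees the truncations at [N], so the ring axioms for series reduce to
    those for polynomials. *)
Lemma fmul_trunc a b n N : (n < N)%N ->
  fmul a b n = (ftrunc N a * ftrunc N b)`_n.
Proof.
move=> nN; rewrite coefM; apply: eq_bigr => [[j /=]]; rewrite ltnS => jn _.
by rewrite !coef_poly (leq_ltn_trans jn nN) (leq_ltn_trans (leq_subr _ _) nN).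
Qed.

Fact fmulC : commutative fmul.
Proof.
by move=> a b; apply/fpsP => i; rewrite !(fmul_trunc _ _ (ltnSn i)) mulrC.
Qed.

Fact fmulA : associative fmul.
Proof.
move=> a b c; apply/fpsP => i.
have h (x y z : fps K) : fmul x (fmul y z) i =
    (ftrunc i.+1 x * (ftrunc i.+1 y * ftrunc i.+1 z))`_i.
  rewrite coefM; apply: eq_bigr => -[j] ji _.
  rewrite coef_poly ji (@fmul_trunc _ _ (i - j)%N i.+1) // ltnS leq_subr //.
by rewrite h fmulC h mulrA mulrC.
Qed.

Fact fmul1 : left_id fone fmul.
Proof.
move=> a; apply/fpsP => i; rewrite /= big_ord_recl /= mul1r subn0.
by rewrite big1 ?addr0 // => j _; rewrite mul0r.
Qed.

Fact fmulDl : left_distributive fmul fadd.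
Proof.
move=> a b c; apply/fpsP => i /=; rewrite -big_split /=.
by apply: eq_bigr => j _; rewrite mulrDl.
Qed.

Fact fone_neq0 : fone != 0.
Proof. by apply/eqP => /fpsP/(_ 0%N) /eqP; rewrite oner_eq0. Qed.

HB.instance Definition _ := GRing.Zmodule_isComNzRing.Build (fps K)
  fmulA fmulC fmul1 fmulDl fone_neq0.

Lemma fcoefM a b n : (a * b) n = \sum_(j < n.+1) a j * b (n - j)%N.
Proof. by []. Qed.
Lemma fcoefD a b n : (a + b) n = a n + b n. Proof. by []. Qed.
Lemma fcoefN a n : (- a) n = - a n. Proof. by []. Qed.
Lemma fcoefB a b n : (a - b) n = a n - b n. Proof. by []. Qed.
Lemma fcoef0 n : (0 : fps K) n = 0. Proof. by []. Qed.
Lemma fcoef1 n : (1 : fps K) n = (n == 0%N)%:R. Proof. by []. Qed.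
Lemma fcoef_sum (I : Type) (r : seq I) (P : pred I) (f : I -> fps K) n :
  (\sum_(i <- r | P i) f i) n = \sum_(i <- r | P i) f i n.
Proof. by elim/big_rec2: _ => //= i x y _ <-. Qed.

Lemma fcoefM0 a b : (a * b) 0%N = a 0%N * b 0%N.
Proof. by rewrite fcoefM big_ord1. Qed.

Fact fps_integral_subproof a b : a * b = 0 -> (a == 0) || (b == 0).
Proof.
move=> ab0; apply/norP => -[a0 b0].
have nz (x : fps K) : x != 0 -> exists n, x n != 0.
  move=> x0; apply: contrapT => h; case/eqP: x0; apply/fpsP => i.
  by apply/eqP/negPn/negP => xi; apply: h; exists i.
case: (ex_minnP (nz _ a0)) => n an ltn.
case: (ex_minnP (nz _ b0)) => m bm ltm.
move/fpsP/(_ (n + m)%N)/eqP: ab0; rewrite fcoefM fcoef0.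
have nm : (n < (n + m).+1)%N by rewrite ltnS leq_addr.
rewrite (bigD1 (Ordinal nm)) //= addKn big1 ?addr0 ?mulf_eq0 ?(negPf an) ?(negPf bm) //.
move=> [j /= jnm] /eqP jn; have [jln|nlj|jn'] := ltngtP j n.
- suff -> : a j = 0 by rewrite mul0r.
  by apply/eqP/negPn/negP => /ltn; rewrite leqNgt jln.
- suff -> : b (n + m - j)%N = 0 by rewrite mulr0.
  apply/eqP/negPn/negP => /ltm; lia.
- by case: jn; apply/val_inj.
Qed.

(** Inverses come from classical choice; [funit_coef0] later supplies the units that occur. *)
Definition funitb a : bool := `[< exists b, b * a = 1 >].
Definition finv a : fps K := xget a [set b | b * a = 1].
Fact fmulVr : {in funitb, left_inverse 1 finv *%R}.
Proof. by move=> a /asboolP[b ba]; rewrite /finv; case: xgetP => [c -> //|/(_ b)]. Qed.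
Fact funitP a b : b * a = 1 -> funitb a.
Proof. by move=> h; apply/asboolP; exists b. Qed.
Fact finv_out : {in [predC funitb], finv =1 id}.
Proof.
move=> a /asboolP h; rewrite /finv; case: xgetP => [c _ hc|//].
by case: h; exists c.
Qed.
HB.instance Definition _ := GRing.ComNzRing_hasMulInverse.Build (fps K)
  fmulVr funitP finv_out.
HB.instance Definition _ := GRing.ComUnitRing_isIntegral.Build (fps K)
  fps_integral_subproof.

Definition pfps (p : {poly K}) : fps K := Fps (fun i => p`_i).
Fact pfps_is_zmod_morphism : zmod_morphism pfps.
Proof. by move=> p q; apply/fpsP => i; rewrite /= coefB. Qed.
HB.instance Definition _ := GRing.isZmodMorphism.Build _ _ pfps
  pfps_is_zmod_morphism.
Fact pfps_is_monoid_morphism : monoid_morphism pfps.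
Proof.
split; first by apply/fpsP => i; rewrite /= coef1.
by move=> p q; apply/fpsP => i; rewrite fcoefM /= coefM.
Qed.
HB.instance Definition _ := GRing.isMonoidMorphism.Build _ _ pfps
  pfps_is_monoid_morphism.

Lemma pfps_inj : injective pfps.
Proof. by move=> p q /fpsP pq; apply/polyP => i; apply: pq. Qed.

Lemma fcoefCM (c : K) a i : (pfps c%:P * a) i = c * a i.
Proof.
rewrite fcoefM big_ord_recl /= subn0 coefC eqxx big1 ?addr0 // => j _.
by rewrite coefC mul0r.
Qed.

Lemma fcoefXM a i : (pfps 'X * a) i = if i is j.+1 then a j else 0.
Proof.
case: i => [|i]; first by rewrite fcoefM0 /= coefX mul0r.
rewrite fcoefM big_ord_recl /= coefX mul0r add0r big_ord_recl /= coefX /= mul1r.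
by rewrite subSS subn0 big1 ?addr0 // => j _; rewrite coefX mul0r.
Qed.

Lemma fcoefXsubM x a i :
  (pfps ('X - x%:P) * a) i = (if i is j.+1 then a j else 0) - x * a i.
Proof. by rewrite rmorphB mulrBl fcoefB fcoefXM fcoefCM. Qed.

Lemma funit_coef0 a : a 0%N != 0 -> a \is a GRing.unit.
Proof.
move=> a0.
(* [g n] lists the first [n] coefficients of the inverse; each new one is forced by one coefficient
   of the product. *)
pose g := fix g (n : nat) : seq K := if n is m.+1 then
  let s := g m in
  rcons s (((n == 1%N)%:R - \sum_(j < m) s`_j * a (m - j)%N) / a 0%N) else [::].
have sg n : size (g n) = n by elim: n => //= n IH; rewrite size_rcons IH.
have ext n i : (i < n)%N -> (g n)`_i = (g i.+1)`_i.
  elim: n => // n IH; rewrite ltnS leq_eqVlt => /orP[/eqP -> //|lt].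
  by rewrite /= nth_rcons sg lt IH.
pose b := Fps (fun n => (g n.+1)`_n).
suff h : b * a = 1 by apply/unitrP; exists b; rewrite [a * b]mulrC h.
apply/fpsP => n; rewrite fcoef1.
have -> : (b * a) n = \sum_(j < n) b j * a (n - j)%N + b n * a 0%N.
  by rewrite fcoefM big_ord_recr /= subnn.
have -> : b n = ((n == 0%N)%:R - \sum_(j < n) (g n)`_j * a (n - j)%N) / a 0%N.
  by rewrite /= nth_rcons sg ltnn eqxx.
rewrite mulfVK //; set S := (X in X + _); set S' := (X in _ - X).
suff -> : S = S' by rewrite addrCA subrr addr0.
by apply: eq_bigr => -[j jn] _ /=; rewrite (ext n).
Qed.

End FpsRing.

Section FpsMap.
Context (K K' : fieldType) (f : {rmorphism K -> K'}).
Definition fmap (a : fps K) : fps K' := Fps (fun i => f (a i)).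
Fact fmap_is_zmod_morphism : zmod_morphism fmap.
Proof. by move=> p q; apply/fpsP => i; rewrite /= rmorphB. Qed.
HB.instance Definition _ := GRing.isZmodMorphism.Build _ _ fmap
  fmap_is_zmod_morphism.
Fact fmap_is_monoid_morphism : monoid_morphism fmap.
Proof.
split; first by apply/fpsP => i; rewrite /= rmorph_nat.
move=> p q; apply/fpsP => i; rewrite fcoefM /= rmorph_sum.
by apply: eq_bigr => j _; rewrite rmorphM.
Qed.
HB.instance Definition _ := GRing.isMonoidMorphism.Build _ _ fmap
  fmap_is_monoid_morphism.
Lemma fmap_pfps p : fmap (pfps p) = pfps (map_poly f p).
Proof. by apply/fpsP => i; rewrite /= coef_map. Qed.
Lemma fmapE a i : fmap a i = f (a i). Proof. by []. Qed.
End FpsMap.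

(** * The valued field C and its Frobenius *)

Lemma expr_small (R : realType) (c e : R) : 0 <= c -> c < 1 -> 0 < e ->
  exists n0, forall n, (n0 <= n)%N -> c ^+ n < e.
Proof.
move=> c0 c1 e0.
have /cvgrPdist_lt/(_ _ e0)[n0 _ h] : GRing.exp c @ \oo --> 0.
  by apply: cvg_expr; rewrite ger0_norm.
exists n0 => n nn; have := h n nn; rewrite /= sub0r normrN ger0_norm //.
exact: exprn_ge0.
Qed.

Lemma expr_big (R : realType) (c M : R) : 1 < c ->
  exists n0, forall n, (n0 <= n)%N -> M < c ^+ n.
Proof.
move=> c1; have c0 : 0 < c by apply: lt_trans c1.
have M0 : 0 < `|M| + 1 by rewrite ltr_wpDl.
have [||| n0 h] := @expr_small R c^-1 (`|M| + 1)^-1.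
- by rewrite invr_ge0 ltW.
- by rewrite invf_lt1.
- by rewrite invr_gt0.
exists n0 => n /h; rewrite exprVn ltf_pV2 ?posrE ?exprn_gt0 //.
by apply: le_lt_trans; rewrite ler_wpDr // ler_norm.
Qed.

Section Valued.
Context (F : finFieldType) (R : realType) (C : Cinfty F R).
Local Notation q := #|F|.
Local Notation N := (@absC F R C).
Implicit Types x y z : C.

Lemma q_gt1 : (1 < q)%N. Proof. exact: finNzRing_gt1. Qed.
Lemma q_gt0 : (0 < q)%N. Proof. exact: ltnW q_gt1. Qed.
Lemma qR_gt1 : 1 < q%:R :> R. Proof. by rewrite ltr1n q_gt1. Qed.
Lemma qR_gt0 : 0 < q%:R :> R. Proof. by rewrite ltr0n q_gt0. Qed.

Lemma absC0 : N 0 = 0. Proof. exact/absC_eq0. Qed.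
Lemma absC_gt0 x : (0 < N x) = (x != 0).
Proof.
rewrite lt_def absC_ge0 andbT; apply/negP/negP => h /eqP h'; apply: h; apply/eqP;
 first by rewrite h' absC0.
by apply/absC_eq0.
Qed.
Lemma absC1 : N 1 = 1.
Proof.
apply: (@mulfI _ (N 1)); first by rewrite gt_eqF // absC_gt0 oner_eq0.
by rewrite -absC_mul !mulr1.
Qed.
Lemma absCX x n : N (x ^+ n) = N x ^+ n.
Proof. by elim: n => [|n IH]; rewrite ?expr0 ?absC1 // !exprS absC_mul IH. Qed.
Lemma absCN x : N (- x) = N x.
Proof.
have h : N (-1) = 1.
  apply/eqP; rewrite -(@eqrXn2 _ 2) ?absC_ge0 ?ler01 // -absCX sqrrN !expr1n.
  by rewrite absC1.
by rewrite -mulN1r absC_mul h mul1r.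
Qed.
Lemma absCV x : N x^-1 = (N x)^-1.
Proof.
have [->|x0] := eqVneq x 0; first by rewrite invr0 absC0 invr0.
apply: (@mulfI _ (N x)); first by rewrite gt_eqF // absC_gt0.
by rewrite -absC_mul !divff ?absC1 // gt_eqF // absC_gt0.
Qed.
Lemma absC_addr_le x y M : N x <= M -> N y <= M -> N (x + y) <= M.
Proof. by move=> xM yM; apply: le_trans (absC_add _ _) _; rewrite ge_max xM. Qed.
Lemma absC_addr_lt x y M : N x < M -> N y < M -> N (x + y) < M.
Proof. by move=> xM yM; apply: le_lt_trans (absC_add _ _) _; rewrite gt_max xM. Qed.
Lemma absCB x y : N (x - y) = N (y - x).
Proof. by rewrite -absCN opprB. Qed.
Lemma absC_sum_le (I : Type) (r : seq I) (P : pred I) (f : I -> C) M : 0 <= M ->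
  (forall i, P i -> N (f i) <= M) -> N (\sum_(i <- r | P i) f i) <= M.
Proof.
move=> M0 h; elim/big_rec: _ => [|i x Pi xM]; first by rewrite absC0.
by apply: absC_addr_le => //; apply: h.
Qed.
(** If [x + y] were smaller than [y], then [y] would be a sum of two elements smaller than itself: a
    strictly dominant term decides the norm. *)
Lemma absC_addr_dom x y : N x < N y -> N (x + y) = N y.
Proof.
move=> xy; apply/eqP; rewrite eq_le absC_addr_le //= ?(ltW xy) //.
rewrite leNgt; apply/negP => h.
have : N y < N y by rewrite -{1}(addKr x y) absC_addr_lt // absCN.
by rewrite ltxx.
Qed.

Lemma abs_cvgP (u : nat -> C) l : abs_cvg N u l <->
  forall e : R, 0 < e -> exists n0, forall n, (n0 <= n)%N -> N (u n - l) < e.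
Proof.
split.
  move=> /cvgrPdist_lt h e e0; have [n0 _ h0] := h _ e0.
  exists n0 => n /h0 /=; rewrite sub0r normrN ger0_norm //; exact: absC_ge0.
move=> h; apply/cvgrPdist_lt => e e0; have [n0 h0] := h _ e0.
exists n0 => // n /h0 /=; rewrite sub0r normrN ger0_norm //; exact: absC_ge0.
Qed.

Lemma absC_small_eq0 x : (forall e : R, 0 < e -> N x < e) -> x = 0.
Proof.
move=> h; apply/eqP/negPn; rewrite -absC_gt0; apply/negP => x0.
by have := h _ x0; rewrite ltxx.
Qed.

Lemma abs_cvg_unique u l l' : abs_cvg N u l -> abs_cvg N u l' -> l = l'.
Proof.
move=> /abs_cvgP h /abs_cvgP h'; apply/eqP; rewrite -subr_eq0; apply/eqP.
apply: absC_small_eq0 => e e0; have [n0 hn] := h _ e0; have [n1 hn'] := h' _ e0.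
have -> : l - l' = (u (maxn n0 n1) - l') - (u (maxn n0 n1) - l).
  by ring.
by apply: absC_addr_lt; rewrite ?absCN ?hn ?hn' // ?leq_maxl ?leq_maxr.
Qed.

Lemma abs_cvg_le u l M : abs_cvg N u l -> (forall n, N (u n) <= M) -> N l <= M.
Proof.
move=> /abs_cvgP h hM; have [l0|l0] := eqVneq l 0.
  by rewrite l0 absC0; apply: le_trans (hM 0%N); apply: absC_ge0.
have [|n hn] := h (N l); first by rewrite absC_gt0.
by have := absC_addr_dom (hn n (leqnn n)); rewrite subrK => <-.
Qed.

(** By the ultrametric inequality, small consecutive increments already make a sequence Cauchy. *)
Lemma abs_cvg_incr (u : nat -> C) :
  (forall e : R, 0 < e -> exists n0, forall n, (n0 <= n)%N -> N (u n.+1 - u n) < e) ->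
  exists l, abs_cvg N u l.
Proof.
move=> h; apply: absC_complete => e e0; have [n0 hn] := h _ e0; exists n0.
have H m k : (n0 <= m)%N -> N (u (m + k)%N - u m) < e.
  move=> mn; elim: k => [|k IH]; first by rewrite addn0 subrr absC0.
  rewrite addnS -(subrKA (u (m + k)%N)); apply: absC_addr_lt => //.
  by apply: hn; apply: leq_trans mn (leq_addr _ _).
move=> m n nm nn; have [mn|/ltnW mn] := leqP n m.
  by rewrite -(subnKC mn) H.
by rewrite absCB -(subnKC mn) H.
Qed.

Lemma ofA_inj : injective (ofA C).
Proof. by move=> a b /fmorph_inj/eqP; rewrite tofrac_eq => /eqP. Qed.
Fact ofA_zmod : zmod_morphism (ofA C).
Proof. by move=> a b; rewrite /ofA !rmorphB. Qed.
HB.instance Definition _ := GRing.isZmodMorphism.Build _ _ (ofA C) ofA_zmod.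
Fact ofA_monoid : monoid_morphism (ofA C).
Proof. by split=> [|a b]; rewrite /ofA ?rmorph1 // !rmorphM. Qed.
HB.instance Definition _ := GRing.isMonoidMorphism.Build _ _ (ofA C) ofA_monoid.
Fact ofF_zmod : zmod_morphism (ofF C).
Proof. by move=> a b; rewrite /ofF polyCB rmorphB. Qed.
HB.instance Definition _ := GRing.isZmodMorphism.Build _ _ (ofF C) ofF_zmod.
Fact ofF_monoid : monoid_morphism (ofF C).
Proof. by split=> [|a b]; rewrite /ofF ?rmorph1 // polyCM rmorphM. Qed.
HB.instance Definition _ := GRing.isMonoidMorphism.Build _ _ (ofF C) ofF_monoid.

Local Notation th := (theta C).
Lemma theta_neq0 : th != 0.
Proof. by rewrite -absC_gt0 absC_theta ltr0n; apply: q_gt0. Qed.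
Lemma ofAE a : ofA C a = (map_poly (ofF C) a).[th].
Proof.
rewrite -{1}(coefK a) poly_def rmorph_sum /= horner_poly; apply: eq_bigr => i _.
by rewrite -mul_polyC rmorphM rmorphXn.
Qed.

Lemma ofF_absC c : c != 0 -> N (ofF C c) = 1.
Proof.
move=> c0; apply/eqP; rewrite -(@eqrXn2 _ q) ?absC_ge0 ?q_gt0 // expr1n -absCX.
have h : N (ofF C c) = N (ofF C c ^+ q) by rewrite -rmorphXn /= expf_card.
rewrite -h; apply/eqP.
have : (N (ofF C c) ^+ q) = N (ofF C c) by rewrite -absCX -h.
have c1 : 0 < N (ofF C c) by rewrite absC_gt0 fmorph_eq0.
rewrite -(prednK q_gt0) exprS -[RHS]mulr1 => /(mulfI (lt0r_neq0 c1))/eqP.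
by rewrite pexpr_eq1 ?absC_ge0 -?subn1 ?subn_gt0 ?q_gt1 // => /eqP.
Qed.
Lemma ofF_absC_le c : N (ofF C c) <= 1.
Proof.
have [->|c0] := eqVneq c 0; first by rewrite rmorph0 absC0 ler01.
by rewrite ofF_absC.
Qed.
Lemma theta_absC : N th = q%:R. Proof. exact: absC_theta. Qed.

Lemma ofA_absC a : a != 0 -> N (ofA C a) = q%:R ^+ (size a).-1.
Proof.
elim/poly_ind: a => [|p c IH]; first by rewrite eqxx.
rewrite rmorphD rmorphM /= -/(ofF C c) -/(theta C) => pc0.
have [p0|p0] := eqVneq p 0.
  move: pc0; rewrite p0 mul0r add0r rmorph0 mul0r add0r polyC_eq0 => c0.
  by rewrite ofF_absC // size_polyC c0 expr0.
rewrite addrC absC_addr_dom absC_mul IH // theta_absC -?exprSr.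
  by rewrite size_MXaddC (negPf p0) /= prednK // size_poly_gt0.
apply: le_lt_trans (ofF_absC_le _) _.
by apply: exprn_egt1 => //; rewrite ?qR_gt1.
Qed.

Lemma pnat_q : [pchar C].-nat q.
Proof.
have [p pp pF] := finPcharP F.
have pC : p \in [pchar C] by apply: (rmorph_pchar (ofF C)).
rewrite (eq_pnat _ (pcharf_eq pC)).
have := abelem_pgroup (fin_ring_pchar_abelem pF).
by rewrite /pgroup cardsT.
Qed.

Definition frn (k : nat) x : C := x ^+ (q ^ k).
Lemma pnat_qX k : [pchar C].-nat (q ^ k)%N.
Proof. by rewrite pnatX pnat_q. Qed.
Fact frn_zmod k : zmod_morphism (frn k).
Proof.
move=> x y; rewrite /frn exprDn_pchar ?pnat_qX //; congr (_ + _).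
have := exprDn_pchar y (- y) (pnat_qX k).
rewrite subrr expr0n expn_eq0 gtn_eqF ?q_gt0 //= => /eqP.
by rewrite eq_sym addrC addr_eq0 => /eqP.
Qed.
HB.instance Definition _ k := GRing.isZmodMorphism.Build _ _ (frn k) (frn_zmod k).
Fact frn_monoid k : monoid_morphism (frn k).
Proof. by split=> [|x y]; rewrite /frn ?expr1n // exprMn. Qed.
HB.instance Definition _ k := GRing.isMonoidMorphism.Build _ _ (frn k) (frn_monoid k).
Lemma frnE k x : frn k x = x ^+ (q ^ k). Proof. by []. Qed.
Lemma frn0 x : frn 0 x = x. Proof. by rewrite /frn expn0 expr1. Qed.
Lemma frnD k l x : frn (k + l) x = frn k (frn l x).
Proof. by rewrite /frn expnD mulnC exprM. Qed.
Lemma frn1 x : frn 1 x = x ^+ q. Proof. by rewrite /frn expn1. Qed.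
Lemma frn_ofF k c : frn k (ofF C c) = ofF C c.
Proof.
elim: k => [|k IH]; first exact: frn0.
by rewrite -addn1 frnD frn1 -rmorphXn /= expf_card.
Qed.
Lemma frn_absC k x : N (frn k x) = N x ^+ (q ^ k). Proof. exact: absCX. Qed.
Lemma qXgt0 k : (0 < q ^ k)%N. Proof. by rewrite expn_gt0 q_gt0. Qed.

Lemma closedC_root (p : {poly C}) : (1 < size p)%N -> exists x, root p x.
Proof.
move=> sp; pose n := (size p).-1; have n0 : (0 < n)%N by rewrite /n -subn1 subn_gt0.
have [x hx] := cfield_closed (fun i => - (p`_i / lead_coef p)) n0.
exists x; rewrite rootE horner_coef -(prednK (ltnW sp)) big_ord_recr /= -/n.
have lc : p`_n != 0 by rewrite -lead_coefE lead_coef_eq0 -size_poly_gt0 ltnW.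
apply/eqP; rewrite hx mulr_sumr -big_split big1 //= => i _.
rewrite lead_coefE -/n mulNr mulrN mulrA [p`_n * _]mulrC divfK // subrr //.
Qed.

Definition frin (k : nat) x : C := xget 0 [set y | frn k y = x].
Lemma frinK k : cancel (frin k) (frn k).
Proof.
move=> x; rewrite /frin; case: xgetP => [y _ -> //|h].
have [|y] := @closedC_root ('X^(q ^ k) - x%:P).
  by rewrite size_XnsubC ?ltnS ?qXgt0.
rewrite rootE !hornerE subr_eq0 => /eqP hy.
by case: (h y).
Qed.
Lemma frnK k : cancel (frn k) (frin k).
Proof. by move=> x; apply: (fmorph_inj (frn k)); rewrite /= frinK. Qed.
Fact frin_zmod k : zmod_morphism (frin k).
Proof. by move=> x y; apply: (can_inj (frnK k)); rewrite rmorphB /= !frinK. Qed.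
HB.instance Definition _ k := GRing.isZmodMorphism.Build _ _ (frin k) (frin_zmod k).
Fact frin_monoid k : monoid_morphism (frin k).
Proof.
by split=> [|x y]; apply: (can_inj (frnK k)); rewrite ?rmorph1 ?rmorphM /= !frinK.
Qed.
HB.instance Definition _ k := GRing.isMonoidMorphism.Build _ _ (frin k) (frin_monoid k).

Lemma frob_fixed x : x ^+ q = x -> exists c, x = ofF C c.
Proof.
move=> xq; have : root (map_poly (ofF C) ('X^q - 'X)) x.
  by rewrite rmorphB /= map_polyXn map_polyX rootE !hornerE xq subrr.
rewrite finField_genPoly rmorph_prod /= rootE horner_prod prodf_seq_eq0.
move=> /hasP[c _]; rewrite rmorphB /= map_polyX map_polyC !hornerE subr_eq0.
by move=> /eqP; exists c.
Qed.

Local Notation Kb := (Kbar C).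
Lemma Kbar0 : Kb 0. Proof. exact: algebraic0. Qed.
Lemma Kbar1 : Kb 1. Proof. exact: algebraic1. Qed.
Lemma KbarD x y : Kb x -> Kb y -> Kb (x + y). Proof. exact: algebraic_add. Qed.
Lemma KbarN x : Kb x -> Kb (- x). Proof. exact: algebraic_opp. Qed.
Lemma KbarB x y : Kb x -> Kb y -> Kb (x - y). Proof. exact: algebraic_sub. Qed.
Lemma KbarM x y : Kb x -> Kb y -> Kb (x * y). Proof. exact: algebraic_mul. Qed.
Lemma KbarV x : Kb x -> Kb x^-1. Proof. exact: algebraic_inv. Qed.
Lemma Kbar_div x y : Kb x -> Kb y -> Kb (x / y). Proof. exact: algebraic_div. Qed.
Lemma Kbar_sum (I : Type) (r : seq I) (P : pred I) (f : I -> C) :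
  (forall i, P i -> Kb (f i)) -> Kb (\sum_(i <- r | P i) f i).
Proof.
move=> h; elim/big_ind: _ => //; [exact: Kbar0|exact: KbarD].
Qed.
Lemma Kbar_prod (I : Type) (r : seq I) (P : pred I) (f : I -> C) :
  (forall i, P i -> Kb (f i)) -> Kb (\prod_(i <- r | P i) f i).
Proof.
move=> h; elim/big_ind: _ => //; [exact: Kbar1|exact: KbarM].
Qed.
Lemma KbarX x n : Kb x -> Kb (x ^+ n).
Proof.
by move=> hx; elim: n => [|n IH]; rewrite ?expr0 ?exprS; [exact: Kbar1|exact: KbarM].
Qed.
Lemma Kbar_ofK c : Kb (ofK C c). Proof. exact: algebraic_id. Qed.
Lemma Kbar_ofA a : Kb (ofA C a). Proof. exact: Kbar_ofK. Qed.
Lemma Kbar_theta : Kb th. Proof. exact: Kbar_ofA. Qed.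
Lemma Kbar_root (p : {poly C}) x : p != 0 -> (forall i, Kb p`_i) -> root p x -> Kb x.
Proof.
move=> p0 pK px; apply/integral_algebraic; apply: integral_root p0 px _.
by move=> _ /(nthP 0)[i _ <-]; apply/integral_algebraic/pK.
Qed.
Lemma Kbar_frin k x : Kb x -> Kb (frin k x).
Proof.
move=> hx; apply: (@Kbar_root ('X^(q ^ k) - x%:P)).
- by rewrite -size_poly_gt0 size_XnsubC ?qXgt0.
- move=> i; rewrite coefB coefXn coefC; apply: KbarB.
    by case: eqP => _; [exact: Kbar1|exact: Kbar0].
  by case: eqP => _ //; exact: Kbar0.
by rewrite rootE !hornerE subr_eq0 -frnE frinK.
Qed.
Lemma Kbar_frn k x : Kb x -> Kb (frn k x). Proof. exact: KbarX. Qed.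

(** * Convergent power series *)

Definition tw (k : nat) : fps C -> fps C := fmap (frn k).
Lemma twD k l a : tw (k + l) a = tw k (tw l a).
Proof. by apply/fpsP => i; apply: frnD. Qed.
Lemma tw0 a : tw 0 a = a.
Proof. by apply/fpsP => i; apply: frn0. Qed.

(** [M] bounds the Gauss norm of [a] on the disc of radius [ro]. Carrying explicit bounds avoids
    suprema. *)
Definition nb (ro M : R) (a : fps C) := forall i, N (a i) * ro ^+ i <= M.

Section Nb.
Context (ro : R) (ro0 : 0 <= ro).
Lemma nb_ge0 M a : nb ro M a -> 0 <= M.
Proof. by move=> /(_ 0%N); apply: le_trans; rewrite mulr_ge0 ?absC_ge0 ?exprn_ge0. Qed.
Lemma nb_le M M' a : M <= M' -> nb ro M a -> nb ro M' a.
Proof. by move=> MM h i; apply: le_trans MM. Qed.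
Lemma nb0 M : 0 <= M -> nb ro M 0.
Proof. by move=> M0 i; rewrite fcoef0 absC0 mul0r. Qed.
Lemma nbD M a b : nb ro M a -> nb ro M b -> nb ro M (a + b).
Proof.
move=> ha hb i; rewrite fcoefD.
apply: le_trans (_ : Num.max (N (a i)) (N (b i)) * ro ^+ i <= _).
  by rewrite ler_wpM2r ?exprn_ge0 // absC_add.
by rewrite maxr_pMl ?exprn_ge0 // ge_max ha hb.
Qed.
Lemma nb_sum (I : Type) (r : seq I) (P : pred I) (f : I -> fps C) M : 0 <= M ->
  (forall i, P i -> nb ro M (f i)) -> nb ro M (\sum_(i <- r | P i) f i).
Proof. by move=> M0 h; elim/big_ind: _ => //; [exact: nb0|exact: nbD]. Qed.
Lemma nbN M a : nb ro M a -> nb ro M (- a).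
Proof. by move=> ha i; rewrite fcoefN absCN. Qed.
Lemma nbB M a b : nb ro M a -> nb ro M b -> nb ro M (a - b).
Proof. by move=> ha hb; apply: nbD => //; apply: nbN. Qed.
Lemma nbM M M' a b : nb ro M a -> nb ro M' b -> nb ro (M * M') (a * b).
Proof.
move=> ha hb i; have M0 := nb_ge0 ha; have M0' := nb_ge0 hb.
have [r0|r0] := eqVneq ro 0.
  case: i => [|i]; last by rewrite r0 expr0n mulr0 mulr_ge0.
  rewrite fcoefM0 expr0 mulr1 absC_mul.
  have := ha 0%N; have := hb 0%N; rewrite !expr0 !mulr1 => *.
  by rewrite ler_pM ?absC_ge0.
have rp : 0 < ro ^+ i by rewrite exprn_gt0 // lt_neqAle eq_sym r0.
rewrite -ler_pdivlMr //; apply: absC_sum_le => [|[j /=]].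
  by rewrite divr_ge0 ?mulr_ge0 // ltW.
rewrite ltnS => ji _; rewrite ler_pdivlMr // absC_mul.
rewrite -{2}(subnKC ji) exprD mulrACA.
by rewrite ler_pM ?mulr_ge0 ?absC_ge0 ?exprn_ge0.
Qed.
Lemma nbC c : nb ro (N c) (pfps c%:P).
Proof.
case=> [|i]; rewrite /= coefC /= ?expr0 ?mulr1 // absC0 mul0r; exact: absC_ge0.
Qed.
Lemma nbXsub x : N x <= ro -> nb ro ro (pfps ('X - x%:P)).
Proof.
move=> xr [|[|i]]; rewrite /= coefB coefX coefC /= ?subr0 ?sub0r ?absCN ?absC1 ?expr1 ?mulr1 ?mul1r //.
by rewrite absC0 mul0r.
Qed.
Lemma nb_tw M a k : nb ro M a -> nb (ro ^+ (q ^ k)) (M ^+ (q ^ k)) (tw k a).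
Proof.
move=> h i; rewrite fmapE /= frn_absC -exprM mulnC exprM -exprMn.
by rewrite lerXn2r ?nnegrE ?mulr_ge0 ?absC_ge0 ?exprn_ge0 ?(nb_ge0 h).
Qed.
End Nb.

Definition bdd ro a := exists M, nb ro M a.
Lemma nb_radius ro ro' M a : 0 <= ro' -> ro' <= ro -> nb ro M a -> nb ro' M a.
Proof.
move=> r0 rr h i; apply: le_trans (h i); rewrite ler_wpM2l ?absC_ge0 //.
by rewrite lerXn2r ?nnegrE // (le_trans r0).
Qed.
Lemma nb_trivial ro (a : fps C) n :
  exists2 M, 0 <= M & forall i, (i < n)%N -> N (a i) * ro ^+ i <= M.
Proof.
elim: n => [|n [M M0 h]]; first by exists 0.
exists (Num.max M (N (a n) * ro ^+ n)); first by rewrite le_max M0.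
move=> i; rewrite ltnS leq_eqVlt => /orP[/eqP ->|/h hi]; rewrite le_max ?lexx ?orbT //.
by rewrite hi.
Qed.
Lemma bdd_poly ro p : bdd ro (pfps p).
Proof.
have [M M0 h] := nb_trivial ro (pfps p) (size p); exists M => i.
have [/h //|hs] := ltnP i (size p).
by rewrite /= nth_default // absC0 mul0r.
Qed.
Lemma bddM ro a b : 0 <= ro -> bdd ro a -> bdd ro b -> bdd ro (a * b).
Proof. by move=> r0 [M ha] [M' hb]; exists (M * M'); apply: nbM. Qed.
Lemma bddD ro a b : 0 <= ro -> bdd ro a -> bdd ro b -> bdd ro (a + b).
Proof.
move=> r0 [M ha] [M' hb]; exists (Num.max M M'); apply: nbD => //.
  by apply: nb_le ha; rewrite le_max lexx.
by apply: nb_le hb; rewrite le_max lexx orbT.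
Qed.
Lemma bddN ro a : bdd ro a -> bdd ro (- a).
Proof. by move=> [M ha]; exists M; apply: nbN. Qed.
Lemma bdd_sum ro (I : Type) (r : seq I) (P : pred I) (f : I -> fps C) : 0 <= ro ->
  (forall i, P i -> bdd ro (f i)) -> bdd ro (\sum_(i <- r | P i) f i).
Proof.
move=> r0 h; elim/big_ind: _ => //; last by move=> *; apply: bddD.
by exists 0; apply: nb0.
Qed.
Lemma bdd_prod ro (I : Type) (r : seq I) (P : pred I) (f : I -> fps C) : 0 <= ro ->
  (forall i, P i -> bdd ro (f i)) -> bdd ro (\prod_(i <- r | P i) f i).
Proof.
move=> r0 h; elim/big_ind: _ => //; last by move=> *; apply: bddM.
by rewrite -(rmorph1 (@pfps C)); apply: bdd_poly.
Qed.

(** Evaluation is encoded by division: [a] minus its value is [X - x] times a series bounded on a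
    disc strictly larger than the norm of [x]. Sums, products and twists then follow by algebra;
    [evl_cvg] recovers the limit of the partial sums. *)
Definition evl x (a : fps C) c := exists ro M b,
  [/\ N x < ro, nb ro M b & a = pfps c%:P + pfps ('X - x%:P) * b].

Lemma evl_cvg x a c : evl x a c -> abs_cvg N (fun n => \sum_(i < n) a i * x ^+ i) c.
Proof.
move=> [ro [M [b [xr hb ->]]]]; apply/abs_cvgP => e e0.
have r0 : 0 < ro by apply: le_lt_trans xr; apply: absC_ge0.
have M0 := nb_ge0 (ltW r0) hb.
set a' := _ + _.
have hs n : \sum_(i < n.+1) a' i * x ^+ i = c - b n * x ^+ n.+1.
  elim: n => [|n IH].
    by rewrite big_ord1 fcoefD fcoefXsubM /= coefC eqxx; ring.
  rewrite big_ord_recr IH fcoefD fcoefXsubM /= coefC /= !exprS.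
  by ring.
have [||| n0 hn] := @expr_small R (N x / ro) (e / (M * N x + 1)).
- by rewrite divr_ge0 ?absC_ge0 // ltW.
- by rewrite ltr_pdivrMr // mul1r.
- by rewrite divr_gt0 // ltr_wpDl // mulr_ge0 ?absC_ge0.
exists n0.+1 => -[//|n nn]; rewrite hs addrAC subrr sub0r absCN absC_mul absCX.
have h1 : N (b n) <= M / ro ^+ n by rewrite ler_pdivlMr ?exprn_gt0.
apply: le_lt_trans (_ : M * N x * (N x / ro) ^+ n < _).
  apply: le_trans (ler_wpM2r _ h1) _; first by rewrite exprn_ge0 ?absC_ge0.
  by rewrite exprS expr_div_n le_eqVlt; apply/orP; left; apply/eqP; ring.
have h2 := hn n nn.
rewrite ltr_pdivlMr in h2; last by rewrite ltr_wpDl // mulr_ge0 ?absC_ge0.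
apply: le_lt_trans h2; rewrite mulrC ler_wpM2l ?exprn_ge0 ?divr_ge0 ?absC_ge0 ?(ltW r0) //.
by rewrite lerDl.
Qed.

Lemma evl_unique x a c c' : evl x a c -> evl x a c' -> c = c'.
Proof. by move=> /evl_cvg h /evl_cvg; apply: abs_cvg_unique. Qed.

(** The coefficients of the quotient are the tails of the series at [x], divided by powers of [x];
    this is what improves the bound to [M / ro]. At the point 0 the quotient is the shifted
    series. *)
Lemma fdiv x ro M a : N x < ro -> nb ro M a -> exists c b,
  nb ro (M / ro) b /\ a = pfps c%:P + pfps ('X - x%:P) * b.
Proof.
move=> xr ha; have r0 : 0 < ro by apply: le_lt_trans xr; apply: absC_ge0.
have M0 := nb_ge0 (ltW r0) ha.
have [x0|x0] := eqVneq x 0.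
  exists (a 0%N), (Fps (fun i => a i.+1)); split.
    by move=> i /=; rewrite ler_pdivlMr // -mulrA -exprSr.
  apply/fpsP => -[|i]; rewrite fcoefD fcoefXsubM /= coefC x0 mul0r ?subr0 ?addr0 //.
  by rewrite add0r.
have ax i : N (a i * x ^+ i) <= M * (N x / ro) ^+ i.
  rewrite absC_mul absCX expr_div_n mulrCA [N (a i) * _]mulrC.
  by rewrite ler_wpM2l ?exprn_ge0 ?absC_ge0 // ler_pdivlMr ?exprn_gt0.
pose u n := \sum_(i < n) a i * x ^+ i.
have qt0 : 0 <= N x / ro by rewrite divr_ge0 ?absC_ge0 // ltW.
have qt1 : N x / ro < 1 by rewrite ltr_pdivrMr // mul1r.
have [c hc] : exists c, abs_cvg N u c.
  apply: abs_cvg_incr => e e0.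
  have [|n0 hn] := @expr_small R (N x / ro) (e / (M + 1)) qt0 qt1.
    by rewrite divr_gt0 // ltr_wpDl.
  exists n0 => n /hn; rewrite ltr_pdivlMr ?ltr_wpDl // => h.
  rewrite /u big_ord_recr /= addrAC subrr add0r; apply: le_lt_trans (ax n) _.
  apply: le_lt_trans h; rewrite mulrC ler_wpM2l ?exprn_ge0 //.
  by rewrite lerDl.
have tail i : N (c - u i) <= M * (N x / ro) ^+ i.
  apply: (@abs_cvg_le (fun n => u (n + i)%N - u i)).
    apply/abs_cvgP => e e0; have [n0 hn] := (abs_cvgP _ _).1 hc e e0.
    exists n0 => n nn; rewrite opprB addrA subrK; apply: hn.
    by rewrite (leq_trans nn) // leq_addr.
  move=> n; elim: n => [|n IH]; first by rewrite add0n subrr absC0 mulr_ge0 ?exprn_ge0.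
  rewrite addSn /u big_ord_recr /= addrAC; apply: absC_addr_le => //.
  apply: le_trans (ax _) _; rewrite ler_wpM2l // addnC exprD.
  by rewrite ler_piMr ?exprn_ge0 // exprn_ile1 // ltW.
exists c, (Fps (fun i => (c - u i.+1) / x ^+ i.+1)); split.
  move=> i /=; rewrite absC_mul absCV absCX mulrAC ler_pdivrMr ?exprn_gt0 ?absC_gt0 //.
  rewrite -ler_pdivlMr ?exprn_gt0 //; apply: le_trans (tail _) _.
  rewrite le_eqVlt; apply/orP; left; apply/eqP.
  by rewrite expr_div_n !exprS; field; rewrite ?expf_neq0 ?gt_eqF.
apply/fpsP => -[|i]; rewrite fcoefD fcoefXsubM /= coefC /=.
  by rewrite /u big_ord1 expr0 expr1; field.
rewrite /u [in X in _ - X]big_ord_recr /= add0r !exprS.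
by field; rewrite x0 expf_neq0.
Qed.

Lemma evl_exists x ro a : N x < ro -> bdd ro a -> exists c, evl x a c.
Proof.
by move=> xr [M ha]; have [c [b [hb ->]]] := fdiv xr ha; exists c, ro, (M / ro), b.
Qed.

(* The norm gain of dividing out a zero, valid at every radius where [a] is bounded. *)
Lemma evl_fdiv x ro M a : N x < ro -> nb ro M a -> evl x a 0 ->
  exists2 b, nb ro (M / ro) b & a = pfps ('X - x%:P) * b.
Proof.
move=> xr ha ha0; have [c [b [hb E]]] := fdiv xr ha.
have c0 : c = 0 by apply: evl_unique ha0; exists ro, (M / ro), b.
by exists b => //; rewrite E c0 rmorph0 add0r.
Qed.

Lemma evl_common x a c a' c' : evl x a c -> evl x a' c' -> exists ro M b b',
  [/\ N x < ro, nb ro M b, nb ro M b', a = pfps c%:P + pfps ('X - x%:P) * b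
    & a' = pfps c'%:P + pfps ('X - x%:P) * b'].
Proof.
move=> [ro [M [b [xr hb ->]]]] [ro' [M' [b' [xr' hb' ->]]]].
have r0 : 0 <= ro by apply: le_trans (ltW xr); apply: absC_ge0.
have r0' : 0 <= ro' by apply: le_trans (ltW xr'); apply: absC_ge0.
exists (Num.min ro ro'), (Num.max M M'), b, b'; split => //.
- by rewrite lt_min xr.
- apply: (@nb_radius ro); rewrite ?le_min ?r0 ?ge_min ?lexx //.
  by apply: nb_le hb; rewrite le_max lexx.
- apply: (@nb_radius ro'); rewrite ?le_min ?r0 ?ge_min ?lexx ?orbT //.
  by apply: nb_le hb'; rewrite le_max lexx orbT.
Qed.

Lemma evlD x a c a' c' : evl x a c -> evl x a' c' -> evl x (a + a') (c + c').
Proof.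
move=> h h'; have [ro [M [b [b' [xr hb hb' -> ->]]]]] := evl_common h h'.
exists ro, M, (b + b'); split => //.
  by apply: nbD => //; apply: le_trans (ltW xr); apply: absC_ge0.
by rewrite polyCD rmorphD mulrDr /=; ring.
Qed.

Lemma evlM x a c a' c' : evl x a c -> evl x a' c' -> evl x (a * a') (c * c').
Proof.
move=> h h'; have [ro [M [b [b' [xr hb hb' -> ->]]]]] := evl_common h h'.
have r0 : 0 <= ro by apply: le_trans (ltW xr); apply: absC_ge0.
have [||M' hM'] := @bddD ro (pfps c%:P * b' + pfps c'%:P * b)
    (pfps ('X - x%:P) * (b * b')) r0.
- by apply: bddD => //; apply: bddM => //; [apply: bdd_poly|exists M|apply: bdd_poly|exists M].
- by apply: bddM => //; [apply: bdd_poly|apply: bddM => //; exists M].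
exists ro, M'; eexists; split; [by []|exact: hM'|].
by rewrite polyCM rmorphM; ring.
Qed.

Lemma evl_poly x p : evl x (pfps p) p.[x].
Proof.
have [p' E] : exists p', p = p.[x]%:P + ('X - x%:P) * p'.
  have : root (p - p.[x]%:P) x by rewrite rootE !hornerE subrr.
  by move/factor_theorem => [p' hp]; exists p'; rewrite mulrC -hp addrC subrK.
have [M hM] := bdd_poly (N x + 1) p'.
exists (N x + 1), M, (pfps p'); split => //; first by rewrite ltrDl.
by rewrite {1}E rmorphD rmorphM.
Qed.

Lemma evl_tw x a c k : evl x a c -> evl (frn k x) (tw k a) (frn k c).
Proof.
move=> [ro [M [b [xr hb ->]]]]; exists (ro ^+ (q ^ k)), (M ^+ (q ^ k)), (tw k b).
have r0 : 0 <= ro by apply: le_trans (ltW xr); apply: absC_ge0.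
split; first by rewrite frn_absC ltrXn2r ?nnegrE ?absC_ge0 // -lt0n qXgt0.
  exact: nb_tw.
by rewrite /tw rmorphD rmorphM /= !fmap_pfps rmorphB /= map_polyX !map_polyC.
Qed.

Lemma evl_sum x (I : Type) (r : seq I) (P : pred I) (f : I -> fps C) (c : I -> C) :
  (forall i, P i -> evl x (f i) (c i)) ->
  evl x (\sum_(i <- r | P i) f i) (\sum_(i <- r | P i) c i).
Proof.
move=> h; elim/big_ind2: _ => //; last by move=> *; apply: evlD.
by have := evl_poly x 0; rewrite rmorph0 horner0.
Qed.
Lemma evl_prod x (I : Type) (r : seq I) (P : pred I) (f : I -> fps C) (c : I -> C) :
  (forall i, P i -> evl x (f i) (c i)) ->
  evl x (\prod_(i <- r | P i) f i) (\prod_(i <- r | P i) c i).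
Proof.
move=> h; elim/big_ind2: _ => //; last by move=> *; apply: evlM.
by have := evl_poly x 1; rewrite rmorph1 hornerC.
Qed.

(** Ultrametric Schwarz lemma. Each zero divided out improves the bound by a factor [ro], and the
    remaining points stay zeros of the quotient because they differ from the one removed. *)
Lemma schwarz (xs : seq C) ro M a : uniq xs -> (forall x, x \in xs -> N x < ro) ->
  nb ro M a -> (forall x, x \in xs -> evl x a 0) ->
  exists2 b, nb ro (M / ro ^+ size xs) b
           & a = pfps (\prod_(x <- xs) ('X - x%:P)) * b.
Proof.
elim: xs M a => [|x xs IH] M a /=.
  by move=> _ _ ha _; exists a; rewrite ?expr0 ?divr1 // big_nil rmorph1 mul1r.
move=> /andP[xs_x uxs] hr ha h0.
have xr := hr x (mem_head _ _).
have [b hb E] := evl_fdiv xr ha (h0 x (mem_head _ _)).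
have [|y yxs|b' hb' E'] := IH (M / ro) b uxs _ hb.
- by move=> y yxs; apply: hr; rewrite inE yxs orbT.
- have yr : N y < ro by apply: hr; rewrite inE yxs orbT.
  have [d hd] := evl_exists yr (ex_intro _ (M / ro) hb : bdd ro b).
  have := evl_unique (h0 y _) ; rewrite inE yxs orbT => /(_ _ isT).
  rewrite {1}E => /(_ _ (evlM (evl_poly _ _) hd)) /esym/eqP.
  rewrite !hornerE mulf_eq0 subr_eq0 => /orP[/eqP yx|/eqP <- //].
  by rewrite -yx yxs in xs_x.
exists b'; first by rewrite exprS invfM mulrA.
by rewrite E E' big_cons rmorphM mulrA.
Qed.

End Valued.

(** * Orders in finite extensions, Siegel's lemma and Liouville's inequality *)

Lemma fracP (D : idomainType) (x : {fraction D}) :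
  exists a b, b != 0 /\ x = tofrac a / tofrac b.
Proof.
elim/quotW: x => x; exists x.1, x.2; split; first exact: denom_ratioP.
apply: (canRL (mulfK _)); first by rewrite tofrac_eq0 denom_ratioP.
unlock FracField.tofrac; rewrite -[LHS]FracField.pi_mul; apply/eqmodP => /=.
by rewrite FracField.equivfE /FracField.mulf !numden_Ratio
  ?mulf_neq0 ?oner_neq0 ?denom_ratioP // !mulr1 mulrC.
Qed.

Section Orders.
Context (F : finFieldType) (R : realType) (C : Cinfty F R).
Local Notation q := #|F|.
Local Notation N := (@absC F R C).
Local Notation th := (theta C).

Lemma absC_det_le n (M : 'M[C]_n) (B : R) : 0 <= B ->
  (forall i j, N (M i j) <= B) -> N (\det M) <= B ^+ n.
Proof.
move=> B0 h; apply: absC_sum_le => [|s _]; first exact: exprn_ge0.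
have -> : N ((-1) ^+ s * \prod_i M i (s i)) = N (\prod_i M i (s i)).
  by case: (s : bool); rewrite ?expr1 ?expr0 ?mulN1r ?mul1r ?absCN.
rewrite (big_morph N (@absC_mul _ _ C) (absC1 C)).
rewrite -[in X in _ <= X](card_ord n) -prodr_const.
by apply: ler_prod => i _; rewrite absC_ge0 h.
Qed.

Lemma absC_adj_le n (M : 'M[C]_n) (B : R) i j : 0 <= B ->
  (forall i j, N (M i j) <= B) -> N ((\adj M) i j) <= B ^+ n.-1.
Proof.
move=> B0 h; rewrite mxE /cofactor.
have -> (x : C) k : N ((-1) ^+ k * x) = N x.
  by rewrite absC_mul absCX absCN absC1 expr1n mul1r.
by apply: absC_det_le => // a b; rewrite !mxE.
Qed.

Lemma common_denom (I : finType) (u : I -> ratfun F) : exists2 b : {poly F}, b != 0 &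
  exists a : I -> {poly F}, forall i, tofrac b * u i = tofrac (a i).
Proof.
have /choice[f hf] : forall i, exists ab : {poly F} * {poly F},
    ab.2 != 0 /\ u i = tofrac ab.1 / tofrac ab.2.
  by move=> i; have [a [b h]] := fracP (u i); exists (a, b).
pose den i := (f i).2; pose num i := (f i).1.
have dn i : den i != 0 := (hf i).1.
have un i : u i = tofrac (num i) / tofrac (den i) := (hf i).2.
exists (\prod_i den i); first by apply/prodf_neq0.
exists (fun i => num i * \prod_(j | j != i) den j) => i.
rewrite un (bigD1 i) //= !rmorphM /= mulrCA -!mulrA; congr (_ * _).
by rewrite mulrC divfK // tofrac_eq0.
Qed.

Definition Kspan d (e : 'I_d -> C) (x : C) :=
  exists u : 'I_d -> ratfun F, x = \sum_j ofK C (u j) * e j.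

Lemma A_free_K d (e : 'I_d -> C) (u : 'I_d -> ratfun F) : A_free e ->
  \sum_j ofK C (u j) * e j = 0 -> forall j, u j = 0.
Proof.
move=> he hu j; have [b b0 [a ha]] := common_denom u.
have h : \sum_j ofA C (a j) * e j = 0.
  transitivity (ofA C b * \sum_j ofK C (u j) * e j); last by rewrite hu mulr0.
  by rewrite mulr_sumr; apply: eq_bigr => i _; rewrite /ofA -ha rmorphM mulrA.
have := ha j; rewrite (he _ h) rmorph0 => /eqP.
by rewrite mulf_eq0 tofrac_eq0 (negPf b0) => /eqP.
Qed.

Section Ht.
Context (d : nat) (e : 'I_d -> C).

Definition Ht (h : nat) (x : C) := exists2 a : 'I_d -> {poly F},
  forall j, (size (a j) <= h)%N & x = \sum_j ofA C (a j) * e j.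

Lemma Ht_le h h' x : (h <= h')%N -> Ht h x -> Ht h' x.
Proof. by move=> hh [a ha ->]; exists a => // j; apply: leq_trans hh. Qed.
Lemma Ht0 h : Ht h 0.
Proof.
exists (fun=> 0) => [j|]; first by rewrite size_poly0.
by rewrite big1 // => j _; rewrite rmorph0 mul0r.
Qed.
Lemma HtD h x y : Ht h x -> Ht h y -> Ht h (x + y).
Proof.
move=> [a ha ->] [b hb ->]; exists (fun j => a j + b j) => [j|].
  by apply: leq_trans (size_polyD _ _) _; rewrite geq_max ha hb.
by rewrite -big_split; apply: eq_bigr => j _; rewrite rmorphD mulrDl.
Qed.
Lemma HtN h x : Ht h x -> Ht h (- x).
Proof.
move=> [a ha ->]; exists (fun j => - a j) => [j|]; first by rewrite size_polyN.
by rewrite -sumrN; apply: eq_bigr => j _; rewrite rmorphN mulNr.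
Qed.
Lemma Ht_sum (I : Type) (r : seq I) (P : pred I) (f : I -> C) h :
  (forall i, P i -> Ht h (f i)) -> Ht h (\sum_(i <- r | P i) f i).
Proof. by move=> hf; elim/big_ind: _ => //; [exact: Ht0|exact: HtD]. Qed.
Lemma HtA (a : {poly F}) m h x : (size a <= m)%N -> Ht h x -> Ht (m + h) (ofA C a * x).
Proof.
move=> am [b hb ->]; exists (fun j => a * b j) => [j|].
  apply: leq_trans (size_polyMleq _ _) _; have := hb j; lia.
by rewrite mulr_sumr; apply: eq_bigr => j _; rewrite rmorphM mulrA.
Qed.
Lemma Ht_theta m h x : Ht h x -> Ht (m.+1 + h) (th ^+ m * x).
Proof.
by move=> hx; rewrite -rmorphXn /=; apply: HtA => //; rewrite size_polyXn.
Qed.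

Context (ka : nat) (hmul : forall i j, Ht ka (e i * e j)).
Lemma HtM h h' x y : Ht h x -> Ht h' y -> Ht (h + h' + ka) (x * y).
Proof.
move=> [a ha ->] [b hb ->]; rewrite mulr_suml; apply: Ht_sum => i _.
rewrite mulr_sumr; apply: Ht_sum => j _; rewrite mulrACA -rmorphM.
apply: HtA => //; apply: leq_trans (size_polyMleq _ _) _.
by have := ha i; have := hb j; lia.
Qed.
Lemma HtX h x n : Ht h x -> Ht (n.+1 * (h + ka)) (x ^+ n.+1).
Proof.
move=> hx; elim: n => [|n IH]; first by rewrite expr1; apply: Ht_le hx; lia.
by rewrite exprS; apply: Ht_le (HtM hx IH); lia.
Qed.
Lemma Ht_frn h x k : Ht h x -> Ht (q ^ k * (h + ka)) (frn k x).
Proof. by rewrite /frn -(prednK (qXgt0 F k)); apply: HtX. Qed.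

Lemma Ht_absC : exists2 C0 : R, 1 <= C0 & forall h x, Ht h x -> N x <= C0 * q%:R ^+ h.
Proof.
exists (1 + \sum_j N (e j)) => [|h x [a ha ->]].
  by rewrite lerDl sumr_ge0 // => j _; apply: absC_ge0.
have s0 : 0 <= \sum_j N (e j) by rewrite sumr_ge0 // => j _; apply: absC_ge0.
have q1 : 1 <= q%:R :> R by rewrite ltW // qR_gt1.
apply: absC_sum_le => [|j _].
  by rewrite mulr_ge0 ?exprn_ge0 ?addr_ge0 ?ler0n ?ler01.
rewrite absC_mul mulrC; apply: ler_pM; rewrite ?absC_ge0 //.
  rewrite (bigD1 j) //= addrCA lerDl addr_ge0 ?ler01 // sumr_ge0 // => i _.
  exact: absC_ge0.
have [->|a0] := eqVneq (a j) 0; first by rewrite rmorph0 absC0 exprn_ge0 ?ler0n.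
by rewrite ofA_absC // ler_weXn2l //; have := ha j; lia.
Qed.

Context (he : A_free e).

(** Multiplication by [x] has a matrix over [A] in the basis [e]. Its determinant is a nonzero
    polynomial, hence of norm at least 1, and the adjugate converts this into a lower bound for [x];
    no conjugates of [x] are needed. *)
Lemma liouville : (0 < d)%N -> exists2 c : R, 0 < c &
  exists K, forall h x, Ht h x -> x != 0 -> c <= N x * q%:R ^+ (K * h).
Proof.
move=> d0; pose i0 := Ordinal d0.
have ei : e i0 != 0.
  apply/negP => /eqP e0; pose a j : {poly F} := (j == i0)%:R.
  have : \sum_j ofA C (a j) * e j = 0.
    rewrite (bigD1 i0) //= e0 mulr0 add0r big1 // => j /negPf ji.
    by rewrite /a ji rmorph0 mul0r.
  by move/he/(_ i0)/eqP; rewrite /a eqxx oner_eq0.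
pose s := 1 + \sum_j N (e j).
have s1 : 0 < s by rewrite ltr_pwDl // sumr_ge0 // => j _; apply: absC_ge0.
have es j : N (e j) <= s.
  rewrite /s (bigD1 j) //= addrCA lerDl addr_ge0 ?ler01 // sumr_ge0 // => i _.
  exact: absC_ge0.
have qp n : 0 < q%:R ^+ n :> R by rewrite exprn_gt0 // qR_gt0.
exists (N (e i0) / (s * q%:R ^+ (ka * d.-1))).
  by rewrite divr_gt0 ?absC_gt0 // mulr_gt0.
exists d.-1 => h x hx x0.
have [M hM] : exists M : 'M[{poly F}]_d,
    (forall i j, (size (M i j) <= h + ka)%N) /\
    forall i, x * e i = \sum_j ofA C (M i j) * e j.
  have /choice[a ha] : forall i, exists a : 'I_d -> {poly F},
      (forall j, (size (a j) <= h + ka)%N) /\ x * e i = \sum_j ofA C (a j) * e j.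
    move=> i; suff [a h1 h2] : Ht (h + ka) (x * e i) by exists a.
    case: hx => a h1 ->; rewrite mulr_suml; apply: Ht_sum => j _.
    by rewrite -mulrA; apply: HtA.
  by exists (\matrix_(i, j) a i j); split=> [i j|i]; rewrite ?mxE;
    [case: (ha i)|rewrite (ha i).2; apply: eq_bigr => j _; rewrite mxE].
case: hM => sM Me.
have dM : \det M != 0.
  apply/negP => /eqP dM0.
  have : \det (map_mx (@FracField.tofrac {poly F}) M) == 0 :> ratfun F by rewrite det_map_mx dM0 rmorph0.
  move/det0P => [u u0 uM].
  have h0 : \sum_i ofK C (u 0 i) * e i = 0.
    apply: (mulfI x0); rewrite mulr0 mulr_sumr.
    under eq_bigr => i _ do rewrite mulrCA Me mulr_sumr.
    rewrite exchange_big big1 //= => j _.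
    have := congr1 (fun A : 'rV_d => ofK C (A 0 j)) uM.
    rewrite !mxE rmorph0 rmorph_sum /= => h1.
    transitivity ((\sum_i ofK C (u 0 i * map_mx (@FracField.tofrac {poly F}) M i j))
      * e j); last by rewrite h1 mul0r.
    by rewrite mulr_suml; apply: eq_bigr => i _; rewrite !mxE rmorphM mulrA.
  case/eqP: u0; apply/rowP => i; rewrite mxE.
  exact: (A_free_K he h0).
pose MC := map_mx (ofA C) M; pose ev := \col_i e i.
have ME : MC *m ev = x *: ev.
  by apply/colP => i; rewrite !mxE Me; apply: eq_bigr => j _; rewrite !mxE.
have key : x * (\adj MC *m ev) i0 0 = \det MC * e i0.
  have : \adj MC *m (MC *m ev) = \det MC *: ev.
    by rewrite mulmxA mul_adj_mx mul_scalar_mx.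
  rewrite ME -scalemxAr => /colP/(_ i0).
  by rewrite [LHS]mxE => ->; rewrite !mxE.
have dMC : 1 <= N (\det MC).
  rewrite det_map_mx ofA_absC // exprn_ege1 // ltW // qR_gt1 //.
have bMC : N ((\adj MC *m ev) i0 0) <= (q%:R ^+ (h + ka)) ^+ d.-1 * s.
  rewrite mxE; apply: absC_sum_le => [|j _].
    by rewrite mulr_ge0 ?(ltW s1) // exprn_ge0 // ltW.
  rewrite absC_mul [ev j 0]mxE; apply: ler_pM; rewrite ?absC_ge0 //.
  apply: absC_adj_le => [|a b]; first exact: ltW.
  rewrite mxE; have [->|a0] := eqVneq (M a b) 0; first by rewrite rmorph0 absC0 ltW.
  by rewrite ofA_absC // ler_weXn2l ?(ltW (qR_gt1 _ _)) //; have := sM a b; lia.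
rewrite ler_pdivrMr ?mulr_gt0 //.
apply: le_trans (_ : N (\det MC) * N (e i0) <= _).
  by rewrite ler_peMl ?absC_ge0.
rewrite -absC_mul -key absC_mul -mulrA ler_wpM2l ?absC_ge0 //.
apply: le_trans bMC _; rewrite -exprM mulnDl exprD le_eqVlt; apply/orP; left.
by rewrite [(d.-1 * h)%N]mulnC; apply/eqP; ring.
Qed.

(** Pigeonhole over the finite field: tuples of height [D] are vectors over [F], and by the count
    there are more of them than possible images. Two tuples with the same image differ by a
    solution. *)
Lemma siegel (I J : finType) (m : J -> I -> C) H D : (0 < d)%N ->
  (forall j i, Ht H (m j i)) -> (#|J| * (D + H + ka) < #|I| * D)%N ->
  exists x : I -> C, [/\ forall i, Ht D (x i), exists i, x i != 0
                       & forall j, \sum_i m j i * x i = 0].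
Proof.
move=> d0 hm hcard; pose L := (D + H + ka)%N.
have /choice[c hc] : forall t : J * I * 'I_d, exists a : 'I_d -> {poly F},
    (forall k, (size (a k) <= H + ka)%N) /\
    m t.1.1 t.1.2 * e t.2 = \sum_k ofA C (a k) * e k.
  move=> [[j i] l] /=; suff [a h1 h2] : Ht (H + ka) (m j i * e l) by exists a.
  case: (hm j i) => a h1 ->; rewrite mulr_suml; apply: Ht_sum => k _.
  by rewrite -mulrA; apply: HtA.
pose PX (X : {ffun I * 'I_d * 'I_D -> F}) i l : {poly F} := \poly_(k < D)
  (if insub k is Some k' then X (i, l, k') else 0).
pose S (X : {ffun I * 'I_d * 'I_D -> F}) j k : {poly F} :=
  \sum_i \sum_l PX X i l * c (j, i, l) k.
have sS X j k : (size (S X j k) <= L)%N.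
  apply: (leq_trans (size_sum _ _ _)); apply/bigmax_leqP => i _.
  apply: (leq_trans (size_sum _ _ _)); apply/bigmax_leqP => l _.
  apply: leq_trans (size_polyMleq _ _) _.
  have h1 : (size (PX X i l) <= D)%N by apply: size_poly.
  by have := (hc (j, i, l)).1 k; rewrite /L; lia.
pose Phi X : {ffun J * 'I_d * 'I_L -> F} := [ffun t : J * 'I_d * 'I_L => (S X t.1.1 t.1.2)`_(t.2)].
have [X [Y [XY PXY]]] : exists X Y, X != Y /\ Phi X = Phi Y.
  apply: contrapT => hno; have inj : injective Phi.
    move=> X Y h; apply/eqP/negPn/negP => XY; apply: hno; by exists X, Y.
  have := leq_card _ inj; rewrite !card_ffun !card_prod !card_ord leq_exp2l ?q_gt1 //.
  rewrite leqNgt => /negP; apply.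
  by rewrite -!mulnA [(d * _)%N]mulnC [(d * D)%N]mulnC !mulnA ltn_pmul2r.
have SXY j k : S X j k = S Y j k.
  apply/polyP => n; have [nL|Ln] := ltnP n L.
    by have /ffunP/(_ (j, k, Ordinal nL)) := PXY; rewrite !ffunE.
  by rewrite !nth_default // (leq_trans (sS _ _ _)).
pose x i := \sum_l ofA C (PX X i l - PX Y i l) * e l.
exists x; split.
- move=> i; exists (fun l => PX X i l - PX Y i l) => // l.
  apply: leq_trans (size_polyD _ _) _; rewrite size_polyN geq_max.
  by rewrite !size_poly.
- apply: contrapT => hno; case/eqP: XY; apply/ffunP => -[[i l] k].
  have xi : x i = 0 by apply/eqP/negPn/negP => xi; apply: hno; exists i.
  have /eqP := he xi l; rewrite subr_eq0 => /eqP/polyP/(_ k).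
  by rewrite !coef_poly ltn_ord valK.
move=> j; rewrite /x.
under eq_bigr => i _ do rewrite mulr_sumr.
have E i l : m j i * (ofA C (PX X i l - PX Y i l) * e l) =
    \sum_k ofA C ((PX X i l - PX Y i l) * c (j, i, l) k) * e k.
  rewrite mulrCA (hc (j, i, l)).2 mulr_sumr; apply: eq_bigr => k _.
  by rewrite rmorphM mulrA.
under eq_bigr => i _ do (under eq_bigr => l _ do rewrite E; rewrite exchange_big).
rewrite exchange_big big1 //= => k _.
transitivity (ofA C (S X j k - S Y j k) * e k); last by rewrite SXY subrr rmorph0 mul0r.
rewrite /S -sumrB rmorph_sum mulr_suml; apply: eq_bigr => i _.
rewrite -sumrB rmorph_sum mulr_suml; apply: eq_bigr => l _.
by rewrite mulrBl.
Qed.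

End Ht.

Lemma KspanD d (e : 'I_d -> C) x y : Kspan e x -> Kspan e y -> Kspan e (x + y).
Proof.
move=> [a ->] [b ->]; exists (fun j => a j + b j).
by rewrite -big_split; apply: eq_bigr => j _; rewrite rmorphD mulrDl.
Qed.
Lemma KspanZ d (e : 'I_d -> C) x u : Kspan e x -> Kspan e (ofK C u * x).
Proof.
move=> [a ->]; exists (fun j => u * a j).
by rewrite mulr_sumr; apply: eq_bigr => j _; rewrite rmorphM mulrA.
Qed.
Lemma Kspan0 d (e : 'I_d -> C) : Kspan e 0.
Proof. by exists (fun=> 0); rewrite big1 // => j _; rewrite rmorph0 mul0r. Qed.
Lemma Kspan_sum d (e : 'I_d -> C) (I : Type) (r : seq I) (P : pred I) (f : I -> C) :
  (forall i, P i -> Kspan e (f i)) -> Kspan e (\sum_(i <- r | P i) f i).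
Proof. by move=> hf; elim/big_ind: _ => //; [exact: Kspan0|exact: KspanD]. Qed.
Lemma Kspan_gen d (e : 'I_d -> C) j : Kspan e (e j).
Proof.
exists (fun i => (i == j)%:R); rewrite (bigD1 j) //= eqxx rmorph1 mul1r big1 ?addr0 //.
by move=> i /negPf ->; rewrite rmorph0 mul0r.
Qed.

Lemma Kspan_free (g : seq C) : exists d (e : 'I_d -> C),
  [/\ A_free e, forall j, e j \in g & forall x, x \in g -> Kspan e x].
Proof.
elim: g => [|x g [d [e [he eg ge]]]].
  by exists 0%N, (fun=> 0); split => [a _ []||] //; case.
have [xe|xe] := EM (Kspan e x).
  exists d, e; split => // [j|y]; first by rewrite inE eg orbT.
  by rewrite inE => /orP[/eqP -> //|/ge].
pose e' := fun j : 'I_d.+1 => if unlift ord0 j is Some k then e k else x.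
have e'0 : e' ord0 = x by rewrite /e' unlift_none.
have e'S k : e' (lift ord0 k) = e k by rewrite /e' liftK.
exists d.+1, e'; split.
- move=> a; rewrite big_ord_recl e'0.
  under eq_bigr => k _ do rewrite e'S.
  have [a0|a0] := eqVneq (a ord0) 0.
    rewrite a0 rmorph0 mul0r add0r => /he h j.
    by case: (unliftP ord0 j) => [k ->|-> //]; apply: h.
  move=> h; case: xe; exists (fun k => - (tofrac (a (lift ord0 k)) / tofrac (a ord0))).
  apply: (@mulfI _ (ofA C (a ord0))); first by rewrite -(rmorph0 (ofA C)) (inj_eq (@ofA_inj _ _ C)).
  move/eqP: h; rewrite addr_eq0 => /eqP ->; rewrite mulr_sumr -sumrN.
  apply: eq_bigr => k _; rewrite mulrA -mulNr; congr (_ * _).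
  by rewrite /ofA -rmorphM -rmorphN /= mulrN mulrC divfK // tofrac_eq0.
- move=> j; case: (unliftP ord0 j) => [k ->|->]; rewrite ?e'S ?e'0 inE ?eqxx //.
  by rewrite eg orbT.
move=> y; rewrite inE => /orP[/eqP ->|/ge [u ->]].
  by rewrite -e'0; apply: Kspan_gen.
by apply: Kspan_sum => k _; apply: KspanZ; rewrite -e'S; apply: Kspan_gen.
Qed.

(** Adjoins one algebraic element [x] at a time: the products [e i * x ^+ j], with [j] below the
    degree of an equation of [x], again span a ring. *)
Lemma Kspan_ring (s : seq C) : (forall x, x \in s -> Kbar C x) ->
  exists d (e : 'I_d -> C), [/\ forall i j, Kspan e (e i * e j), Kspan e 1,
    forall j, Kbar C (e j) & forall x, x \in s -> Kspan e x].
Proof.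
elim: s => [|x s IH] hs.
  exists 1%N, (fun=> 1); split => // [_ _||_]; [| |exact: Kbar1].
  - by exists (fun=> 1); rewrite big_ord1 rmorph1 mulr1.
  - by exists (fun=> 1); rewrite big_ord1 rmorph1 mulr1.
have [|d [e [emul e1 eK es]]] := IH.
  by move=> y ys; apply: hs; rewrite inE ys orbT.
have [p p0 px] := hs x (mem_head _ _).
pose n := (size p).-1.
have sp : (1 < size p)%N.
  have := root_size_gt1 _ px; rewrite map_poly_eq0 size_map_poly; exact.
have sn : size p = n.+1 by rewrite /n prednK // ltnW.
have n0 : (0 < n)%N by rewrite -ltnS -sn.
have xn : x ^+ n = \sum_(i < n) ofK C (- (p`_i / lead_coef p)) * x ^+ i.
  move/rootP: px; rewrite horner_coef size_map_poly sn big_ord_recr /= => h.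
  have lc : lead_coef p != 0 by rewrite lead_coef_eq0.
  apply: (@mulfI _ (ofK C (lead_coef p))); first by rewrite fmorph_eq0.
  move/eqP: h; rewrite addrC addr_eq0 coef_map /= -lead_coefE -/n => /eqP ->.
  rewrite mulr_sumr -sumrN; apply: eq_bigr => i _.
  rewrite coef_map /= mulrA -mulNr; congr (_ * _).
  by rewrite -rmorphM -rmorphN mulrN mulrC divfK.
pose m := (d * n)%N.
pose e' (k : 'I_#|{: 'I_d * 'I_n}|) := e (enum_val k).1 * x ^+ (enum_val k).2.
have ge i (j : 'I_n) : Kspan e' (e i * x ^+ j).
  have -> : e i * x ^+ j = e' (enum_rank (i, j)) by rewrite /e' enum_rankK.
  exact: Kspan_gen.
have gs y j : Kspan e y -> (j < n)%N -> Kspan e' (y * x ^+ j).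
  move=> [u ->] jn; rewrite mulr_suml; apply: Kspan_sum => i _.
  by rewrite -mulrA; apply: KspanZ; apply: (ge i (Ordinal jn)).
have gx y j : Kspan e y -> Kspan e' (y * x ^+ j).
  move=> hy; have [k] := ubnP j; elim: k j => // k IHk j.
  rewrite ltnS => jk; have [jn|nj] := ltnP j n; first exact: gs.
  rewrite -(subnKC nj) exprD xn mulrCA mulr_suml; apply: Kspan_sum => i _.
  rewrite -mulrA; apply: KspanZ; rewrite mulrCA -exprD; apply: IHk.
  by have := ltn_ord i; lia.
exists #|{: 'I_d * 'I_n}|, e'; split.
- move=> i j; rewrite /e' mulrACA -exprD; apply: gx; exact: emul.
- by have := gx 1 0%N e1; rewrite expr0 mulr1.
- move=> j; apply: KbarM => //; apply: KbarX; apply: hs; exact: mem_head.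
move=> y; rewrite inE => /orP[/eqP ->|/es ys].
  by have := gx 1 1%N e1; rewrite expr1 mul1r.
by have := gx y 0%N ys; rewrite expr0 mulr1.
Qed.

(** Multiplying a basis of a finite-dimensional [K]-algebra by a common denominator of its structure
    constants makes these constants polynomials, so heights become additive up to the constant
    [ka]. *)
Lemma order_exists (s : seq C) : (forall x, x \in s -> Kbar C x) ->
  exists d (e : 'I_d -> C) ka, [/\ (0 < d)%N, A_free e,
    forall i j, Ht e ka (e i * e j), forall j, Kbar C (e j) &
    exists2 b : {poly F}, b != 0 & forall x, x \in s -> exists h, Ht e h (ofA C b * x)].
Proof.
move=> hs; have [d0 [g [gmul g1 gK gs]]] := Kspan_ring hs.
have [d [e [he eg ge]]] := Kspan_free (map g (enum 'I_d0)).
have ge' y : Kspan g y -> Kspan e y.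
  move=> [u ->]; apply: Kspan_sum => j _; apply: KspanZ; apply: ge.
  by apply: map_f; rewrite mem_enum.
have eg' j : exists i, e j = g i by have /mapP[i _ ->] := eg j; exists i.
have emul i j : Kspan e (e i * e j).
  by have [a ->] := eg' i; have [b ->] := eg' j; apply: ge'.
have /choice[u hu] : forall t : 'I_d * 'I_d, exists u : 'I_d -> ratfun F,
    e t.1 * e t.2 = \sum_k ofK C (u k) * e k by move=> [i j]; apply: emul.
have [b b0 [a ha]] := common_denom (fun t : 'I_d * 'I_d * 'I_d => u t.1 t.2).
have bC0 : ofA C b != 0 by rewrite -(rmorph0 (ofA C)) (inj_eq (@ofA_inj _ _ C)).
pose e' j := ofA C b * e j.
have e'free : A_free e'.
  move=> c h; apply: he; apply: (mulfI bC0); rewrite mulr0 -[RHS]h mulr_sumr.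
  by apply: eq_bigr => j _; rewrite mulrCA.
have d_gt0 : (0 < d)%N.
  have [v hv] := ge' _ g1; rewrite lt0n; apply/negP => /eqP d0'; subst d.
  by move: hv; rewrite big_ord0 => /eqP; rewrite oner_eq0.
pose ka := (\max_(t : 'I_d * 'I_d * 'I_d) size (a t))%N.
exists d, e', ka; split => //.
- move=> i j; exists (fun k => a (i, j, k)) => [k|].
    exact: (leq_bigmax (i, j, k)).
  rewrite /e' mulrACA (hu (i, j)) -mulrA mulr_sumr mulr_sumr.
  apply: eq_bigr => k _; have := ha (i, j, k) => /= h.
  by rewrite /ofA -h rmorphM /=; ring.
- by move=> j; apply: KbarM; [exact: Kbar_ofA|have [i ->] := eg' j].
have /choice[v hv] : forall x : C, exists v : 'I_d -> ratfun F,
    x \in s -> x = \sum_k ofK C (v k) * e k.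
  move=> x; have [xs|xs] := boolP (x \in s); last by exists (fun=> 0).
  by have [v hv] := ge' _ (gs _ xs); exists v.
have [c c0 [w hw]] := common_denom (fun t : seq_sub s * 'I_d => v (ssval t.1) t.2).
exists (b * c) => [|x xs]; first by rewrite mulf_neq0.
pose y : seq_sub s := SeqSub xs.
exists (\max_k size (w (y, k)))%N; exists (fun k => w (y, k)) => [k|].
  exact: (leq_bigmax k).
rewrite {1}(hv x xs) rmorphM /= -mulrA mulr_sumr mulr_sumr.
apply: eq_bigr => k _; have := hw (y, k) => /= h.
by rewrite /e' /ofA -h rmorphM /=; ring.
Qed.

End Orders.

(** * The linear independence criterion *)

(** The surplus of unknowns over equations is [l * n]. It absorbs the height loss [u] once solutions
    of height [2 * l * t] with [t > u] are allowed. *)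
Lemma siegel_count1 l n t u : (0 < l)%N -> (0 < n)%N -> (u < t)%N ->
  (l.-1 * (2 * l * n) * (2 * l * t + u) < l * (2 * l * n - n) * (2 * l * t))%N.
Proof.
case: l => // l _ n0 ut /=; have -> : (2 * l.+1 * n - n = n * (2 * l + 1))%N by lia.
have -> : (l.+1 * (n * (2 * l + 1)) * (2 * l.+1 * t) =
  (2 * l.+1 * n * t) * (l.+1 * (2 * l + 1)))%N by ring.
apply: (@leq_ltn_trans ((2 * l.+1 * n * t) * (l * (2 * l.+1 + 1)))%N).
  have -> : (2 * l.+1 * n * t * (l * (2 * l.+1 + 1)) =
    l * (2 * l.+1 * n) * (2 * l.+1 * t + t))%N by ring.
  by rewrite leq_mul2l leq_add2l (ltnW ut) orbT.
rewrite ltn_mul2l !muln_gt0 n0 (leq_ltn_trans _ ut) //=; lia.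
Qed.

(** Here the surplus is [l * T]: [l.+1] unknown polynomials with [2 * l * T] coefficients each,
    against [l] polynomial equations. *)
Lemma siegel_count2 l T t u : (0 < l)%N -> (0 < T)%N -> (u < t)%N ->
  (l * (2 * l * T + T) * ((2 * l + 2) * t + u) < l.+1 * (2 * l * T) * ((2 * l + 2) * t))%N.
Proof.
move=> l0 T0 ut.
have -> : (l.+1 * (2 * l * T) * ((2 * l + 2) * t) =
  (l * T * t) * (l.+1 * 2 * (2 * l + 2)))%N by ring.
apply: (@leq_ltn_trans ((l * T * t) * ((2 * l + 1) * (2 * l + 3)))%N).
  have -> : (l * T * t * ((2 * l + 1) * (2 * l + 3)) =
    l * (2 * l * T + T) * ((2 * l + 2) * t + t))%N by ring.
  by rewrite leq_mul2l leq_add2l (ltnW ut) orbT.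
rewrite ltn_mul2l !muln_gt0 l0 T0 (leq_ltn_trans _ ut) //=; lia.
Qed.

Section CriterionCore.
Context (F : finFieldType) (R : realType) (C : Cinfty F R).
Local Notation q := #|F|.
Local Notation N := (@absC F R C).
Local Notation th := (theta C).
Context (l : nat) (B : 'M[{poly C}]_l) (v : 'I_l -> fps C).
Hypothesis tw_v : forall i, tw 1 (v i) = \sum_j pfps (B i j) * v j.

Definition twmx k (M : 'M[{poly C}]_l) := map_mx (map_poly (@frn F R C k)) M.
Fixpoint Cp k m : 'M[{poly C}]_l :=
  if m is m'.+1 then twmx (k + m') B *m Cp k m' else 1%:M.
Lemma CpS k m : Cp k m.+1 = twmx (k + m) B *m Cp k m. Proof. by []. Qed.
Arguments Cp : simpl never.

Lemma tw_pfps k (p : {poly C}) : tw k (pfps p) = pfps (map_poly (@frn F R C k) p).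
Proof. exact: fmap_pfps. Qed.

Lemma tw_Cp k m i : tw (k + m) (v i) = \sum_j pfps (Cp k m i j) * tw k (v j).
Proof.
elim: m i => [|m IH] i.
  rewrite addn0 (bigD1 i) //= mxE eqxx rmorph1 mul1r big1 ?addr0 // => j ji.
  by rewrite mxE eq_sym (negPf ji) rmorph0 mul0r.
rewrite addnS -addn1 twD tw_v /tw rmorph_sum.
have -> : \sum_j fmap (@frn F R C (k + m)) (pfps (B i j) * v j) =
    \sum_j \sum_u pfps (twmx (k + m) B i j * Cp k m j u) * tw k (v u).
  apply: eq_bigr => j _; rewrite rmorphM /= fmap_pfps -/(tw _ _) IH mulr_sumr.
  by apply: eq_bigr => u _; rewrite mxE rmorphM mulrA.
rewrite exchange_big; apply: eq_bigr => u _ /=.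
by rewrite CpS mxE rmorph_sum mulr_suml.
Qed.

Context (d : nat) (e : 'I_d -> C) (ka : nat).
Hypotheses (d0 : (0 < d)%N) (he : A_free e)
  (hmul : forall i j, Ht e ka (e i * e j)).

Definition hp h (p : {poly C}) := forall i, Ht e h p`_i.
Lemma hp_le h h' p : (h <= h')%N -> hp h p -> hp h' p.
Proof. by move=> hh hP i; apply: Ht_le (hP i). Qed.
Lemma hpM h h' p p' : hp h p -> hp h' p' -> hp (h + h' + ka) (p * p').
Proof. by move=> hP hP' i; rewrite coefM; apply: Ht_sum => j _; apply: HtM. Qed.
Lemma hp_sum (I : Type) (r : seq I) (P : pred I) (f : I -> {poly C}) h :
  (forall i, P i -> hp h (f i)) -> hp h (\sum_(i <- r | P i) f i).
Proof. by move=> hf k; rewrite coef_sum; apply: Ht_sum => i /hf. Qed.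
Lemma hp_frn h p k : hp h p -> hp (q ^ k * (h + ka)) (map_poly (@frn F R C k) p).
Proof. by move=> hP i; rewrite coef_map; apply: Ht_frn. Qed.
Lemma hp_horner h p m n : hp h p -> (size p <= n)%N -> Ht e ((m * n).+1 + h) p.[th ^+ m].
Proof.
move=> hP sp; rewrite (horner_coef_wide _ sp); apply: Ht_sum => i _.
rewrite -exprM mulrC; apply: Ht_le (Ht_theta (m * i) (hP i)).
by rewrite leq_add2r ltnS leq_mul // ltnW.
Qed.

Context (hB b : nat).
Hypotheses (hpB : forall i j, hp hB (B i j)) (sB : forall i j, (size (B i j) <= b.+1)%N).
Let g := (hB + ka)%N.

(** The factor with twist [k + i] has height [g * q ^ (k + i)]. These heights form a geometric
    progression, so the product costs no more than a constant times the last one, whatever the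
    number of factors. *)
Lemma hp_Cp k m i j : hp (2 * g * q ^ (k + m.+1)) (Cp k m.+1 i j).
Proof.
have q2 : (2 <= q)%N := q_gt1 F.
have bt k' i' j' : hp (q ^ k' * g) (twmx k' B i' j') by rewrite mxE; apply: hp_frn.
elim: m i j => [|m IH] i j.
  rewrite CpS mulmx1 addn0; apply: hp_le (bt k i j); rewrite addn1 expnS.
  by move: (q ^ k)%N g => Q gg; nia.
rewrite CpS mxE; apply: hp_sum => u _.
apply: hp_le (hpM (bt _ _ _) (IH _ _)).
have -> : (q ^ (k + m.+2) = q * q ^ (k + m.+1))%N by rewrite addnS expnS.
have : (0 < q ^ (k + m.+1))%N by apply: qXgt0.
have : (ka <= g)%N by rewrite /g leq_addl.
move: (q ^ (k + m.+1))%N g => Q gg; nia.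
Qed.

Lemma size_Cp k m i j : (size (Cp k m i j) <= m * b + 1)%N.
Proof.
elim: m i j => [|m IH] i j.
  by rewrite mxE; case: eqP => _; rewrite ?size_poly1 ?size_poly0.
rewrite CpS mxE; apply: (leq_trans (size_sum _ _ _)); apply/bigmax_leqP => u _.
apply: (leq_trans (size_polyMleq _ _)).
have : (size (twmx (k + m) B i u) <= b.+1)%N.
  by rewrite mxE; apply: leq_trans (sB i u); apply: size_poly.
have := IH u j; move: (size (Cp k m u j)) (size (twmx (k + m) B i u)) => x y.
by rewrite mulSn; lia.
Qed.

Context (hr : nat) (rho : 'I_l -> C) (l0 : 'I_l).
Hypotheses (hrho : forall i, Ht e hr (rho i)).

(** [NN n] is the number of zeros imposed on the auxiliary function; the factor [2 * l] produces the
    surplus of [siegel_count1]. The twist by [2 * NN n] raises norms to the power [S n], the unit in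
    which all heights below are measured. *)
Let NN n := (2 * l * n)%N.
Let S n := (q ^ (2 * NN n))%N.

Lemma S_bounds n :
  [/\ (q ^ NN n <= S n)%N, (q ^ NN n * NN n <= S n)%N & (0 < S n)%N].
Proof.
rewrite /S mul2n -addnn expnD muln_gt0 qXgt0; split => //.
  by rewrite leq_pmulr // qXgt0.
by rewrite leq_mul2l ltnW ?orbT // ltn_expl // q_gt1.
Qed.

(** The last clause makes the coefficient vector of the auxiliary function with respect to the
    [tw k (v i)] proportional, at [theta ^+ (q ^ k)], to the twisted relation [rho]. Comparing with
    the index [l0] costs only [l.-1] equations per point. *)
Lemma siegel_Q : exists c, forall n, (0 < n)%N -> exists Q : 'I_l -> {poly C},
  [/\ forall i, (size (Q i) <= NN n - n)%N, forall i, hp (c * S n) (Q i),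
      exists i, Q i != 0
    & forall k i, (0 < k <= NN n)%N ->
      (\sum_u Q u * Cp k (2 * NN n - k) u i).[frn k th] * frn k (rho l0) =
      (\sum_u Q u * Cp k (2 * NN n - k) u l0).[frn k th] * frn k (rho i)].
Proof.
pose c1 := (2 * b + 4 + 2 * g + hr + 2 * ka)%N.
pose T := (c1 + ka + 1)%N.
exists (2 * l * T)%N => n n0; have [S1 S2 S0] := S_bounds n.
have l_gt0 : (0 < l)%N by case: (l) l0 => // -[].
have NN0 : (0 < NN n)%N by rewrite /NN !muln_gt0 l_gt0.
pose I := ('I_l * 'I_(NN n - n))%type; pose J := ('I_l.-1 * 'I_(NN n))%type.
pose m (j : J) (i : I) : C := let k := j.2.+1 in let x := lift l0 j.1 in
  th ^+ (q ^ k * i.2) *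
   ((Cp k (2 * NN n - k) i.1 x).[frn k th] * frn k (rho l0) -
    (Cp k (2 * NN n - k) i.1 l0).[frn k th] * frn k (rho x)).
have hm j i : Ht e (c1 * S n) (m j i).
  rewrite /m; set k := j.2.+1.
  have kN : (k <= NN n)%N by apply: ltn_ord.
  have qk : (q ^ k <= q ^ NN n)%N by rewrite leq_exp2l ?q_gt1.
  have [m' Em] : exists m', (2 * NN n - k = m'.+1)%N by exists (2 * NN n - k).-1; lia.
  have hc x y : Ht e ((q ^ k * (2 * NN n * b + 1)).+1 + 2 * g * S n
       + q ^ k * (hr + ka) + ka)
      ((Cp k (2 * NN n - k) i.1 x).[frn k th] * frn k (rho y)).
    apply: HtM => //; last by apply: Ht_frn.
    apply: hp_horner.
      rewrite Em; have := @hp_Cp k m' i.1 x.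
      by have -> : (k + m'.+1 = 2 * NN n)%N by lia.
    apply: leq_trans (size_Cp _ _ _ _) _; rewrite leq_add2r leq_mul2r; lia.
  apply: Ht_le (Ht_theta (q ^ k * i.2) (HtD (hc _ _) (HtN (hc _ _)))).
  have i2 : (i.2 <= NN n)%N by apply: leq_trans (ltnW (ltn_ord _)) (leq_subr _ _).
  have h1 : (q ^ k * i.2 <= S n)%N by apply: leq_trans S2; apply: leq_mul.
  have h2 : (q ^ k * NN n <= S n)%N by apply: leq_trans S2; rewrite leq_mul2r qk orbT.
  have h3 : (q ^ k <= S n)%N by apply: leq_trans S1.
  move: (nat_of_ord i.2) h1 i2 => w h1 _.
  rewrite /c1; move: (q ^ k)%N (S n) (NN n) h1 h2 h3 S0 => x y z h1 h2 h3 y0.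
  have -> : (x * (2 * z * b + 1) = 2 * b * (x * z) + x)%N by ring.
  have : (2 * b * (x * z) <= 2 * b * y)%N by rewrite leq_mul2l h2 orbT.
  have : (x * (hr + ka) <= y * (hr + ka))%N by rewrite leq_mul2r h3 orbT.
  by move: (x * z)%N (x * w)%N h1 {h2} => *; nia.
have [|x [hx [i0 xi0] hsol]] := @siegel F R C d e ka hmul he I J m (c1 * S n) (2 * l * T * S n) d0 hm.
  have E : (2 * l * T * S n = 2 * l * (T * S n))%N by rewrite mulnA.
  rewrite E !card_prod !card_ord -addnA; apply: siegel_count1 => //.
  by rewrite /T; nia.
move: hsol; set Qf := fun u => \poly_(a < NN n - n)
  (if insub a is Some a' then x (u, a') else 0) : {poly C}.
move=> hsol; exists Qf.
have Qa u (a : 'I_(NN n - n)) : (Qf u)`_a = x (u, a).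
  by rewrite coef_poly ltn_ord valK.
split.
- by move=> i; apply: size_poly.
- move=> i a; rewrite coef_poly; case: ltnP => _; last exact: Ht0.
  by case: insubP => [a' _ _|_]; [exact: hx|exact: Ht0].
- case: i0 xi0 => u a xi; exists u; apply/negP => /eqP Qu.
  by rewrite -Qa Qu coef0 eqxx in xi.
move=> k i /andP[k0 kN]; have [->//|il] := eqVneq i l0.
case: (unliftP l0 i) il => [i' -> _|->]; last by rewrite eqxx.
case: k k0 kN => // k _ kN; pose j : J := (i', Ordinal kN).
apply/eqP; rewrite -subr_eq0; apply/eqP.
rewrite -[RHS](hsol j) !horner_sum !mulr_suml -sumrB.
transitivity (\sum_u \sum_a m j (u, a) * x (u, a)); last first.
  by rewrite pair_bigA; apply: eq_bigr => -[].
apply: eq_bigr => u _; rewrite !hornerM -!mulrA -mulrBr.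
rewrite (@horner_coef_wide _ (NN n - n)) ?size_poly // mulr_suml; apply: eq_bigr => a _.
by rewrite Qa /m /= /frn -exprM; ring.
Qed.

Lemma tw_inj k : injective (@tw F R C k).
Proof. by move=> x y /fpsP xy; apply/fpsP => i; apply: (fmorph_inj (@frn F R C k)); apply: xy. Qed.

(** The auxiliary function. The large twist makes it bounded on the disc of radius [q ^ S n], and
    [Gs_Cp] rewrites it through any smaller twist of [v]. *)
Definition Gs n (Q : 'I_l -> {poly C}) := \sum_i pfps (Q i) * tw (2 * NN n) (v i).

Context (vth : 'I_l -> C) (M : R).
Hypotheses (hv : forall i, nb q%:R M (v i)) (hev : forall i, evl th (v i) (vth i))
  (rel : \sum_i rho i * vth i = 0) (rho0 : rho l0 != 0).

Lemma Gs_Cp n Q k : (k <= 2 * NN n)%N -> Gs n Q =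
  \sum_j pfps (\sum_u Q u * Cp k (2 * NN n - k) u j) * tw k (v j).
Proof.
move=> kn; rewrite /Gs; have E := subnKC kn.
under eq_bigr => i _ do rewrite -{1}E tw_Cp mulr_sumr.
rewrite exchange_big; apply: eq_bigr => j _ /=.
by rewrite rmorph_sum mulr_suml; apply: eq_bigr => u _; rewrite rmorphM mulrA.
Qed.

Lemma Gs_zero n Q k : (0 < k <= NN n)%N ->
  (forall i, (\sum_u Q u * Cp k (2 * NN n - k) u i).[frn k th] * frn k (rho l0) =
      (\sum_u Q u * Cp k (2 * NN n - k) u l0).[frn k th] * frn k (rho i)) ->
  evl (frn k th) (Gs n Q) 0.
Proof.
move=> /andP[k0 kN] h; rewrite (Gs_Cp Q (k := k)); last by lia.
suff <- : \sum_j (\sum_u Q u * Cp k (2 * NN n - k) u j).[frn k th] * frn k (vth j) = 0.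
  by apply: evl_sum => j _; apply: evlM; [exact: evl_poly|exact: evl_tw].
apply: (@mulIf _ (frn k (rho l0))); first by rewrite fmorph_eq0.
rewrite mul0r mulr_suml.
under eq_bigr => j _ do rewrite mulrAC h -mulrA -rmorphM.
by rewrite -mulr_sumr -rmorph_sum rel rmorph0 mulr0.
Qed.

Lemma frn_theta_absC k : N (frn k th) = q%:R ^+ (q ^ k).
Proof. by rewrite frn_absC theta_absC. Qed.

Lemma frn_theta_inj : injective (fun k => @frn F R C k th).
Proof.
move=> k k' /(congr1 N); rewrite !frn_theta_absC.
have q1 := qR_gt1 F R; have q0 := qR_gt0 F R.
move=> E; apply: (@expnI q); first exact: q_gt1.
by apply/eqP; rewrite eqn_leq -!(ler_eXn2l q1) E lexx.
Qed.

Definition zpts n : seq C := [seq frn k th | k <- iota 1 (NN n)].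

(** The Schwarz lemma at radius [q ^ S n]: the [NN n] zeros exceed the degree of the [Q i] by at
    least [n], which leaves the gain [S n * n] in the exponent. The bound is then brought back to
    radius 1, where the product over the zeros costs only one more [S n]. *)
Lemma Gs_bound C0 D n (Q : 'I_l -> {poly C}) : 1 <= C0 -> (0 < n)%N ->
  (forall h x, Ht e h x -> N x <= C0 * q%:R ^+ h) ->
  (forall i, (size (Q i) <= NN n - n)%N) -> (forall i, hp D (Q i)) ->
  (forall k, (0 < k <= NN n)%N -> evl (frn k th) (Gs n Q) 0) ->
  forall m, N (Gs n Q m) * q%:R ^+ (S n * n) <= C0 * q%:R ^+ (S n + D) * M ^+ S n.
Proof.
move=> C1 n0 hC0 sQ hQ h0 m; have [S1 S2 S0] := S_bounds n.
have l_gt0 : (0 < l)%N by case: (l) l0 => // -[].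
have q1 := qR_gt1 F R; have q0 := qR_gt0 F R.
have nN : (n <= NN n)%N by rewrite /NN leq_pmull // muln_gt0 l_gt0.
pose ro : R := q%:R ^+ S n.
have ro1 : 1 <= ro by rewrite exprn_ege1 // ltW.
have ro0 : 0 <= ro by apply: le_trans ro1; apply: ler01.
have M0 : 0 <= M by apply: (nb_ge0 (ltW q0) (hv l0)).
pose MG := C0 * q%:R ^+ D * ro ^+ (NN n - n) * M ^+ S n.
have hG : nb ro MG (Gs n Q).
  apply: nb_sum => // [|i _].
    by rewrite !mulr_ge0 ?exprn_ge0 ?(ltW q0) // (le_trans ler01).
  apply: nbM => //; last exact: (@nb_tw _ _ _ _ (ltW q0) M (v i) (2 * NN n) (hv i)).
  move=> a /=; have [aN|Na] := ltnP a (size (Q i)); last first.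
    rewrite nth_default // absC0 mul0r !mulr_ge0 ?exprn_ge0 ?(ltW q0) //.
    by rewrite (le_trans ler01).
  apply: ler_pM; rewrite ?absC_ge0 ?exprn_ge0 //; first exact: hC0 (hQ i a).
  by rewrite ler_weXn2l // (leq_trans (ltnW aN)).
have uz : uniq (zpts n) by rewrite map_inj_uniq ?iota_uniq //; apply: frn_theta_inj.
have zP x : x \in zpts n -> exists2 k, (0 < k <= NN n)%N & x = frn k th.
  by move=> /mapP[k]; rewrite mem_iota add1n ltnS => hk ->; exists k.
have zs : size (zpts n) = NN n by rewrite size_map size_iota.
have [||b0 hb0 Eb] := schwarz uz _ hG.
- move=> x /zP[k /andP[k0 kN] ->]; rewrite frn_theta_absC ltr_eXn2l //.
  by rewrite ltn_exp2l ?q_gt1 // mul2n -addnn; lia.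
- by move=> x /zP[k hk ->]; apply: h0.
have hprod : nb 1 ((q%:R ^+ (q ^ NN n)) ^+ size (zpts n))
    (pfps (\prod_(x <- zpts n) ('X - x%:P))).
  suff H xs : {subset xs <= zpts n} -> nb 1 ((q%:R ^+ (q ^ NN n)) ^+ size xs)
    (pfps (\prod_(x <- xs) ('X - x%:P))) by apply: H.
  elim: xs => [|x xs IH] hx.
    rewrite big_nil /= expr0 => -[|j]; rewrite /= coef1 /= ?absC1 ?absC0 ?mul0r ?ler01 //.
  rewrite big_cons rmorphM exprS; apply: nbM => //; last first.
    by apply: IH => y yx; apply: hx; rewrite inE yx orbT.
  have [k /andP[k0 kN] Ex] := zP x (hx x (mem_head _ _)).
  have hle : N x <= q%:R ^+ (q ^ NN n).
    by rewrite Ex frn_theta_absC ler_weXn2l ?(ltW q1) // leq_exp2l ?q_gt1.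
  have h1 : 1 <= q%:R ^+ (q ^ NN n) :> R by rewrite exprn_ege1 // ltW.
  move=> -[|[|j]]; rewrite /= coefB coefX coefC /= ?subr0 ?sub0r ?absCN ?absC1 ?expr1n ?mulr1 //.
  by rewrite absC0 (le_trans ler01).
have hb1 := nb_radius ler01 ro1 hb0.
have := nbM ler01 hprod hb1; rewrite -Eb => /(_ m); rewrite expr1n mulr1 zs.
move=> hle; have qS : 0 < q%:R ^+ (S n * n) :> R by rewrite exprn_gt0.
apply: le_trans (ler_wpM2r (ltW qS) hle) _.
have E : MG / ro ^+ NN n * q%:R ^+ (S n * n) = C0 * q%:R ^+ D * M ^+ S n.
  rewrite /MG exprM -/ro; have : ro != 0 by rewrite gt_eqF // (lt_le_trans ltr01).
  have -> : ro ^+ NN n = ro ^+ (NN n - n) * ro ^+ n by rewrite -exprD subnK.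
  move=> r0; move: (ro ^+ (NN n - n)) (expf_neq0 (NN n - n) r0) => x x0.
  by move: (ro ^+ n) (expf_neq0 n r0) => y y0; field; rewrite x0 y0.
rewrite -[leLHS]mulrA E -exprM exprD.
have h2 : q%:R ^+ (q ^ NN n * NN n) <= q%:R ^+ S n :> R by rewrite ler_weXn2l // ltW.
apply: le_trans (ler_wpM2r _ h2) _.
  by rewrite !mulr_ge0 ?exprn_ge0 ?(ltW q0) // (le_trans ler01).
by rewrite le_eqVlt; apply/orP; left; apply/eqP; ring.
Qed.

Definition Wr n (Q : 'I_l -> {poly C}) i j :=
  \sum_u map_poly (@frn F R C i) (Q u) * Cp (2 * NN n) i u j.

Lemma tw_Gs n Q i : tw i (Gs n Q) = \sum_j pfps (Wr n Q i j) * tw (2 * NN n) (v j).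
Proof.
rewrite /Gs /tw rmorph_sum /=.
have -> : \sum_(k < l) fmap (@frn F R C i) (pfps (Q k) * fmap (@frn F R C (2 * NN n)) (v k)) =
  \sum_k \sum_j pfps (map_poly (@frn F R C i) (Q k) * Cp (2 * NN n) i k j) * tw (2 * NN n) (v j).
  apply: eq_bigr => k _; rewrite rmorphM /= fmap_pfps -/(tw _ _) -/(tw _ _) -twD addnC tw_Cp.
  by rewrite mulr_sumr; apply: eq_bigr => j _; rewrite rmorphM mulrA.
by rewrite exchange_big; apply: eq_bigr => j _ /=; rewrite /Wr rmorph_sum mulr_suml.
Qed.

(** The [l.+1] twists of the auxiliary function of index 0 to [l] lie in the span of the [l]
    functions [tw (2 * NN n) (v j)], so they are dependent; the point is that the height of the
    relation is linear in [S n], with a constant independent of [n]. *)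
Lemma siegel_A c : exists c', forall n (Q : 'I_l -> {poly C}), (0 < n)%N ->
  (forall i, (size (Q i) <= NN n - n)%N) -> (forall i, hp (c * S n) (Q i)) ->
  exists A : 'I_l.+1 -> {poly C},
  [/\ forall i, hp (c' * S n) (A i), exists i, A i != 0
    & \sum_i pfps (A i) * tw i (Gs n Q) = 0].
Proof.
pose c3 := (q ^ l * (c + ka) + 2 * g * q ^ l + c + ka)%N.
pose T := (c3 + ka + 1)%N.
exists ((2 * l + 2) * T)%N => n Q n0 sQ hQ; have [S1 S2 S0] := S_bounds n.
have l_gt0 : (0 < l)%N by case: (l) l0 => // -[].
have q2 := q_gt1 F.
have hW (i : 'I_l.+1) j : hp (c3 * S n) (Wr n Q i j).
  apply: hp_sum => u _; case: i => -[|i] il.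
    have -> : map_poly (@frn F R C 0) (Q u) * Cp (2 * NN n) 0 u j =
        Q u * (u == j)%:R.
      have -> : Cp (2 * NN n) 0 u j = (u == j)%:R by rewrite [LHS]mxE.
      by congr (_ * _); apply/polyP => k; rewrite coef_map /= frn0.
    apply: hp_le (_ : hp (c * S n) _); first by rewrite /c3; nia.
    by case: eqP => _ k; rewrite ?mulr1 ?mulr0 ?coef0; [exact: hQ|exact: Ht0].
  apply: hp_le (hpM (hp_frn i.+1 (hQ u)) (hp_Cp (2 * NN n) i u j)).
  rewrite expnD -/(S n) /=.
  have : (q ^ i.+1 <= q ^ l)%N by rewrite leq_exp2l.
  rewrite /c3; move: (q ^ i.+1)%N (q ^ l)%N (S n) g S0 => x y z gg z0 xy.
  have : (x * (c * z + ka) <= y * (c + ka) * z)%N.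
    by apply: (@leq_trans (y * (c * z + ka)))%N; [rewrite leq_mul2r xy orbT|nia].
  have : (2 * gg * (z * x) <= 2 * gg * y * z)%N.
    by rewrite [(z * x)%N]mulnC mulnA leq_mul2r leq_mul2l xy !orbT.
  by move: (x * (c * z + ka))%N (2 * gg * (z * x))%N; nia.
pose T2 := (NN n + l * b + 1)%N.
have sW (i : 'I_l.+1) j : (size (Wr n Q i j) <= T2)%N.
  apply: (leq_trans (size_sum _ _ _)); apply/bigmax_leqP => u _.
  apply: (leq_trans (size_polyMleq _ _)).
  have h1 := size_Cp (2 * NN n) i u j.
  have h2 : (size (map_poly (@frn F R C i) (Q u)) <= NN n - n)%N.
    by rewrite size_map_poly.
  have h3 : (i * b <= l * b)%N by rewrite leq_mul2r -ltnS ltn_ord orbT.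
  by rewrite /T2; lia.
pose da := (2 * l * T2)%N.
pose I := ('I_l.+1 * 'I_da)%type; pose J := ('I_l * 'I_(da + T2))%type.
pose m (j : J) (i : I) : C := if (i.2 <= j.2)%N then (Wr n Q i.1 j.1)`_(j.2 - i.2) else 0.
have hm j i : Ht e (c3 * S n) (m j i).
  by rewrite /m; case: leqP => _; [exact: hW|exact: Ht0].
have [|x [hx [i0 xi0] hsol]] := @siegel F R C d e ka hmul he I J m (c3 * S n) ((2 * l + 2) * T * S n) d0 hm.
  have E : ((2 * l + 2) * T * S n = (2 * l + 2) * (T * S n))%N by rewrite mulnA.
  rewrite E !card_prod !card_ord /da -addnA; apply: siegel_count2 => //.
    by rewrite /T2; lia.
  by rewrite /T; nia.
pose A i : {poly C} := \poly_(a < da) (if insub a is Some a' then x (i, a') else 0).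
have Aa i (a : 'I_da) : (A i)`_a = x (i, a) by rewrite coef_poly ltn_ord valK.
exists A; split.
- move=> i a; rewrite coef_poly; case: ltnP => _; last exact: Ht0.
  by case: insubP => [a' _ _|_]; [exact: hx|exact: Ht0].
- case: i0 xi0 => u a xi; exists u; apply/negP => /eqP Qu.
  by rewrite -Aa Qu coef0 eqxx in xi.
have AW j : \sum_i A i * Wr n Q i j = 0.
  apply/polyP => k; rewrite coef0 coef_sum; have [kl|lk] := ltnP k (da + T2); last first.
    rewrite big1 // => i _; apply: nth_default; apply: leq_trans lk.
    apply: (leq_trans (size_polyMleq _ _)); have := sW i j.
    have : (size (A i) <= da)%N by apply: size_poly.
    by lia.
  rewrite -[RHS](hsol (j, Ordinal kl)).
  transitivity (\sum_u \sum_a m (j, Ordinal kl) (u, a) * x (u, a)); last first.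
    by rewrite pair_bigA; apply: eq_bigr => -[].
  apply: eq_bigr => i _; rewrite coefM.
  rewrite (big_ord_widen_cond (da + T2) xpredT (fun a => (A i)`_a * (Wr n Q i j)`_(k - a))) //.
  pose w a := (if (a <= k)%N then (Wr n Q i j)`_(k - a) else 0) * (A i)`_a.
  transitivity (\sum_(a < da) w a); last by apply: eq_bigr => a _; rewrite /w Aa.
  rewrite [RHS](big_ord_widen_cond (da + T2) xpredT w) ?leq_addr // /w.
  rewrite big_mkcond [RHS]big_mkcond /=; apply: eq_bigr => a _; rewrite ltnS.
  case: (leqP a k) => ak; case: (ltnP a da) => ad; rewrite ?mul0r //; first by rewrite mulrC.
  by rewrite [(A i)`_a]nth_default ?mul0r // (leq_trans _ ad) // size_poly.
under eq_bigr => i _ do rewrite tw_Gs mulr_sumr.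
rewrite exchange_big big1 //= => j _.
under eq_bigr => i _ do rewrite mulrA -rmorphM.
by rewrite -mulr_suml -rmorph_sum AW rmorph0 mul0r.
Qed.

Lemma first_coef (a : fps C) : a != 0 -> exists2 m, a m != 0 & forall j, (j < m)%N -> a j = 0.
Proof.
move=> a0; have h : exists m, a m != 0.
  apply: contrapT => h; case/eqP: a0; apply/fpsP => i.
  by apply/eqP/negPn/negP => xi; apply: h; exists i.
case: (ex_minnP h) => m am hm; exists m => // j jm.
by apply/eqP/negPn/negP => /hm; rewrite leqNgt jm.
Qed.

Lemma coef_lowest (a b' : fps C) s m : (forall j, (j < s)%N -> a j = 0) ->
  (forall j, (j < m)%N -> b' j = 0) -> (a * b') (s + m)%N = a s * b' m.
Proof.
move=> ha hb; rewrite fcoefM.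
have sm : (s < (s + m).+1)%N by rewrite ltnS leq_addr.
rewrite (bigD1 (Ordinal sm)) //= addKn big1 ?addr0 // => -[j /= js] jneq.
have [jl|lj|E] := ltngtP j s; first by rewrite ha // mul0r.
  by rewrite hb ?mulr0 //; lia.
by case/eqP: jneq; apply/val_inj.
Qed.

(** If the auxiliary function were nonzero, its first coefficient [la] would be tiny by [Gs_bound].
    The relation of [siegel_A] between its twists, read at the lowest exponents, makes an algebraic
    coefficient of controlled height tiny as well, against Liouville. *)
Lemma Gs_vanish : exists n (Q : 'I_l -> {poly C}),
  [/\ (0 < n)%N /\ forall i, (size (Q i) <= NN n - n)%N,
  forall i, exists h, hp h (Q i), exists i, Q i != 0,
  (forall k i, (0 < k <= NN n)%N ->
      (\sum_u Q u * Cp k (2 * NN n - k) u i).[frn k th] * frn k (rho l0) =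
      (\sum_u Q u * Cp k (2 * NN n - k) u l0).[frn k th] * frn k (rho i))
  & Gs n Q = 0].
Proof.
have [c hQ] := siegel_Q; have [c' hA] := siegel_A c.
have [C0 C1 hC0] := Ht_absC e.
have [cl cl0 [K hL]] := liouville hmul he d0.
have q1 := qR_gt1 F R; have q0 := qR_gt0 F R.
have C00 : 0 < C0 by apply: lt_le_trans C1.
have M0 : 0 <= M by apply: (nb_ge0 (ltW q0) (hv l0)).
have [mu hmu] := expr_big M q1; have {hmu} hM := ltW (hmu mu (leqnn _)).
have [nu hnu] := expr_big (C0 * C0 / cl + C0) q1; have {hnu} hnu := hnu nu (leqnn _).
(* The summands pay, in units of [S n], for the height [c'] and its Liouville loss [K * c'], for the
   height [c] of [Q], for the bound [M <= q ^ mu], and for the constants below [q ^ nu]. *)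
pose n := ((K + 1) * c' + 1 + c + mu + nu + 1)%N.
have n0 : (0 < n)%N by rewrite /n addn1.
have [Q [sQ hpQ Q0 relQ]] := hQ n n0.
exists n, Q; split => //; first by move=> i; exists (c * S n)%N.
apply/eqP/negPn/negP => G0; have [m Gm ltm] := first_coef G0.
have [A [hpA [i1 Ai1] relA]] := hA n Q n0 sQ hpQ.
have [S1 S2 S0] := S_bounds n.
have hz k : (0 < k <= NN n)%N -> evl (frn k th) (Gs n Q) 0.
  by move=> hk; apply: Gs_zero => // i; apply: relQ.
have := Gs_bound C1 n0 hC0 sQ hpQ hz m; set la := Gs n Q m in Gm *.
have hS x y : (x <= y)%N -> q%:R ^+ x <= q%:R ^+ y :> R by move=> xy; rewrite ler_weXn2l // ltW.
have qp x : 0 < q%:R ^+ x :> R by rewrite exprn_gt0.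
move=> hla.
have hla2 : N la * q%:R ^+ (((K + 1) * c' + nu) * S n) <= C0.
  have E : q%:R ^+ (S n * n) = q%:R ^+ (((K + 1) * c' + nu) * S n) *
     (q%:R ^+ (S n + c * S n) * q%:R ^+ (mu * S n) * q%:R ^+ S n) :> R.
    by rewrite -!exprD; congr (_ ^+ _); rewrite /n; ring.
  have X0 : 0 < q%:R ^+ (S n + c * S n) * q%:R ^+ (mu * S n) * q%:R ^+ S n :> R by rewrite !mulr_gt0.
  rewrite -(ler_pM2r X0) -[X in X <= _]mulrA -E; apply: le_trans hla _.
  rewrite -mulrA ler_wpM2l ?(ltW C00) //.
  apply: le_trans (_ : q%:R ^+ (S n + c * S n) * q%:R ^+ (mu * S n) <= _).
    by rewrite ler_wpM2l ?(ltW (qp _)) // exprM lerXn2r // nnegrE ltW.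
  by rewrite ler_peMr ?mulr_ge0 ?(ltW (qp _)) // exprn_ege1 // ltW.
have snu : q%:R ^+ nu <= q%:R ^+ (nu * S n) :> R by apply: hS; rewrite leq_pmulr.
have la1 : N la <= 1.
  have h1 : N la * C0 <= C0.
    apply: le_trans hla2; rewrite ler_wpM2l ?absC_ge0 // mulnDl exprD.
    apply: le_trans (_ : q%:R ^+ (nu * S n) <= _); last first.
      by rewrite ler_peMl ?(ltW (qp _)) // exprn_ege1 // ltW.
    apply: le_trans snu; apply: le_trans (ltW hnu).
    by rewrite lerDr divr_ge0 ?mulr_ge0 ?(ltW C00) // ltW.
  by rewrite -(ler_pM2r C00) mul1r.
have hsz : exists s i, (A i)`_s != 0.
  by exists (size (A i1)).-1, i1; rewrite -lead_coefE lead_coef_eq0.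
have hsz' : exists s, [exists i, (A i)`_s != 0].
  by have [s [i hi]] := hsz; exists s; apply/existsP; exists i.
case: (ex_minnP hsz') => s /existsP[i2 Ai2] hs.
have lts i j : (j < s)%N -> (A i)`_j = 0.
  move=> js; apply/eqP/negPn/negP => hne.
  by have := hs j; rewrite leqNgt js => /(_ _)/negP; apply => //; apply/existsP; exists i.
pose P i := (A i)`_s != 0.
case: (arg_minnP (fun i : 'I_l.+1 => (i : nat)) (Ai2 : P i2)) => i0 Pi0 hi0.
(* [s] is the lowest exponent occurring in the [A i], and all twists of the auxiliary function start
   at the same exponent [m]; hence the coefficient at [s + m] involves only powers of [la]. *)
have rel0 : \sum_i (A i)`_s * la ^+ (q ^ i) = 0.
  have := congr1 (fun a : fps C => a (s + m)%N) relA; rewrite fcoef_sum fcoef0 => E; rewrite -[RHS]E.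
  apply: eq_bigr => i _; rewrite (@coef_lowest _ _ s m) //; first exact: lts.
  by move=> j /ltm; rewrite fmapE => ->; rewrite rmorph0.
(* [i0] is the smallest twist present, so all other terms carry a strictly higher power of [la],
   which has norm at most 1. *)
have key : N ((A i0)`_s) <= C0 * q%:R ^+ (c' * S n) * N la.
  have la0 : 0 < N la by rewrite absC_gt0.
  have X0 : 0 < N la ^+ (q ^ i0) by rewrite exprn_gt0.
  rewrite -(ler_pM2r X0) -absCX -absC_mul.
  move: rel0; rewrite (bigD1 i0) //= => /eqP; rewrite addr_eq0 => /eqP ->.
  rewrite absCN; apply: absC_sum_le => [|i ii0].
    by rewrite !mulr_ge0 ?(ltW C00) ?(ltW (qp _)) ?absC_ge0.
  have [Pi|/negPn/eqP ->] := boolP (P i); last first.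
    by rewrite mul0r absC0 !mulr_ge0 ?(ltW C00) ?(ltW (qp _)) ?absC_ge0.
  rewrite absC_mul -[leRHS]mulrA !absCX.
  apply: ler_pM; rewrite ?absC_ge0 ?exprn_ge0 ?absC_ge0 //.
    exact: hC0 (hpA i s).
  rewrite -exprS; apply: ler_wiXn2l; rewrite ?absC_ge0 //.
  have : (i0 < i)%N by rewrite ltn_neqAle eq_sym ii0 hi0.
  by rewrite ltn_exp2l // q_gt1.
have hl := hL _ _ (hpA i0 s) Pi0.
have : cl * q%:R ^+ (nu * S n) <= C0 * C0.
  apply: le_trans (_ : N (A i0)`_s * q%:R ^+ (K * (c' * S n)) * q%:R ^+ (nu * S n) <= _).
    by rewrite ler_wpM2r ?(ltW (qp _)).
  apply: le_trans (_ : C0 * q%:R ^+ (c' * S n) * N la * q%:R ^+ (K * (c' * S n)) * q%:R ^+ (nu * S n) <= _).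
    by do 2 (rewrite ler_wpM2r ?(ltW (qp _)) //).
  have -> : C0 * q%:R ^+ (c' * S n) * N la * q%:R ^+ (K * (c' * S n)) * q%:R ^+ (nu * S n) =
      C0 * (N la * q%:R ^+ (((K + 1) * c' + nu) * S n)).
    rewrite (_ : ((K + 1) * c' + nu) * S n = c' * S n + K * (c' * S n) + nu * S n)%N; last by ring.
    by rewrite !exprD; ring.
  by rewrite ler_wpM2l // ltW.
rewrite leNgt => /negP; apply.
rewrite [ltRHS]mulrC -ltr_pdivrMr //; apply: lt_le_trans snu; apply: le_lt_trans hnu.
by rewrite lerDl ltW.
Qed.

Context (hinv : forall m, \det (map_mx (horner_eval (frin m th)) B) != 0)
  (eK : forall j, Kbar C (e j)).

Lemma Ht_Kbar h x : Ht e h x -> Kbar C x.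
Proof.
by move=> [a _ ->]; apply: Kbar_sum => j _; apply: KbarM => //; apply: Kbar_ofA.
Qed.

Lemma frn_horner k (p : {poly C}) x : frn k p.[x] = (map_poly (@frn F R C k) p).[frn k x].
Proof. by rewrite horner_map. Qed.

(** Evaluating the twist of [B] by [k + m] at [theta ^+ (q ^ k)] is the same as twisting the value
    of [B] at the [q ^ m]-th root of [theta], where [hinv] applies. *)
Lemma Cp_unit k m : map_mx (horner_eval (frn k th)) (Cp k m) \in unitmx.
Proof.
elim: m => [|m IH]; first by rewrite /Cp map_mx1 unitmx1.
rewrite CpS map_mxM unitmx_mul IH andbT.
have -> : map_mx (horner_eval (frn k th)) (twmx (k + m) B) =
    map_mx (@frn F R C (k + m)) (map_mx (horner_eval (frin m th)) B).
  apply/matrixP => i j; rewrite !mxE /horner_eval frn_horner frnD frinK //.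
by rewrite map_unitmx unitmxE unitfE.
Qed.

Lemma Cp_hp k m i j : exists h, hp h (Cp k m.+1 i j).
Proof. by eexists; apply: hp_Cp. Qed.

(** A nonzero [Q i1] has fewer roots than there are points, so it survives at some
    [theta ^+ (q ^ k)]. There the coefficient vector of the vanishing auxiliary function is nonzero
    and proportional to the twisted [rho]; untwisting it by [k] gives the functional relation. *)
Lemma abp_core : exists P : 'I_l -> {poly C}, [/\ forall i k, Kbar C (P i)`_k,
  \sum_i pfps (P i) * v i = 0 & exists2 c, c != 0 & forall i, (P i).[th] = c * rho i].
Proof.
have [n [Q [[n0 sQ] hpQ [i1 Q0] relQ G0]]] := Gs_vanish.
have l_gt0 : (0 < l)%N by case: (l) l0 => // -[].
have NN0 : (0 < NN n)%N by rewrite /NN !muln_gt0 l_gt0.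
have [k hk Qk] : exists2 k, (0 < k <= NN n)%N & (Q i1).[frn k th] != 0.
  apply: contrapT => hno.
  have hr0 : all (root (Q i1)) (zpts n).
    apply/allP => x /mapP[k]; rewrite mem_iota add1n ltnS => hk ->; rewrite rootE.
    by apply/negPn/negP => hne; apply: hno; exists k.
  have := max_poly_roots Q0 hr0.
  rewrite map_inj_uniq ?iota_uniq => [/(_ isT)|]; last exact: frn_theta_inj.
  have -> : size (zpts n) = NN n by rewrite size_map size_iota.
  rewrite ltnNge => /negP; apply; exact: leq_trans (sQ i1) (leq_subr _ _).
pose P' j := \sum_u Q u * Cp k (2 * NN n - k) u j.
have rP i : (P' i).[frn k th] * frn k (rho l0) = (P' l0).[frn k th] * frn k (rho i).
  exact: relQ.
have r0 : frn k (rho l0) != 0 by rewrite fmorph_eq0.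
have Pl0 : (P' l0).[frn k th] != 0.
  apply/negP => /eqP Pl; pose Qv := \row_u (Q u).[frn k th].
  have Z : Qv *m map_mx (horner_eval (frn k th)) (Cp k (2 * NN n - k)) = 0.
    apply/rowP => i; rewrite !mxE.
    have /eqP := rP i; rewrite Pl mul0r mulf_eq0 (negPf r0) orbF /P' horner_sum => /eqP E; rewrite -[RHS]E.
    by apply: eq_bigr => u _; rewrite !mxE /horner_eval hornerM.
  have : Qv = 0 by apply: (can_inj (mulmxK (Cp_unit k (2 * NN n - k)))); rewrite Z mul0mx.
  by move/rowP/(_ i1)/eqP; rewrite !mxE (negPf Qk).
exists (fun j => map_poly (@frin F R C k) (P' j)); split.
- move=> i a; rewrite coef_map /=; apply: Kbar_frin.
  have [m' Em] : exists m', (2 * NN n - k = m'.+1)%N by exists (2 * NN n - k).-1; lia.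
  rewrite /P' Em coef_sum; apply: Kbar_sum => u _; have [h hu] := hpQ u.
  have [h' hu'] := Cp_hp k m' u i; exact: Ht_Kbar (hpM hu hu' a).
- apply: (@tw_inj k); rewrite /tw rmorph0 rmorph_sum /= -[RHS]G0 (@Gs_Cp n Q k); last by lia.
  apply: eq_bigr => j _; rewrite rmorphM /= fmap_pfps -map_poly_comp_id0 ?rmorph0 //.
  by rewrite map_poly_id // => x _ /=; rewrite frinK.
exists (frin k ((P' l0).[frn k th] / frn k (rho l0))).
  by rewrite fmorph_eq0 mulf_neq0 ?invr_neq0.
move=> i; apply: (fmorph_inj (@frn F R C k)); rewrite /= frn_horner -map_poly_comp_id0 ?rmorph0 //.
rewrite rmorphM /= frinK map_poly_id => [|x _ /=]; last by rewrite frinK.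
by apply: (mulIf r0); rewrite rP; field.
Qed.

End CriterionCore.

Section Criterion.
Context (F : finFieldType) (R : realType) (C : Cinfty F R).
Local Notation q := #|F|.
Local Notation N := (@absC F R C).
Local Notation th := (theta C).

(* A direct form of the Anderson-Brownawell-Papanikolas criterion. *)
Theorem abp (l : nat) (B : 'M[{poly C}]_l) (v : 'I_l -> fps C) (vth rho : 'I_l -> C) :
  (forall i j k, Kbar C (B i j)`_k) ->
  (forall i, tw 1 (v i) = \sum_j pfps (B i j) * v j) ->
  (forall i, bdd q%:R (v i)) -> (forall i, evl th (v i) (vth i)) ->
  (forall m, \det (map_mx (horner_eval (frin m th)) B) != 0) ->
  (forall i, Kbar C (rho i)) -> (exists i, rho i != 0) ->
  \sum_i rho i * vth i = 0 ->
  exists P : 'I_l -> {poly C}, [/\ forall i k, Kbar C (P i)`_k,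
    \sum_i pfps (P i) * v i = 0 & forall i, (P i).[th] = rho i].
Proof.
move=> BK tw_v bv ev hinv rK [l0 r0] rel.
have q0 := qR_gt0 F R.
pose s := [seq rho i | i <- enum 'I_l] ++
  flatten [seq (B ij.1 ij.2 : seq C) | ij <- enum {: 'I_l * 'I_l}].
have sK x : x \in s -> Kbar C x.
  rewrite mem_cat => /orP[/mapP[i _ ->]//|/flattenP[t /mapP[[i j] _ ->]]].
  by move=> /(nthP 0)[k _ <-]; apply: BK.
have [d [e [ka [d0 he hmul eK [b b0 hb]]]]] := order_exists sK.
have bC0 : ofA C b != 0 by rewrite -(rmorph0 (ofA C)) (inj_eq (@ofA_inj _ _ C)).
have q1 : (0 < q - 1)%N by rewrite subn_gt0 q_gt1.
(* A constant with [eta ^+ (q - 1) = b]: replacing [v] by [eta] times [v] multiplies [B] by [b], so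
   its coefficients become integral in the chosen order. *)
have [|eta heta] := @closedC_root F R C ('X^(q - 1) - (ofA C b)%:P).
  by rewrite size_XnsubC ?ltnS.
move: heta; rewrite rootE !hornerE subr_eq0 => /eqP heta.
have eta0 : eta != 0.
  by apply: contraNneq bC0 => E; rewrite -heta E expr0n; case: (q - 1)%N q1.
have etaq : eta ^+ q = eta * ofA C b by rewrite -heta -exprS -subSn ?q_gt0 // subn1.
pose B' := map_mx (fun p => (ofA C b)%:P * p) B.
pose v' i := pfps eta%:P * v i.
have [hB hBP] : exists hB, forall i j k, Ht e hB (B' i j)`_k.
  have /choice[f hf] : forall x : C, exists h, x \in s -> Ht e h (ofA C b * x).
    by move=> x; have [/hb[h]|xs] := boolP (x \in s); [exists h|exists 0%N].
  exists (\max_(x <- s) f x)%N => i j k; rewrite mxE coefCM.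
  have [kB|Bk] := ltnP k (size (B i j)); last by rewrite nth_default // mulr0; apply: Ht0.
  have xs : (B i j)`_k \in s.
    rewrite mem_cat; apply/orP; right; apply/flattenP; exists (B i j : seq C).
      by apply/mapP; exists (i, j); rewrite ?mem_enum.
    exact: mem_nth.
  by apply: Ht_le (hf _ xs); apply: leq_bigmax_seq.
have [hr hrP] : exists hr, forall i, Ht e hr (ofA C b * rho i).
  have /choice[f hf] : forall i, exists h, Ht e h (ofA C b * rho i).
    by move=> i; apply: hb; rewrite mem_cat map_f ?mem_enum.
  by exists (\max_i f i)%N => i; apply: Ht_le (hf i); apply: leq_bigmax.
have /choice[Mf hMf] : forall i, exists M, nb q%:R M (v' i).
  move=> i; have [M hM] := bv i; exists (N eta * M).
  by apply: nbM => //; first [exact: nbC|exact: ltW].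
have [M hM] : exists M, forall i, nb q%:R M (v' i).
  exists (\sum_i Mf i) => i; apply: nb_le (hMf i).
  rewrite (bigD1 i) //= lerDl sumr_ge0 // => j _; exact: (nb_ge0 (ltW q0) (hMf j)).
have [|||||||||P [PK Pv [c c0 Pth]]] := @abp_core F R C l B' v' _ d e ka d0 he hmul hB
  (\max_(ij : 'I_l * 'I_l) size (B' ij.1 ij.2))%N _ _ hr (fun i => ofA C b * rho i) l0 _
  (fun i => eta * vth i) M hM.
- move=> i; rewrite /v' /tw rmorphM /= fmap_pfps map_polyC /= frn1 -/(tw 1 _) tw_v mulr_sumr.
  apply: eq_bigr => j _; rewrite mxE etaq !rmorphM /=; ring.
- by move=> i j k; apply: hBP.
- move=> i j; apply: leqW; exact: (leq_bigmax (i, j)).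
- by [].
- by move=> i; apply: evlM => //; have := evl_poly th eta%:P; rewrite hornerC.
- transitivity (eta * ofA C b * \sum_i rho i * vth i); last by rewrite rel mulr0.
  by rewrite mulr_sumr; apply: eq_bigr => i _; ring.
- by rewrite mulf_neq0.
- move=> m.
  have -> : map_mx (horner_eval (frin m th)) B' = ofA C b *: map_mx (horner_eval (frin m th)) B.
    by apply/matrixP => i j; rewrite !mxE /horner_eval hornerM hornerC.
  by rewrite detZ mulf_neq0 ?expf_neq0.
- exact: eK.
have cb : c * ofA C b != 0 by rewrite mulf_neq0.
have cK : Kbar C (c * ofA C b)^-1.
  apply: KbarV; have -> : c * ofA C b = (P l0).[th] / rho l0 by rewrite Pth; field.
  apply: Kbar_div => //; rewrite horner_coef; apply: Kbar_sum => i _.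
  by apply: KbarM => //; apply: KbarX; apply: Kbar_theta.
exists (fun i => (c * ofA C b)^-1%:P * P i); split.
- by move=> i k; rewrite coefCM; apply: KbarM.
- have e0 : pfps eta%:P != 0 by rewrite -(rmorph0 (@pfps C)) (inj_eq (@pfps_inj _)) polyC_eq0.
  apply: (mulfI e0); rewrite mulr0.
  transitivity (pfps (c * ofA C b)^-1%:P * \sum_i pfps (P i) * v' i); last by rewrite Pv mulr0.
  by rewrite !mulr_sumr; apply: eq_bigr => i _; rewrite rmorphM /v'; ring.
by move=> i; rewrite hornerM hornerC Pth; field; rewrite bC0 c0.
Qed.

End Criterion.

(** * Entire functions and the Drinfeld exponential *)

Section Entire.
Context (F : finFieldType) (R : realType) (C : Cinfty F R).
Local Notation q := #|F|.
Local Notation N := (@absC F R C).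
Local Notation th := (theta C).
Implicit Types (a b : fps C) (x y : C).

Definition ent a := forall ro : R, 0 <= ro -> bdd ro a.

Lemma ent_evl a x : ent a -> exists c, evl x a c.
Proof.
move=> ha; apply: (@evl_exists _ _ _ x (N x + 1)); first by rewrite ltrDl.
by apply: ha; rewrite addr_ge0 ?absC_ge0 ?ler01.
Qed.

(** Convergence at a power of [theta] of norm larger than [ro] bounds the terms there, hence on the
    whole disc of radius [ro]. *)
Lemma ent_sum_evl (c : nat -> C) (f : C -> C) : entire_sum c f ->
  ent (Fps c) /\ forall x, evl x (Fps c) (f x).
Proof.
move=> hf; have hent : ent (Fps c).
  move=> ro ro0; have [n0 hn] := expr_big ro (qR_gt1 F R).
  have {}hn := hn n0 (leqnn _).
  have /abs_cvgP/(_ 1 ltr01)[m hm] := hf (th ^+ n0).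
  have [M M0 hM] := nb_trivial (q%:R ^+ n0) (Fps c) m.+1.
  exists (Num.max M 1) => i.
  apply: le_trans (_ : N (c i) * (q%:R ^+ n0) ^+ i <= _).
    by rewrite ler_wpM2l ?absC_ge0 // lerXn2r ?nnegrE ?(ltW hn) // (le_trans ro0 (ltW hn)).
  have [im|mi] := ltnP i m.+1; first by rewrite le_max hM.
  rewrite le_max; apply/orP; right; rewrite -(theta_absC C) -!absCX -absC_mul.
  set u := fun n => \sum_(j < n) c j * (th ^+ n0) ^+ j in hm.
  have -> : c i * (th ^+ n0) ^+ i = (u i.+1 - f (th ^+ n0)) - (u i - f (th ^+ n0)).
    by rewrite /u big_ord_recr /=; ring.
  apply: ltW; apply: absC_addr_lt; rewrite ?absCN; apply: hm; lia.
split=> // x; have [d hd] := ent_evl x hent.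
suff -> : f x = d by [].
by apply: abs_cvg_unique (hf x) _; apply: (evl_cvg hd).
Qed.

Lemma evl_bound a y c ro M m : evl y a c -> nb ro M a -> 0 < ro -> N y <= ro ->
  (forall i, (i < m)%N -> a i = 0) -> N c <= M * (N y / ro) ^+ m.
Proof.
move=> hc hM r0 yr hm; have M0 := nb_ge0 (ltW r0) hM.
have t0 : 0 <= N y / ro by rewrite divr_ge0 ?absC_ge0 ?ltW.
have t1 : N y / ro <= 1 by rewrite ler_pdivrMr // mul1r.
apply: abs_cvg_le (evl_cvg hc) _ => n.
apply: absC_sum_le => [|i _]; first by rewrite mulr_ge0 ?exprn_ge0.
have [im|mi] := ltnP i m; first by rewrite hm // mul0r absC0 mulr_ge0 ?exprn_ge0.
rewrite absC_mul absCX; apply: le_trans (_ : M * (N y / ro) ^+ i <= _).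
  rewrite expr_div_n mulrCA [N (a i) * _]mulrC ler_wpM2l ?exprn_ge0 ?absC_ge0 //.
  by rewrite ler_pdivlMr ?exprn_gt0.
by rewrite ler_wpM2l // ler_wiXn2l.
Qed.

(** Identity theorem: the points [theta ^- n.+1] lie in the closed unit disc, and dividing out [m]
    of them at radius [q] improves the bound by [q ^ m]. *)
Lemma evl_eq0 a : bdd q%:R a -> (forall n, evl (th ^- n.+1) a 0) -> a = 0.
Proof.
move=> [M hM] h0; have q1 := qR_gt1 F R; have q0 := qR_gt0 F R.
have M0 := nb_ge0 (ltW q0) hM.
have Nth n : N (th ^- n.+1) <= 1.
  by rewrite absCV absCX theta_absC invf_le1 ?exprn_gt0 // exprn_ege1 // ltW.
apply/fpsP => i; apply: absC_small_eq0 => e e0.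
have [m hm] := expr_big (M / e) q1; have {}hm := hm m (leqnn _).
pose xs := [seq th ^- n.+1 | n <- iota 0 m].
have uxs : uniq xs.
  rewrite map_inj_uniq ?iota_uniq // => n n' /(congr1 N).
  rewrite !absCV !absCX theta_absC => /invr_inj E; apply/eq_add_S/eqP.
  by rewrite eqn_leq -!(ler_eXn2l q1) E lexx.
have [||b hb Eb] := schwarz uxs _ hM.
- by move=> x /mapP[n _ ->]; apply: le_lt_trans (Nth n) q1.
- by move=> x /mapP[n _ ->].
have hp1 : nb 1 1 (pfps (\prod_(x <- xs) ('X - x%:P))).
  have : forall x, x \in xs -> N x <= 1 by move=> x /mapP[n _ ->].
  elim: (xs) => [|x s IH] hx.
    rewrite big_nil => -[|j]; rewrite /= coef1 /= ?absC1 ?absC0 ?mul0r ?ler01 //.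
  rewrite big_cons rmorphM -[X in nb _ X](mulr1 1); apply: nbM => //; last first.
    by apply: IH => y ys; apply: hx; rewrite inE ys orbT.
  by apply: nbXsub => //; apply: hx; rewrite mem_head.
have hb1 := nb_radius ler01 (ltW q1) hb.
have := nbM ler01 hp1 hb1 i; rewrite -Eb expr1n mulr1 mul1r size_map size_iota => hle.
by apply: le_lt_trans hle _; rewrite ltr_pdivrMr ?exprn_gt0 // mulrC -ltr_pdivrMr.
Qed.

Definition sc y a : fps C := Fps (fun i => a i * y ^+ i).
(** The series of the function sending [x] to the [q ^ k]-th power of the value of [a] at [x]. *)
Definition sp k a : fps C :=
  Fps (fun i => if (q ^ k %| i)%N then frn k (a (i %/ q ^ k)%N) else 0).

Lemma ent_sc y a : ent a -> ent (sc y a).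
Proof.
move=> ha ro ro0; have [|M hM] := ha (N y * ro); first by rewrite mulr_ge0 ?absC_ge0.
by exists M => i; rewrite /= absC_mul absCX -mulrA -exprMn.
Qed.

Lemma evl_sc y a x c : ent a -> evl (y * x) a c -> evl x (sc y a) c.
Proof.
move=> ha hc; have [d hd] := ent_evl x (ent_sc y ha).
suff -> : c = d by []; apply: abs_cvg_unique (evl_cvg hc) _.
have := evl_cvg hd; congr abs_cvg; apply/funext => n; apply: eq_bigr => i _.
by rewrite /= exprMn mulrA.
Qed.

Lemma ent_sp k a : ent a -> ent (sp k a).
Proof.
move=> ha ro ro0; have [M hM] := ha ro ro0; exists (M ^+ (q ^ k)) => i /=.
have M0 := nb_ge0 ro0 hM.
case: ifP => [/dvdnP[j ->]|_]; last by rewrite absC0 mul0r exprn_ge0.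
rewrite mulnK ?qXgt0 // frn_absC exprM -exprMn.
by rewrite lerXn2r ?nnegrE ?mulr_ge0 ?exprn_ge0 ?absC_ge0.
Qed.

Lemma evl_sp k a x c : ent a -> evl x a c -> evl x (sp k a) (frn k c).
Proof.
move=> ha hc; have [d hd] := ent_evl x (ent_sp k ha).
suff -> : frn k c = d by [].
have hs n : \sum_(i < n * q ^ k) sp k a i * x ^+ i = frn k (\sum_(i < n) a i * x ^+ i).
  elim: n => [|n IH]; first by rewrite mul0n !big_ord0 rmorph0.
  rewrite mulSn addnC big_split_ord /= IH big_ord_recr rmorphD /=; congr (_ + _).
  rewrite (bigD1 (Ordinal (qXgt0 F k))) //= addn0 dvdn_mull // mulnK ?qXgt0 //.
  rewrite big1 ?addr0 => [|j j0].
    by rewrite rmorphM /= [frn k (x ^+ n)]/frn -exprM.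
  rewrite dvdn_addr ?dvdn_mull // gtnNdvd ?mul0r ?ltn_ord //.
  by rewrite lt0n; apply: contraNneq j0 => j0; apply/eqP/val_inj.
apply/eqP; rewrite -subr_eq0; apply/eqP; apply: absC_small_eq0 => e e0.
have q0 := qXgt0 F k.
have [e1 e10 he1] : exists2 e1 : R, 0 < e1 & e1 ^+ (q ^ k) <= e.
  exists (Num.min 1 e); first by rewrite lt_min ltr01.
  apply: le_trans (_ : Num.min 1 e <= _); last by rewrite ge_min lexx orbT.
  rewrite -[leRHS]expr1 ler_wiXn2l // ?le_min ?ler01 ?(ltW e0) // ge_min lexx //.
have [n1 h1] := (abs_cvgP _ _).1 (evl_cvg hc) e1 e10.
have [n2 h2] := (abs_cvgP _ _).1 (evl_cvg hd) e e0.
pose n := maxn n1 n2.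
have -> : frn k c - d = (\sum_(i < n * q ^ k) sp k a i * x ^+ i - d) -
   frn k (\sum_(i < n) a i * x ^+ i - c) by rewrite rmorphB hs; ring.
apply: absC_addr_lt.
  apply: h2; apply: leq_trans (leq_maxr n1 n2) _; exact: leq_pmulr.
rewrite absCN frn_absC; apply: lt_le_trans he1.
rewrite ltrXn2r ?nnegrE ?absC_ge0 ?(ltW e10) -?lt0n //; apply: h1; exact: leq_maxl.
Qed.

Lemma entD a b : ent a -> ent b -> ent (a + b).
Proof. by move=> ha hb ro ro0; apply: bddD => //; [apply: ha|apply: hb]. Qed.
Lemma entN a : ent a -> ent (- a).
Proof. by move=> ha ro ro0; apply: bddN; apply: ha. Qed.
Lemma entM a b : ent a -> ent b -> ent (a * b).
Proof. by move=> ha hb ro ro0; apply: bddM => //; [apply: ha|apply: hb]. Qed.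
Lemma ent_poly p : ent (pfps p).
Proof. by move=> ro _; apply: bdd_poly. Qed.
Lemma ent_fsum (I : Type) (r : seq I) (f : I -> fps C) :
  (forall i, ent (f i)) -> ent (\sum_(i <- r) f i).
Proof. by move=> h ro ro0; apply: bdd_sum => // i _; apply: h. Qed.

Lemma evlN x a c : evl x a c -> evl x (- a) (- c).
Proof.
move=> h; have := evlM (evl_poly x (-1)%:P) h.
by rewrite hornerC polyCN !rmorphN rmorph1 !mulN1r.
Qed.
Lemma evlB x a c b d : evl x a c -> evl x b d -> evl x (a - b) (c - d).
Proof. by move=> ha hb; apply: evlD => //; apply: evlN. Qed.
Lemma evlZ x a c y : evl x a c -> evl x (pfps y%:P * a) (y * c).
Proof. by move=> h; have := evlM (evl_poly x y%:P) h; rewrite hornerC. Qed.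

Lemma ent_eq a b : ent a -> ent b ->
  (forall x c d, evl x a c -> evl x b d -> c = d) -> a = b.
Proof.
move=> ha hb h; apply/eqP; rewrite -subr_eq0; apply/eqP; apply: evl_eq0.
  by apply: (entD ha (entN hb)); rewrite ler0n.
move=> n; have [c hc] := ent_evl (th ^- n.+1) ha.
have [d hd] := ent_evl (th ^- n.+1) hb.
by rewrite -(subrr c) {2}(h _ _ _ hc hd); apply: evlB.
Qed.

Lemma absC_thX_sub i : (1 < i)%N -> N (th ^+ i - th) = q%:R ^+ i.
Proof.
move=> i1; have q1 := qR_gt1 F R.
rewrite addrC absC_addr_dom absCX ?absCN theta_absC //.
by rewrite -[ltLHS]expr1 ltr_eXn2l.
Qed.
Lemma thX_sub_neq0 i : (1 < i)%N -> th ^+ i - th != 0.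
Proof. by move=> i1; rewrite -absC_gt0 absC_thX_sub // exprn_gt0 // qR_gt0. Qed.

End Entire.

(** * Existence and uniqueness of the Drinfeld exponential *)

Section Drinfeld.
Context (F : finFieldType) (R : realType) (C : Cinfty F R).
Local Notation q := #|F|.
Local Notation N := (@absC F R C).
Local Notation th := (theta C).

Lemma teval_wide n (P : {poly C}) x : (size P <= n)%N ->
  teval P x = \sum_(i < n) P`_i * frn i x.
Proof.
move=> sn; rewrite /teval (big_ord_widen n (fun i => P`_i * x ^+ (q ^ i))) //.
rewrite big_mkcond; apply: eq_bigr => i _; case: ltnP => // h.
by rewrite nth_default // mul0r.
Qed.

Context (r : nat) (phi : {poly F} -> {poly C}) (hphi : drinfeld_module r phi).
Definition dcoef k := (phi 'X)`_k.
Local Notation g := dcoef.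

Lemma size_phiX : size (phi 'X) = r.+1.
Proof. by rewrite (drinfeld_size hphi) ?polyX_eq0 // size_polyX muln1. Qed.
Lemma dcoef0 : g 0%N = th. Proof. exact: (drinfeld_coef0 hphi). Qed.
Lemma dcoef_Kbar k : Kbar C (g k). Proof. exact: (drinfeld_Kbar hphi). Qed.
Lemma dcoef_lead : g r != 0.
Proof.
have := lead_coef_eq0 (phi 'X); rewrite lead_coefE size_phiX /= -size_poly_eq0 size_phiX.
by rewrite /dcoef => ->.
Qed.
Lemma teval_phiX x : teval (phi 'X) x = \sum_(k < r.+1) g k * frn k x.
Proof. by apply: teval_wide; rewrite size_phiX. Qed.

(** Coefficients of the exponential, obtained by comparing those of [X ^ (q ^ m)] in the functional
    equation for [phi 'X]; index 0 is normalised to 1. *)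
Definition aseq := fix aseq (n : nat) : seq C := if n is m.+1 then
  let s := aseq m in rcons s (if m == 0%N then 1 else
   (th ^+ (q ^ m) - th)^-1 * \sum_(k < r) (if (k.+1 <= m)%N then
      g k.+1 * frn k.+1 s`_(m - k.+1) else 0)) else [::].
Definition alpha n : C := (aseq n.+1)`_n.

Lemma size_aseq n : size (aseq n) = n.
Proof. by elim: n => //= n IH; rewrite size_rcons IH. Qed.
Lemma aseqE n i : (i < n)%N -> (aseq n)`_i = alpha i.
Proof.
elim: n => // n IH; rewrite ltnS leq_eqVlt => /orP[/eqP -> //|lt].
by rewrite /= nth_rcons size_aseq lt IH.
Qed.
Lemma alpha0 : alpha 0 = 1. Proof. by []. Qed.
Lemma qX_gt1 n : (0 < n)%N -> (1 < q ^ n)%N.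
Proof. by move=> n0; rewrite -{1}(expn0 q) ltn_exp2l ?q_gt1. Qed.
Lemma alphaE n : (0 < n)%N -> alpha n * (th ^+ (q ^ n) - th) =
  \sum_(k < r) (if (k.+1 <= n)%N then g k.+1 * frn k.+1 (alpha (n - k.+1)) else 0).
Proof.
move=> n0; rewrite {1}/alpha /= nth_rcons size_aseq ltnn eqxx gtn_eqF // mulrC mulVKf.
  by apply: eq_bigr => k _; case: leqP => // kn; rewrite aseqE //; lia.
by rewrite thX_sub_neq0 // qX_gt1.
Qed.

Lemma alpha_bound : exists2 G : R, 1 <= G &
  (forall n, N (alpha n) <= G ^+ (q ^ n)) /\
  forall n M, 0 <= M -> (0 < n)%N ->
   (forall k, (k < r)%N -> (k.+1 <= n)%N -> N (alpha (n - k.+1)) <= M ^+ (q ^ (n - k.+1))) ->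
   N (alpha n) * q%:R ^+ (q ^ n) <= G * M ^+ (q ^ n).
Proof.
pose G := 1 + \sum_(k < r) N (g k.+1).
have G1 : 1 <= G by rewrite lerDl sumr_ge0 // => k _; apply: absC_ge0.
have G0 : 0 <= G by apply: le_trans G1; apply: ler01.
have gG (k : 'I_r) : N (g k.+1) <= G.
  rewrite /G (bigD1 k) //= addrCA lerDl addr_ge0 ?ler01 // sumr_ge0 // => i _.
  exact: absC_ge0.
have step n' (B : R) : 0 <= B -> (0 < n')%N ->
   (forall k, (k < r)%N -> (k.+1 <= n')%N -> N (frn k.+1 (alpha (n' - k.+1))) <= B) ->
   N (alpha n') * q%:R ^+ (q ^ n') <= G * B.
  move=> B0 n0 hB; rewrite -(@absC_thX_sub _ _ C) ?qX_gt1 // -absC_mul alphaE //.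
  apply: absC_sum_le => [|k _]; first by rewrite mulr_ge0.
  case: ifP => kn; last by rewrite absC0 mulr_ge0.
  by rewrite absC_mul ler_pM ?absC_ge0 ?hB.
exists G => //; split; last first.
  move=> n' M M0 n0 h; apply: step => // [|k kr kn]; first exact: exprn_ge0.
  rewrite frn_absC; have {2}-> : n' = ((n' - k.+1) + k.+1)%N by lia.
  by rewrite expnD exprM lerXn2r ?nnegrE ?absC_ge0 ?exprn_ge0 ?h.
move=> n'; apply: le_trans (_ : G ^+ (q ^ n' - 1) <= _); last first.
  by rewrite ler_weXn2l // leq_subr.
have [m] := ubnP n'; elim: m n' => // m IH [_|n'].
  by rewrite alpha0 absC1 expn0 subnn expr0.
rewrite ltnS => nm.
have q2 := q_gt1 F.
have h := @step n'.+1 (G ^+ (q ^ n'.+1 - 2)) (exprn_ge0 _ G0) isT.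
have {h} : N (alpha n'.+1) * q%:R ^+ (q ^ n'.+1) <= G * G ^+ (q ^ n'.+1 - 2).
  apply: h => k kr kn; rewrite frn_absC.
  apply: le_trans (_ : (G ^+ (q ^ (n'.+1 - k.+1) - 1)) ^+ (q ^ k.+1) <= _).
    by rewrite lerXn2r ?nnegrE ?absC_ge0 ?exprn_ge0 // IH //; lia.
  rewrite -exprM ler_weXn2l // mulnBl -expnD mul1n subnK //.
  by rewrite leq_sub2l // qX_gt1.
rewrite -exprS => h; apply: le_trans (_ : N (alpha n'.+1) * q%:R ^+ (q ^ n'.+1) <= _).
  by rewrite ler_peMr ?absC_ge0 // exprn_ege1 // ltW // qR_gt1.
by apply: le_trans h _; rewrite ler_weXn2l //; have := qX_gt1 (ltn0Sn n'); lia.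
Qed.

(** Each use of the second half of [alpha_bound] replaces the base [M] by [3 / 4 * M] from some
    index on, because [q * (3 / 4) > 1] makes the constant [G] negligible against a [q ^ n]-th
    power. *)
Lemma alpha_small (e : R) : 0 < e -> exists n0, forall n, (n0 <= n)%N ->
  N (alpha n) <= e ^+ (q ^ n).
Proof.
move=> e0; have [G G1 [hG hstep]] := alpha_bound.
have q1 := qR_gt1 F R; have q0 := qR_gt0 F R; have q2 := q_gt1 F.
have q2R : 2 <= q%:R :> R by rewrite ler_nat.
have G0 : 0 < G by apply: lt_le_trans G1.
have H j : exists n0, forall n, (n0 <= n)%N -> N (alpha n) <= (G * (3 / 4) ^+ j) ^+ (q ^ n).
  elim: j => [|j [n0 IH]]; first by exists 0%N => n _; rewrite expr0 mulr1.
  have [|n1 hn1] := @expr_big R (q%:R * (3 / 4)) G; first by lra.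
  exists (n0 + r + n1).+1 => n nn.
  have P0 : 0 < q%:R ^+ (q ^ n) :> R by rewrite exprn_gt0.
  rewrite -(ler_pM2r P0); set M := G * (3 / 4) ^+ j in IH.
  have M0 : 0 <= M by rewrite mulr_ge0 ?exprn_ge0 //; lra.
  have n_gt0 : (0 < n)%N by lia.
  apply: le_trans (hstep n M M0 n_gt0 _) _; first by move=> k kr kn; apply: IH; lia.
  have -> : G * (3 / 4) ^+ j.+1 = M * (3 / 4) by rewrite /M exprSr; ring.
  rewrite [leRHS]mulrC -[leRHS]exprMn mulrCA exprMn mulrC ler_wpM2l ?exprn_ge0 //.
  apply: ltW; apply: hn1; have : (n <= q ^ n)%N by apply/ltnW/ltn_expl.
  by lia.
have [||| j hj] := @expr_small R (3 / 4) (e / G); [lra|lra|by rewrite divr_gt0|].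
have [n0 hn] := H j; exists n0 => n /hn h; apply: le_trans h _.
rewrite lerXn2r ?nnegrE ?mulr_ge0 ?exprn_ge0 ?(ltW e0) ?(ltW G0) //; try lra.
by have := hj j (leqnn _); rewrite ltr_pdivlMr // mulrC => /ltW.
Qed.

(** The sum has at most one term: [alpha n] is placed at index [q ^ n]. The lock keeps it from
    unfolding. *)
Definition ec : fps C := locked (Fps (fun i => \sum_(n < i.+1 | (q ^ n == i)%N) alpha n)).
Lemma ecE i : ec i = \sum_(n < i.+1 | (q ^ n == i)%N) alpha n.
Proof. by rewrite /ec -lock. Qed.

Lemma ec_qX n : ec (q ^ n)%N = alpha n.
Proof.
have nq : (n < (q ^ n).+1)%N by rewrite ltnS ltnW // ltn_expl // q_gt1.
rewrite ecE (bigD1 (Ordinal nq)) //= big1 ?addr0 // => -[m hm] /= /andP[/eqP E].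
by move/eqP; case; apply/val_inj => /=; apply: (@expnI q) => //; apply: q_gt1.
Qed.
Lemma ec_out i : (forall n, (q ^ n != i)%N) -> ec i = 0.
Proof. by move=> h; rewrite ecE big1 // => n; rewrite (negPf (h _)). Qed.
Lemma ecP i : ec i = 0 \/ exists2 n, i = (q ^ n)%N & ec i = alpha n.
Proof.
have [[n ->]|h] := EM (exists n, i = (q ^ n)%N); [right|left].
  by exists n; rewrite ?ec_qX.
by apply: ec_out => n; apply/eqP => E; apply: h; exists n.
Qed.
Lemma ec0 : ec 0%N = 0.
Proof. by apply: ec_out => n; rewrite gtn_eqF // qXgt0. Qed.
Lemma ec1 : ec 1%N = 1. Proof. by rewrite -(expn0 q) ec_qX alpha0. Qed.

Lemma ent_ec : ent ec.
Proof.
move=> ro ro0; have r1 : 0 < ro + 1 by rewrite ltr_wpDl.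
have [|n0 hn] := @alpha_small (ro + 1)^-1; first by rewrite invr_gt0.
have [M M0 hM] := nb_trivial ro ec (q ^ n0).
exists (Num.max M 1) => i.
have [lt|ge] := ltnP i (q ^ n0); first by rewrite le_max hM.
rewrite le_max; apply/orP; right; have [->|[n Ei ->]] := ecP i.
  by rewrite absC0 mul0r ler01.
have nn : (n0 <= n)%N by move: ge; rewrite Ei leq_exp2l // q_gt1.
apply: le_trans (_ : (ro + 1)^-1 ^+ i * (ro + 1) ^+ i <= _).
  apply: ler_pM; rewrite ?absC_ge0 ?exprn_ge0 //; first by rewrite Ei hn.
  by rewrite lerXn2r ?nnegrE ?(ltW r1) // lerDl.
by rewrite -exprMn mulVf ?expr1n // gt_eqF.
Qed.

Lemma sp_sum_coef a i : (\sum_(k < r.+1) pfps (g k)%:P * sp k a) i = th * a i +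
  \sum_(k < r) g k.+1 * (if (q ^ k.+1 %| i)%N then frn k.+1 (a (i %/ q ^ k.+1)%N) else 0).
Proof.
rewrite fcoef_sum big_ord_recl fcoefCM [nat_of_ord ord0]/= dcoef0; congr (_ + _).
  by rewrite /= expn0 dvd1n divn1 frn0.
by apply: eq_bigr => k _; rewrite lift0 fcoefCM.
Qed.

Lemma ec_eq : \sum_(k < r.+1) pfps (g k)%:P * sp k ec = sc th ec.
Proof.
apply/fpsP => i; rewrite sp_sum_coef /=.
have [[n Ei]|h] := EM (exists n, i = (q ^ n)%N); last first.
  have h0 : ec i = 0 by apply: ec_out => n; apply/eqP => E; apply: h; exists n.
  rewrite h0 mulr0 mul0r add0r big1 // => k _.
  case: ifP => [/dvdnP[j Ej]|_]; last by rewrite mulr0.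
  rewrite Ej mulnK ?qXgt0 // ec_out ?rmorph0 ?mulr0 // => m.
  by apply/eqP => Em; apply: h; exists (m + k.+1)%N; rewrite expnD Em.
rewrite Ei ec_qX.
have [n0|n0] := posnP n.
  rewrite n0 expn0 alpha0 mulr1 mul1r expr1 big1 ?addr0 // => k _.
  by rewrite dvdn1 gtn_eqF ?mulr0 // qX_gt1.
have := alphaE n0; rewrite mulrBr => /eqP; rewrite subr_eq => /eqP ->.
rewrite addrC mulrC; congr (_ + _); apply: eq_bigr => k _.
have [kn|kn] := leqP k.+1 n; last first.
  by rewrite gtnNdvd ?mulr0 ?qXgt0 // ltn_exp2l // q_gt1.
have {1 2}-> : n = ((n - k.+1) + k.+1)%N by lia.
by rewrite expnD dvdn_mull // mulnK ?qXgt0 // ec_qX.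
Qed.

Definition ex x : C := xget 0 [set c | evl x ec c].
Lemma exP x : evl x ec (ex x).
Proof.
rewrite /ex; case: xgetP => [c _ //|h].
by have [c hc] := ent_evl x ent_ec; case: (h c).
Qed.
Lemma ex_cvg x : abs_cvg N (fun m => \sum_(n < m) alpha n * frn n x) (ex x).
Proof.
have hs m : \sum_(i < q ^ m) ec i * x ^+ i = \sum_(n < m) alpha n * frn n x.
  elim: m => [|m IH]; first by rewrite expn0 big_ord1 big_ord0 ec0 mul0r.
  rewrite [RHS]big_ord_recr -IH /=.
  have mm : (q ^ m < q ^ m.+1)%N by rewrite ltn_exp2l // q_gt1.
  rewrite -(subnKC (ltnW mm)) big_split_ord /=; congr (_ + _).
  have d0 : (0 < q ^ m.+1 - q ^ m)%N by rewrite subn_gt0.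
  rewrite (bigD1 (Ordinal d0)) //= addn0 ec_qX big1 ?addr0 // => i i0.
  rewrite ec_out ?mul0r // => n; apply/eqP => E.
  have h1 : (q ^ m < q ^ n)%N.
    rewrite E -{1}(addn0 (q ^ m)%N) ltn_add2l lt0n.
    by apply: contraNneq i0 => i0; apply/eqP/val_inj.
  have h2 : (q ^ n < q ^ m.+1)%N by rewrite E -ltn_subRL ltn_ord.
  by move: h1 h2; rewrite !ltn_exp2l ?q_gt1 // ltnS => h1; rewrite leqNgt h1.
apply/abs_cvgP => e e0; have [n0 hn] := (abs_cvgP _ _).1 (evl_cvg (exP x)) e e0.
exists n0 => n nn; rewrite -hs; apply: hn; apply: leq_trans nn _.
by rewrite ltnW // ltn_expl // q_gt1.
Qed.

Lemma abs_cvgD u v (l l' : C) : abs_cvg N u l -> abs_cvg N v l' ->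
  abs_cvg N (fun n => u n + v n) (l + l').
Proof.
move=> /abs_cvgP hu /abs_cvgP hv; apply/abs_cvgP => e e0.
have [n1 h1] := hu e e0; have [n2 h2] := hv e e0.
exists (maxn n1 n2) => n; rewrite geq_max => /andP[hn1 hn2].
by rewrite opprD addrACA absC_addr_lt ?h1 ?h2.
Qed.
Lemma abs_cvgZ u (l c : C) : abs_cvg N u l -> abs_cvg N (fun n => c * u n) (c * l).
Proof.
move=> /abs_cvgP hu; apply/abs_cvgP => e e0.
have c0 : 0 < N c + 1 by rewrite ltr_wpDl ?absC_ge0.
have [|n1 h1] := hu (e / (N c + 1)); first by rewrite divr_gt0.
exists n1 => n /h1; rewrite ltr_pdivlMr // -mulrBr absC_mul mulrC => h.
by apply: le_lt_trans h; rewrite ler_wpM2r ?absC_ge0 // lerDl.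
Qed.

Lemma exD x y : ex (x + y) = ex x + ex y.
Proof.
apply: abs_cvg_unique (ex_cvg _) _.
have := abs_cvgD (ex_cvg x) (ex_cvg y); congr abs_cvg; apply/funext => n.
by rewrite -big_split; apply: eq_bigr => i _; rewrite rmorphD mulrDr.
Qed.
Lemma exZ c x : ex (ofF C c * x) = ofF C c * ex x.
Proof.
apply: abs_cvg_unique (ex_cvg _) _.
have := abs_cvgZ (ofF C c) (ex_cvg x); congr abs_cvg; apply/funext => n.
by rewrite mulr_sumr; apply: eq_bigr => i _; rewrite rmorphM /= frn_ofF mulrCA.
Qed.
Lemma ex0 : ex 0 = 0.
Proof. by have := exZ 0 0; rewrite rmorph0 !mul0r. Qed.
Lemma ex_theta x : teval (phi 'X) (ex x) = ex (th * x).
Proof.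
rewrite teval_phiX; have h1 := evl_sc ent_ec (exP (th * x)).
apply: evl_unique h1; rewrite -ec_eq; apply: evl_sum => k _; apply: evlZ.
by apply: evl_sp; [exact: ent_ec|exact: exP].
Qed.

Lemma is_drinfeld_exp_ex : is_drinfeld_exp phi ex.
Proof.
split; [by split; [exact: exD|exact: exZ]| |exact: ex_theta].
by exists ec; split; [exact: ec0|exact: ec1|move=> x; apply: evl_cvg (exP x)].
Qed.

(** The functional equation holds for the series by the identity theorem, and for [i > 1] it
    determines the coefficient of index [i] from lower ones, since [theta ^+ i] differs from
    [theta]. *)
Lemma drinfeld_exp_uniq f : is_drinfeld_exp phi f -> f = ex.
Proof.
move=> [_ [c [c0 c1 hc]] hth]; have [hent hevl] := ent_sum_evl hc.
suff E : Fps c = ec.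
  by apply/funext => x; apply: evl_unique (hevl x) _; rewrite E; apply: exP.
have E : \sum_(k < r.+1) pfps (g k)%:P * sp k (Fps c) = sc th (Fps c).
  apply: ent_eq => [||x d d' hd hd'].
  - by apply: ent_fsum => k; apply: entM; [exact: ent_poly|exact: ent_sp].
  - exact: ent_sc.
  rewrite (evl_unique hd' (evl_sc hent (hevl _))) -hth teval_phiX.
  apply: evl_unique hd _; apply: evl_sum => k _; apply: evlZ.
  by apply: evl_sp.
apply/fpsP => i; have [m] := ubnP i; elim: m i => // m IH i; rewrite ltnS => im.
case: (ltnP 1 i) => [i1|]; last first.
  by case: i im => [|[|//]] im _; rewrite ?ec0 ?ec1.
have /fpsP/(_ i) := E; have /fpsP/(_ i) := ec_eq; rewrite !sp_sum_coef /=.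
set A := \sum_(k < r) _; set A' := \sum_(k < r) _.
have -> : A' = A.
  apply: eq_bigr => k _.
  case: ifP => // /dvdnP[j Ej]; congr (_ * frn _ _).
  rewrite Ej mulnK ?qXgt0 //; apply: IH; apply: leq_trans im.
  rewrite Ej ltn_Pmulr ?qX_gt1 //; rewrite lt0n; apply: contraTneq i1 => j0.
  by rewrite Ej j0 mul0n.
move=> h1 h2; apply: (mulIf (thX_sub_neq0 C i1)).
rewrite !mulrBr -h2 -h1; ring.
Qed.

Lemma drinfeld_expE : drinfeld_exp phi = ex.
Proof.
rewrite /drinfeld_exp; case: xgetP => [f _ hf|/(_ ex)]; first exact: drinfeld_exp_uniq.
by case; apply: is_drinfeld_exp_ex.
Qed.

End Drinfeld.

(** * Twisted polynomials as additive functions *)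

Section TwistedPoly.
Context (F : finFieldType) (R : realType) (C : Cinfty F R).
Local Notation q := #|F|.
Local Notation N := (@absC F R C).
Local Notation th := (theta C).
Implicit Types (P Q : {poly C}) (x y : C).

Lemma tevalD P Q x : teval (P + Q) x = teval P x + teval Q x.
Proof.
pose n := maxn (size P) (size Q).
rewrite !(@teval_wide _ _ _ n) ?leq_maxl ?leq_maxr ?size_polyD // -big_split.
by apply: eq_bigr => i _; rewrite coefD mulrDl.
Qed.
Lemma tevalZ c P x : teval (c *: P) x = c * teval P x.
Proof.
rewrite !(@teval_wide _ _ _ (size P)) ?size_scale_leq // mulr_sumr.
by apply: eq_bigr => i _; rewrite coefZ mulrA.
Qed.
Lemma teval0 x : teval 0 x = 0 :> C.
Proof. by rewrite /teval size_poly0 big_ord0. Qed.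
Lemma teval_sum (I : Type) (r : seq I) (p : pred I) (f : I -> {poly C}) x :
  teval (\sum_(i <- r | p i) f i) x = \sum_(i <- r | p i) teval (f i) x.
Proof. by elim/big_rec2: _ => [|i y z _ <-]; rewrite ?teval0 ?tevalD. Qed.
Lemma tevalXn k x : teval 'X^k x = frn k x.
Proof.
rewrite /teval size_polyXn (bigD1 ord_max) //= coefXn eqxx mul1r big1 ?addr0 //.
move=> i ik; rewrite coefXn; case: eqP => [E|_]; last by rewrite mul0r.
by case/eqP: ik; apply/val_inj.
Qed.
Lemma teval1 x : teval 1 x = x :> C.
Proof. by have := tevalXn 0 x; rewrite expr0 frn0. Qed.
Lemma teval_tmul P Q x : teval (tmul P Q) x = teval P (teval Q x).
Proof.
rewrite /tmul teval_sum [RHS]/teval; apply: eq_bigr => i _.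
rewrite teval_sum -frnE [teval Q x]/teval rmorph_sum mulr_sumr; apply: eq_bigr => j _.
by rewrite tevalZ tevalXn rmorphM /= -mulrA !frnE -!exprM addnC expnD.
Qed.

(** The difference, seen as an ordinary polynomial with exponents [q ^ i], vanishes everywhere; were
    it not constant, adding a nonzero constant would still give a polynomial with a root. *)
Lemma teval_inj P Q : (forall x, teval P x = teval Q x) -> P = Q.
Proof.
move=> h; apply/eqP; rewrite -subr_eq0; set D := P - Q.
have hD x : teval D x = 0 by rewrite tevalD -scaleN1r tevalZ h mulN1r subrr.
pose p : {poly C} := \sum_(i < size D) D`_i *: 'X^(q ^ i).
have hp x : p.[x] = 0.
  by rewrite -[RHS](hD x) horner_sum; apply: eq_bigr => i _; rewrite !hornerE.
have p0 : p = 0.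
  have [sp|sp] := leqP (size p) 1.
    by rewrite (size1_polyC sp); have := hp 0; rewrite horner_coef0 => ->.
  have sp1 : (1 < size (p - 1)%R)%N by rewrite size_polyDl // size_polyN size_poly1.
  have [x] := closedC_root sp1.
  rewrite rootE !hornerE hp sub0r oppr_eq0 oner_eq0 //.
apply/eqP/polyP => n; rewrite coef0; have [ns|sn] := ltnP n (size D); last exact: nth_default.
have := congr1 (fun p : {poly C} => p`_(q ^ n)) p0; rewrite coef0 coef_sum.
rewrite (bigD1 (Ordinal ns)) //= coefZ coefXn eqxx mulr1 big1 ?addr0 // => i ni.
rewrite coefZ coefXn; case: eqP => [/expnI E|_]; last by rewrite mulr0.
by case/eqP: ni; apply/val_inj/esym/E/q_gt1.
Qed.

End TwistedPoly.

(** * Quasi-periodic functions and Anderson generating functions *)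

Section QuasiPeriodic.
Context (F : finFieldType) (R : realType) (C : Cinfty F R).
Local Notation q := #|F|.
Local Notation N := (@absC F R C).
Local Notation th := (theta C).
Context (r : nat) (phi : {poly F} -> {poly C}) (hphi : drinfeld_module r phi).
Local Notation g := (dcoef phi).
Local Notation ex := (ex r phi).
Local Notation ec := (ec r phi).

Lemma phiC c x : teval (phi c%:P) x = ofF C c * x.
Proof.
by rewrite -[c%:P]mulr1 mul_polyC (drinfeldZ hphi) (drinfeld1 hphi) tevalZ teval1.
Qed.
Lemma phiM a b x : teval (phi (a * b)) x = teval (phi a) (teval (phi b) x).
Proof. by rewrite (drinfeldM hphi) teval_tmul. Qed.

Lemma ofA_cons (p : {poly F}) c : ofA C (p * 'X + c%:P) = th * ofA C p + ofF C c.
Proof. by rewrite rmorphD rmorphM mulrC. Qed.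

Lemma ex_ofA a x : ex (ofA C a * x) = teval (phi a) (ex x).
Proof.
elim/poly_ind: a => [|p c IH].
  rewrite rmorph0 mul0r ex0.
  have := drinfeldZ hphi 0 0; rewrite !scale0r rmorph0 scale0r => ->.
  by rewrite teval0.
rewrite ofA_cons mulrDl exD exZ (drinfeldD hphi) tevalD phiC -mulrA.
by rewrite -(ex_theta hphi) IH [p * 'X]mulrC phiM.
Qed.

Section Fixk.
Context (k : nat) (k0 : (0 < k)%N).

(** Coefficientwise solution of [f(theta X) - theta f(X) = exp(X) ^ (q ^ k)]. Below index [q] the
    right-hand side vanishes, so the solution starts at [q] and the vanishing denominator at index 1
    is avoided. *)
Definition fc : fps C := locked
  (Fps (fun i => if (i < q)%N then 0 else sp k ec i / (th ^+ i - th))).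
Lemma fcE i : fc i = if (i < q)%N then 0 else sp k ec i / (th ^+ i - th).
Proof. by rewrite /fc -lock. Qed.
Lemma sp_low i : (i < q)%N -> sp k ec i = 0.
Proof.
move=> iq /=; case: ifP => // h; have i0 : i = 0%N.
  have qk : (q <= q ^ k)%N by rewrite -{1}(expn1 q) leq_exp2l // q_gt1.
  have [//|ip] := posnP i.
  by have h' := leq_trans qk (dvdn_leq ip h); rewrite leqNgt iq in h'.
by rewrite i0 div0n (ec0 r phi) rmorph0.
Qed.

Lemma ent_fc : ent fc.
Proof.
move=> ro ro0; have [M hM] := ent_sp k (ent_ec r phi) ro0.
exists M => i; rewrite fcE; have M0 := nb_ge0 ro0 hM; case: ltnP => iq.
  by rewrite absC0 mul0r.
have i1 : (1 < i)%N by apply: leq_trans iq; apply: q_gt1.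
apply: le_trans (hM i); rewrite ler_wpM2r ?exprn_ge0 // absC_mul absCV absC_thX_sub //.
rewrite ler_pdivrMr ?exprn_gt0 ?qR_gt0 // ler_peMr ?absC_ge0 // exprn_ege1 //.
by rewrite ltW // qR_gt1.
Qed.

Lemma fc_eq : sc th fc - pfps th%:P * fc = sp k ec.
Proof.
apply/fpsP => i; rewrite fcoefB fcoefCM [sc _ _ i]/= fcE; case: ltnP => iq.
  by rewrite mul0r mulr0 subrr sp_low.
have i1 : (1 < i)%N by apply: leq_trans iq; apply: q_gt1.
by field; apply: thX_sub_neq0.
Qed.

Definition qp x : C := xget 0 [set c | evl x fc c].
Lemma qpP x : evl x fc (qp x).
Proof.
rewrite /qp; case: xgetP => [c _ //|h].
by have [c hc] := ent_evl x ent_fc; case: (h c).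
Qed.
Lemma qp_theta x : qp (th * x) - th * qp x = frn k (ex x).
Proof.
have h1 := evl_sc ent_fc (qpP (th * x)).
have h2 := evlB h1 (evlZ th (qpP x)); rewrite fc_eq in h2.
by apply: evl_unique h2 _; apply: evl_sp; [exact: ent_ec|exact: exP].
Qed.

(** Iterates [qp_theta] at [x / theta ^+ n]. The remainder tends to 0 because [fc] vanishes to order
    at least 2. The sum is formally a twisted generating function at [theta], and it shows that [qp]
    is additive. *)
Lemma qp_lim x : abs_cvg N (fun n => \sum_(i < n) frn k (ex (x / th ^+ i.+1)) * th ^+ i) (qp x).
Proof.
have th0 := theta_neq0 C; have q1 := qR_gt1 F R; have q0 := qR_gt0 F R.
have st n : qp x = th ^+ n * qp (x / th ^+ n) +
    \sum_(i < n) frn k (ex (x / th ^+ i.+1)) * th ^+ i.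
  elim: n => [|n IH]; first by rewrite big_ord0 expr0 divr1 mul1r addr0.
  rewrite IH big_ord_recr /= -qp_theta.
  have -> : th * (x / th ^+ n.+1) = x / th ^+ n by rewrite exprS; field; rewrite expf_neq0 // th0.
  by rewrite exprSr; ring.
have ro0 : 0 < N x + 1 by rewrite ltr_wpDl ?absC_ge0.
have [M hM] := ent_fc (ltW ro0).
have M0 := nb_ge0 (ltW ro0) hM.
apply/abs_cvgP => e e0; have [n0 hn] := expr_big (M / e) q1.
exists n0 => n /hn h; rewrite (st n) opprD addrCA subrr addr0 absCN absC_mul absCX theta_absC.
have b1 : N (qp (x / th ^+ n)) <= M * (N (x / th ^+ n) / (N x + 1)) ^+ 2.
  apply: (evl_bound (qpP _) hM ro0).
    rewrite absC_mul absCV absCX theta_absC ler_pdivrMr ?exprn_gt0 //.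
    apply: le_trans (_ : N x + 1 <= _); first by rewrite lerDl.
    by apply: ler_peMr; [exact: ltW|apply: exprn_ege1; exact: ltW].
  by move=> i i2; rewrite fcE (leq_trans i2) // q_gt1.
have b2 : N (x / th ^+ n) / (N x + 1) <= (q%:R ^+ n)^-1.
  rewrite absC_mul absCV absCX theta_absC mulrAC ler_piMl ?invr_ge0 ?exprn_ge0 ?(ltW q0) //.
  by rewrite ler_pdivrMr // mul1r lerDl.
have P0 : 0 < q%:R ^+ n :> R by rewrite exprn_gt0.
apply: le_lt_trans (_ : q%:R ^+ n * (M * (q%:R ^+ n)^-1 ^+ 2) < _).
  rewrite ler_wpM2l ?(ltW P0) //; apply: le_trans b1 _; rewrite ler_wpM2l //.
  by rewrite lerXn2r ?nnegrE ?divr_ge0 ?absC_ge0 ?invr_ge0 ?(ltW P0) ?(ltW ro0).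
rewrite expr2 mulrCA mulVKf ?gt_eqF // ltr_pdivrMr // mulrC -ltr_pdivrMr //.
Qed.

Lemma qpD x y : qp (x + y) = qp x + qp y.
Proof.
apply: abs_cvg_unique (qp_lim _) _.
have := abs_cvgD (qp_lim x) (qp_lim y); congr abs_cvg; apply/funext => n.
by rewrite -big_split; apply: eq_bigr => i _; rewrite mulrDl exD rmorphD mulrDl.
Qed.
Lemma qpZ c x : qp (ofF C c * x) = ofF C c * qp x.
Proof.
apply: abs_cvg_unique (qp_lim _) _.
have := abs_cvgZ (ofF C c) (qp_lim x); congr abs_cvg; apply/funext => n.
rewrite mulr_sumr; apply: eq_bigr => i _.
by rewrite -mulrA exZ rmorphM /= frn_ofF mulrA.
Qed.

(** Value at [t ^ m] of the biderivation sending [t] to [tau ^ k], unfolded by the product rule. It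
    shows that the [xget] in [biderivation_tau] has something to choose. *)
Fixpoint dm (m : nat) : {poly C} :=
  if m is m'.+1 then th *: dm m' + tmul 'X^k (phi 'X^m') else 0.
Definition delta (a : {poly F}) : {poly C} := \sum_(m < size a) ofF C a`_m *: dm m.

Lemma delta_wide n (a : {poly F}) : (size a <= n)%N -> delta a = \sum_(m < n) ofF C a`_m *: dm m.
Proof.
move=> sn; rewrite /delta (big_ord_widen n (fun m => ofF C a`_m *: dm m)) //.
rewrite big_mkcond; apply: eq_bigr => i _; case: ltnP => // h.
by rewrite nth_default // rmorph0 scale0r.
Qed.
Lemma deltaD a b : delta (a + b) = delta a + delta b.
Proof.
pose n := maxn (size a) (size b).
rewrite !(@delta_wide n) ?leq_maxl ?leq_maxr ?size_polyD // -big_split.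
by apply: eq_bigr => i _; rewrite coefD rmorphD scalerDl.
Qed.
Lemma deltaZ c a : delta (c *: a) = ofF C c *: delta a.
Proof.
rewrite !(@delta_wide (size a)) ?size_scale_leq // scaler_sumr.
by apply: eq_bigr => i _; rewrite coefZ rmorphM scalerA.
Qed.
Lemma delta_coef0 a : (delta a)`_0 = 0.
Proof.
have h m : (dm m)`_0 = 0.
  elim: m => [|m IH]; first by rewrite coef0.
  rewrite /= coefD coefZ IH mulr0 add0r coef_sum big1 // => i _.
  rewrite coef_sum big1 // => j _; rewrite coefZ !coefXn.
  case: (posnP i) => [->|i0]; first by rewrite eq_sym gtn_eqF // !mul0r.
  by rewrite (_ : (0%N == i + j)%N = false) ?mulr0 //; apply/eqP; lia.
by rewrite coef_sum big1 // => m _; rewrite coefZ h mulr0.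
Qed.
Lemma delta_teval a y : teval (delta (a * 'X)) y = th * teval (delta a) y + frn k (teval (phi a) y).
Proof.
have E : delta (a * 'X) = \sum_(m < size a) ofF C a`_m *: dm m.+1.
  rewrite (@delta_wide (size a).+1) ?(leq_trans (size_polyMleq _ _)) ?size_polyX ?addn2 //.
  rewrite big_ord_recl coefMX eqxx rmorph0 scale0r add0r.
  by apply: eq_bigr => m _; rewrite lift0 coefMX.
have Ea z : teval (phi a) z = \sum_(m < size a) ofF C a`_m * teval (phi 'X^m) z.
  have phi0 : phi 0 = 0 by have := drinfeldZ hphi 0 0; rewrite !scale0r rmorph0 scale0r.
  rewrite -{1}(coefK a) poly_def (big_morph phi (drinfeldD hphi) phi0) teval_sum.
  by apply: eq_bigr => m _; rewrite (drinfeldZ hphi) tevalZ.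
rewrite E teval_sum /delta teval_sum Ea rmorph_sum mulr_sumr -big_split.
apply: eq_bigr => m _; rewrite /= !tevalZ tevalD tevalZ teval_tmul tevalXn rmorphM /= frn_ofF.
by ring.
Qed.
Lemma deltaC c : delta c%:P = 0.
Proof.
rewrite (@delta_wide 1) ?size_polyC; last by case: (c != 0).
by rewrite big_ord1 /= scaler0.
Qed.

Lemma delta_biderivation : is_biderivation phi delta.
Proof.
split; [exact: deltaD|exact: deltaZ|exact: delta_coef0|move=> a b].
apply: teval_inj => y; rewrite tevalD tevalZ teval_tmul.
elim/poly_ind: a y => [|p c IH] y.
  by rewrite mul0r -[0]/(0%:P) deltaC rmorph0 mul0r !teval0 addr0.
have -> : (p * 'X + c%:P) * b = (p * b) * 'X + c *: b.
  by rewrite mulrDl mul_polyC mulrAC.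
rewrite !deltaD deltaZ deltaC addr0 tevalD tevalZ !delta_teval IH phiM ofA_cons.
by ring.
Qed.
Lemma deltaX : delta 'X = 'X^k.
Proof.
apply: teval_inj => y; have := delta_teval 1 y; rewrite mul1r => ->.
rewrite -[1]/(1%:P) deltaC teval0 mulr0 add0r tevalXn.
by congr (frn _ _); rewrite polyC1 (drinfeld1 hphi) teval1.
Qed.

Lemma biderivation_tauP : is_biderivation phi (biderivation_tau phi k) /\
  biderivation_tau phi k 'X = 'X^k.
Proof.
rewrite /biderivation_tau; case: xgetP => [d _ //|/(_ delta)].
by case; split; [exact: delta_biderivation|exact: deltaX].
Qed.

Lemma qp_quasi_periodic : is_quasi_periodic phi (biderivation_tau phi k) qp.
Proof.
have [[dD dZ _ dM] dX] := biderivation_tauP; set d := biderivation_tau phi k in dD dZ dM dX *.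
split; first by split; [exact: qpD|exact: qpZ].
  exists fc; split => [i iq|x]; first by rewrite fcE iq.
  exact: evl_cvg (qpP x).
have d1 y : teval (d 1) y = 0.
  have := congr1 (fun P => teval P y) (dM 1 1).
  rewrite mulr1 tevalD tevalZ teval_tmul rmorph1 (drinfeld1 hphi) teval1 mul1r.
  by move/eqP; rewrite -subr_eq0 opprD addrA subrr sub0r oppr_eq0 => /eqP.
move=> a x; rewrite (drinfeld_expE hphi); elim/poly_ind: a => [|p c IH].
  have -> : d 0 = 0 by have := dZ 0 0; rewrite !scale0r rmorph0 scale0r.
  by rewrite rmorph0 !mul0r teval0 subr0; have := qpZ 0 0; rewrite rmorph0 !mul0r.
have -> : d (p * 'X + c%:P) = th *: d p + tmul 'X^k (phi p) + ofF C c *: d 1.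
  by rewrite dD [p * 'X]mulrC dM dX -dZ alg_polyC.
rewrite !tevalD !tevalZ teval_tmul tevalXn d1 -IH mulr0 addr0 -ex_ofA ofA_cons.
rewrite mulrDl qpD qpZ -mulrA -qp_theta -/(theta C).
by ring.
Qed.

Lemma quasi_periodic_uniq f : is_quasi_periodic phi (biderivation_tau phi k) f -> f = qp.
Proof.
move=> [_ [c [clow hc]] ha]; have [hent hevl] := ent_sum_evl hc.
suff E : Fps c = fc.
  by apply/funext => x; apply: evl_unique (hevl x) _; rewrite E; apply: qpP.
have E : sc th (Fps c) - pfps th%:P * Fps c = sp k ec.
  apply: ent_eq => [||x d d' hd hd'].
  - by apply: entD; [exact: ent_sc|apply: entN; apply: entM => //; exact: ent_poly].
  - exact: (ent_sp k (ent_ec r phi)).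
  rewrite (evl_unique hd' (evl_sp k (ent_ec r phi) (exP r phi x))).
  rewrite (evl_unique hd (evlB (evl_sc hent (hevl _)) (evlZ th (hevl x)))).
  by have := ha 'X x; rewrite biderivation_tauP.2 tevalXn (drinfeld_expE hphi).
apply/fpsP => i; rewrite fcE; case: ltnP => iq; first exact: clow.
have i1 : (1 < i)%N by apply: leq_trans iq; apply: q_gt1.
have /fpsP/(_ i) <- := E; rewrite fcoefB fcoefCM /=.
by field; apply: thX_sub_neq0.
Qed.

Lemma quasi_periodicE : quasi_periodic phi (biderivation_tau phi k) = qp.
Proof.
rewrite /quasi_periodic; case: xgetP => [f _ hf|/(_ qp)]; first exact: quasi_periodic_uniq.
by case; apply: qp_quasi_periodic.
Qed.

End Fixk.

(* Anderson generating functions. *)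
Definition agf mu : fps C := Fps (fun i => ex (mu / th ^+ i.+1)).

Lemma ex_lip : exists2 M, 0 <= M & forall y, N y <= 1 -> N (ex y) <= M * N y.
Proof.
have [M hM] := ent_ec r phi ler01; exists M; first exact: (nb_ge0 ler01 hM).
move=> y y1; have := evl_bound (m := 1) (exP r phi y) hM ltr01 y1; rewrite divr1 expr1; apply.
by case=> //; rewrite ec0.
Qed.
Lemma ex_lin : exists2 M, 0 <= M & forall y, N y <= 1 -> N (ex y - y) <= M * N y ^+ 2.
Proof.
have h : ent (ec - pfps 'X) by apply: entD; [exact: ent_ec|apply: entN; exact: ent_poly].
have [M hM] := h _ ler01; exists M; first exact: (nb_ge0 ler01 hM).
move=> y y1; have he := evlB (exP r phi y) (evl_poly y 'X); rewrite hornerX in he.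
have := evl_bound (m := 2) he hM ltr01 y1; rewrite divr1; apply.
by case=> [|[|//]] _; rewrite fcoefB /= coefX ?ec0 ?ec1 subrr.
Qed.

Lemma agf_bdd mu : bdd q%:R (agf mu).
Proof.
have [M M0 hM] := ex_lip; have q1 := qR_gt1 F R; have q0 := qR_gt0 F R.
have [n0 hn] := expr_big (N mu) q1.
have [M' M0' hM'] := nb_trivial q%:R (agf mu) n0.
exists (Num.max M' (M * N mu)) => i; rewrite le_max.
have [/hM' -> //|ni] := ltnP i n0; apply/orP; right.
have E : N (mu / th ^+ i.+1) = N mu / q%:R ^+ i.+1 by rewrite absC_mul absCV absCX theta_absC.
have P0 n : 0 < q%:R ^+ n :> R by rewrite exprn_gt0.
apply: le_trans (_ : M * N (mu / th ^+ i.+1) * q%:R ^+ i <= _).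
  rewrite ler_wpM2r ?(ltW (P0 _)) //; apply: hM.
  by rewrite E ler_pdivrMr // mul1r ltW // hn //; lia.
rewrite E -mulrA ler_wpM2l // exprSr invfM mulrA mulrAC divfK ?gt_eqF //.
by rewrite ler_pdivrMr // ler_peMr ?absC_ge0 // ltW.
Qed.

Lemma q_ltX k : (0 < k)%N -> q%:R < q%:R ^+ (q ^ k) :> R.
Proof. by move=> k0; rewrite -[ltLHS]expr1 ltr_eXn2l ?qR_gt1 // qX_gt1. Qed.

Lemma agf_tw_bdd mu k : bdd (q%:R ^+ (q ^ k)) (tw k (agf mu)).
Proof.
have [M hM] := agf_bdd mu; exists (M ^+ (q ^ k)).
by apply: nb_tw => //; apply: ltW; apply: qR_gt0.
Qed.

Lemma agf_evl mu k : (0 < k)%N -> evl th (tw k (agf mu)) (qp k mu).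
Proof.
move=> k0; have [||c hc] := @evl_exists _ _ _ th (q%:R ^+ (q ^ k)) (tw k (agf mu)).
- by rewrite theta_absC q_ltX.
- exact: agf_tw_bdd.
suff -> : qp k mu = c by [].
exact: abs_cvg_unique (qp_lim k0 mu) (evl_cvg hc).
Qed.

Lemma agfD mu nu : agf (mu + nu) = agf mu + agf nu.
Proof. by apply/fpsP => i; rewrite fcoefD /= mulrDl exD. Qed.

Section Lattice.
Context (mu : C) (hmu : period_lattice phi mu).
Lemma ex_mu : ex mu = 0. Proof. by move: hmu; rewrite /period_lattice /= (drinfeld_expE hphi). Qed.

(** Coefficient by coefficient this is the functional equation of the exponential; the lattice
    condition enters at index 0, where the coefficient would be the exponential of [mu]. *)
Lemma agf_eq : \sum_(k < r.+1) pfps (g k)%:P * tw k (agf mu) = pfps 'X * agf mu.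
Proof.
apply/fpsP => i; rewrite fcoef_sum fcoefXM.
under eq_bigr => k _ do rewrite fcoefCM fmapE /=.
rewrite -(teval_phiX hphi) (ex_theta hphi); have th0 := theta_neq0 C.
have -> : th * (mu / th ^+ i.+1) = mu / th ^+ i by rewrite exprS; field; rewrite expf_neq0 // th0.
by case: i => [|i] //; rewrite expr0 divr1 ex_mu.
Qed.

(** By [agf_eq] the product equals a combination of proper twists, which are bounded beyond [theta].
    Its partial sums at [theta] telescope to [- theta ^+ n.+1] times the exponential of
    [mu / theta ^+ n.+1], which tends to [- mu]. *)
Lemma agf_res : evl th (pfps ('X - th%:P) * agf mu) (- mu).
Proof.
have E : pfps ('X - th%:P) * agf mu = \sum_(k < r) pfps (g k.+1)%:P * tw k.+1 (agf mu).
  rewrite rmorphB mulrBl -agf_eq big_ord_recl (dcoef0 hphi) tw0 addrAC subrr add0r.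
  by apply: eq_bigr => k _; rewrite lift0.
have hc : evl th (pfps ('X - th%:P) * agf mu) (\sum_(k < r) g k.+1 * qp k.+1 mu).
  by rewrite E; apply: evl_sum => k _; apply: evlZ; apply: agf_evl.
suff -> : - mu = \sum_(k < r) g k.+1 * qp k.+1 mu by [].
apply: abs_cvg_unique (evl_cvg hc); have th0 := theta_neq0 C.
have q1 := qR_gt1 F R; have q0 := qR_gt0 F R.
have hs n : \sum_(i < n.+1) (pfps ('X - th%:P) * agf mu) i * th ^+ i =
    - (th ^+ n.+1 * agf mu n).
  elim: n => [|n IH]; first by rewrite big_ord1 fcoefXsubM expr0 expr1 mulr1 sub0r.
  have Ec : (pfps ('X - th%:P) * agf mu) n.+1 = agf mu n - th * agf mu n.+1.
    by rewrite fcoefXsubM.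
  transitivity (- (th ^+ n.+1 * agf mu n) + (agf mu n - th * agf mu n.+1) * th ^+ n.+1).
    by rewrite -IH -Ec big_ord_recr.
  rewrite [in RHS]exprS.
  by move: (agf mu n) (agf mu n.+1) (th ^+ n.+1) => x y z; ring.
have [M M0 hM] := ex_lin; have [n0 hn0] := expr_big (N mu) q1.
apply/abs_cvgP => e e0; have [n1 hn1] := expr_big (M * N mu ^+ 2 / e) q1.
exists (n0 + n1).+1 => -[//|n] nn; rewrite hs opprK addrC -opprB absCN.
have E2 : th ^+ n.+1 * agf mu n - mu = th ^+ n.+1 * (ex (mu / th ^+ n.+1) - mu / th ^+ n.+1).
  by rewrite mulrBr mulrCA divff ?expf_neq0 // mulr1.
have P0 : 0 < q%:R ^+ n.+1 :> R by rewrite exprn_gt0.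
have Ey : N (mu / th ^+ n.+1) = N mu / q%:R ^+ n.+1 by rewrite absC_mul absCV absCX theta_absC.
rewrite E2 absC_mul absCX theta_absC.
apply: le_lt_trans (_ : q%:R ^+ n.+1 * (M * (N mu / q%:R ^+ n.+1) ^+ 2) < _).
  rewrite ler_wpM2l ?(ltW P0) // -Ey; apply: hM.
  by rewrite Ey ler_pdivrMr // mul1r ltW // hn0 //; lia.
rewrite expr_div_n expr2 [X in M * (_ / X)]expr2 invfM.
have -> : q%:R ^+ n.+1 * (M * (N mu * N mu * ((q%:R ^+ n.+1)^-1 / q%:R ^+ n.+1))) =
    M * N mu ^+ 2 / q%:R ^+ n.+1 :> R by rewrite expr2; field; rewrite gt_eqF.
rewrite ltr_pdivrMr // [e * _]mulrC -ltr_pdivrMr //; apply: hn1; lia.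
Qed.

(** The coefficients are torsion points of [phi]: one application of [phi 'X] leads to the preceding
    coefficient and finally to 0. *)
Lemma agf_Kbar i : Kbar C (agf mu i).
Proof.
have th0 := theta_neq0 C.
have step c : Kbar C (teval (phi 'X) c) -> Kbar C c.
  move=> hc; pose p := \sum_(k < r.+1) g k *: 'X^(q ^ k) - (teval (phi 'X) c)%:P.
  have pK j : Kbar C p`_j.
    rewrite coefB coefC coef_sum; apply: KbarB; last by case: eqP => // _; apply: Kbar0.
    apply: Kbar_sum => k _; rewrite coefZ coefXn; apply: KbarM; first exact: dcoef_Kbar hphi _.
    by case: eqP => _; [exact: Kbar1|exact: Kbar0].
  apply: Kbar_root pK _; last first.
    rewrite rootE !hornerE horner_sum (teval_phiX hphi) subr_eq0; apply/eqP/eq_bigr => k _.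
    by rewrite !hornerE.
  apply/negP => /eqP/polyP/(_ (q ^ r)%N); rewrite coef0 coefB coefC gtn_eqF ?qXgt0 // subr0.
  rewrite coef_sum (bigD1 ord_max) //= coefZ coefXn eqxx mulr1 big1 ?addr0 => [|k kr].
    by move/eqP; rewrite (negPf (dcoef_lead hphi)).
  rewrite coefZ coefXn; case: eqP => [/expnI E|_]; last by rewrite mulr0.
  by case/eqP: kr; apply/val_inj/esym/E/q_gt1.
have St j : th * (mu / th ^+ j.+1) = mu / th ^+ j.
  by rewrite exprS; field; rewrite expf_neq0 // th0.
elim: i => [|i IH]; apply: step; rewrite (ex_theta hphi) St //.
by rewrite expr0 divr1 ex_mu; apply: Kbar0.
Qed.

Lemma agf_theta : agf (th * mu) = pfps 'X * agf mu.
Proof.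
have th0 := theta_neq0 C; apply/fpsP => i; rewrite fcoefXM /=.
have -> : th * mu / th ^+ i.+1 = mu / th ^+ i by rewrite exprS; field; rewrite expf_neq0 // th0.
by case: i => [|i] //; rewrite expr0 divr1 ex_mu.
Qed.
End Lattice.

Lemma latticeD mu nu : period_lattice phi mu -> period_lattice phi nu ->
  period_lattice phi (mu + nu).
Proof. by rewrite /period_lattice /= (drinfeld_expE hphi) exD => -> ->; rewrite addr0. Qed.
Lemma lattice0 : period_lattice phi 0.
Proof. by rewrite /period_lattice /= (drinfeld_expE hphi) ex0. Qed.
Lemma latticeA a mu : period_lattice phi mu -> period_lattice phi (ofA C a * mu).
Proof.
rewrite /period_lattice /= (drinfeld_expE hphi) ex_ofA => ->.
by rewrite /teval big1 // => i _; rewrite -frnE rmorph0 mulr0.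
Qed.
Lemma lattice_sum (I : Type) (s : seq I) (P : pred I) (f : I -> C) :
  (forall i, P i -> period_lattice phi (f i)) -> period_lattice phi (\sum_(i <- s | P i) f i).
Proof. by move=> h; elim/big_ind: _ => //; [exact: lattice0|exact: latticeD]. Qed.

Lemma agf0 : agf 0 = 0.
Proof. by apply/fpsP => i; rewrite /= mul0r ex0. Qed.
Lemma agf_sum (I : Type) (s : seq I) (P : pred I) (f : I -> C) :
  agf (\sum_(i <- s | P i) f i) = \sum_(i <- s | P i) agf (f i).
Proof. exact: (big_morph agf agfD agf0). Qed.
Lemma agfA a mu : period_lattice phi mu ->
  agf (ofA C a * mu) = pfps (map_poly (ofF C) a) * agf mu.
Proof.
move=> hmu; elim/poly_ind: a => [|p c IH].
  by rewrite rmorph0 mul0r rmorph0 rmorph0 mul0r agf0.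
rewrite ofA_cons mulrDl agfD -mulrA agf_theta; last exact: latticeA.
rewrite IH rmorphD rmorphM /= map_polyX map_polyC /= rmorphD rmorphM /= mulrDl.
congr (_ + _); first by ring.
by apply/fpsP => i; rewrite fcoefCM /= -mulrA exZ.
Qed.

End QuasiPeriodic.

(** * The period determinant *)

Section FpsOrder.
Context (K : fieldType).
Implicit Types a b : fps K.

Lemma fcoefXnM n a i : (pfps 'X^n * a) i = if (i < n)%N then 0 else a (i - n)%N.
Proof.
elim: n i => [|n IH] i; first by rewrite expr0 rmorph1 mul1r subn0.
by rewrite exprS rmorphM -mulrA fcoefXM; case: i => [|i] //; rewrite IH ltnS subSS.
Qed.

Definition ford a n := [/\ forall i, (i < n)%N -> a i = 0 & a n != 0].
Lemma ford_exists a : a != 0 -> exists n, ford a n.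
Proof.
move=> a0; have : exists i, a i != 0.
  apply: contrapT => h; case/eqP: a0; apply/fpsP => i; apply/eqP.
  by apply: contrapT => /negP hi; apply: h; exists i.
move=> ex; exists (ex_minn ex); case: ex_minnP => n hn hm; split=> // i.
by rewrite ltnNge => /negP ni; apply/eqP; apply: contrapT => /negP/hm.
Qed.
Lemma ford_split a n : (forall i, (i < n)%N -> a i = 0) -> a = pfps 'X^n * Fps (fun i => a (i + n)%N).
Proof.
move=> h; apply/fpsP => i; rewrite fcoefXnM; case: ltnP => [/h //|ni].
by rewrite /= subnK.
Qed.
Lemma ford_div a b n : ford a n -> (forall i, (i < n)%N -> b i = 0) -> exists c, b = a * c.
Proof.
move=> [ha an] hb; rewrite (ford_split ha) (ford_split hb).
have u : Fps (fun i => a (i + n)%N) \is a GRing.unit by apply: funit_coef0.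
exists ((Fps (fun i => a (i + n)%N))^-1 * Fps (fun i => b (i + n)%N)).
by rewrite -mulrA mulrA mulrA -[_ * _ * _^-1]mulrA divrr // mulr1.
Qed.
End FpsOrder.

Lemma mulmx_det0 (D : idomainType) m n (M : 'M[D]_(m, n)) (A : 'M[D]_n) :
  \det A != 0 -> M *m A = 0 -> M = 0.
Proof.
move=> dA MA; have : M *m A *m \adj A = 0 by rewrite MA mul0mx.
by rewrite -mulmxA mul_mx_adj mul_mx_scalar => /eqP; rewrite scalemx_eq0 (negPf dA) => /eqP.
Qed.

Section Companion.
Context (F : finFieldType) (R : realType) (C : Cinfty F R).
HB.instance Definition _ k := GRing.RMorphism.copy (@tw F R C k) (fmap (@frn F R C k)).
Local Notation q := #|F|.
Local Notation N := (@absC F R C).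
Local Notation th := (theta C).
Local Notation ptw k := (map_poly (@frn F R C k)).

(* The matrix of Frobenius on [f^(0), ..., f^(r-1)]. *)
Definition comp_mx r (g : nat -> C) : 'M[{poly C}]_r :=
  \matrix_(a, b) if (b.+1 == r)%N then (g r)^-1 *: ('X *+ (a == 0 :> nat) - (g a)%:P)
                 else (a == b.+1 :> nat)%:R.

Lemma det_comp_mx r g : (0 < r)%N ->
  \det (comp_mx r g) = (- 1) ^+ r.-1 * ((g r)^-1 *: ('X - (g 0%N)%:P)).
Proof.
case: r => // r _; rewrite (expand_det_row _ ord0) (bigD1 ord_max) //= big1 => [|b bm]; last first.
  rewrite mxE ifF ?mul0r //; apply/eqP => /= E; case/eqP: bm; apply/val_inj; move: E => /= [] //.
rewrite addr0 mxE eqxx /= mulr1n mulrC; congr (_ * _).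
rewrite /cofactor /= add0n (_ : row' _ _ = 1%:M) ?det1 ?mulr1 //.
apply/matrixP => a b; have br : (b < r)%N := ltn_ord b.
by rewrite !mxE lift0 lift_max /= !eqSS (ltn_eqF br).
Qed.
End Companion.

Section Periods.
Context (F : finFieldType) (R : realType) (C : Cinfty F R).
Local Notation q := #|F|.
Local Notation N := (@absC F R C).
Local Notation th := (theta C).
Local Notation ptw k := (map_poly (@frn F R C k)).
Context (r : nat) (phi : {poly F} -> {poly C}) (hphi : drinfeld_module r phi).
Local Notation g := (dcoef phi).
Local Notation agf := (agf r phi).
Local Notation Lat := (period_lattice phi).
Local Notation ro1 := (q%:R ^+ q : R).

Definition B0 : 'M[{poly C}]_r := comp_mx r g.
Definition Bm : 'M[{poly C}]_r := map_mx (ptw 1) B0.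
(** The twists start at 1: they are bounded on radius [q ^ q], hence have values at [theta], unlike
    the generating function itself. *)
Definition vrow (mu : C) : 'rV[fps C]_r := \row_l tw l.+1 (agf mu).
Definition urow (mu : C) : 'rV[fps C]_r := \row_l tw l (agf mu).
Local Notation pm := (map_mx (@pfps C)).
Local Notation twm := (map_mx (@tw F R C 1)).

Lemma twm_pm m n (A : 'M[{poly C}]_(m, n)) : twm (pm A) = pm (map_mx (ptw 1) A).
Proof. by apply/matrixP => i j; rewrite !mxE tw_pfps. Qed.

Lemma urow_B0 mu : Lat mu -> vrow mu = urow mu *m pm B0.
Proof.
move=> hmu; apply/rowP => b; rewrite !mxE; have gr := dcoef_lead hphi.
under eq_bigr => a _ do rewrite !mxE.
case: eqP => [br|br]; last first.
  have b1 : (b.+1 < r)%N by have := ltn_ord b; lia.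
  rewrite (bigD1 (Ordinal b1)) //= eqxx rmorph1 mulr1 big1 ?addr0 // => a ab.
  rewrite (_ : (a == b.+1 :> nat) = false) ?rmorph0 ?mulr0 //.
  by apply/eqP => E; case/eqP: ab; apply/val_inj.
have E := agf_eq hphi hmu; rewrite big_ord_recr /= in E.
have r0 := drinfeld_rank hphi.
have -> : tw b.+1 (agf mu) = pfps (g r)^-1%:P * (pfps 'X * agf mu - \sum_(k < r) pfps (g k)%:P * tw k (agf mu)).
  by rewrite -E [X in X - _]addrC addrK mulrA -rmorphM -polyCM mulVf // rmorph1 mul1r br.
have -> : pfps 'X * agf mu = \sum_(k < r) pfps ('X *+ (k == 0 :> nat)) * tw k (agf mu).
  rewrite (bigD1 (Ordinal r0)) //= ?eqxx mulr1n tw0 big1 ?addr0 // => k k0.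
  rewrite (_ : (k == 0 :> nat) = false) ?mulr0n ?rmorph0 ?mul0r //.
  by apply/eqP => Ek; case/eqP: k0; apply/val_inj.
rewrite -sumrB mulr_sumr; apply: eq_bigr => k _.
by rewrite -mul_polyC rmorphM rmorphB /= -mulrBl [RHS]mulrC mulrA.
Qed.
Lemma vrow_tw mu : vrow mu = twm (urow mu).
Proof. by apply/rowP => l; rewrite !mxE -twD add1n. Qed.
Lemma vrow_B mu : Lat mu -> twm (vrow mu) = vrow mu *m pm Bm.
Proof. by move=> h; rewrite {1}(urow_B0 h) map_mxM -vrow_tw twm_pm. Qed.

Lemma det_B0 : \det B0 = (- 1) ^+ r.-1 * ((g r)^-1 *: ('X - th%:P)).
Proof. by rewrite det_comp_mx ?(drinfeld_rank hphi) // (dcoef0 hphi). Qed.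
Lemma det_Bm : \det Bm = ((- 1) ^+ r.-1 * frn 1 (g r)^-1) *: ('X - (frn 1 th)%:P).
Proof.
rewrite det_map_mx det_B0 rmorphM rmorphXn rmorphN1 /= map_polyZ /= map_polyXsubC.
by rewrite -[(-1) ^+ _]/((-1) ^+ r.-1) -(rmorph_sign (@polyC C)) mul_polyC scalerA.
Qed.
Lemma det_Bm_neq0 : \det Bm != 0.
Proof.
by rewrite det_Bm scaler_eq0 polyXsubC_eq0 orbF mulf_neq0 ?signr_eq0 // fmorph_eq0 invr_eq0 dcoef_lead.
Qed.

Lemma ro1_gt : q%:R < ro1.
Proof. by have := @q_ltX F R 1 isT; rewrite expn1. Qed.
Lemma ro1_ge0 : 0 <= ro1.
Proof. by rewrite exprn_ge0 // ltW // qR_gt0. Qed.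
Lemma theta_ro1 : N th < ro1.
Proof. by rewrite theta_absC ro1_gt. Qed.

Lemma agf_tw_bdd1 mu k : (0 < k)%N -> bdd ro1 (tw k (agf mu)).
Proof.
move=> k0; have [M hM] := agf_tw_bdd r phi mu k; exists M; apply: nb_radius hM; first exact: ro1_ge0.
rewrite ler_eXn2l ?qR_gt1 // -{1}(expn1 q) leq_exp2l //; exact: q_gt1.
Qed.
Lemma bdd_evl (a : fps C) : bdd ro1 a -> exists c, evl th a c.
Proof. exact: evl_exists theta_ro1. Qed.

Lemma nb_prodXsub (xs : seq C) ro : 0 <= ro -> (forall x, x \in xs -> N x <= ro) ->
  nb ro (ro ^+ size xs) (pfps (\prod_(x <- xs) ('X - x%:P))).
Proof.
move=> ro0; elim: xs => [|x xs IH] h.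
  by rewrite big_nil expr0 -polyC1; have := nbC ro (1 : C); rewrite absC1.
rewrite big_cons rmorphM exprS; apply: nbM => //.
  by apply: nbXsub => //; apply: h; rewrite mem_head.
by apply: IH => y hy; apply: h; rewrite inE hy orbT.
Qed.

(** Discreteness of the lattice. Infinitely many zeros of the exponential in a bounded disc would,
    by the Schwarz lemma, make its linear coefficient smaller than 1, although it equals 1. *)
Lemma lattice_finite (M : R) (w : nat -> C) :
  (forall n, Lat (w n)) -> (forall n, N (w n) <= M) -> exists i j, (i < j)%N /\ w i = w j.
Proof.
move=> hw hM; apply: contrapT => hn.
have winj : injective w.
  move=> i j E; apply/eqP; apply: contrapT => /negP ij; apply: hn.
  by case: (ltngtP i j) ij => // h _; [exists i, j|exists j, i].
have M0 : 0 <= M := le_trans (absC_ge0 _) (hM 0%N).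
have s0 : 0 < M + 1 by rewrite ltr_wpDl.
have ro0 : 0 < 2 * (M + 1) by rewrite mulr_gt0.
have [A hA] := ent_ec r phi (ltW ro0).
have [n0 hn0] := @expr_big R 2 A ltac:(lra).
pose xs := map w (iota 0 n0).
have xsM x : x \in xs -> N x <= M by move=> /mapP [n _ ->].
have [|x /xsM h|x /mapP [n _ ->]|b hb E] := @schwarz _ _ _ xs (2 * (M + 1)) A (ec r phi) _ _ hA.
- by rewrite map_inj_uniq ?iota_uniq.
- lra.
- have := exP r phi (w n); have := hw n.
  by rewrite /period_lattice /= (drinfeld_expE hphi) => ->.
have hx : forall x, x \in xs -> N x <= M + 1 by move=> x /xsM; lra.
have h1 : nb (M + 1) ((M + 1) ^+ size xs * (A / (2 * (M + 1)) ^+ size xs)) (ec r phi).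
  rewrite E; apply: nbM; [exact: ltW|apply: nb_prodXsub => //; exact: ltW|].
  by apply: nb_radius hb; [exact: ltW|lra].
have := h1 1%N; rewrite ec1 absC1 mul1r expr1 size_map size_iota exprMn invfM.
have P0 : 0 < (M + 1) ^+ n0 by rewrite exprn_gt0.
have Q0 : 0 < 2 ^+ n0 :> R by rewrite exprn_gt0.
have -> : (M + 1) ^+ n0 * (A * (2 ^- n0 / (M + 1) ^+ n0)) = A / 2 ^+ n0.
  by field; rewrite !gt_eqF.
have : A / 2 ^+ n0 < 1 by rewrite ltr_pdivrMr // mul1r hn0.
by lra.
Qed.

Section Basis.
Context (mu : 'I_r -> C) (hmu : forall j, Lat (mu j)) (free_mu : A_free mu).
Definition Ups : 'M[fps C]_r := \matrix_(j, l) vrow (mu j) 0 l.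

Lemma Ups_B : twm Ups = Ups *m pm Bm.
Proof.
apply/matrixP => j l; have /rowP/(_ l) := vrow_B (hmu j); rewrite !mxE => ->.
by apply: eq_bigr => k _; rewrite !mxE.
Qed.

Lemma det_pm_Bm : \det (pm Bm) != 0.
Proof. by rewrite det_map_mx -(rmorph0 (@pfps C)) (inj_eq (@pfps_inj C)) det_Bm_neq0. Qed.

(** A Frobenius-fixed kernel vector has entries in [F[[t]]]. Its truncations give lattice points
    divisible by higher and higher powers of [theta], whose quotients [w n] are bounded lattice
    points. Two of them coincide, which yields a relation over [A] with constant term -1 at [j0]. *)
Lemma Ups_fixed_kernel (y : 'rV[fps C]_r) j0 : twm y = y -> y 0 j0 = 1 -> y *m Ups = 0 -> False.
Proof.
move=> yf y1 yU; have r0 := drinfeld_rank hphi.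
have hF j i : exists c, y 0 j i = ofF C c.
  apply: frob_fixed; have /rowP/(_ j) := yf; rewrite mxE => /fpsP/(_ i).
  by rewrite fmapE /= frn1.
have [yF hyF] := choice (fun p : 'I_r * nat => hF p.1 p.2).
have k0 : \sum_j y 0 j * agf (mu j) = 0.
  apply: (@tw_inj _ _ _ 1); rewrite rmorph0 rmorph_sum /=.
  have /rowP/(_ (Ordinal r0)) := yU; rewrite mxE mxE => {2}<-.
  apply: eq_bigr => j _; rewrite rmorphM /= !mxE; congr (_ * _).
  by have /rowP/(_ j) := yf; rewrite mxE.
pose a M j : {poly F} := \poly_(i < M) yF (j, i).
pose nu M := \sum_j ofA C (a M j) * mu j.
have nuL M : Lat (nu M) by apply: (lattice_sum hphi) => j _; apply: (latticeA hphi).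
have agf_nu M i : (i < M)%N -> agf (nu M) i = 0.
  move=> iM; have -> : agf (nu M) = \sum_j (pfps (map_poly (ofF C) (a M j)) - y 0 j) * agf (mu j).
    transitivity (agf (nu M) - \sum_j y 0 j * agf (mu j)); first by rewrite k0 subr0.
    rewrite agf_sum -sumrB; apply: eq_bigr => j _.
    by rewrite (agfA hphi) // mulrBl.
  rewrite fcoef_sum big1 // => j _; rewrite fcoefM big1 // => k _.
  have kM : (k < M)%N by have := ltn_ord k; lia.
  by rewrite fcoefB /= coef_map coef_poly kM (hyF (j, k : nat)) subrr mul0r.
have th0 := theta_neq0 C.
pose w n := nu n.+1 / th ^+ n.+1.
have wL n : Lat (w n).
  by rewrite /period_lattice /= (drinfeld_expE hphi); apply: (agf_nu n.+1 n).
have wM n : N (w n) <= \sum_j N (mu j).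
  rewrite absC_mul absCV absCX theta_absC ler_pdivrMr ?exprn_gt0 ?qR_gt0 //.
  have S0 : 0 <= \sum_j N (mu j) by apply: sumr_ge0 => j _; apply: absC_ge0.
  apply: absC_sum_le => [|j _]; first by rewrite mulr_ge0 // exprn_ge0 // ltW // qR_gt0.
  rewrite absC_mul mulrC; apply: ler_pM; rewrite ?absC_ge0 //.
    by rewrite (bigD1 j) //= lerDl; apply: sumr_ge0 => k _; apply: absC_ge0.
  have [->|a0] := eqVneq (a n.+1 j) 0; first by rewrite rmorph0 absC0 exprn_ge0 // ltW // qR_gt0.
  rewrite ofA_absC // ler_weXn2l // ?ltW ?qR_gt1 //.
  have := size_poly n.+1 (fun i => yF (j, i)); rewrite -/(a n.+1 j); lia.
have [i [i' [ii E]]] := lattice_finite wL wM.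
have : \sum_j ofA C (a i.+1 j * 'X^(i' - i) - a i'.+1 j) * mu j = 0.
  transitivity (nu i.+1 * th ^+ (i' - i) - nu i'.+1); last first.
    have -> : nu i'.+1 = w i' * th ^+ i'.+1 by rewrite /w divfK // expf_neq0.
    rewrite -E (_ : i'.+1 = (i.+1 + (i' - i))%N); last lia.
    by rewrite exprD mulrA /w divfK ?expf_neq0 // subrr.
  rewrite /nu mulr_suml -sumrB; apply: eq_bigr => j _.
  rewrite rmorphB rmorphM rmorphXn /=; ring.
move=> /free_mu/(_ j0)/polyP/(_ 0%N)/eqP.
rewrite coefB coefMXn coef_poly coef0 subn_gt0 ii /= sub0r oppr_eq0 => /eqP E0.
rewrite coef_poly /= in E0.
have := hyF (j0, 0%N); rewrite /= E0 rmorph0 y1 fcoef1 => /eqP.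
by rewrite oner_eq0.
Qed.

(** Artin's argument: a kernel vector of minimal support, normalised to have an entry 1, minus its
    twist has smaller support, hence is Frobenius-fixed, and [Ups_fixed_kernel] excludes this. *)
Lemma det_Ups_neq0 : \det Ups != 0.
Proof.
apply/negP => /det0P [x0 x0n x0U].
pose supp (x : 'rV[fps C]_r) := #|[pred j | x 0 j != 0]|.
have exn : exists n, `[< exists x, [/\ x != 0, x *m Ups = 0 & supp x = n] >].
  by exists (supp x0); apply/asboolP; exists x0.
have [x [xn xU xs] xmin] : exists2 x : 'rV[fps C]_r, [/\ x != 0, x *m Ups = 0 & supp x = ex_minn exn] &
    forall y, y *m Ups = 0 -> (supp y < supp x)%N -> y = 0.
  case: ex_minnP => n /asboolP [x [xn xU xs]] hm; exists x => // y yU ys; apply/eqP.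
  apply: contrapT => /negP yn; suff: (n <= supp y)%N by rewrite -xs leqNgt ys.
  by apply: hm; apply/asboolP; exists y.
have [j1 xj1] : exists j, x 0 j != 0.
  apply: contrapT => h; case/eqP: xn; apply/rowP => j; rewrite mxE; apply/eqP.
  by apply: contrapT => /negP hj; apply: h; exists j.
have hex j : exists n, x 0 j != 0 -> ford (x 0 j) n.
  by have [->|/ford_exists [n hn]] := eqVneq (x 0 j) 0; [exists 0%N|exists n].
have [od hod] := choice hex.
(* Series are not a field, so the normalising entry must be one of lowest order; it then divides all
   the others. *)
have [j0 xj0 hj0] : exists2 j0, x 0 j0 != 0 & forall j, x 0 j != 0 -> (od j0 <= od j)%N.
  by case: (@arg_minnP _ j1 (fun j => x 0 j != 0) od xj1) => j0; exists j0.
have hey j : exists c, x 0 j = x 0 j0 * c.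
  apply: (ford_div (hod _ xj0)) => i ij.
  have [-> //|xj] := eqVneq (x 0 j) 0; have [h _] := hod _ xj; apply: h.
  exact: leq_trans ij (hj0 _ xj).
have [y hy] := choice hey.
pose Y : 'rV[fps C]_r := \row_j y j.
have xY : x = x 0 j0 *: Y by apply/rowP => j; rewrite !mxE.
have YU : Y *m Ups = 0.
  apply/eqP; move: xU; rewrite xY -scalemxAl => /eqP.
  by rewrite scalemx_eq0 (negPf xj0).
have y1 : y j0 = 1 by apply: (mulfI xj0); rewrite -hy mulr1.
apply: (@Ups_fixed_kernel Y j0); rewrite ?mxE //.
have twYU : twm Y *m Ups = 0.
  have : twm Y *m Ups *m pm Bm = 0 by rewrite -mulmxA -Ups_B -map_mxM YU map_mx0.
  exact/mulmx_det0/det_pm_Bm.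
apply/eqP; rewrite -subr_eq0; apply/eqP; apply: xmin; first by rewrite mulmxBl twYU YU subrr.
apply: proper_card; apply/properP; split.
  apply/fintype.subsetP => j; rewrite !inE !mxE => h; apply: contraNneq h => xj.
  suff -> : y j = 0 by rewrite rmorph0 subrr.
  by apply: (mulfI xj0); rewrite -hy mulr0.
by exists j0; rewrite !inE ?xj0 // !mxE y1 rmorph1 subrr eqxx.
Qed.
End Basis.

(** For any root [x], the product of [x - c] over [c] in [F] equals [y], so one of the factors has
    norm below 1; it is again a root. *)
Lemma artin_schreier (y : C) : N y < 1 -> exists2 x, N x < 1 & x ^+ q - x = y.
Proof.
move=> y1; pose p : {poly C} := 'X^q - 'X - y%:P.
have sp : size p = q.+1.
  rewrite /p -addrA size_polyDl ?size_polyXn // (leq_ltn_trans (size_polyD _ _)) //.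
  by rewrite !size_polyN size_polyX size_polyC gtn_max !ltnS q_gt1 (leq_trans (leq_b1 _)) // q_gt0.
have sp1 : (1 < size p)%N by rewrite sp ltnS q_gt0.
have [x] := closedC_root sp1.
rewrite rootE !hornerE subr_eq0 => /eqP hx.
have E (z : C) : z ^+ q - z = \prod_(c : F) (z - ofF C c).
  have := congr1 (fun P => (map_poly (ofF C) P).[z]) (finField_genPoly F).
  rewrite rmorphB rmorph_prod /= map_polyXn map_polyX !hornerE => ->.
  by rewrite horner_prod; apply: eq_bigr => c _; rewrite map_polyXsubC !hornerE.
have [c hc] : exists c, N (x - ofF C c) < 1.
  apply: contrapT => h; suff: 1 <= N y by lra.
  rewrite -hx E; have -> : N (\prod_(c : F) (x - ofF C c)) = \prod_(c : F) N (x - ofF C c).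
    exact: (big_morph N (@absC_mul F R C) (@absC1 F R C)).
  elim/big_ind: _ => // [a b ha hb|c _]; first by rewrite -[1]mulr1 ler_pM.
  by rewrite leNgt; apply/negP => h'; apply: h; exists c.
exists (x - ofF C c) => //; rewrite -hx.
have := frn_ofF C 1 c; rewrite frnE expn1 => Ec.
have -> : (x - ofF C c) ^+ q = x ^+ q - ofF C c by rewrite -{2}Ec -!(@frn1 _ _ C) rmorphB.
by ring.
Qed.

(** Solving the difference equation [Om_eq] coefficient by coefficient leads to Artin-Schreier
    equations. Compared with an infinite product, this makes it visible that the coefficients are
    algebraic over [K]. *)
Fixpoint om n : C := if n is m.+1 then
  xget 0 [set x | N x < 1 /\ x ^+ q - x = th ^- q * om m ^+ q] else 1.

Lemma omP n : N (om n) <= (ro1 ^+ n)^-1 /\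
  (N (om n.+1) < 1 /\ om n.+1 ^+ q - om n.+1 = th ^- q * om n ^+ q).
Proof.
have q1 := qR_gt1 F R; have q0 := qR_gt0 F R; have r0 : 0 < ro1 by rewrite exprn_gt0.
have r1 : 1 < ro1 := lt_trans q1 ro1_gt.
have st n' : N (om n') <= (ro1 ^+ n')^-1 ->
    N (om n'.+1) < 1 /\ om n'.+1 ^+ q - om n'.+1 = th ^- q * om n' ^+ q.
  move=> h; rewrite /=; case: xgetP => [x _ //|].
  have [|x x1 hx] := @artin_schreier (th ^- q * om n' ^+ q); last by move=> /(_ x) [].
  rewrite absC_mul absCV !absCX theta_absC mulrC ltr_pdivrMr // mul1r.
  apply: (le_lt_trans _ r1); rewrite exprn_ile1 ?absC_ge0 //; apply: (le_trans h).
  by rewrite invf_le1 ?exprn_gt0 // exprn_ege1 // ltW.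
elim: n => [|n [IH1 IH2]]; first by split; [rewrite /= absC1 expr0 invr1|apply: st; rewrite /= absC1 expr0 invr1].
suff h : N (om n.+1) <= (ro1 ^+ n.+1)^-1 by split; [|exact: st].
have [x1 hx] := IH2; set x := om n.+1 in x1 hx *.
have -> : N x = N (th ^- q * om n ^+ q).
  rewrite -hx; have [-> //|xn] := eqVneq x 0.
    by rewrite expr0n (gtn_eqF (q_gt0 F)) subrr.
  rewrite absC_addr_dom ?absCN // absCX -{2}(expr1 (N x)) ltr_iXn2l ?absC_gt0 //.
  exact: q_gt1.
rewrite absC_mul absCV !absCX theta_absC exprS invfM ler_pM ?invr_ge0 ?exprn_ge0 ?absC_ge0 ?(ltW q0) //.
apply: (le_trans _ IH1); rewrite -{2}(expr1 (N (om n))) ler_wiXn2l ?absC_ge0 ?q_gt0 //.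
by apply: (le_trans IH1); rewrite invf_le1 ?exprn_gt0 // exprn_ege1 // ltW.
Qed.

(* The product of the [1 - t / theta^(q^i)] over [i >= 1]. *)
Definition Om : fps C := Fps om.
Lemma Om_eq : Om = pfps (1 - th ^- q *: 'X) * tw 1 Om.
Proof.
apply/fpsP => i; rewrite rmorphB rmorph1 mulrBl mul1r fcoefB -mul_polyC rmorphM -mulrA fcoefCM fcoefXM.
have e j : tw 1 Om j = om j ^+ q by rewrite -frn1.
case: i => [|i]; first by rewrite e mulr0 subr0 expr1n.
rewrite !e -[Om i.+1]/(om i.+1); have [_ [_ h]] := omP i; rewrite -h.
by rewrite opprB addrCA subrr addr0.
Qed.
Lemma Om_nb : nb ro1 1 Om.
Proof.
move=> i; have r0 : 0 < ro1 by rewrite exprn_gt0 ?qR_gt0.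
have [h _] := omP i; apply: le_trans (ler_wpM2r _ h) _; first by rewrite exprn_ge0 // ltW.
by rewrite mulVf // gt_eqF // exprn_gt0.
Qed.
(** The constant coefficient is 1 and the rest contributes at most [q / q ^ q], which is less than
    1. *)
Lemma Om_evl : exists2 c, evl th Om c & c != 0.
Proof.
have [c hc] := evl_exists theta_ro1 (ex_intro _ 1 Om_nb : bdd ro1 Om).
exists c => //; apply: contraTneq (@ltr01 R) => c0; rewrite {}c0 in hc.
have q0 := qR_gt0 F R; have r0 : 0 < ro1 by rewrite exprn_gt0.
have h1 : nb ro1 1 (Om - pfps 1).
  apply: nbB; [exact: ro1_ge0|exact: Om_nb|].
  by rewrite -polyC1; have := nbC ro1 (1 : C); rewrite absC1.
have := evl_bound (m := 1) (evlB hc (evl_poly th 1)) h1 r0 (ltW theta_ro1).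
rewrite hornerC sub0r absCN absC1 mul1r expr1 theta_absC => h.
rewrite -leNgt; have : 1 <= q%:R / ro1; last first.
  by rewrite ler_pdivlMr // mul1r => h'; have := ro1_gt; rewrite ltNge h'.
by apply: h => -[] // _; rewrite rmorph1 fcoefB fcoef1 /= subrr.
Qed.

(** Unfolding [Om_eq] [n] times gives at [theta] the partial product of the Carlitz period, times
    the value of [tw n Om], which tends to 1. *)
Lemma Om_pi (p : C) c : is_carlitz_period p -> evl th Om c ->
  exists2 w : C, w ^+ (q - 1) = - th & p * c = - w ^+ q.
Proof.
move=> [w hw hp] hc; exists w => //.
have [c' hc' c'0] := Om_evl; rewrite (evl_unique hc' hc) {c' hc'} in c'0.
have q0 := qR_gt0 F R; have q1 := qR_gt1 F R; have r0 : 0 < ro1 by rewrite exprn_gt0.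
have th0 := theta_neq0 C.
have st n : Om = pfps (\prod_(1 <= i < n.+1) (1 - th ^- (q ^ i) *: 'X)) * tw n Om.
  elim: n => [|n IH]; first by rewrite big_geq // rmorph1 mul1r tw0.
  rewrite {1}IH [in RHS]big_nat_recr //= rmorphM -mulrA; congr (_ * _).
  rewrite {1}Om_eq rmorphM /= tw_pfps -twD addn1; congr (pfps _ * _).
  rewrite rmorphB rmorph1 /= map_polyZ map_polyX /=; congr (_ - _ *: _).
  by rewrite fmorphV rmorphXn /= frnE -exprM -expnSr.
have ev n : exists2 d, evl th (tw n Om) d & N (d - 1) <= q%:R^-1 ^+ (q ^ n)%N.
  have hb := nb_tw ro1_ge0 n Om_nb; rewrite expr1n in hb.
  have rr : ro1 <= ro1 ^+ (q ^ n) by rewrite -{1}(expr1 ro1) ler_weXn2l ?qXgt0 // ltW // (lt_trans q1 ro1_gt).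
  have hlt : N th < ro1 ^+ (q ^ n) := lt_le_trans theta_ro1 rr.
  have [d hd] := evl_exists hlt (ex_intro _ 1 hb : bdd _ _).
  exists d => //.
  have rn0 : 0 < ro1 ^+ (q ^ n) by rewrite exprn_gt0.
  have h1 : nb (ro1 ^+ (q ^ n)) 1 (tw n Om - pfps 1).
    apply: nbB; [exact: ltW|exact: hb|].
    by rewrite -polyC1; have := nbC (ro1 ^+ (q ^ n)) (1 : C); rewrite absC1.
  have := evl_bound (m := 1) (evlB hd (evl_poly th 1)) h1 rn0 (ltW hlt).
  rewrite hornerC mul1r expr1 theta_absC => h; apply: le_trans (h _) _.
    by case=> // _; rewrite rmorph1 fcoefB fcoef1 fmapE /= rmorph1 subrr.
  rewrite ler_pdivrMr // -exprMn; apply: le_trans (_ : q%:R ^+ 1 <= _); first by rewrite expr1.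
  have -> : q%:R^-1 * ro1 = q%:R ^+ q.-1 :> R.
    by rewrite -[RHS](mulKf (x := q%:R)) ?gt_eqF // -exprS prednK ?q_gt0.
  rewrite -exprM ler_weXn2l ?(ltW q1) //.
  by rewrite muln_gt0 qXgt0 andbT -ltnS prednK ?q_gt1 // q_gt0.
pose pr n := \prod_(1 <= i < n.+1) (1 - th ^- (q ^ i - 1)) : C.
have prE n d : evl th (tw n Om) d -> c = pr n * d.
  move=> hd; apply: (evl_unique hc); rewrite {1}(st n); apply: evlM => //.
  suff -> : pr n = (\prod_(1 <= i < n.+1) (1 - th ^- (q ^ i) *: 'X)).[th] by apply: evl_poly.
  rewrite horner_prod; apply: eq_bigr => i _; rewrite !hornerE; congr (_ - _).
  by rewrite -{2}(subnK (qXgt0 F i)) exprD expr1 invfM divfK.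
suff -> : p = - w ^+ q / c by rewrite divfK.
apply: abs_cvg_unique hp _; apply/abs_cvgP => e e0.
have K0 : 0 < N (w ^+ q / c) + 1 by rewrite ltr_wpDl ?absC_ge0.
have qi1 : q%:R^-1 < 1 :> R by rewrite invf_lt1.
have qi0 : 0 <= q%:R^-1 :> R by rewrite invr_ge0 ltW.
have [n0 hn0] := expr_small qi0 qi1 (divr_gt0 e0 K0).
exists n0 => n nn; have [d hd hd1] := ev n; have E := prE _ _ hd.
have prn : pr n != 0 by apply: contraNneq c'0 => h; rewrite E h mul0r.
have dn : d != 0 by apply: contraNneq c'0 => h; rewrite E h mulr0.
have -> : - w ^+ q * \prod_(1 <= i < n.+1) (1 - th ^- (q ^ i - 1))^-1 - - w ^+ q / c =
    - (w ^+ q / c) * (d - 1).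
  rewrite prodfV -/(pr n) E; field; by rewrite prn dn.
rewrite absC_mul absCN; apply: le_lt_trans (_ : (N (w ^+ q / c) + 1) * N (d - 1) < _).
  by rewrite ler_wpM2r ?absC_ge0 // lerDl.
rewrite mulrC -ltr_pdivlMr //; apply: le_lt_trans hd1 _; apply: hn0.
by apply: leq_trans nn _; apply: ltnW; apply: ltn_expl; apply: q_gt1.
Qed.

Section BasisDet.
Context (mu : 'I_r -> C) (hmu : forall j, Lat (mu j)) (free_mu : A_free mu).
Local Notation Ups := (Ups mu).

Lemma Ups_bdd j l : bdd ro1 (Ups j l).
Proof. by rewrite !mxE; apply: agf_tw_bdd1. Qed.
Lemma bdd_det n (A : 'M[fps C]_n) : (forall i j, bdd ro1 (A i j)) -> bdd ro1 (\det A).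
Proof.
move=> h; apply: bdd_sum => [|s _]; first exact: ro1_ge0.
apply: bddM; first exact: ro1_ge0.
  by rewrite -(rmorph_sign (@pfps C)); apply: bdd_poly.
by apply: bdd_prod => //; exact: ro1_ge0.
Qed.

(** The coefficients lie in [F] and have norm 0 or 1, so a bound at a radius larger than 1 leaves
    only finitely many of them. *)
Lemma fixed_poly (a : fps C) : bdd ro1 a -> tw 1 a = a -> exists p : {poly F}, a = pfps (map_poly (ofF C) p).
Proof.
move=> [M hM] ha; have q0 := qR_gt0 F R; have r1 : 1 < ro1 := lt_trans (qR_gt1 F R) ro1_gt.
have hF i : exists c, a i = ofF C c.
  by apply: frob_fixed; move/fpsP/(_ i): ha; rewrite fmapE /= frn1.
have [aF haF] := choice hF; have [n0 hn0] := expr_big M r1.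
exists (\poly_(i < n0) aF i); apply/fpsP => i; rewrite /= coef_map coef_poly haF; case: ltnP => // ni.
congr (ofF C _); apply/eqP; apply: contraT => an.
by have := hM i; rewrite haF ofF_absC // mul1r leNgt hn0.
Qed.

(** The multipliers of [\det Ups] and [Om] under Frobenius are inverse to each other up to the
    constant [k1]. Choosing [kap] with [kap ^+ q.-1 = k1^-1] makes the product Frobenius-fixed,
    hence a polynomial over [F]. *)
Lemma det_Ups_Om : exists kap (p : {poly F}), [/\ Kbar C kap, kap != 0, p != 0 &
  pfps kap%:P * \det Ups * Om = pfps (map_poly (ofF C) p)].
Proof.
have th0 := theta_neq0 C; have gr := dcoef_lead hphi.
pose k1 : C := (-1) ^+ r.-1 * frn 1 (g r)^-1 * - th ^+ q.
have k1n : k1 != 0.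
  apply: mulf_neq0; last by rewrite oppr_eq0 expf_neq0.
  by apply: mulf_neq0; [rewrite signr_eq0|rewrite fmorph_eq0 invr_eq0].
have k1K : Kbar C k1.
  apply: KbarM; first apply: KbarM.
  - by apply: KbarX; apply: KbarN; apply: Kbar1.
  - by apply: Kbar_frn; apply: KbarV; apply: dcoef_Kbar hphi _.
  - by apply: KbarN; apply: KbarX; apply: Kbar_theta.
pose P : {poly C} := 'X^(q.-1) - (k1^-1)%:P.
have sP : size P = q.-1.+1.
  rewrite size_polyDl ?size_polyXn // size_polyN size_polyC invr_eq0 k1n ltnS.
  by rewrite -ltnS prednK ?q_gt0 // q_gt1.
have P1 : (1 < size P)%N by rewrite sP prednK ?q_gt0 // q_gt1.
have [kap] := closedC_root P1; have P0 : P != 0 by rewrite -size_poly_eq0 sP.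
move=> hk; have := hk; rewrite rootE !hornerE subr_eq0 => /eqP kE.
have kap0 : kap != 0.
  apply: contraTneq k1n => k0; move: kE; rewrite k0 expr0n gtn_eqF => [/eqP|]; last first.
    by rewrite -ltnS prednK ?q_gt0 // q_gt1.
  by rewrite eq_sym invr_eq0 => ->.
have kapq : frn 1 kap * k1 = kap.
  by rewrite frn1 -(prednK (q_gt0 F)) exprSr -mulrA mulrCA kE mulVf ?mulr1.
have kapK : Kbar C kap.
  apply: Kbar_root P0 _ hk => i; rewrite coefB coefXn coefC; apply: KbarB.
    by case: eqP => _; [apply: Kbar1|apply: Kbar0].
  by case: eqP => _; [apply: KbarV|apply: Kbar0].
have dn : pfps kap%:P * \det Ups * Om != 0.
  rewrite !mulf_neq0 ?det_Ups_neq0 // ?(inj_eq (@pfps_inj C)).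
    by rewrite -(rmorph0 (@pfps C)) (inj_eq (@pfps_inj C)) polyC_eq0.
  by apply/negP => /eqP/fpsP/(_ 0%N)/eqP; rewrite fcoef0 /= oner_eq0.
have [||p hp] := @fixed_poly (pfps kap%:P * \det Ups * Om).
- apply: bddM; [exact: ro1_ge0| |by exists 1; exact: Om_nb].
  apply: bddM; [exact: ro1_ge0|exact: bdd_poly|exact/bdd_det/Ups_bdd].
- have dE : tw 1 (\det Ups) = \det Ups * pfps (\det Bm).
    by rewrite -det_map_mx (Ups_B hmu) det_mulmx det_map_mx.
  rewrite !rmorphM /= tw_pfps map_polyC /= dE det_Bm.
  rewrite [in RHS]Om_eq -{2}kapq.
  have -> : 1 - th ^- q *: 'X = (- th ^- q) *: ('X - (frn 1 th)%:P) :> {poly C}.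
    by rewrite scalerBr !scaleNr opprK [LHS]addrC frn1 -[X in _ = _ + X]mul_polyC -polyCM mulVf ?expf_neq0.
  rewrite -!mul_polyC /k1 !(rmorphM, rmorphN) /=.
  have -> : pfps (th ^- q)%:P = (pfps (th ^+ q)%:P)^-1.
    apply: (mulIf (x := pfps (th ^+ q)%:P)).
      by rewrite -(rmorph0 (@pfps C)) (inj_eq (@pfps_inj C)) polyC_eq0 expf_neq0.
    rewrite mulVr -?rmorphM -?polyCM ?mulVf ?expf_neq0 ?rmorph1 //.
    by apply: funit_coef0; rewrite /= coefC /= expf_neq0.
  have u : pfps (th ^+ q)%:P \is a GRing.unit by apply: funit_coef0; rewrite /= coefC /= expf_neq0.
  set T := pfps _%:P in u *; set d := \det _; set X := pfps _; set O := tw 1 Om.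
  have E : T * T^-1 = 1 by rewrite divrr.
  rewrite -[LHS]mulr1 -E; ring.
exists kap, p; split => //; apply: contraNneq dn => p0.
by rewrite hp p0 !rmorph0.
Qed.

(** The polynomial of [det_Ups_Om] does not vanish at [theta], because [ofA] is injective. This is
    the Legendre relation: the determinant is an algebraic multiple of the inverse of [Om(theta)],
    hence of the Carlitz period. *)
Lemma det_Ups_evl : exists kap D c, [/\ Kbar C kap, kap != 0, evl th (\det Ups) D, evl th Om c & D * c = kap].
Proof.
have [kap [p [kK k0 p0 E]]] := det_Ups_Om.
have [D hD] := bdd_evl (bdd_det Ups_bdd).
have [c hc c0] := Om_evl.
have h1 := evlM (evlZ kap hD) hc; rewrite E in h1.
have := evl_unique h1 (evl_poly th _); rewrite -ofAE => Ep.
exists (ofA C p / kap), D, c; split=> //.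
- by apply: Kbar_div => //; apply: Kbar_ofA.
- by rewrite mulf_neq0 ?invr_eq0 // -(rmorph0 (ofA C)) (inj_eq (@ofA_inj _ _ C)).
- by rewrite -Ep; field.
Qed.
End BasisDet.
End Periods.

(** * Complex multiplication on the Frobenius module *)

Section CMatrix.
Context (F : finFieldType) (R : realType) (C : Cinfty F R).
Local Notation q := #|F|.
Local Notation N := (@absC F R C).
Local Notation th := (theta C).
Local Notation ptw k := (map_poly (@frn F R C k)).
Local Notation pm := (map_mx (@pfps C)).
Local Notation twm := (map_mx (@tw F R C 1)).
Local Notation ro1 := (q%:R ^+ q : R).
Definition pF (a : {poly F}) : fps C := pfps (map_poly (ofF C) a).

Definition Kser (a : fps C) := forall i, Kbar C (a i).
Lemma KserD a b : Kser a -> Kser b -> Kser (a + b).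
Proof. by move=> ha hb i; rewrite fcoefD; apply: KbarD. Qed.
Lemma KserM a b : Kser a -> Kser b -> Kser (a * b).
Proof. by move=> ha hb i; rewrite fcoefM; apply: Kbar_sum => j _; apply: KbarM. Qed.
Lemma Kser_poly (p : {poly C}) : (forall i, Kbar C p`_i) -> Kser (pfps p).
Proof. by []. Qed.
Lemma Kser0 : Kser 0. Proof. by move=> i; apply: Kbar0. Qed.
Lemma Kser1 : Kser 1.
Proof. by move=> i; rewrite fcoef1; case: eqP => _; [exact: Kbar1|exact: Kbar0]. Qed.
Lemma KserN a : Kser a -> Kser (- a).
Proof. by move=> ha i; rewrite fcoefN; apply: KbarN. Qed.
Lemma Kser_sum (I : Type) (s : seq I) (P : pred I) (f : I -> fps C) :
  (forall i, P i -> Kser (f i)) -> Kser (\sum_(i <- s | P i) f i).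
Proof. by move=> h; elim/big_ind: _ => //; [exact: Kser0|exact: KserD]. Qed.
Lemma Kser_prod (I : Type) (s : seq I) (P : pred I) (f : I -> fps C) :
  (forall i, P i -> Kser (f i)) -> Kser (\prod_(i <- s | P i) f i).
Proof. by move=> h; elim/big_ind: _ => //; [exact: Kser1|exact: KserM]. Qed.
Lemma Kser_sign n : Kser ((-1) ^+ n).
Proof. by elim: n => [|n IH]; [exact: Kser1|rewrite exprS; apply: KserM => //; apply/KserN/Kser1]. Qed.
Lemma Kser_det n (A : 'M[fps C]_n) : (forall i j, Kser (A i j)) -> Kser (\det A).
Proof.
by move=> h; apply: Kser_sum => s _; apply: KserM; [exact: Kser_sign|exact: Kser_prod].
Qed.
Lemma Kser_pF a : Kser (pF a).
Proof. by move=> i; rewrite /pF /= coef_map; apply: Kbar_ofA. Qed.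

Lemma Om_Kser : Kser (Om C).
Proof.
elim=> [|i IH]; first exact: Kbar1.
have [_ [_ h]] := omP C i; set y := th ^- q * om C i ^+ q in h.
have yK : Kbar C y.
  by apply: KbarM; [apply: KbarV; apply: KbarX; exact: Kbar_theta|exact: KbarX].
pose p : {poly C} := 'X^q - 'X - y%:P.
have p0 : p != 0.
  apply/negP => /eqP/polyP/(_ q); rewrite coef0 /p !coefB coefXn coefX coefC eqxx.
  by rewrite !gtn_eqF ?q_gt1 ?q_gt0 // !subr0 => /eqP; rewrite oner_eq0.
apply: (Kbar_root p0) => [j|]; last by rewrite rootE !hornerE subr_eq0 -h.
have b (u v : nat) : Kbar C (u == v)%:R by case: eqP => _; [exact: Kbar1|exact: Kbar0].
rewrite !coefB coefXn coefX coefC; apply: KbarB; first by apply: KbarB; exact: b.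
by case: eqP => _ //; exact: Kbar0.
Qed.

Definition evm m n (A : 'M[fps C]_(m, n)) (V : 'M[C]_(m, n)) :=
  forall i j, evl th (A i j) (V i j).
Lemma evmM m n k (A : 'M[fps C]_(m, n)) (A' : 'M[fps C]_(n, k)) V V' : evm A V -> evm A' V' -> evm (A *m A') (V *m V').
Proof. by move=> h h' i j; rewrite !mxE; apply: evl_sum => l _; apply: evlM. Qed.
Lemma evm_exists m n (A : 'M[fps C]_(m, n)) : (forall i j, bdd ro1 (A i j)) -> exists V, evm A V.
Proof.
move=> h; have hx (p : 'I_m * 'I_n) : exists c, evl th (A p.1 p.2) c by apply: bdd_evl.
have [V hV] := choice hx; exists (\matrix_(i, j) V (i, j)) => i j.
by rewrite mxE; apply: (hV (i, j)).
Qed.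
Lemma evm_unique m n (A : 'M[fps C]_(m, n)) V V' : evm A V -> evm A V' -> V = V'.
Proof. by move=> h h'; apply/matrixP => i j; apply: evl_unique (h i j) (h' i j). Qed.
Lemma evm_poly m n (A : 'M[{poly C}]_(m, n)) : evm (pm A) (map_mx (horner_eval th) A).
Proof. by move=> i j; rewrite !mxE; apply: evl_poly. Qed.
Lemma evl_sign n : evl th ((-1) ^+ n) ((-1) ^+ n).
Proof.
have h1 : evl th 1 1 by have := evl_poly th 1; rewrite rmorph1 hornerC.
by elim: n => [//|n IH]; rewrite !exprS; apply: evlM => //; apply: evlN.
Qed.
Lemma evm_det n (A : 'M[fps C]_n) V : evm A V -> evl th (\det A) (\det V).
Proof.
by move=> h; apply: evl_sum => s _; apply: evlM; [exact: evl_sign|apply: evl_prod].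
Qed.

Context (r : nat) (phi : {poly F} -> {poly C}) (hphi : drinfeld_module r phi).
Local Notation g := (dcoef phi).
Local Notation agf := (agf r phi).
Local Notation Lat := (period_lattice phi).
Local Notation vrow := (vrow r phi).
Local Notation Bm := (Bm r phi).
Local Notation B0 := (B0 r phi).
Local Notation Ups := (@Ups F R C r phi).

Lemma vrowD mu nu : vrow (mu + nu) = vrow mu + vrow nu.
Proof. by apply/rowP => l; rewrite !mxE agfD rmorphD. Qed.
Lemma tw_pF k a : tw k (pF a) = pF a.
Proof.
by rewrite /pF tw_pfps -map_poly_comp; congr pfps; apply: eq_map_poly => x; apply: frn_ofF.
Qed.
Lemma vrowA a mu : Lat mu -> vrow (ofA C a * mu) = pF a *: vrow mu.
Proof. by move=> h; apply/rowP => l; rewrite !mxE (agfA hphi) // rmorphM /= tw_pF. Qed.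
Lemma vrow0 : vrow 0 = 0.
Proof. by apply/rowP => l; rewrite !mxE agf0 rmorph0. Qed.
Lemma vrow_sum (I : Type) (s : seq I) (P : pred I) (f : I -> C) :
  vrow (\sum_(i <- s | P i) f i) = \sum_(i <- s | P i) vrow (f i).
Proof. exact: (big_morph vrow vrowD vrow0). Qed.

(* The coordinate vector of the differential: it spans the kernel of [B0(theta)]. *)
Definition gcol : 'cV[C]_r := \col_b g b.+1.
Lemma B0_gcol : pm B0 *m pm (map_mx (@polyC C) gcol) =
  \col_a (if (a == 0 :> nat) then pfps ('X - th%:P) else 0).
Proof.
have gr := dcoef_lead hphi; have r0 := drinfeld_rank hphi.
rewrite -map_mxM; apply/colP => a; rewrite !mxE.
have rl : (r.-1 < r)%N by rewrite prednK.
pose last := Ordinal rl.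
have -> : \sum_j B0 a j * map_mx (@polyC C) gcol j 0 =
   'X *+ (a == 0 :> nat) - (g a)%:P + (if (a == 0 :> nat) then 0 else (g a)%:P).
  rewrite (bigD1 last) //= !mxE /= prednK // eqxx.
  rewrite -scalerAl mulrC mul_polyC scalerA mulVf // scale1r; congr (_ + _).
  case: eqP => [a0|/eqP a0].
    rewrite big1 // => j jl; rewrite !mxE ifF; last first.
      by apply/eqP => jr; case/eqP: jl; apply/val_inj => /=; lia.
    by rewrite a0 mul0r.
  have a1 : (a.-1 < r)%N by have := ltn_ord a; lia.
  rewrite (bigD1 (Ordinal a1)) /=; last first.
    apply/eqP => /(congr1 val) /=; have := ltn_ord a; move: a0; rewrite -lt0n; lia.
  rewrite !mxE /= prednK ?lt0n // ifF; last by apply/eqP; have := ltn_ord a; lia.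
  rewrite eqxx mul1r big1 ?addr0 // => j /andP[jl ja]; rewrite !mxE ifF; last first.
    by apply/eqP => jr; case/eqP: jl; apply/val_inj => /=; lia.
  rewrite (_ : (a == j.+1 :> nat) = false) ?mul0r //.
  by apply/eqP => E; case/eqP: ja; apply/val_inj; rewrite /= E.
case: eqP => [a0|_]; last by rewrite mulr0n sub0r addNr rmorph0.
by rewrite mulr1n addr0 a0 (dcoef0 hphi).
Qed.

Lemma vrow_gcol mu V : Lat mu -> evm (vrow mu) V -> V *m gcol = (- mu)%:M.
Proof.
move=> hmu hV; apply/matrixP => i j; rewrite !ord1 !mxE eqxx mulr1n.
apply: (evl_unique _ (agf_res hphi hmu)).
have -> : pfps ('X - th%:P) * agf mu = \sum_(k < r) tw k.+1 (agf mu) * pfps (g k.+1)%:P.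
  rewrite rmorphB mulrBl -(agf_eq hphi hmu) big_ord_recl (dcoef0 hphi) tw0 addrAC subrr add0r.
  by apply: eq_bigr => k _; rewrite lift0 mulrC.
apply: evl_sum => k _; rewrite mxE; apply: evlM; last by have := evl_poly th (g k.+1)%:P; rewrite hornerC.
by have := hV 0 k; rewrite mxE.
Qed.

Section Fixc.
Context (lam : C) (hlam : Lat lam) (c : C) (hc : forall x, Lat x -> Lat (c * x)).
Context (lam0 : lam != 0).
Context (a : 'I_r -> {poly F}) (c_int : c ^+ r = \sum_j ofA C (a j) * c ^+ j).
Context (c_free : A_free (fun j : 'I_r => c ^+ j)).

Lemma Lat_cX j : Lat (c ^+ j * lam).
Proof. by elim: j => [|j IH]; [rewrite expr0 mul1r|rewrite exprS -mulrA; apply: hc]. Qed.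
Local Notation mu := (fun j : 'I_r => c ^+ j * lam).
Lemma mu_free : A_free mu.
Proof.
move=> b hb; apply: c_free; apply: (mulIf lam0); rewrite mul0r -[RHS]hb mulr_suml.
by apply: eq_bigr => j _; rewrite mulrA.
Qed.
Local Notation Y0 := (Ups mu).

Definition NF : 'M[{poly F}]_r := \matrix_(j, k) if (j.+1 == r)%N then a k else (k == j.+1 :> nat)%:R.
Local Notation Nf := (map_mx pF NF).

Lemma NFP (j : 'I_r) : c * c ^+ j = \sum_k ofA C (NF j k) * c ^+ k.
Proof.
rewrite -exprS; under eq_bigr => k _ do rewrite mxE.
case: eqP => [jr|jr]; first by rewrite jr.
have j1 : (j.+1 < r)%N by have := ltn_ord j; lia.
rewrite (bigD1 (Ordinal j1)) //= eqxx rmorph1 mul1r big1 ?addr0 // => k kj.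
rewrite (_ : (k == j.+1 :> nat) = false) ?rmorph0 ?mul0r //.
by apply/eqP => E; case/eqP: kj; apply/val_inj.
Qed.
Lemma vrow_N (j : 'I_r) : vrow (c * mu j) = row j (Nf *m Y0).
Proof.
have -> : c * mu j = \sum_k ofA C (NF j k) * mu k.
  by rewrite mulrA NFP mulr_suml; apply: eq_bigr => k _; rewrite mulrA.
rewrite vrow_sum; apply/rowP => l; rewrite summxE !mxE; apply: eq_bigr => k _.
by rewrite (vrowA _ (Lat_cX _)) !mxE.
Qed.

Section Fixp.
Context (kap : C) (p : {poly F}) (kK : Kbar C kap) (p0 : p != 0).
Context (hp : pfps kap%:P * \det Y0 * Om C = pF p).
(** [W] is [pF p] times the inverse of [Y0], without denominators. So [Y] is the conjugate by [Y0]
    of the matrix of multiplication by [p * c], acting on the right on the vectors [vrow]. *)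
Definition W : 'M[fps C]_r := (pfps kap%:P * Om C) *: \adj Y0.
Definition Y : 'M[fps C]_r := locked (W *m Nf *m Y0).

Lemma Y0Y : Y0 *m Y = pF p *: (Nf *m Y0).
Proof.
have E : Y0 *m W = (pF p)%:M.
  rewrite /W -scalemxAr mul_mx_adj scale_scalar_mx -hp; congr (_%:M); ring.
by rewrite /Y -lock !mulmxA E -mulmxA mul_scalar_mx.
Qed.
Let dY0 : \det Y0 != 0. Proof. exact: (det_Ups_neq0 hphi (fun j => Lat_cX j) mu_free). Qed.

Lemma mulmx_det0l m (A : 'M[fps C]_r) (M : 'M[fps C]_(r, m)) : \det A != 0 -> A *m M = 0 -> M = 0.
Proof.
move=> dA AM; apply: trmx_inj; rewrite trmx0; apply: (@mulmx_det0 _ _ _ _ A^T).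
  by rewrite det_tr.
by rewrite -trmx_mul AM trmx0.
Qed.

(** After multiplication by [Y0] both sides agree, since [Nf] has entries in [F[t]] and is not
    changed by the twist. *)
Lemma Y_B : pm Bm *m twm Y = Y *m pm Bm.
Proof.
apply/eqP; rewrite -subr_eq0; apply/eqP; apply: (mulmx_det0l dY0).
have U := Ups_B hphi (fun j => Lat_cX j).
have NfE : twm Nf = Nf by apply/matrixP => i j; rewrite !mxE tw_pF.
have e1 : Y0 *m (pm Bm *m twm Y) = pF p *: (Nf *m Y0 *m pm Bm).
  by rewrite mulmxA -U -map_mxM Y0Y map_mxZ map_mxM /= tw_pF NfE U mulmxA.
have e2 : Y0 *m (Y *m pm Bm) = pF p *: (Nf *m Y0 *m pm Bm) by rewrite mulmxA Y0Y -scalemxAl.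
by rewrite mulmxBr e1 e2 subrr.
Qed.

Lemma Y_bdd i j : bdd ro1 (Y i j).
Proof.
have r0 := @ro1_ge0 F R; have hb := @Ups_bdd _ _ _ r phi mu.
rewrite /Y -lock mxE; apply: bdd_sum => // k _; apply: bddM => //.
rewrite mxE; apply: bdd_sum => // l _; apply: bddM => //; last by rewrite mxE; apply: bdd_poly.
rewrite mxE; apply: bddM => //; first by apply: bddM => //; [exact: bdd_poly|exists 1; exact: Om_nb].
rewrite mxE; apply: bddM => //; first by rewrite -(rmorph_sign (@pfps C)); apply: bdd_poly.
by apply: bdd_det => i' j'; rewrite [row' _ _ _ _]mxE [col' _ _ _ _]mxE; apply: hb.
Qed.
Lemma Y_Kser i j : Kser (Y i j).
Proof.
have hb u v : Kser (Y0 u v) by rewrite !mxE => n; rewrite fmapE; apply/Kbar_frn/(agf_Kbar hphi)/Lat_cX.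
rewrite /Y -lock mxE; apply: Kser_sum => k _; apply: KserM => //.
rewrite mxE; apply: Kser_sum => l _; apply: KserM; last by rewrite mxE; apply: Kser_pF.
rewrite mxE; apply: KserM.
  apply: KserM; last exact: Om_Kser.
  by apply: Kser_poly => n; rewrite coefC; case: eqP => // _; exact: Kbar0.
rewrite mxE; apply: KserM; first exact: Kser_sign.
by apply: Kser_det => i' j'; rewrite [row' _ _ _ _]mxE [col' _ _ _ _]mxE; apply: hb.
Qed.

Lemma Y_gcol V : evm Y V -> V *m gcol = (ofA C p * c) *: gcol.
Proof.
move=> hV; have [U hU] : exists U, evm Y0 U by apply: evm_exists => i j; apply: Ups_bdd.
have dU : \det U != 0.
  have [kap' [D [cc [_ k0 hD _ E]]]] := det_Ups_evl hphi (fun j => Lat_cX j) mu_free.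
  rewrite (evl_unique (evm_det hU) hD); apply: contraNneq k0 => D0.
  by rewrite -E D0 mul0r.
have Ug : U *m gcol = \col_j (- mu j).
  apply/matrixP => j k; rewrite !ord1.
  have h : evm (vrow (mu j)) (row j U) by move=> i l; have := hU j l; rewrite !ord1 [Ups _ _ _]mxE [row _ _ _ _]mxE.
  by have /matrixP/(_ 0 0) := vrow_gcol (Lat_cX j) h; rewrite -row_mul !mxE eqxx mulr1n.
pose NV : 'M[C]_r := map_mx (ofA C) NF.
have hN : evm Nf NV by move=> i j; rewrite !mxE ofAE; apply: evl_poly.
have E1 : U *m V = ofA C p *: (NV *m U).
  apply: (evm_unique (evmM hU hV)); rewrite Y0Y => i j; rewrite mxE [X in evl _ _ X]mxE.
  by apply: evlM; [rewrite ofAE; apply: evl_poly|apply: evmM].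
have E2 : U *m (V *m gcol - (ofA C p * c) *: gcol) = 0.
  rewrite mulmxBr mulmxA E1 -scalemxAl -scalemxAr -mulmxA Ug; apply/colP => j.
  rewrite !mxE (eq_bigr (fun k => - (ofA C (NF j k) * c ^+ k * lam))) => [|k _]; last first.
    by rewrite !mxE; ring.
  by rewrite sumrN -mulr_suml -NFP; ring.
have : (V *m gcol - (ofA C p * c) *: gcol)^T *m U^T = 0 by rewrite -trmx_mul E2 trmx0.
move=> /mulmx_det0; rewrite det_tr => /(_ dU) /(congr1 trmx); rewrite trmxK trmx0 => /eqP.
by rewrite subr_eq0 => /eqP.
Qed.

(** The combination of columns of [pm Bm *m twm Y] from which the first column of [Y] is recovered.
    It contains the factor [X - theta ^+ q], which has to be divided out with control of norms. *)
Definition Z (i : 'I_r) : fps C := pfps (frn 1 (g r)^-1)%:P * (pfps ('X - (frn 1 th)%:P) * Y i (Ordinal (drinfeld_rank hphi))).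

Lemma ZE i : Z i = \sum_b (pm Bm *m twm Y) i b * pfps (frn 1 (g b.+1 / g r))%:P.
Proof.
have r0 := drinfeld_rank hphi.
have E : pm Bm *m map_mx (fun x => pfps x%:P) (map_mx (@frn F R C 1) gcol) =
    \col_l (if (l == 0 :> nat) then pfps ('X - (frn 1 th)%:P) else 0).
  have := congr1 twm B0_gcol; rewrite map_mxM twm_pm => E.
  transitivity (twm (pm B0 *m pm (map_mx (@polyC C) gcol))).
    rewrite map_mxM twm_pm; congr (_ *m _); apply/colP => l; by rewrite !mxE /= tw_pfps map_polyC.
  rewrite B0_gcol; apply/colP => l; rewrite !mxE /=; case: eqP => _; last by rewrite rmorph0.
  by rewrite tw_pfps map_polyXsubC.
have E' : Y *m pm Bm *m map_mx (fun x => pfps x%:P) (map_mx (@frn F R C 1) gcol) =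
    \col_l (Y l (Ordinal r0) * pfps ('X - (frn 1 th)%:P)).
  rewrite -mulmxA E; apply/colP => l; rewrite !mxE (bigD1 (Ordinal r0)) //= mxE /= big1 ?addr0 // => j j0.
  rewrite mxE ifF ?mulr0 //; apply/eqP => h; case/eqP: j0; exact/val_inj.
have /colP/(_ i) := E'; rewrite -Y_B [LHS]mxE [RHS]mxE => E2.
rewrite /Z (bool_irrelevance (drinfeld_rank hphi) r0) [pfps ('X - _) * _]mulrC -E2 mulr_sumr.
apply: eq_bigr => b _.
have -> : pfps (frn 1 (g b.+1 / g r))%:P = pfps (frn 1 (g b.+1))%:P * pfps (frn 1 (g r)^-1)%:P.
  by rewrite -rmorphM -polyCM -rmorphM.
have -> : map_mx (fun x => pfps x%:P) (map_mx (@frn F R C 1) gcol) b 0 = pfps (frn 1 (g b.+1))%:P.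
  by rewrite !mxE.
by ring.
Qed.

(** Untwisted, the claim is that [B0(theta)] kills [Y(theta)] applied to [gcol]: [gcol] is an
    eigenvector of the latter by [Y_gcol] and lies in the kernel of the former. *)
Lemma Z_evl i : evl (frn 1 th) (Z i) 0.
Proof.
have [V hV] := evm_exists Y_bdd.
have Eg := Y_gcol hV.
have -> : Z i = tw 1 ((pm B0 *m Y *m pm (map_mx (@polyC C) gcol)) i 0 * pfps (g r)^-1%:P).
  rewrite ZE [RHS]rmorphM [X in tw 1 X * _]mxE rmorph_sum /= mulr_suml; apply: eq_bigr => b _.
  rewrite [tw 1 (_ * _)]rmorphM /= -mulrA; congr (_ * _).
    rewrite !mxE rmorph_sum; apply: eq_bigr => l _; rewrite rmorphM /=; congr (_ * _).
      by rewrite !mxE tw_pfps.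
    by rewrite !mxE.
  by rewrite !mxE !tw_pfps !map_polyC -rmorphM -polyCM -rmorphM.
rewrite -(rmorph0 (@frn F R C 1)); apply: evl_tw.
rewrite -(mul0r (g r)^-1); apply: evlM; last by have := evl_poly th (g r)^-1%:P; rewrite hornerC.
have hg : evm (pm (map_mx (@polyC C) gcol)) gcol.
  by move=> k l; rewrite !mxE; have := evl_poly th (g k.+1)%:P; rewrite hornerC.
have h1 := evmM (evmM (@evm_poly _ _ B0) hV) hg.
have := h1 i 0; suff -> : map_mx (horner_eval th) B0 *m V *m gcol = 0 by rewrite [X in evl _ _ X]mxE.
rewrite -mulmxA Eg -scalemxAr; suff -> : map_mx (horner_eval th) B0 *m gcol = 0 by rewrite scaler0.
apply: (evm_unique (evmM (@evm_poly _ _ B0) hg)); rewrite B0_gcol => k l.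
rewrite !mxE; case: eqP => _; last by have := evl_poly th 0; rewrite rmorph0 horner0.
by have := evl_poly th ('X - th%:P); rewrite hornerXsubC subrr.
Qed.

(** A weighted norm at radius [S ^+ r]: the variable has weight [r], as [t] has in terms of [tau],
    and entry [(i, b)] is allowed weight [b - i]. With these weights the companion matrix preserves
    the shape of the bound. *)
Definition wq (S M : R) := forall i b : 'I_r, nb (S ^+ r) (M * S ^+ b / S ^+ i) (Y i b).

Lemma Y_col (i : 'I_r) (k : 'I_r) (k1 : (k.+1 < r)%N) : Y i (Ordinal k1) = (pm Bm *m twm Y) i k.
Proof.
rewrite Y_B mxE (bigD1 (Ordinal k1)) //= !mxE /= ifF; last by apply/eqP; lia.
rewrite eqxx !rmorph1 mulr1 big1 ?addr0 // => l lk; rewrite !mxE ifF; last by apply/eqP; lia.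
rewrite (_ : (l == k.+1 :> nat) = false) ?rmorph0 ?mulr0 //.
by apply/eqP => E; case/eqP: lk; apply/val_inj.
Qed.

Definition C1 : R := 1 + N (frn 1 (g r)^-1) + \sum_(b < r.+1) N (frn 1 (g b / g r)).
Lemma C1_ge1 : 1 <= C1.
Proof. by rewrite /C1 -addrA lerDl addr_ge0 ?absC_ge0 // sumr_ge0 // => b _; apply: absC_ge0. Qed.
Lemma C1_g : N (frn 1 (g r)^-1) <= C1.
Proof. by rewrite /C1 addrAC lerDr addr_ge0 // sumr_ge0 // => b _; apply: absC_ge0. Qed.
Lemma C1_b b : (b < r.+1)%N -> N (frn 1 (g b / g r)) <= C1.
Proof.
move=> br; rewrite /C1 (bigD1 (Ordinal br)) //= addrCA lerDl addr_ge0 ?addr_ge0 ?absC_ge0 //.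
by rewrite sumr_ge0 // => l _; apply: absC_ge0.
Qed.

Lemma BY_nb S M : 1 <= S -> q%:R < S ^+ r -> 0 <= M -> wq S M -> forall i k : 'I_r,
  nb ((S ^+ q) ^+ r) (C1 * M ^+ q * (S ^+ q) ^+ k.+1 / (S ^+ q) ^+ i) ((pm Bm *m twm Y) i k).
Proof.
move=> S1 Sr M0 hM i k; set T := S ^+ q.
have T1 : 1 <= T by rewrite exprn_ege1.
have T0 : 0 < T by lra.
have P0 n : 0 < T ^+ n by rewrite exprn_gt0.
have c1 := C1_ge1; have Mq : 0 <= M ^+ q by rewrite exprn_ge0.
have Tr0 : 0 <= T ^+ r by apply: ltW.
have B0' : 0 <= C1 * M ^+ q * T ^+ k.+1 / T ^+ i by rewrite !mulr_ge0 ?invr_ge0 ?(ltW (P0 _)) //; lra.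
have tY (l : 'I_r) : nb (T ^+ r) (M ^+ q * T ^+ k / T ^+ l) (tw 1 (Y l k)).
  have S0 : 0 <= S ^+ r by rewrite exprn_ge0 //; lra.
  have := nb_tw S0 1 (hM l k); rewrite expn1 /T -!exprM ![(q * _)%N]mulnC !exprM => h.
  apply: nb_le h; rewrite !exprMn exprVn -!exprM; lra.
rewrite mxE; apply: nb_sum => // l _; rewrite !mxE.
case: eqP => [lr|lr]; last first.
  rewrite rmorph_nat; case: eqP => il; last by rewrite rmorph0 mul0r; apply: nb0.
  rewrite rmorph1 mul1r; apply: nb_le (tY l); rewrite il.
  rewrite ler_pdivrMr // [in leRHS]exprS [T ^+ l.+1]exprS invfM.
  have -> : C1 * M ^+ q * (T * T ^+ k) * (T^-1 / T ^+ l) * T ^+ l = C1 * (M ^+ q * T ^+ k).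
    by field; rewrite !gt_eqF.
  by rewrite ler_peMl // mulr_ge0 // ltW.
have hl : T ^+ l * T = T ^+ r by rewrite -exprSr lr.
have tY' : nb (T ^+ r) (M ^+ q * T ^+ k.+1 / T ^+ r) (tw 1 (Y l k)).
  apply: nb_le (tY l); rewrite -hl exprSr.
  by rewrite le_eqVlt; apply/orP; left; apply/eqP; field; rewrite !gt_eqF.
rewrite map_polyZ rmorphB /= map_polyC /= -mul_polyC rmorphM -[X in nb _ _ X]mulrA.
case: eqP => [i0|i0].
  rewrite i0 (dcoef0 hphi) mulr1n map_polyX expr0 divr1.
  apply: nb_le (nbM Tr0 (nbC _ _) (nbM Tr0 (nbXsub Tr0 _) tY')).
    rewrite (_ : _ * (_ * _) = N (frn 1 (g r)^-1) * (M ^+ q * T ^+ k.+1)); last by field; rewrite !gt_eqF.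
    by rewrite -[leRHS]mulrA ler_wpM2r ?C1_g // mulr_ge0 // ltW.
  rewrite frn_absC theta_absC expn1 /T -exprM mulnC exprM lerXn2r ?nnegrE ?(ltW Sr) ?ler0n ?exprn_ge0 //.
  lra.
rewrite mulr0n rmorph0 sub0r rmorphN mulNr mulrN; apply: nbN; rewrite mulrA -rmorphM -polyCM -rmorphM.
apply: nb_le (nbM Tr0 (nbC _ _) tY').
rewrite [_^-1 * _]mulrC mulrA; apply: ler_pM.
- by rewrite !mulr_ge0 ?absC_ge0 // ltW.
- by rewrite invr_ge0 ltW.
- rewrite mulrA ler_wpM2r ?(ltW (P0 _)) // ler_wpM2r // C1_b // ltnS ltnW //.
- rewrite lef_pV2 ?posrE // ler_weXn2l // ltnW //.
Qed.

Definition C2 : R := C1 * C1 * (1 + N (frn 1 (g r))).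
Lemma C2_ge : 1 <= C1 * C1 /\ C1 <= C2 /\ 1 <= C2.
Proof.
have c1 := C1_ge1; have n0 := absC_ge0 (frn 1 (g r) : C).
have a1 : C1 <= C1 * C1 by rewrite ler_peMr //; lra.
have a2 : C1 * C1 <= C2 by rewrite ler_peMr //; [lra|lra].
by split; [lra|split; lra].
Qed.

(** Twisting turns the radius parameter [S] into [S ^+ q]. The commutation [Y_B] expresses [Y]
    through its twist: a shift for the columns of positive index, and a division by [X - theta ^+ q]
    for the first column. *)
Lemma wq_step S M : 1 <= S -> q%:R < S ^+ r -> 0 <= M -> wq S M -> wq (S ^+ q) (C2 * M ^+ q).
Proof.
move=> S1 Sr M0 hM i b; have hB := BY_nb S1 Sr M0 hM; set T := S ^+ q in hB *.
have T1 : 1 <= T by rewrite exprn_ege1.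
have T0 : 0 < T by lra.
have P0 n : 0 < T ^+ n by rewrite exprn_gt0.
have c1 := C1_ge1; have Mq : 0 <= M ^+ q by rewrite exprn_ge0.
have [c11 [c12 c21]] := C2_ge; have Tr0 : 0 <= T ^+ r by apply: ltW.
have r0 := drinfeld_rank hphi.
have gr := dcoef_lead hphi.
case: b => -[|b] br.
  have -> : Ordinal br = Ordinal (drinfeld_rank hphi) by apply/val_inj.
  have hth : N (frn 1 th) < T ^+ r.
    rewrite frn_absC theta_absC expn1 /T -exprM mulnC exprM ltrXn2r ?nnegrE ?gtn_eqF ?q_gt0 //.
  have hZ : nb (T ^+ r) (C1 * C1 * M ^+ q * T ^+ r / T ^+ i) (Z i).
    rewrite ZE; have BB : 0 <= C1 * C1 * M ^+ q * T ^+ r / T ^+ i.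
      by rewrite !mulr_ge0 ?invr_ge0 ?(ltW (P0 _)) //; lra.
    apply: nb_sum => // k _; apply: nb_le (nbM Tr0 (hB i k) (nbC _ _)).
    have kr : (k.+1 < r.+1)%N by rewrite ltnS ltn_ord.
    have := C1_b kr; set n := N _ => nC.
    have n0 : 0 <= n by apply: absC_ge0.
    rewrite mulrC mulrA [leRHS]mulrAC -!mulrA ler_pM //.
      by rewrite !mulr_ge0 ?invr_ge0 ?(ltW (P0 _)) //; lra.
    rewrite ler_wpM2l //; first lra.
    rewrite ler_wpM2l // mulrC ler_wpM2l ?invr_ge0 ?(ltW (P0 _)) //.
    by rewrite ler_weXn2l.
  have [d hd Ed] := evl_fdiv hth hZ (Z_evl i).
  have -> : Y i (Ordinal (drinfeld_rank hphi)) = pfps (frn 1 (g r))%:P * d.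
    have nz : pfps ('X - (frn 1 th)%:P) != 0 :> fps C.
      by rewrite -(rmorph0 (@pfps C)) (inj_eq (@pfps_inj C)) polyXsubC_eq0.
    have gg : pfps (frn 1 (g r))%:P * pfps (frn 1 (g r)^-1)%:P = 1 :> fps C.
      by rewrite -rmorphM -polyCM -rmorphM mulfV // rmorph1 polyC1 rmorph1.
    by apply: (mulfI nz); rewrite mulrCA -Ed /Z [RHS]mulrA gg mul1r.
  apply: nb_le (nbM Tr0 (nbC _ _) hd).
  rewrite expr0 mulr1 /C2; set n := N _.
  have n0 : 0 <= n by apply: absC_ge0.
  have -> : n * (C1 * C1 * M ^+ q * T ^+ r / T ^+ i / T ^+ r) = n * (C1 * C1 * M ^+ q / T ^+ i).
    by field; rewrite !gt_eqF.
  have -> : C1 * C1 * (1 + n) * M ^+ q / T ^+ i = (1 + n) * (C1 * C1 * M ^+ q / T ^+ i) by ring.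
  rewrite ler_wpM2r //; first by rewrite !mulr_ge0 ?invr_ge0 ?(ltW (P0 _)) //; lra.
  by rewrite lerDr.
have b1 : (b < r)%N by apply: ltnW.
rewrite (@Y_col i (Ordinal b1) br) /=; apply: nb_le (hB i (Ordinal b1)).
by rewrite /= ler_wpM2r ?invr_ge0 ?(ltW (P0 _)) // ler_wpM2r ?(ltW (P0 _)) // ler_wpM2r.
Qed.

Lemma wq_start : exists S M, [/\ 1 <= S, q%:R < S ^+ r, 1 <= M & wq S M].
Proof.
have r0 := drinfeld_rank hphi; have q0 := qR_gt0 F R; have q1 := qR_gt1 F R.
(* With this real exponent [S ^+ r] is exactly the radius [q ^ q] at which the entries of [Y] are
   known to be bounded. *)
pose S : R := q%:R `^ (q%:R / r%:R).
have Sr : S ^+ r = ro1.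
  rewrite -powR_mulrn ?powR_ge0 // -powRrM divfK ?powR_mulrn ?ltW //.
  by rewrite pnatr_eq0 -lt0n.
have S1 : 1 <= S.
  rewrite -(powRr0 q%:R) ler_powR ?(ltW q1) // divr_ge0 //.
have hx (ij : 'I_r * 'I_r) : exists M, nb ro1 M (Y ij.1 ij.2) by apply: Y_bdd.
have [M hM] := choice hx.
have M0 ij : 0 <= M ij by apply: nb_ge0 (hM ij); exact: ro1_ge0.
exists S, (1 + ro1 * \sum_ij M ij); split => //; first by rewrite Sr ro1_gt.
  by rewrite lerDl mulr_ge0 ?ro1_ge0 // sumr_ge0.
move=> i b; rewrite Sr; apply: nb_le (hM (i, b)).
have S0 : 0 < S by lra.
have P0 n : 0 < S ^+ n by rewrite exprn_gt0.
rewrite ler_pdivlMr //; apply: le_trans (_ : M (i, b) * ro1 <= _).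
  rewrite ler_wpM2l // -Sr ler_weXn2l // ltnW //.
apply: le_trans (_ : (1 + ro1 * \sum_ij M ij) * 1 <= _); last first.
  rewrite ler_wpM2l ?exprn_ege1 //.
  by rewrite addr_ge0 // mulr_ge0 ?ro1_ge0 // sumr_ge0.
rewrite mulr1 mulrC (bigD1 (i, b)) //= mulrDr; set u := ro1 * M (i, b).
set v := \sum_(_ | _) _; have : 0 <= ro1 * v by rewrite mulr_ge0 ?ro1_ge0 // sumr_ge0.
lra.
Qed.

(** The bounds at the radii with parameter [S ^+ (q ^ k)] show that the coefficient of index [n] is
    at most the [q ^ k]-th power of [L * S ^+ r / (S ^+ r) ^+ n]. For large [n] this base is below
    1, and letting [k] grow kills the coefficient. *)
Lemma Y_polynomial : exists n0, forall i b n, (n0 <= n)%N -> Y i b n = 0.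
Proof.
have [S [M [S1 Sr M1 hM]]] := wq_start.
have [c11 [c12 c21]] := C2_ge.
(* Dividing by [C2] makes the bound self-reproducing under [wq_step], since [C2 * (x / C2) ^+ q] is
   at most [x ^+ q / C2] when [q >= 2] and [x >= 0]. *)
pose L := (C2 * M) ^+ 2.
have q1 := qR_gt1 F R; have r0 := drinfeld_rank hphi.
have S0 : 0 < S by lra.
have M0 : 0 <= M by lra.
have C0 : 0 < C2 by lra.
have L0 : 0 <= L by rewrite exprn_ge0 // mulr_ge0 //; lra.
have hk k : wq (S ^+ (q ^ k)) (L ^+ (q ^ k) / C2).
  elim: k => [|k IH].
    move=> i b; apply: nb_le (hM i b); rewrite !expn0 !expr1.
    rewrite ler_wpM2r ?invr_ge0 ?exprn_ge0 ?(ltW S0) // ler_wpM2r ?exprn_ge0 ?(ltW S0) //.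
    rewrite ler_pdivlMr // /L exprMn expr2 expr2.
    have : M * C2 <= C2 * C2 * M by rewrite mulrC ler_wpM2r // ler_peMl // ltW.
    have : C2 * C2 * M <= C2 * C2 * (M * M).
      by apply: ler_wpM2l; [rewrite mulr_ge0 // ltW|rewrite ler_peMl].
    lra.
  have S1' : 1 <= S ^+ (q ^ k) by rewrite exprn_ege1.
  have Sr' : q%:R < (S ^+ (q ^ k)) ^+ r.
    apply: lt_le_trans Sr _; rewrite lerXn2r ?nnegrE ?exprn_ge0 ?(ltW S0) //.
    by rewrite -{1}(expr1 S) ler_weXn2l // qXgt0.
  have M0' : 0 <= L ^+ (q ^ k) / C2 by apply: divr_ge0; [exact: exprn_ge0|exact: ltW].
  have := wq_step S1' Sr' M0' IH; rewrite -exprM -expnSr => h i b.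
  apply: nb_le (h i b); have P1 : 0 <= S ^+ (q ^ k.+1) by rewrite exprn_ge0 // ltW.
  apply: ler_wpM2r; first by rewrite invr_ge0 exprn_ge0.
  apply: ler_wpM2r; first by rewrite exprn_ge0.
  rewrite exprMn -exprM -expnSr exprVn mulrCA ler_wpM2l ?(exprn_ge0 _ L0) //.
  rewrite ler_pdivrMr ?exprn_gt0 // mulrC ler_pdivlMr //.
  rewrite -expr2 ler_weXn2l //; exact: q_gt1.
clearbody L.
have Sr1 : 1 < S ^+ r by lra.
have [n0 hn0] := expr_big (L * S ^+ r) Sr1.
exists n0 => i b n nn; apply: absC_small_eq0 => e e0.
have D0 : 0 < (S ^+ r) ^+ n by rewrite !exprn_gt0.
pose x := L * S ^+ r / (S ^+ r) ^+ n.
have x0 : 0 <= x by apply: divr_ge0; [apply: mulr_ge0 => //; rewrite exprn_ge0 // ltW|exact: ltW].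
have x1 : x < 1 by rewrite ltr_pdivrMr // mul1r hn0.
have [k0 hk0] := expr_small x0 x1 e0.
have := hk k0 i b n; set m := (q ^ k0)%N => h.
apply: le_lt_trans (_ : x ^+ m < _); last first.
  by apply: hk0; rewrite ltnW // ltn_expl // q_gt1.
rewrite /x expr_div_n ler_pdivlMr ?exprn_gt0 //.
have -> : ((S ^+ r) ^+ n) ^+ m = ((S ^+ m) ^+ r) ^+ n.
  by rewrite exprAC (exprAC S r m).
apply: le_trans h _; rewrite exprMn.
have -> : (S ^+ r) ^+ m = (S ^+ m) ^+ r by rewrite -!exprM mulnC.
have S1m : 1 <= S ^+ m by rewrite exprn_ege1.
have Sm0 : 0 < S ^+ m by lra.
have Lm : 0 <= L ^+ m by rewrite exprn_ge0.
have e1 : L ^+ m / C2 <= L ^+ m by rewrite ler_pdivrMr // ler_peMr.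
have e2 : L ^+ m / C2 * (S ^+ m) ^+ b <= L ^+ m * (S ^+ m) ^+ r.
  apply: ler_pM; [apply: divr_ge0; [exact: Lm|exact: ltW]|apply: exprn_ge0; exact: ltW|exact: e1|].
  by apply: ler_weXn2l => //; apply: ltnW.
rewrite ler_pdivrMr ?exprn_gt0 //; apply: le_trans e2 _; rewrite ler_peMr ?exprn_ege1 //.
by rewrite mulr_ge0 ?exprn_ge0 // ltW.
Qed.

Lemma cm_matrix_exists : exists X : 'M[{poly C}]_r, [/\ forall i j k, Kbar C (X i j)`_k,
  pm X = Y & Bm *m map_mx (ptw 1) X = X *m Bm].
Proof.
have [n0 hn0] := Y_polynomial.
pose X : 'M[{poly C}]_r := \matrix_(i, j) \poly_(k < n0) Y i j k.
have XY : pm X = Y.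
  apply/matrixP => i j; rewrite !mxE; apply/fpsP => k; rewrite /= coef_poly.
  by case: ltnP => // /hn0 ->.
exists X; split => //.
  move=> i j k; rewrite mxE coef_poly; case: ifP => _; [exact: Y_Kser|exact: Kbar0].
have E : pm (Bm *m map_mx (ptw 1) X) = pm (X *m Bm) by rewrite !map_mxM /= XY -twm_pm XY Y_B.
apply/matrixP => i j; apply: (@pfps_inj C); have /matrixP/(_ i j) := E.
by rewrite [LHS]mxE [RHS]mxE.
Qed.
End Fixp.

(* Replacing [c] by a multiple makes its matrix polynomial in [t]. *)
Lemma cm_matrix : exists (p : {poly F}) (X : 'M[{poly C}]_r), [/\ p != 0,
  forall i j k, Kbar C (X i j)`_k, Bm *m map_mx (ptw 1) X = X *m Bm &
  forall n, Lat ((ofA C p * c) ^+ n * lam) /\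
   vrow ((ofA C p * c) ^+ n.+1 * lam) = vrow ((ofA C p * c) ^+ n * lam) *m pm X].
Proof.
have [kap [p [kK k0 p0 hp]]] := det_Ups_Om hphi (fun j => Lat_cX j) mu_free.
have [X [XK XY XB]] := cm_matrix_exists kK p0 hp.
exists p, X; split => // n; set c' := ofA C p * c.
have cXn m : c' ^+ m * lam = ofA C (p ^+ m) * (c ^+ m * lam).
  by rewrite /c' exprMn rmorphXn /= mulrA.
split; first by rewrite cXn; apply: (latticeA hphi); apply: Lat_cX.
have hcl j : Lat (c' * (c ^+ j * lam)).
  by rewrite /c' -mulrA; apply: (latticeA hphi); exact/hc/Lat_cX.
have step j : vrow (c' * mu j) = vrow (mu j) *m pm X.
  rewrite /c' -mulrA vrowA; last exact/hc/Lat_cX.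
  have -> : vrow (mu j) = row j Y0 by apply/rowP => l; rewrite !mxE.
  by rewrite vrow_N XY -row_mul (Y0Y hp) linearZ.
have stepS (b : 'I_r -> {poly F}) : vrow (c' * \sum_j ofA C (b j) * mu j) =
    vrow (\sum_j ofA C (b j) * mu j) *m pm X.
  rewrite mulr_sumr !vrow_sum mulmx_suml; apply: eq_bigr => j _.
  have -> : c' * (ofA C (b j) * (c ^+ j * lam)) = ofA C (b j) * (c' * (c ^+ j * lam)) by ring.
  by rewrite (vrowA _ (hcl j)) step (vrowA _ (Lat_cX j)) scalemxAl.
have [b hb] : exists b : 'I_r -> {poly F}, c ^+ n = \sum_j ofA C (b j) * c ^+ j.
  elim: n => [|n [b IH]].
    exists (fun j => (j == 0 :> nat)%:R); rewrite (bigD1 (Ordinal (drinfeld_rank hphi))) //=.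
    rewrite rmorph1 mul1r big1 ?addr0 // => j j0.
    rewrite (_ : (j == 0 :> nat) = false) ?rmorph0 ?mul0r //.
    by apply/eqP => E; case/eqP: j0; apply/val_inj.
  exists (fun k => \sum_j b j * NF j k); rewrite exprS IH mulr_sumr.
  under [RHS]eq_bigr => k _ do rewrite rmorph_sum mulr_suml.
  rewrite exchange_big; apply: eq_bigr => j _; rewrite mulrCA NFP mulr_sumr.
  by apply: eq_bigr => k _; rewrite rmorphM mulrA.
have E : c ^+ n * lam = \sum_j ofA C (b j) * mu j.
  by rewrite hb mulr_suml; apply: eq_bigr => j _; rewrite mulrA.
have -> : c' ^+ n.+1 * lam = ofA C (p ^+ n) * (c' * (c ^+ n * lam)).
  by rewrite exprS -mulrA cXn; ring.
by rewrite (vrowA _ (hcl n)) cXn (vrowA _ (Lat_cX n)) E stepS scalemxAl.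
Qed.
End Fixc.
End CMatrix.

(** * Generators of the endomorphism fields *)

Section Generators.
Context (F : finFieldType) (R : realType) (C : Cinfty F R).
Local Notation q := #|F|.
Local Notation N := (@absC F R C).
Local Notation th := (theta C).
Local Notation K := (ratfun F).
Local Notation kp := (map_poly (ofK C)).

Definition inK (c x : C) := exists p : {poly K}, x = (kp p).[c].

Lemma inKD c x y : inK c x -> inK c y -> inK c (x + y).
Proof. by move=> [p ->] [p' ->]; exists (p + p'); rewrite rmorphD hornerD. Qed.
Lemma inKM c x y : inK c x -> inK c y -> inK c (x * y).
Proof. by move=> [p ->] [p' ->]; exists (p * p'); rewrite rmorphM hornerM. Qed.
Lemma inK_ofK c u : inK c (ofK C u).
Proof. by exists u%:P; rewrite map_polyC hornerC. Qed.
Lemma inK_id c : inK c c.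
Proof. by exists 'X; rewrite map_polyX hornerX. Qed.
Lemma inK_trans c x y : inK c x -> inK x y -> inK c y.
Proof.
move=> [p ->] [p' ->]; exists (p' \Po p).
by rewrite map_comp_poly horner_comp.
Qed.
Lemma inKX c x n : inK c x -> inK c (x ^+ n).
Proof.
move=> h; elim: n => [|n IH]; last by rewrite exprS; apply: inKM.
by rewrite expr0 -(rmorph1 (ofK C)); apply: inK_ofK.
Qed.
Lemma inK_sum c (I : Type) (s : seq I) (P : pred I) (f : I -> C) :
  (forall i, P i -> inK c (f i)) -> inK c (\sum_(i <- s | P i) f i).
Proof.
move=> h; elim/big_ind: _ => //; [|exact: inKD].
by rewrite -(rmorph0 (ofK C)); apply: inK_ofK.
Qed.

Lemma theta_expr_inj : injective (fun n => th ^+ n).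
Proof.
move=> m n /(congr1 N); rewrite !absCX theta_absC => E.
by apply/eqP; rewrite eqn_leq -!(ler_eXn2l (qR_gt1 F R)) E lexx.
Qed.
Lemma nonroot_theta (p : {poly C}) : p != 0 -> exists n, ~~ root p (th ^+ n).
Proof.
move=> p0; apply: contrapT => h.
have := max_poly_roots (rs := [seq th ^+ n | n <- iota 0 (size p)]) p0.
rewrite map_inj_uniq ?iota_uniq ?size_map ?size_iota ?ltnn; last exact: theta_expr_inj.
suff -> : all (root p) [seq th ^+ n | n <- iota 0 (size p)] by move=> /(_ isT isT).
by apply/allP => _ /mapP [n _ ->]; apply: contrapT => /negP hn; apply: h; exists n.
Qed.

Definition sepK (x : C) := exists p : {poly K}, root (kp p) x /\ separable_poly p.
Lemma sepK_Kbar x : sepK x -> Kbar C x.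
Proof.
by move=> [p [px sp]]; exists p => //; apply: separable_poly_neq0.
Qed.

(** The predicate [Q] records that the primitive element may be taken as a [K]-combination of the
    generators: each step forms [theta ^+ n * y - ga], with [n] avoiding the finitely many bad
    multipliers. *)
Lemma primitive_element (s : seq C) (Q : C -> Prop) : (forall x, x \in s -> sepK x) ->
  Q 0 -> (forall x y, Q x -> Q y -> Q (x + y)) -> (forall u x, Q x -> Q (ofK C u * x)) ->
  (forall x, x \in s -> Q x) ->
  exists ga, [/\ Q ga, Kbar C ga & forall x, x \in s -> inK ga x].
Proof.
move=> hs Q0 QD QZ; elim: s hs => [|y s IH] hs Qs.
  by exists 0; split=> //; exact: Kbar0.
have [||ga [Qga Kga hga]] := IH.
- by move=> x xs; apply: hs; rewrite inE xs orbT.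
- by move=> x xs; apply: Qs; rewrite inE xs orbT.
have [q [qy sq]] := hs y (mem_head _ _).
have [p p0 px] := Kga.
have [r r0 hr] := large_field_PET p0 px qy sq.
have [n hn] := nonroot_theta r0.
have tE : ofK C (tofrac 'X^n) = th ^+ n by rewrite -[LHS]/(ofA C 'X^n) rmorphXn.
have := hr (tofrac 'X^n); rewrite tE => /(_ hn) [[p1 h1] [p2 h2]].
set z := th ^+ n * y - ga in h1 h2.
exists z; split.
- apply: QD; first by rewrite -tE; apply: QZ; apply: Qs; rewrite mem_head.
  by rewrite -mulN1r -(rmorphN1 (ofK C)); apply: QZ.
- apply: KbarB => //; apply: KbarM; first by apply/KbarX/Kbar_theta.
  by apply: sepK_Kbar; apply: hs; rewrite mem_head.
- move=> x; rewrite inE => /orP[/eqP ->|xs]; first by exists p2.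
  by apply: inK_trans (hga x xs); exists p1.
Qed.

Lemma free_card m r (e : 'I_m -> C) (b : 'I_r -> C) : A_free b ->
  (forall j, Kspan e (b j)) -> (r <= m)%N.
Proof.
move=> fb hb; have [U hU] := choice hb.
pose M : 'M[K]_(r, m) := \matrix_(i, j) U i j.
rewrite leqNgt; apply/negP => mr.
have : kermx M != 0.
  by rewrite -mxrank_eq0 mxrank_ker -lt0n subn_gt0; apply: leq_ltn_trans mr; apply: rank_leq_col.
case/rowV0Pn => v /sub_kermxP vM; apply/negP; rewrite negbK; apply/eqP/rowP => i.
rewrite mxE; apply: (A_free_K (u := fun i => v 0 i) fb).
transitivity (\sum_j ofK C ((v *m M) 0 j) * e j); last first.
  by rewrite vM big1 // => j _; rewrite mxE rmorph0 mul0r.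
under [RHS]eq_bigr => j _ do rewrite mxE rmorph_sum mulr_suml.
rewrite exchange_big; apply: eq_bigr => k _; rewrite hU mulr_sumr.
by apply: eq_bigr => j _; rewrite !mxE rmorphM mulrA.
Qed.

Lemma pow_span (c : C) m (u : 'I_m -> K) : c ^+ m = \sum_j ofK C (u j) * c ^+ j ->
  forall n, Kspan (fun j : 'I_m => c ^+ j) (c ^+ n).
Proof.
move=> hc; elim/ltn_ind => n IH; have [nm|mn] := ltnP n m.
  exact: (@Kspan_gen _ _ _ _ (fun j : 'I_m => c ^+ j) (Ordinal nm)).
rewrite -(subnK mn) exprD hc mulr_sumr; apply: Kspan_sum => j _.
rewrite mulrCA -exprD; apply: KspanZ; apply: IH.
by have := ltn_ord j; lia.
Qed.
Lemma inK_span (c : C) m (u : 'I_m -> K) x : c ^+ m = \sum_j ofK C (u j) * c ^+ j ->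
  inK c x -> Kspan (fun j : 'I_m => c ^+ j) x.
Proof.
move=> hc [p ->]; rewrite horner_coef; apply: Kspan_sum => i _.
by rewrite coef_map; apply: KspanZ; apply: pow_span hc _.
Qed.

Definition generator r (c : C) := A_free (fun j : 'I_r => c ^+ j) /\
  exists a : 'I_r -> {poly F}, c ^+ r = \sum_j ofA C (a j) * c ^+ j.

Lemma generator_scale r (p : {poly F}) c : p != 0 -> generator r c -> generator r (ofA C p * c).
Proof.
move=> p0 [fc [a hc]]; split.
  move=> b hb j; have : b j * p ^+ j = 0.
    apply: (fc (fun j => b j * p ^+ j)); rewrite -[RHS]hb; apply: eq_bigr => k _.
    by rewrite rmorphM rmorphXn /= exprMn mulrA.
  by move/eqP; rewrite mulf_eq0 expf_eq0 (negPf p0) andbF orbF => /eqP.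
exists (fun j => a j * p ^+ (r - j)); rewrite exprMn hc mulr_sumr; apply: eq_bigr => j _.
rewrite rmorphM rmorphXn /= exprMn -{1}(subnK (ltnW (ltn_ord j))) exprD; ring.
Qed.

Lemma inK_scale (p : {poly F}) c x : p != 0 -> inK c x -> inK (ofA C p * c) x.
Proof.
move=> p0; apply: inK_trans; exists ((tofrac p)^-1 *: 'X).
rewrite map_polyZ map_polyX hornerZ hornerX /= fmorphV mulrA mulVf ?mul1r //.
by rewrite -(rmorph0 (ofA C)) (inj_eq (@ofA_inj _ _ C)).
Qed.

Lemma generator_minpoly r c : (0 < r)%N -> generator r c -> exists a : 'I_r -> {poly F},
  exists h : {poly K}, [/\ h \is monic, size h = r.+1, irreducible_poly h, root (kp h) c &
    h = 'X^r - \sum_(j < r) tofrac (a j) *: 'X^j].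
Proof.
move=> r0 [fc [a hc]]; exists a; set S := \sum_(j < r) tofrac (a j) *: 'X^j : {poly K}.
have sS : (size S < size ('X^r : {poly K}))%N.
  rewrite size_polyXn ltnS; apply: (leq_trans (size_sum _ _ _)); apply/bigmax_leqP => j _.
  by apply: leq_trans (size_scale_leq _ _) _; rewrite size_polyXn.
exists ('X^r - S); set h := 'X^r - S.
have sh : size h = r.+1 by rewrite size_polyDl ?size_polyN // size_polyXn.
have hr : root (kp h) c.
  rewrite rootE rmorphB /= map_polyXn rmorph_sum /= hornerD hornerN hornerXn subr_eq0 hc horner_sum.
  by apply/eqP/eq_bigr => j _; rewrite map_polyZ map_polyXn hornerZ hornerXn.
have h0 : h != 0 by rewrite -size_poly_eq0 sh.
split=> //; first by rewrite monicE lead_coefDl ?size_polyN // lead_coefXn.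
apply/(subfx_irreducibleP hr h0) => p pc p0; rewrite sh ltnNge; apply/negP => sp.
move: pc; rewrite rootE (@horner_coef_wide _ r) ?size_map_poly // => /eqP E.
case/eqP: p0; apply/polyP => i; rewrite coef0; have [ir|ri] := ltnP i r; last first.
  by rewrite nth_default // (leq_trans sp).
apply: (A_free_K (u := fun i : 'I_r => p`_i) fc _ (Ordinal ir)).
by rewrite -[RHS]E; apply: eq_bigr => j _; rewrite coef_map.
Qed.

Lemma irr_bezout (h p : {poly K}) c : irreducible_poly h -> root (kp h) c -> (kp p).[c] != 0 ->
  exists2 u : {poly K}, (kp u).[c] * (kp p).[c] = 1 & h %| (u * p - 1).
Proof.
move=> hirr hc pc; have : coprimep p h.
  rewrite coprimep_sym irreducible_poly_coprime //; apply: contra pc => /dvdpP [w ->].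
  by rewrite rmorphM hornerM (eqP hc) mulr0.
case/Bezout_eq1_coprimepP => -[u v] /= E; exists u; last first.
  by rewrite -E opprD addrA subrr sub0r dvdpNr dvdp_mull.
by have := congr1 (fun P => (kp P).[c]) E; rewrite rmorphD !rmorphM rmorph1 hornerD !hornerM (eqP hc) mulr0 addr0 hornerC.
Qed.

Lemma inK_subfield r c : (0 < r)%N -> generator r c -> is_subfield [set x | inK c x].
Proof.
move=> r0 /(generator_minpoly r0) [a [h [_ _ hirr hc _]]].
have hV x : inK c x -> inK c x^-1.
  move=> [p ->]; have [->|pc] := eqVneq (kp p).[c] 0.
    by rewrite invr0 -(rmorph0 (ofK C)); apply: inK_ofK.
  have [u E _] := irr_bezout hirr hc pc; exists u.
  by apply: (mulIf pc); rewrite E mulVf.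
split.
- by rewrite inE /= -(rmorph1 (ofK C)); apply: inK_ofK.
- move=> x y; rewrite !inE /= => hx hy; apply: inKD => //.
  by rewrite -mulN1r -(rmorphN1 (ofK C)); apply: inKM => //; apply: inK_ofK.
- by move=> x y; rewrite !inE /= => hx hy; apply: inKM => //; apply: hV.
Qed.

Context (r : nat) (phi : {poly F} -> {poly C}) (hphi : drinfeld_module r phi).
Local Notation Lat := (period_lattice phi).
Local Notation O := (lattice_End Lat).

Lemma End1 : O 1. Proof. by move=> x; rewrite mul1r. Qed.
Lemma EndD x y : O x -> O y -> O (x + y).
Proof. by move=> hx hy z hz; rewrite mulrDl; apply: (latticeD hphi); [apply: hx|apply: hy]. Qed.
Lemma EndM x y : O x -> O y -> O (x * y).
Proof. by move=> hx hy z hz; rewrite -mulrA; apply: hx; apply: hy. Qed.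
Lemma EndA a x : O x -> O (ofA C a * x).
Proof. by move=> hx z hz; rewrite -mulrA; apply: (latticeA hphi); apply: hx. Qed.
Lemma EndX x n : O x -> O (x ^+ n).
Proof. by move=> h; elim: n => [|n IH]; [exact: End1|rewrite exprS; apply: EndM]. Qed.
Lemma endo_End x : O x -> endo_field phi x.
Proof. by move=> hx A [_ hA]; apply: hA; right. Qed.

Lemma nfree_rel m (b : 'I_m -> C) : ~ A_free b -> exists2 a : 'I_m -> {poly F},
  \sum_j ofA C (a j) * b j = 0 & exists j, a j != 0.
Proof.
move=> h; apply: contrapT => h'; apply: h => a ha j; apply: contrapT => aj; apply: h'.
by exists a => //; exists j; apply/eqP.
Qed.

Context (hCM : is_CM r phi) (hgal : galois_over_K (endo_field phi)).

(** A primitive element is a combination of endomorphisms over [K], so a polynomial multiple of it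
    is an endomorphism. The rank condition is used in both directions: fewer than [r] powers cannot
    span, and [r.+1] endomorphisms are dependent. *)
Lemma cm_generator : exists c, [/\ O c, generator r c & forall x, endo_field phi x -> inK c x].
Proof.
have r0 := drinfeld_rank hphi.
have [[b Ob fb] hmax] := hCM.
pose Q x := exists2 a : {poly F}, a != 0 & O (ofA C a * x).
have [|||||ga [[a0 a00 Oga] Kga hga]] := @primitive_element [seq b j | j <- enum 'I_r] Q.
- move=> x /mapP [j _ ->]; have [_ _ /(_ _ (endo_End (Ob j)))] := hgal.
  by move=> [p [_ px sp _]]; exists p.
- by exists 1; [exact: oner_neq0|rewrite mulr0; have := EndA 0 End1; rewrite rmorph0 mul0r].
- move=> x y [a an Ox] [a' an' Oy]; exists (a * a'); first exact: mulf_neq0.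
  rewrite rmorphM mulrDr /=; apply: EndD.
    by have -> : ofA C a * ofA C a' * x = ofA C a' * (ofA C a * x) by [ring]; apply: EndA.
  by have -> : ofA C a * ofA C a' * y = ofA C a * (ofA C a' * y) by [ring]; apply: EndA.
- move=> u x [a an Ox]; have [n [d [dn ->]]] := fracP u.
  exists (a * d); first exact: mulf_neq0.
  have dC : ofA C d != 0 by rewrite -(rmorph0 (ofA C)) (inj_eq (@ofA_inj _ _ C)).
  have -> : ofA C (a * d) * (ofK C (tofrac n / tofrac d) * x) = ofA C n * (ofA C a * x).
    rewrite rmorphM [ofK C (_ / _)]rmorphM fmorphV -/(ofA C n) -/(ofA C d); field.
    by rewrite dC.
  exact: EndA.
- by move=> x /mapP [j _ ->]; exists 1; [exact: oner_neq0|rewrite rmorph1 mul1r].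
pose c0 := ofA C a0 * ga.
have hb j : inK c0 (b j) by apply: inK_scale => //; apply: hga; apply: map_f; rewrite mem_enum.
(* A relation of degree [m < r] would put the [r] independent elements [b j] into the span of [m]
   powers. *)
have short m (al : nat -> {poly F}) : (m < r)%N -> al m != 0 ->
    \sum_(j < m.+1) ofA C (al j) * c0 ^+ j <> 0.
  move=> mr am E; rewrite big_ord_recr /= in E.
  have aC : ofA C (al m) != 0 by rewrite -(rmorph0 (ofA C)) (inj_eq (@ofA_inj _ _ C)).
  have hc : c0 ^+ m = \sum_(j < m) ofK C (- (tofrac (al m))^-1 * tofrac (al j)) * c0 ^+ j.
    apply: (mulfI aC); move/eqP: E; rewrite addrC addr_eq0 => /eqP ->.
    rewrite mulr_sumr -sumrN; apply: eq_bigr => j _.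
    by rewrite rmorphM rmorphN fmorphV -/(ofA C _) -/(ofA C (al j)) mulrA mulrA mulrN mulfV // mulN1r mulNr.
  have := @free_card m r _ b fb (fun j => inK_span hc (hb j)); rewrite leqNgt mr //.
have f0 : A_free (fun j : 'I_r => c0 ^+ j).
  move=> al E j; apply/eqP; apply: contraT => aj.
  pose al' n := if insub n is Some i then al i else 0 : {poly F}.
  have al'E (i : 'I_r) : al' i = al i by rewrite /al' valK.
  have [m am hm] := @arg_maxnP _ j (fun j => al j != 0) (fun j => j : nat) aj.
  suff : False by []; apply: (@short m al'); [exact: ltn_ord|by rewrite al'E|].
  rewrite -[RHS]E (big_ord_widen r (fun j => ofA C (al' j) * c0 ^+ j)) //.
  rewrite big_mkcond; apply: eq_bigr => i _; rewrite al'E; case: ltnP => // mi.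
  have /eqP -> : al i == 0 by apply: contraT => ai; have := hm i ai; rewrite /geq /= leqNgt mi.
  by rewrite rmorph0 mul0r.
have Oc0 : O c0 by [].
clearbody c0.
have [al E [j1 aj1]] := nfree_rel (hmax (fun j : 'I_r.+1 => c0 ^+ j) (fun j => EndX j Oc0)).
have ar : al ord_max != 0.
  apply: contraNneq aj1 => h; rewrite big_ord_recr /= h rmorph0 mul0r addr0 in E.
  have := f0 _ E; case: (unliftP ord_max j1) => [j ->|-> _]; last by rewrite h.
  move=> /(_ j) <-; apply/eqP; congr (al _); apply/val_inj.
  by rewrite /= /bump leqNgt ltn_ord.
(* Multiplying by the leading coefficient of the relation makes the generator integral over [A]. *)
pose A := al ord_max; pose c := ofA C A * c0.
have gc : generator r c.
  split.
    move=> b' hb' j; have : b' j * A ^+ j = 0.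
      apply: (f0 (fun j => b' j * A ^+ j)); rewrite -[RHS]hb'; apply: eq_bigr => k _.
      by rewrite rmorphM rmorphXn /= -mulrA -exprMn.
    by move/eqP; rewrite mulf_eq0 expf_eq0 (negPf ar) andbF orbF => /eqP.
  exists (fun j => - (al (widen_ord (leqnSn r) j) * A ^+ (r.-1 - j))).
  rewrite big_ord_recr /= in E; move/eqP: E; rewrite addrC addr_eq0 => /eqP E.
  have -> : c ^+ r = ofA C A ^+ r.-1 * (ofA C (al ord_max) * c0 ^+ r).
    by rewrite /c exprMn mulrA -exprSr prednK.
  rewrite E -sumrN mulr_sumr; apply: eq_bigr => j _.
  have jr : (j <= r.-1)%N by have := ltn_ord j; lia.
  rewrite rmorphN rmorphM rmorphXn /= /c exprMn -{1}(subnK jr) exprD; ring.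
have hendo x : O x -> inK c x.
  move=> Ox; have [_ [a ha]] := gc.
  pose e (j : 'I_r.+1) := if unlift ord_max j is Some i then c ^+ (i : 'I_r) else x.
  have Oe j : O (e j) by rewrite /e; case: unlift => // i; apply: EndX; apply: EndA.
  have [be Eb [j2 bj2]] := nfree_rel (hmax e Oe).
  rewrite big_ord_recr /= in Eb.
  have el (i : 'I_r) : e (widen_ord (leqnSn r) i) = c ^+ i.
    rewrite /e (_ : widen_ord _ i = lift ord_max i) ?liftK //.
    by apply/val_inj; rewrite /= /bump leqNgt ltn_ord.
  have em : e ord_max = x by rewrite /e unlift_none.
  have {}Eb : \sum_(i < r) ofA C (be (widen_ord (leqnSn r) i)) * c ^+ i + ofA C (be ord_max) * x = 0.
    by rewrite -[RHS]Eb em; congr (_ + _); apply: eq_bigr => i _; rewrite el.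
  have [fc _] := gc.
  have bm : be ord_max != 0.
    apply: contraNneq bj2 => h; rewrite h rmorph0 mul0r addr0 in Eb.
    have := fc _ Eb; case: (unliftP ord_max j2) => [j ->|-> _]; last by rewrite h.
    move=> /(_ j) <-; apply/eqP; congr (be _); apply/val_inj.
    by rewrite /= /bump leqNgt ltn_ord.
  have bC : ofA C (be ord_max) != 0 by rewrite -(rmorph0 (ofA C)) (inj_eq (@ofA_inj _ _ C)).
  have -> : x = ofK C (- (tofrac (be ord_max))^-1) * \sum_(i < r) ofA C (be (widen_ord (leqnSn r) i)) * c ^+ i.
    apply: (mulfI bC); move/eqP: Eb; rewrite addrC addr_eq0 => /eqP ->.
    by rewrite mulrA rmorphN fmorphV -/(ofA C _) mulrN mulfV // mulN1r.
  apply: inKM; first exact: inK_ofK.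
  by apply: inK_sum => i _; apply: inKM; [exact: inK_ofK|apply: inKX; exact: inK_id].
exists c; split=> // [|x hx]; first exact: EndA.
apply: (hx [set y | inK c y]); split; first exact: (inK_subfield r0 gc).
by move=> y [[u _ <-]|/hendo //]; apply: inK_ofK.
Qed.
End Generators.

(** * The Galois group of the compositum *)

Section Compositum.
Context (F : finFieldType) (R : realType) (C : Cinfty F R).
Local Notation K := (ratfun F).
Local Notation kp := (map_poly (ofK C)).
Context (n : nat) (r : 'I_n -> nat) (c : 'I_n -> C) (h : 'I_n -> {poly K}).
Context (rt : forall i, 'I_(r i) -> C) (k0 : forall i, 'I_(r i)).
Context (h_irr : forall i, irreducible_poly (h i)) (h_sep : forall i, separable_poly (h i)).
Context (h_split : forall i, kp (h i) = \prod_k ('X - (@rt i k)%:P)).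
Context (rt_k0 : forall i, rt (k0 i) = c i) (rt_in : forall i (k : 'I_(r i)), inK (c i) (rt k)).
Context (disj : forall i j x, i != j -> inK (c i) x -> inK (c j) x -> exists u, x = ofK C u).

Lemma root_prodX (I : finType) (E : idomainType) (f : I -> E) (k : I) :
  root (\prod_k ('X - (f k)%:P)) (f k).
Proof. by rewrite (bigD1 k) //= rootM root_XsubC eqxx. Qed.

Lemma rt_inj i : injective (@rt i).
Proof.
have : separable_poly (\prod_(y <- [seq @rt i k | k <- enum 'I_(r i)]) ('X - y%:P)).
  by rewrite big_map big_enum /= -h_split separable_map h_sep.
by rewrite separable_prod_XsubC => u; apply/injectiveP.
Qed.

Section AbstractField.
Context (L : fieldExtType K) (io : {rmorphism L -> C}) (io_alg : forall u, io u%:A = ofK C u).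
Context (gaL : L) (genL : forall x, exists p : {poly K}, x = (map_poly (in_alg L) p).[gaL]).
Context (ga_span : Kspan c (io gaL)) (ga_gen : forall i, inK (io gaL) (c i)).
Local Notation lp := (map_poly (in_alg L)).

Lemma io_inj : injective io. Proof. exact: fmorph_inj. Qed.
Lemma io_lp p x : io (lp p).[x] = (kp p).[io x].
Proof.
by rewrite -horner_map -map_poly_comp; congr (_.[_]); apply: eq_map_poly => u; apply: io_alg.
Qed.
Lemma rtL_ex i (k : 'I_(r i)) : exists P : {poly K}, io (lp P).[gaL] = rt k.
Proof.
by have [P hP] := inK_trans (ga_gen i) (rt_in k); exists P; rewrite io_lp.
Qed.

Section Roots.
Context (P : forall i, 'I_(r i) -> {poly K}) (hP : forall i k, io (lp (@P i k)).[gaL] = rt k).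
Definition rtL i k := (lp (@P i k)).[gaL].
Definition cL i := rtL (k0 i).
Lemma io_rtL i k : io (@rtL i k) = rt k. Proof. exact: hP. Qed.
Lemma io_cL i : io (cL i) = c i. Proof. by rewrite io_rtL rt_k0. Qed.
Lemma rtL_inj i : injective (@rtL i).
Proof. by move=> k k' /(congr1 io); rewrite !io_rtL => /rt_inj. Qed.
Lemma h_splitL i : lp (h i) = \prod_k ('X - (@rtL i k)%:P).
Proof.
apply: (map_poly_inj io); rewrite -map_poly_comp (eq_map_poly (g := ofK C)); last exact: io_alg.
rewrite h_split rmorph_prod; apply: eq_bigr => k _.
by rewrite /= map_polyXsubC io_rtL.
Qed.

Definition rseq := [seq @rtL i k | i <- enum 'I_n, k <- enum 'I_(r i)].
Lemma rseq_in i k : @rtL i k \in rseq.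
Proof. by apply/allpairsPdep; exists i, k; split; rewrite ?mem_enum. Qed.
Lemma rseq_full : <<1 & rseq>>%VS = fullv.
Proof.
apply/eqP; rewrite eqEsubv subvf; apply/subvP => x _.
have ga_in : gaL \in <<1 & rseq>>%VS.
  have [u hu] := ga_span.
  have -> : gaL = \sum_i (u i)%:A * cL i.
    apply: io_inj; rewrite hu rmorph_sum; apply: eq_bigr => i _.
    by rewrite rmorphM io_alg io_cL.
  apply: memv_suml => i _; apply: memvM; last exact: seqv_sub_adjoin (rseq_in _).
  by apply: (subvP (subv_adjoin_seq _ _)); apply: memvZ; apply: mem1v.
have [p ->] := genL x; apply: rpred_horner => //.
apply: polyOverS (_ : map_poly _ p \is a polyOver 1%VS).
  exact/subvP/subv_adjoin_seq.
by apply/polyOver1P; exists p.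
Qed.

Lemma splitting_axiom : SplittingField.axiom L.
Proof.
exists (\prod_i lp (h i)).
  by apply: rpred_prod => i _; apply/polyOver1P; exists (h i).
exists rseq; last exact: rseq_full.
rewrite (eq_bigr _ (fun i _ => h_splitL i)) /rseq big_allpairs_dep big_enum /=.
by under [X in _ %= X]eq_bigr => i _ do rewrite big_enum; apply: eqpxx.
Qed.
End Roots.
End AbstractField.

(* The conjugates [ga s] of a primitive element are indexed by the Galois group. *)
Definition compositum_spec (hga : {poly K}) (g : C) :=
  exists (S : finType) (ga : S -> C) (s0 : S) (P : forall i : 'I_n, 'I_(r i) -> {poly K}),
  [/\ separable_poly hga, forall s, root (kp hga) (ga s), ga s0 = g,
      forall i (k : 'I_(r i)), (kp (P i k)).[ga s0] = rt k &
      forall Nw : forall i : 'I_n, 'I_(r i) -> int,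
        (forall s, \sum_i \sum_(k < r i) (if (kp (P i k)).[ga s] == c i then Nw i k else 0) = 0) ->
        forall i (k k' : 'I_(r i)), Nw i k = Nw i k'].

Section GaloisGroup.
Context (L : splittingFieldType K) (io : {rmorphism L -> C}) (io_alg : forall u, io u%:A = ofK C u).
Context (gaL : L) (genL : forall x, exists p : {poly K}, x = (map_poly (in_alg L) p).[gaL]).
Context (ga_span : Kspan c (io gaL)) (ga_gen : forall i, inK (io gaL) (c i)).
Local Notation lp := (map_poly (in_alg L)).
Context (P : forall i, 'I_(r i) -> {poly K}) (hP : forall i k, io (lp (@P i k)).[gaL] = rt k).
Local Notation rtL := (@rtL L gaL P _).
Local Notation cL := (@cL L gaL P).
Local Notation G := ('Gal({:L} / 1))%g.

Lemma in_gal (s : gal_of {:L}) : s \in G.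
Proof. by rewrite gal_kHom ?subvf //; apply: k1AHom. Qed.
Lemma gal_lp (s : gal_of {:L}) p x : s (lp p).[x] = (lp p).[s x].
Proof.
rewrite -horner_map; congr (_.[_]); rewrite -map_poly_comp; apply: eq_map_poly => u /=.
by rewrite linearZ /= rmorph1.
Qed.
Lemma seq_full : <<1 & rseq gaL P>>%VS = {:L}%VS.
Proof. exact: (rseq_full io_alg genL ga_span hP). Qed.

Lemma gal1L : galois 1 {:L}.
Proof.
rewrite /galois sub1v normalFieldf andbT /= -seq_full.
apply: separable_Fadjoin_seq; apply/allP => _ /allpairsPdep [i [k [_ _ ->]]].
apply/separable_elementP; exists (lp (h i)); split.
- by apply/polyOver1P; exists (h i).
- by rewrite (h_splitL io_alg hP); apply: (root_prodX (fun k => rtL k)).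
- by rewrite separable_map h_sep.
Qed.

Definition Kf i : {subfield L} := <<1; cL i>>%AS.
Lemma Kf_inK i x : x \in Kf i -> inK (c i) (io x).
Proof.
move=> /Fadjoin_polyP [p /polyOver1P [p' ->] ->]; exists p'.
by rewrite (io_lp io_alg) (io_cL hP).
Qed.
Lemma rtL_Kf i (k : 'I_(r i)) : rtL k \in Kf i.
Proof.
have [p hp] := rt_in k; apply/Fadjoin_polyP; exists (lp p); first by apply/polyOver1P; exists p.
apply: (fmorph_inj io); rewrite (io_rtL hP) hp -(io_cL hP i).
exact/esym/(io_lp io_alg).
Qed.
Lemma Kf_normal i : normalField 1 (Kf i).
Proof.
apply/splitting_normalField; first exact: sub1v.
exists (lp (h i)); first by apply/polyOver1P; exists (h i).
exists [seq rtL k | k <- enum 'I_(r i)].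
  by rewrite (h_splitL io_alg hP) big_map big_enum eqpxx.
apply/eqP; rewrite eqEsubv; apply/andP; split.
  apply/Fadjoin_seqP; split; first exact: sub1v.
  by move=> _ /mapP [k _ ->]; apply: rtL_Kf.
apply/FadjoinP; split; first exact: subv_adjoin_seq.
by apply: seqv_sub_adjoin; apply/mapP; exists (k0 i); rewrite ?mem_enum.
Qed.
Local Notation H i := ('Gal({:L} / Kf i))%g.
Lemma H_normal i : normal (H i) G.
Proof. by apply: normalField_normal; rewrite ?gal1L ?sub1v ?subvf ?Kf_normal. Qed.
Lemma H_gal i : fixedField (H i) = Kf i.
Proof. by apply/galois_fixedField; apply: galoisS gal1L; rewrite sub1v subvf. Qed.

(** Since [H i] is normal the product is the subgroup generated by both, and the field fixed by it
    lies in the intersection of [Kf i] and [Kf j], which is the base field. *)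
Lemma H_mul i j : i != j -> (H i * H j)%g = G.
Proof.
move=> ij; rewrite -norm_joinEr; last first.
  apply: fintype.subset_trans (normal_norm (H_normal i)); exact: normal_sub (H_normal j).
rewrite /joing -gal_generated; congr ('Gal(_ / _))%g; apply/eqP; rewrite eqEsubv sub1v andbT.
apply/subvP => x hx.
have x1 : x \in Kf i by rewrite -(H_gal i); apply: (subvP (fixedFieldS (finset.subsetUl _ _))) hx.
have x2 : x \in Kf j by rewrite -(H_gal j); apply: (subvP (fixedFieldS (finset.subsetUr _ _))) hx.
have [u hu] := disj ij (Kf_inK x1) (Kf_inK x2).
have -> : x = u%:A by apply: (fmorph_inj io); rewrite io_alg.
by apply: memvZ; apply: mem1v.
Qed.

Lemma H_cL i s : s \in H i -> s (cL i) = cL i.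
Proof. by move=> hs; apply: (fixed_gal (subvf _) hs); apply: memv_adjoin. Qed.

Section Weights.
Context (Nw : forall i : 'I_n, 'I_(r i) -> int).
(** Exactly one conjugate is sent by [s] to the distinguished root [cL i]; [nw i s] is its
    exponent. *)
Definition nw i (s : gal_of {:L}) : int := \sum_(k < r i) (if s (rtL k) == cL i then Nw k else 0).
Context (hN : forall s, \sum_i nw i s = 0).

Lemma nwM i s t : t \in H i -> nw i (s * t)%g = nw i s.
Proof.
move=> ht; apply: eq_bigr => k _; rewrite galM ?memvf // -{1}(H_cL ht).
by rewrite (inj_eq (fmorph_inj t)).
Qed.

(** Sum the weight identity over the coset of [s] modulo [H i]. The term of [i] is constant on it.
    For [j] different from [i], [H j] and [H i] together give the whole group and [nw j] is
    invariant under [H j], so the sum of [nw j] does not depend on [s]. *)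
Lemma nw_const i s : (#|H i|)%:Z * nw i s + \sum_(j | j != i) \sum_(t in H i) nw j t = 0.
Proof.
have E : \sum_j \sum_(t in H i) nw j (s * t)%g = 0.
  by rewrite exchange_big big1.
rewrite -[RHS]E [in RHS](bigD1 i) //=; congr (_ + _).
  rewrite (eq_bigr (fun=> nw i s)) => [|t ht]; last by rewrite nwM.
  by rewrite sumr_const -mulr_natl natz.
apply: eq_bigr => j ji.
have sG : s \in (H j * H i)%g by rewrite (H_mul ji) in_gal.
case/mulsgP: sG => w u hw hu ->.
rewrite [RHS](reindex_inj (mulgI u^-1)%g) /=.
rewrite [RHS](eq_bigl (mem (H i))) => [|t]; last by rewrite groupMl ?groupV.
apply: eq_bigr => t ht; rewrite mulgA mulgK conjgC nwM //.
by rewrite memJ_norm //; apply: (fintype.subsetP (normal_norm (H_normal j))); rewrite in_gal.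
Qed.

(** By [nw_const] the weight [nw i s] does not depend on [s], and by transitivity on the roots it
    takes the value [Nw l] for every [l]. *)
Lemma weights_const i (k k' : 'I_(r i)) : Nw k = Nw k'.
Proof.
have tr (l : 'I_(r i)) : exists s, nw i s = Nw l.
  have [||||s _ hs] := @normalField_root_minPoly _ _ 1%AS {:L}%AS (rtL l) (cL i).
  - exact: sub1v.
  - exact: normalFieldf.
  - exact: memvf.
  - have /polyOver1P [m Em] := minPolyOver 1 (rtL l); rewrite Em.
    have hl : root (lp (h i)) (rtL l).
      by rewrite (h_splitL io_alg hP); apply: (root_prodX (fun k => rtL k)).
    have : h i %| m.
      have : ~~ coprimep (h i) m.
        rewrite -(coprimep_map (in_alg L)); apply/negP => /coprimep_root /(_ hl).
        by rewrite -Em; apply/negP; rewrite negbK; exact: root_minPoly.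
      by rewrite irreducible_poly_coprime // negbK.
    case/dvdpP => w ->; rewrite rmorphM rootM /=; apply/orP; right.
    by rewrite (h_splitL io_alg hP); apply: (root_prodX (fun k => rtL k)).
  exists s; rewrite /nw (bigD1 l) //= hs eqxx big1 ?addr0 // => l' l'l.
  rewrite ifF //; apply/negP => /eqP; rewrite -hs => /fmorph_inj/(rtL_inj hP) E.
  by rewrite E eqxx in l'l.
have [s <-] := tr k; have [s' <-] := tr k'.
move: (nw_const i s) (nw_const i s'); set W := \sum_(j | _) _ => E1 E2.
have : (#|H i|)%:Z * nw i s = (#|H i|)%:Z * nw i s' by apply: (addIr W); rewrite E1 E2.
move/mulfI; apply.
by rewrite eqz_nat -lt0n cardG_gt0.
Qed.
End Weights.

Lemma gaL_sep (m : {poly K}) : irreducible_poly m -> root (kp m) (io gaL) -> separable_poly m.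
Proof.
move=> mirr mr; have /separableP/(_ gaL (memvf _)) : separable 1 {:L} by case/and3P: gal1L.
rewrite /separable_element; have /polyOver1P [m' Em] := minPolyOver 1 gaL; rewrite Em separable_map.
apply: dvdp_separable; have : ~~ coprimep m m'.
  rewrite -(coprimep_map (ofK C)); apply/negP => /coprimep_root /(_ mr).
  by rewrite -(io_lp io_alg) -Em minPolyxx rmorph0 eqxx.
by rewrite irreducible_poly_coprime // negbK.
Qed.

Lemma compositum_L (hga : {poly K}) :
  irreducible_poly hga -> root (kp hga) (io gaL) -> compositum_spec hga (io gaL).
Proof.
move=> hirr hroot.
have hroot' : (lp hga).[gaL] = 0.
  by apply: (fmorph_inj io); rewrite (io_lp io_alg) rmorph0; apply/eqP.
exists (gal_of {:L}), (fun s : gal_of {:L} => io (s gaL)), 1%g, P; split.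
- exact: (gaL_sep hirr hroot).
- by move=> s; rewrite rootE -(io_lp io_alg) -gal_lp hroot' !rmorph0.
- by rewrite gal_id.
- by move=> i k; rewrite gal_id -(io_lp io_alg); apply: hP.
- move=> Nw hN i k k'; apply: (@weights_const Nw) => s.
  rewrite -[RHS](hN s); apply: eq_bigr => j _; apply: eq_bigr => l _.
  rewrite -(io_lp io_alg) -gal_lp -(io_cL hP j).
  by rewrite (inj_eq (fmorph_inj io)).
Qed.
End GaloisGroup.

Lemma compositum_abs (L0 : fieldExtType K) (io0 : {rmorphism L0 -> C})
    (io_alg : forall u, io0 u%:A = ofK C u) (gaL : L0)
    (genL : forall x, exists p : {poly K}, x = (map_poly (in_alg L0) p).[gaL])
    (ga_span : Kspan c (io0 gaL)) (ga_gen : forall i, inK (io0 gaL) (c i)) (hga : {poly K}) :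
  irreducible_poly hga -> root (kp hga) (io0 gaL) -> compositum_spec hga (io0 gaL).
Proof.
move=> hirr hroot.
have [P hP] : exists P : forall i : 'I_n, 'I_(r i) -> {poly K},
    forall i k, io0 (map_poly (in_alg L0) (P i k)).[gaL] = rt k.
  have H i : exists Pi : 'I_(r i) -> {poly K},
      forall k, io0 (map_poly (in_alg L0) (Pi k)).[gaL] = rt k.
    by have [Pi hPi] := choice (fun k : 'I_(r i) => rtL_ex io_alg ga_gen k); exists Pi.
  exists (fun i => projT1 (cid (H i))) => i k; exact: (projT2 (cid (H i))).
have ax := splitting_axiom io_alg genL ga_span hP.
pose L : splittingFieldType K :=
  HB.pack_for (splittingFieldType K) (L0 : Type) L0 (FieldExt_isSplittingField.Build K L0 ax).
pose io : {rmorphism L -> C} := io0.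
refine (compositum_L (L := L) (io := io) (gaL := gaL) io_alg genL ga_span hP hirr hroot).
Qed.

Lemma compositum : exists hga g, [/\ irreducible_poly hga, root (kp hga) g & compositum_spec hga g].
Proof.
have [|||||g [gspan [p p0 pg] ggen]] := @primitive_element _ _ C [seq c i | i <- enum 'I_n] (Kspan c).
- move=> x /mapP [i _ ->]; exists (h i); split=> //.
  by rewrite h_split -rt_k0; apply: (root_prodX (fun k => rt k)).
- by exists (fun=> 0); rewrite big1 // => i _; rewrite rmorph0 mul0r.
- by move=> x y; apply: KspanD.
- by move=> u x; apply: KspanZ.
- by move=> x /mapP [i _ ->]; apply: Kspan_gen.
have ex : exists m, `[< exists f : {poly K}, [/\ f != 0, root (kp f) g & size f = m] >].
  by exists (size p); apply/asboolP; exists p.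
case: (ex_minnP ex) => m /asboolP [f [f0 fg sf]] hmin.
have firr : irreducible_poly f.
  apply/(subfx_irreducibleP fg f0) => p' p'g p'0; rewrite sf; apply: hmin.
  by apply/asboolP; exists p'.
exists f, g; split=> //.
pose L0 := SubFieldExtType fg firr.
pose io0 : {rmorphism L0 -> C} := @subfx_inj _ _ (ofK C) g f.
have E : io0 (subfx_root (ofK C) g f) = g := subfx_inj_root fg f0.
rewrite -[X in compositum_spec _ X]E.
apply: (@compositum_abs L0 io0); rewrite ?E //.
- exact: (subfx_inj_base fg f0).
- by move=> x; have [p' ->] := subfxEroot fg f0 x; exists p'.
- by move=> i; apply: ggen; apply: map_f; rewrite mem_enum.
Qed.
End Compositum.

Lemma galois_roots (F : finFieldType) (R : realType) (C : Cinfty F R) r (phi : {poly F} -> {poly C})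
    (c : C) : (0 < r)%N -> galois_over_K (endo_field phi) -> generator r c -> endo_field phi c ->
  exists a : 'I_r -> {poly F}, exists h : {poly ratfun F}, exists rt : 'I_r -> C, exists k0 : 'I_r,
  [/\ h \is monic /\ h = 'X^r - \sum_(j < r) tofrac (a j) *: 'X^j, irreducible_poly h,
    separable_poly h, map_poly (ofK C) h = \prod_k ('X - (rt k)%:P) &
    rt k0 = c /\ forall k, endo_field phi (rt k)].
Proof.
move=> r0 [_ _ hgal] gc /hgal [p [pirr pc psep [s sin ps]]].
have [a [h [hmon sh hirr hc hE]]] := generator_minpoly r0 gc.
have ph : p %= h.
  have [_ h1] := pirr; rewrite eqp_sym; apply: h1; first by rewrite sh; case: (r) r0.
  have : ~~ coprimep h p.
    rewrite -(coprimep_map (ofK C)); apply/negP => /coprimep_root /(_ hc).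
    by rewrite -rootE pc.
  by rewrite irreducible_poly_coprime // negbK.
have p0 : p != 0 by apply: separable_poly_neq0.
have hsE : map_poly (ofK C) h = \prod_(y <- s) ('X - y%:P).
  apply/eqP; rewrite -eqp_monic ?map_monic ?monic_prod_XsubC //.
  rewrite -(eqp_ltrans (_ : map_poly (ofK C) p %= _)) ?eqp_map //.
  by rewrite ps; apply: eqp_scale; rewrite fmorph_eq0 lead_coef_eq0.
have ss : size s = r.
  by apply/eqP; rewrite -eqSS -sh -(size_map_poly (ofK C)) hsE size_prod_XsubC.
have cs : c \in s by rewrite -root_prod_XsubC -hsE.
have ci : (index c s < r)%N by rewrite -ss index_mem.
exists a, h, (fun k => s`_k), (Ordinal ci); split=> //.
- by rewrite -(eqp_separable ph).
- by rewrite hsE (big_nth 0) big_mkord ss.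
- split; first by rewrite /= nth_index.
  by move=> k; apply: sin; rewrite mem_nth // ss.
Qed.

(** * Difference algebra over rational functions *)

Section FracLift.
Context (A : idomainType).
Context (S : fieldType) (f : {rmorphism A -> S}).
(** Extension of an injective morphism to the fraction field; the representation is chosen, and
    [fliftE] shows that the choice does not matter. *)
Definition flift (f_inj : injective f) (x : {fraction A}) : S :=
  xget 0 [set y | exists n d, [/\ d != 0, x = tofrac n / tofrac d & y = f n / f d]].
Context (f_inj : injective f).
Let f_neq0 d : d != 0 -> f d != 0.
Proof. by rewrite -(inj_eq f_inj) rmorph0. Qed.
Let tofrac_neq0 (d : A) : d != 0 -> tofrac d != 0.
Proof. by rewrite tofrac_eq0. Qed.

Lemma fliftE n d : d != 0 -> flift f_inj (tofrac n / tofrac d) = f n / f d.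
Proof.
move=> d0; rewrite /flift; set P := [set y | _].
have [n' [d' [d'0 E ->]]] : P (xget 0 P) by apply: (xgetPex 0); exists (f n / f d), n, d.
apply/eqP; rewrite eqr_div ?f_neq0 // -!rmorphM; apply/eqP; congr (f _).
by apply/eqP; rewrite -tofrac_eq !rmorphM -eqr_div ?tofrac_neq0 // E.
Qed.
Lemma flift_tofrac a : flift f_inj (tofrac a) = f a.
Proof. by rewrite -[tofrac a]divr1 -(rmorph1 (@tofrac A)) fliftE ?oner_neq0 // rmorph1 divr1. Qed.

Fact flift_zmod : zmod_morphism (flift f_inj).
Proof.
move=> x y; have [n [d [d0 ->]]] := fracP x; have [m [e [e0 ->]]] := fracP y.
rewrite -mulNr addf_div ?tofrac_neq0 // -[- tofrac m]rmorphN -!rmorphM -rmorphD.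
by rewrite !fliftE ?mulf_neq0 // rmorphD !rmorphM rmorphN -addf_div ?f_neq0 // mulNr.
Qed.
Fact flift_monoid : monoid_morphism (flift f_inj).
Proof.
split; first by rewrite -(rmorph1 (@tofrac A)) flift_tofrac rmorph1.
move=> x y; have [n [d [d0 ->]]] := fracP x; have [m [e [e0 ->]]] := fracP y.
by rewrite mulf_div -!rmorphM !fliftE ?mulf_neq0 // !rmorphM mulf_div.
Qed.
HB.instance Definition _ := GRing.isZmodMorphism.Build _ _ (flift f_inj) flift_zmod.
HB.instance Definition _ := GRing.isMonoidMorphism.Build _ _ (flift f_inj) flift_monoid.
End FracLift.

Section RationalFunctions.
Context (F : finFieldType) (R : realType) (C : Cinfty F R).
Local Notation q := #|F|.
Local Notation K := (ratfun F).
Local Notation ptw k := (map_poly (@frn F R C k)).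
Local Notation Phi := {fraction {poly C}}.

Lemma tofrac_inj (A : idomainType) : injective (@tofrac A).
Proof. by move=> x y /eqP; rewrite tofrac_eq => /eqP. Qed.
Lemma ptwf_inj : injective (@tofrac {poly C} \o ptw 1).
Proof. by move=> x y /tofrac_inj; apply: map_poly_inj. Qed.
Lemma ofFf_inj : injective (@tofrac {poly C} \o map_poly (ofF C)).
Proof. by move=> x y /tofrac_inj; apply: map_poly_inj. Qed.

Definition taf : Phi -> Phi := flift ptwf_inj.
HB.instance Definition _ := GRing.RMorphism.copy taf (flift ptwf_inj).
Definition kaf : K -> Phi := flift ofFf_inj.
HB.instance Definition _ := GRing.RMorphism.copy kaf (flift ofFf_inj).

Lemma taf_tofrac p : taf (tofrac p) = tofrac (ptw 1 p).
Proof. exact: flift_tofrac. Qed.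
Lemma kaf_tofrac p : kaf (tofrac p) = tofrac (map_poly (ofF C) p).
Proof. exact: flift_tofrac. Qed.
Lemma ptw_ofF p : ptw 1 (map_poly (ofF C) p) = map_poly (ofF C) p.
Proof. by rewrite -map_poly_comp; apply: eq_map_poly => c; apply: frn_ofF. Qed.
Lemma taf_kaf u : taf (kaf u) = kaf u.
Proof.
have [n [d [d0 ->]]] := fracP u.
by rewrite !fmorph_div /= !kaf_tofrac !taf_tofrac !ptw_ofF.
Qed.

Lemma ptw_fixed (p : {poly C}) : ptw 1 p = p -> exists p0, p = map_poly (ofF C) p0.
Proof.
move=> hp; have H i : exists c, p`_i = ofF C c.
  by apply: frob_fixed; rewrite -frn1 -(coef_map (@frn F R C 1)) hp.
have [f hf] := choice H; exists (\poly_(i < size p) f i); apply/polyP => i.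
rewrite coef_map coef_poly; case: ltnP => h; first exact: hf.
by rewrite nth_default // raddf0.
Qed.

(** In lowest terms with monic denominator, invariance makes the denominator divide its own twist,
    which has the same degree and is monic too; so numerator and denominator are both fixed. *)
Lemma taf_fixed x : taf x = x -> exists u, x = kaf u.
Proof.
have [n0 [d0 [d00 ->]]] := fracP x.
have [n [d [dm cop ->]]] : exists n d : {poly C}, [/\ d \is monic, coprimep n d &
    tofrac n0 / tofrac d0 = tofrac n / tofrac d].
  pose g := gcdp n0 d0; have g0 : g != 0 by rewrite gcdp_eq0 (negPf d00) andbF.
  pose d1 := d0 %/ g; pose l := lead_coef d1.
  have Ed : d0 = d1 * g by rewrite divpK // dvdp_gcdr.
  have En : n0 = n0 %/ g * g by rewrite divpK // dvdp_gcdl.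
  have d10 : d1 != 0 by apply: contraNneq d00 => h; rewrite Ed h mul0r.
  have l0 : l != 0 by rewrite lead_coef_eq0.
  exists (l^-1 *: (n0 %/ g)), (l^-1 *: d1); split.
  - by rewrite monicE lead_coefZ mulVf.
  - rewrite coprimepZl ?invr_eq0 // coprimepZr ?invr_eq0 //.
    by apply: coprimep_div_gcd; rewrite d00 orbT.
  - rewrite {1}En {1}Ed -!mul_polyC !rmorphM /= -!mulf_div.
    by rewrite !divff ?mulr1 ?mul1r // tofrac_eq0 ?polyC_eq0 ?invr_eq0.
have d0' : d != 0 by apply: monic_neq0.
rewrite fmorph_div /= !taf_tofrac => /eqP.
rewrite eqr_div ?tofrac_eq0 ?map_poly_eq0 // -!rmorphM tofrac_eq => /eqP E.
have dd : ptw 1 d = d.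
  apply/eqP; rewrite -eqp_monic ?map_monic //.
  rewrite eqp_sym -dvdp_size_eqp ?size_map_poly //.
  have : d %| n * ptw 1 d by rewrite -E dvdp_mull.
  by rewrite Gauss_dvdpr // coprimep_sym.
have nn : ptw 1 n = n by apply: (mulIf d0'); rewrite E dd.
have [n1 ->] := ptw_fixed nn; have [d1 ->] := ptw_fixed dd.
by exists (tofrac n1 / tofrac d1); rewrite fmorph_div /= !kaf_tofrac.
Qed.

End RationalFunctions.

Section Difference.
Context (K Phi : fieldType) (taf : {rmorphism Phi -> Phi}) (kaf : {rmorphism K -> Phi}).
Context (taf_kaf : forall u, taf (kaf u) = kaf u).
Context (taf_fixed : forall x, taf x = x -> exists u, x = kaf u).
Context (h : {poly K}) (h_irr : irreducible_poly h).
Local Notation H := (map_poly kaf h).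
Definition taX : {poly Phi} -> {poly Phi} := map_poly taf.
HB.instance Definition _ := GRing.RMorphism.copy taX (map_poly taf).

Lemma taX_H : taX H = H.
Proof. by rewrite /taX -map_poly_comp; apply: eq_map_poly => u; apply: taf_kaf. Qed.
Lemma H_neq0 : H != 0.
Proof. by rewrite map_poly_eq0 irredp_neq0. Qed.
Lemma dvd_taX p : H %| p -> H %| taX p.
Proof. by move=> /dvdpP [w ->]; rewrite rmorphM /= taX_H dvdp_mull. Qed.

(* The monic generator of a Frobenius-stable ideal has Frobenius-invariant coefficients. *)
Lemma tau_ideal (I : {poly Phi} -> Prop) : I H -> (forall p p', I p -> I p' -> I (p + p')) ->
  (forall a p, I p -> I (a * p)) -> (forall p, I p -> I (taX p)) ->
  I 1 \/ forall p, I p -> H %| p.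
Proof.
move=> IH ID IM It.
have ex : exists m, `[< exists g : {poly Phi}, [/\ g != 0, I g & size g = m] >].
  by exists (size H); apply/asboolP; exists H; rewrite H_neq0.
case: (ex_minnP ex) => m /asboolP [g0 [g00 Ig0 sg0]] hmin.
pose g := (lead_coef g0)^-1 *: g0.
have l0 : (lead_coef g0)^-1 != 0 by rewrite invr_eq0 lead_coef_eq0.
have gm : g \is monic by rewrite monicE lead_coefZ mulVf // lead_coef_eq0.
have sg : size g = m by rewrite size_scale.
have Ig : I g by rewrite /g -mul_polyC; apply: IM.
have hg p : I p -> g %| p.
  move=> Ip; apply: contraT => hp; have : I (p %% g).
    have -> : p %% g = p + (- (p %/ g)) * g by rewrite {2}(divp_eq p g); ring.
    by apply: ID => //; apply: IM.
  move=> Im; have /hmin : `[< exists g' : {poly Phi}, [/\ g' != 0, I g' & size g' = size (p %% g)] >].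
    by apply/asboolP; exists (p %% g); split=> //; rewrite -dvdpE.
  by rewrite -sg leqNgt ltn_modp monic_neq0.
have gt : taX g = g.
  apply/eqP; rewrite -eqp_monic ?map_monic //.
  by rewrite eqp_sym -dvdp_size_eqp ?size_map_poly //; apply: hg; apply: It.
have Hc i : exists u, g`_i = kaf u by apply: taf_fixed; rewrite -{2}gt coef_map.
have [f hf] := choice Hc; pose g' := \poly_(i < size g) f i.
have gE : g = map_poly kaf g'.
  apply/polyP => i; rewrite coef_map coef_poly; case: ltnP => hi; first exact: hf.
  by rewrite nth_default // raddf0.
have g'h : g' %| h by rewrite -(dvdp_map kaf) -gE; apply: hg.
have [s1|s1] := eqVneq (size g') 1%N.
  left; have : size g == 1%N by rewrite gE size_map_poly s1.
  case/size_poly1P => a a0 ga; move: gm; rewrite ga monicE lead_coefC => /eqP a1.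
  by move: Ig; rewrite ga a1.
right=> p /hg; apply: dvdp_trans; rewrite gE dvdp_map.
by have [_ /(_ _ s1 g'h)] := h_irr; rewrite /eqp => /andP [].
Qed.

Context (M : finType) (b : M -> {poly Phi}) (b_cop : forall m, coprimep (b m) H).

Lemma cop_inv p : coprimep p H -> exists u, H %| u * p - 1.
Proof.
case/Bezout_eq1_coprimepP => -[u v] /= E; exists u.
by rewrite -E opprD addrA subrr sub0r dvdpNr dvdp_mull.
Qed.

(** The ideal generated by [p] and [H] is Frobenius-stable because the image of [p] is a multiple of
    [p] modulo [H]; by [tau_ideal] it is everything. So morphisms between rank one equations are
    zero or isomorphisms. *)
Lemma tau_unit m m' p : ~~ (H %| p) -> H %| taX p * b m - b m' * p -> coprimep p H.
Proof.
move=> hp E; have [u hu] := cop_inv (b_cop m).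
have [] := @tau_ideal (fun x => exists a, H %| x - a * p).
- by exists 0; rewrite mul0r subr0.
- by move=> x y [a ha] [a' ha']; exists (a + a'); rewrite mulrDl opprD addrACA dvdp_add.
- by move=> z x [a ha]; exists (z * a); rewrite -mulrA -mulrBr dvdp_mull.
- move=> x [a ha]; exists (taX a * (u * b m')).
  have -> : taX x - taX a * (u * b m') * p = taX (x - a * p)
      + (taX a * u * (taX p * b m - b m' * p) - taX a * taX p * (u * b m - 1)).
    by rewrite rmorphB rmorphM /=; ring.
  by rewrite dvdp_add ?dvd_taX // dvdp_sub // dvdp_mull.
- move=> [a /dvdpP [w]] /eqP; rewrite subr_eq => /eqP h1.
  by apply/Bezout_eq1_coprimepP; exists (a, w); rewrite /= h1 addrC.
- by move=> /(_ p) h1; case/negP: hp; apply: h1; exists 1; rewrite mul1r subrr dvdp0.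
Qed.

Context (Rel : (M -> {poly Phi}) -> Prop).
Context (RD : forall c d, Rel c -> Rel d -> Rel (fun m => c m + d m)).
Context (RZ : forall a c, Rel c -> Rel (fun m => a * c m)).
Context (Rt : forall c, Rel c -> Rel (fun m => taX (c m) * b m)).
Context (R0 : forall c, (forall m, H %| c m) -> Rel c).

(** The values at [m0] of the relations supported within the support of [c] form a Frobenius-stable
    ideal, since [b m0] is invertible modulo [H]; it contains [c m0], hence 1. *)
Lemma coord_one c m0 : Rel c -> ~~ (H %| c m0) ->
  exists d, [/\ Rel d, d m0 = 1 & forall m, H %| c m -> H %| d m].
Proof.
move=> Rc hm0; have [u hu] := cop_inv (b_cop m0).
have Rdel w : H %| w -> Rel (fun m => if m == m0 then w else 0).
  by move=> hw; apply: R0 => m; case: eqP; rewrite ?dvdp0.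
have [] := @tau_ideal (fun p => exists d, [/\ Rel d, d m0 = p & forall m, H %| c m -> H %| d m]).
- exists (fun m => if m == m0 then H else 0); rewrite eqxx; split=> //; first exact: Rdel.
  by move=> m _; case: eqP; rewrite ?dvdp0.
- move=> p p' [d [Rd dm hd]] [d' [Rd' dm' hd']]; exists (fun m => d m + d' m); split.
  + exact: RD.
  + by rewrite dm dm'.
  + by move=> m hm; apply: dvdp_add; [apply: hd|apply: hd'].
- move=> a p [d [Rd dm hd]]; exists (fun m => a * d m); split; [exact: RZ|by rewrite dm|].
  by move=> m hm; apply: dvdp_mull; apply: hd.
- move=> p [d [Rd dm hd]].
  exists (fun m => u * (taX (d m) * b m) + (if m == m0 then - (taX p * (u * b m0 - 1)) else 0)).
  split.
  + by apply: RD; [apply: RZ; apply: Rt|apply: Rdel; rewrite dvdpNr dvdp_mull].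
  + by rewrite eqxx dm; ring.
  + move=> m hm; apply: dvdp_add; first by apply: dvdp_mull; apply: dvdp_mulr; apply/dvd_taX/hd.
    by case: eqP; rewrite ?dvdp0 // dvdpNr dvdp_mull.
- by move=> [d hd]; exists d.
- by move=> h1; case/negP: hm0; apply: h1; exists c.
Qed.

Context (T : pred M) (T_cl : forall m m' p, coprimep p H -> H %| taX p * b m - b m' * p -> T m = T m').
Definition dsupp (c : M -> {poly Phi}) := #|[pred m | ~~ (H %| c m)]|.

(** Take such a relation [d] of minimal support. Its defect [b m0 * d - taX d * b] is a relation
    vanishing at [m0]; if it were nonzero it could be used to shrink the support. So every nonzero
    [d m] is an isomorphism from the equation of [m0] to that of [m], and [T] agrees there. *)
Lemma coord_class c m0 : Rel c -> ~~ (H %| c m0) -> exists d, [/\ Rel d, H %| d m0 - 1,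
  forall m, H %| c m -> H %| d m & forall m, ~~ (H %| d m) -> T m = T m0].
Proof.
move=> Rc hm0.
have ex : exists k, `[< exists d, [/\ Rel d, H %| d m0 - 1, forall m, H %| c m -> H %| d m & dsupp d = k] >].
  have [d [Rd d1 hd]] := coord_one Rc hm0; exists (dsupp d); apply/asboolP; exists d; split=> //.
  by rewrite d1 subrr dvdp0.
case: (ex_minnP ex) => k /asboolP [d [Rd d1 hd sd]] hmin; exists d; split=> // m hm.
pose f m := b m0 * d m - taX (d m) * b m.
have Rf : Rel f.
  rewrite /f; have -> : (fun m => b m0 * d m - taX (d m) * b m) =
    (fun m => b m0 * d m + (-1) * (taX (d m) * b m)) by apply/funext => x; rewrite mulN1r.
  by apply: RD; apply: RZ => //; apply: Rt.
have fm0 : H %| f m0.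
  have -> : f m0 = b m0 * (d m0 - 1) - b m0 * taX (d m0 - 1).
    by rewrite /f rmorphB rmorph1 /=; ring.
  by rewrite dvdp_sub // dvdp_mull // dvd_taX.
have [[m1 hm1]|hf] : {m1 | ~~ (H %| f m1)} + (forall m1, H %| f m1).
- case: (pselect (exists m1, ~~ (H %| f m1))) => [/cid [m1 h1]|h1]; first by left; exists m1.
  by right=> m1; apply: contrapT => /negP h2; apply: h1; exists m1.
- have [e [Re em1 he]] := coord_one Rf hm1.
  have hf m' : H %| d m' -> H %| f m'.
    by move=> h1; apply: dvdp_sub; [exact: dvdp_mull|apply: dvdp_mulr; exact: dvd_taX].
  have dm1 : ~~ (H %| d m1) by apply: contra hm1 => /hf.
  suff : (dsupp (fun m => d m - d m1 * e m)%R < dsupp d)%N.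
    rewrite ltnNge sd => /negP []; apply: hmin; apply/asboolP.
    exists (fun m => d m - d m1 * e m); split=> //.
    + have -> : (fun m => d m - d m1 * e m) = (fun m => d m + (- d m1) * e m).
        by apply/funext => x; rewrite mulNr.
      by apply: RD => //; apply: RZ.
    + have -> : d m0 - d m1 * e m0 - 1 = (d m0 - 1) - d m1 * e m0 by ring.
      by rewrite dvdp_sub // dvdp_mull // he.
    + by move=> m' hm'; rewrite dvdp_sub ?hd // dvdp_mull // he // hf // hd.
  apply: proper_card; apply/fintype.properP; split.
    apply/fintype.subsetP => m'; rewrite !inE; apply: contra => hm'.
    by rewrite dvdp_sub // dvdp_mull // he // hf.
  by exists m1; rewrite !inE // em1 mulr1 subrr dvdp0.
- have E : H %| taX (d m) * b m - b m0 * d m.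
    by have := hf m; rewrite /f -dvdpNr opprB.
  by apply: T_cl (tau_unit hm E) E.
Qed.

(* A relation between solutions of rank one difference equations splits according to the
   isomorphism classes of these equations. *)
Lemma relation_split c : Rel c -> Rel (fun m => if T m then c m else 0).
Proof.
have [k] := ubnP (dsupp c); elim: k c => // k IH c; rewrite ltnS => sc Rc.
have [[m0 hm0]|hc] : {m0 | ~~ (H %| c m0)} + (forall m1, H %| c m1).
- case: (pselect (exists m1, ~~ (H %| c m1))) => [/cid [m1 h1]|h1]; first by left; exists m1.
  by right=> m1; apply: contrapT => /negP h2; apply: h1; exists m1.
- have [d [Rd d1 hd hT]] := coord_class Rc hm0.
  pose c' m := c m + (- c m0) * d m.
  have Rc' : Rel c' by apply: RD => //; apply: RZ.
  have Rd' : Rel (fun m => if T m then c m0 * d m else 0).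
    have [Tm0|Tm0] := boolP (T m0); last first.
      apply: R0 => m; case: ifP => Tm; rewrite ?dvdp0 // dvdp_mull //.
      by apply: contraT => /hT h1; rewrite h1 (negPf Tm0) in Tm.
    have -> : (fun m => if T m then c m0 * d m else 0) =
        (fun m => c m0 * d m + (if T m then 0 else - (c m0 * d m))).
      by apply/funext => m; case: ifP; rewrite ?addr0 ?subrr.
    apply: RD; first exact: RZ.
    apply: R0 => m; case: ifP => Tm; rewrite ?dvdp0 // dvdpNr dvdp_mull //.
    by apply: contraT => /hT h1; rewrite h1 Tm0 in Tm.
  have -> : (fun m => if T m then c m else 0) =
      (fun m => (if T m then c' m else 0) + (if T m then c m0 * d m else 0)).
    by apply/funext => m; case: ifP; rewrite ?addr0 // /c' mulNr subrK.
  apply: RD => //; apply: IH => //; apply: leq_trans sc; apply: proper_card.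
  apply/fintype.properP; split.
    apply/fintype.subsetP => m; rewrite !inE; apply: contra => hm.
    by rewrite /c' dvdp_add // dvdp_mull // hd.
  exists m0; rewrite !inE // negbK /c'.
  have -> : c m0 + - c m0 * d m0 = - c m0 * (d m0 - 1) by ring.
  by rewrite dvdp_mull.
- by apply: R0 => m; case: ifP; rewrite ?dvdp0.
Qed.
End Difference.

(** * Bounded series and evaluation at theta *)

Section BoundedSeries.
Context (F : finFieldType) (R : realType) (C : Cinfty F R).
Local Notation q := #|F|.
Local Notation th := (theta C).
Local Notation ro1 := (q%:R ^+ q : R).

Record bser := BSer { bs_val :> fps C; bs_bdd : `[< bdd ro1 bs_val >] }.
HB.instance Definition _ := [isSub for bs_val].
HB.instance Definition _ := [Choice of bser by <:].

Lemma bserP (a : bser) : bdd ro1 a. Proof. by case: a => a /= /asboolP. Qed.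
Lemma bs_inj (a b : bser) : bs_val a = bs_val b -> a = b. Proof. exact: val_inj. Qed.
Definition mkb (a : fps C) (h : bdd ro1 a) : bser := BSer (asboolT h).

Let ro_ge0 : 0 <= ro1. Proof. exact: ro1_ge0. Qed.
Definition badd (a b : bser) := mkb (bddD ro_ge0 (bserP a) (bserP b)).
Definition bopp (a : bser) := mkb (bddN (bserP a)).
Definition bmul (a b : bser) := mkb (bddM ro_ge0 (bserP a) (bserP b)).
Definition pbs (p : {poly C}) : bser := mkb (bdd_poly ro1 p).

Fact baddA : associative badd. Proof. by move=> a b c; apply: bs_inj; rewrite /= addrA. Qed.
Fact baddC : commutative badd. Proof. by move=> a b; apply: bs_inj; rewrite /= addrC. Qed.
Fact badd0 : left_id (pbs 0) badd. Proof. by move=> a; apply: bs_inj; rewrite /= rmorph0 add0r. Qed.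
Fact baddN : left_inverse (pbs 0) bopp badd.
Proof. by move=> a; apply: bs_inj; rewrite /= addNr rmorph0. Qed.
HB.instance Definition _ := GRing.isZmodule.Build bser baddA baddC badd0 baddN.
Fact bmulA : associative bmul. Proof. by move=> a b c; apply: bs_inj; rewrite /= mulrA. Qed.
Fact bmulC : commutative bmul. Proof. by move=> a b; apply: bs_inj; rewrite /= mulrC. Qed.
Fact bmul1 : left_id (pbs 1) bmul. Proof. by move=> a; apply: bs_inj; rewrite /= rmorph1 mul1r. Qed.
Fact bmulDl : left_distributive bmul badd.
Proof. by move=> a b c; apply: bs_inj; rewrite /= mulrDl. Qed.
Fact bone_neq0 : pbs 1 != 0.
Proof. by apply/eqP => /(congr1 bs_val)/(@pfps_inj C)/eqP; rewrite oner_eq0. Qed.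
HB.instance Definition _ := GRing.Zmodule_isComNzRing.Build bser bmulA bmulC bmul1 bmulDl bone_neq0.

Fact bs_zmod : zmod_morphism bs_val. Proof. by []. Qed.
HB.instance Definition _ := GRing.isZmodMorphism.Build _ _ bs_val bs_zmod.
Fact bs_monoid : monoid_morphism bs_val. Proof. by split=> //; exact: rmorph1. Qed.
HB.instance Definition _ := GRing.isMonoidMorphism.Build _ _ bs_val bs_monoid.
Fact bs_integral (a b : bser) : a * b = 0 -> (a == 0) || (b == 0).
Proof.
move=> /(congr1 bs_val); rewrite rmorphM rmorph0 => /eqP; rewrite mulf_eq0.
by rewrite -!(rmorph0 bs_val) !(inj_eq bs_inj).
Qed.
Definition bunitb (a : bser) : bool := `[< exists b, b * a = 1 >].
Definition binv (a : bser) : bser := xget a [set b | b * a = 1].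
Fact bmulVr : {in bunitb, left_inverse 1 binv *%R}.
Proof. by move=> a /asboolP [b hb]; exact: (@xgetPex _ a [set b | b * a = 1] (ex_intro _ b hb)). Qed.
Fact bunitP (a b : bser) : b * a = 1 -> bunitb a.
Proof. by move=> h; apply/asboolP; exists b. Qed.
Fact binv_out : {in [predC bunitb], binv =1 id}.
Proof.
move=> a /negP h; rewrite /binv; case: xgetP => // b _ hb.
by case: h; apply: (@bunitP a b).
Qed.
HB.instance Definition _ := GRing.ComNzRing_hasMulInverse.Build bser bmulVr bunitP binv_out.
HB.instance Definition _ := GRing.ComUnitRing_isIntegral.Build bser bs_integral.

Fact pbs_zmod : zmod_morphism pbs. Proof. by move=> x y; apply: bs_inj; rewrite /= !rmorphB. Qed.
HB.instance Definition _ := GRing.isZmodMorphism.Build _ _ pbs pbs_zmod.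
Fact pbs_monoid : monoid_morphism pbs.
Proof. by split=> // x y; apply: bs_inj; rewrite /= !rmorphM. Qed.
HB.instance Definition _ := GRing.isMonoidMorphism.Build _ _ pbs pbs_monoid.
Lemma pbs_inj : injective pbs.
Proof. by move=> x y /(congr1 bs_val)/(@pfps_inj C). Qed.

Fact btw_bdd (a : bser) : bdd ro1 (tw 1 a).
Proof.
have [M hM] := bserP a; exists (M ^+ (q ^ 1)).
have H2 : nb (ro1 ^+ (q ^ 1)) (M ^+ (q ^ 1)) (tw 1 a) by apply: nb_tw.
apply: (nb_radius _ _ H2) => //.
have h1 : 1 <= ro1 by apply: exprn_ege1; exact: ltW (qR_gt1 F R).
by rewrite expn1; apply: ler_eXnr => //; exact: q_gt0.
Qed.
Definition btw (a : bser) : bser := mkb (btw_bdd a).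
Fact btw_zmod : zmod_morphism btw. Proof. by move=> x y; apply: bs_inj; rewrite /= !rmorphB. Qed.
HB.instance Definition _ := GRing.isZmodMorphism.Build _ _ btw btw_zmod.
Fact btw_monoid : monoid_morphism btw.
Proof.
split=> [|x y]; apply: bs_inj; rewrite /= ?rmorphM //.
by rewrite tw_pfps !rmorph1.
Qed.
HB.instance Definition _ := GRing.isMonoidMorphism.Build _ _ btw btw_monoid.
Lemma btw_inj : injective btw.
Proof.
move=> x y /(congr1 bs_val)/fpsP h; apply/bs_inj/fpsP => i.
by have := h i; rewrite /tw !fmapE => /fmorph_inj.
Qed.
Lemma btw_pbs p : btw (pbs p) = pbs (map_poly (@frn F R C 1) p).
Proof. by apply: bs_inj; rewrite /= tw_pfps. Qed.

Definition bev (a : bser) : C := xget 0 [set c | evl th a c].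
Lemma bevP (a : bser) : evl th a (bev a).
Proof. by apply: (xgetPex 0); apply: bdd_evl; exact: bserP. Qed.
Lemma bevE a c : evl th (bs_val a) c -> bev a = c.
Proof. exact: evl_unique (bevP a). Qed.
Fact bev_zmod : zmod_morphism bev.
Proof. by move=> x y; apply: bevE; apply: evlB; exact: bevP. Qed.
HB.instance Definition _ := GRing.isZmodMorphism.Build _ _ bev bev_zmod.
Lemma bev_pbs p : bev (pbs p) = p.[th].
Proof. by apply: bevE; apply: evl_poly. Qed.
Fact bev_monoid : monoid_morphism bev.
Proof.
split; first by rewrite -[1]/(pbs 1) bev_pbs hornerC.
by move=> x y; apply: bevE; apply: evlM; exact: bevP.
Qed.
HB.instance Definition _ := GRing.isMonoidMorphism.Build _ _ bev bev_monoid.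

Local Notation Phi := {fraction {poly C}}.
Definition Psi := {fraction bser}.
Lemma btwf_inj : injective (@tofrac bser \o btw).
Proof. by move=> x y /tofrac_inj/btw_inj. Qed.
Lemma pbsf_inj : injective (@tofrac bser \o pbs).
Proof. by move=> x y /tofrac_inj/pbs_inj. Qed.
Definition tas : {fraction bser} -> {fraction bser} := flift btwf_inj.
HB.instance Definition _ := GRing.RMorphism.copy tas (flift btwf_inj).
Definition ips : Phi -> {fraction bser} := flift pbsf_inj.
HB.instance Definition _ := GRing.RMorphism.copy ips (flift pbsf_inj).
Lemma tas_tofrac a : tas (tofrac a) = tofrac (btw a). Proof. exact: flift_tofrac. Qed.
Lemma ips_tofrac p : ips (tofrac p) = tofrac (pbs p). Proof. exact: flift_tofrac. Qed.
Lemma tas_ips x : tas (ips x) = ips (@taf F R C x).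
Proof.
have [n [d [d0 ->]]] := fracP x.
by rewrite !fmorph_div /= !ips_tofrac !taf_tofrac !tas_tofrac !ips_tofrac !btw_pbs.
Qed.

Local Notation fA := (map_poly (ofF C)).
(* The point [(theta, g)] is evaluated after pseudo-division by the polynomial of [g]. *)
Lemma bev_dvd (hA : {poly {poly F}}) (g : C) (S : {poly bser}) : hA != 0 ->
  (map_poly (ofA C) hA).[g] = 0 ->
  map_poly (@tofrac bser \o pbs \o fA) hA %| map_poly (@tofrac bser) S ->
  (map_poly bev S).[g] = 0.
Proof.
move=> h0 hg hdiv; pose HD := map_poly (pbs \o fA) hA.
have fA_inj : injective (pbs \o fA) by move=> x y /pbs_inj; apply: map_poly_inj.
have lE : lead_coef HD = pbs (fA (lead_coef hA)) by rewrite /HD lead_coef_map_inj ?rmorph0.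
have sE : size HD = size hA by apply: size_map_inj_poly => //; rewrite rmorph0.
have HDE : map_poly (@tofrac bser \o pbs \o fA) hA = map_poly (@tofrac bser) HD.
  by rewrite /HD -map_poly_comp.
have HD0 : HD != 0 by rewrite -size_poly_eq0 sE size_poly_eq0.
have E := Pdiv.ComRing.rdivp_eq HD S.
have r0 : Pdiv.Ring.rmodp S HD = 0.
  apply: (map_inj_poly (@tofrac_inj bser) (rmorph0 _)); rewrite rmorph0; apply/eqP.
  apply: contraT => h; have : map_poly (@tofrac bser) HD %| map_poly (@tofrac bser) (Pdiv.Ring.rmodp S HD).
    have -> : Pdiv.Ring.rmodp S HD = lead_coef HD ^+ Pdiv.Ring.rscalp S HD *: S - Pdiv.Ring.rdivp S HD * HD.
      by rewrite E addrC addKr.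
    rewrite rmorphB rmorphM /= map_polyZ dvdp_sub ?dvdp_mull //.
    by rewrite -mul_polyC dvdp_mull // -HDE.
  move/(dvdp_leq h); rewrite !size_map_inj_poly ?rmorph0 //; try exact: tofrac_inj.
  by rewrite -sE leqNgt Pdiv.Ring.ltn_rmodp HD0.
have := congr1 (fun P => (map_poly bev P).[g]) E; rewrite r0 addr0 rmorphM map_polyZ hornerZ hornerM /=.
have -> : (map_poly bev HD).[g] = 0.
  rewrite -[RHS]hg /HD -map_poly_comp; congr (_.[_]); apply: eq_map_poly => a /=.
  by rewrite bev_pbs ofAE.
have l0 : bev (lead_coef HD) != 0.
  by rewrite lE bev_pbs -ofAE -(rmorph0 (ofA C)) (inj_eq (@ofA_inj _ _ C)) lead_coef_eq0.
rewrite mulr0 => /eqP; rewrite mulf_eq0 => /orP [|/eqP //].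
by rewrite rmorphXn /= expf_eq0 (negPf l0) andbF.
Qed.
End BoundedSeries.

(** * Hensel lifting *)

Section Hensel.
Context (K : fieldType).
Implicit Types (a b : fps K).
Definition fc0 a : K := a 0%N.
Fact fc0_zmod : zmod_morphism fc0. Proof. by []. Qed.
HB.instance Definition _ := GRing.isZmodMorphism.Build _ _ fc0 fc0_zmod.
Fact fc0_monoid : monoid_morphism fc0. Proof. by split=> // a b; exact: fcoefM0. Qed.
HB.instance Definition _ := GRing.isMonoidMorphism.Build _ _ fc0 fc0_monoid.

Lemma horner_taylor2 (A : comNzRingType) (p : {poly A}) x y :
  exists w, p.[x + y] = p.[x] + y * p^`().[x] + y ^+ 2 * w.
Proof.
elim/poly_ind: p => [|p c [w IH]]; first by exists 0; rewrite deriv0 !horner0; ring.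
exists (p^`().[x] + w * (x + y)).
by rewrite derivMXaddC !hornerE /= IH; ring.
Qed.

Context (H : {poly fps K}) (g : K).
Local Notation H0 := (map_poly fc0 H).
Context (Hg : root H0 g) (H'g : H0^`().[g] != 0).

(** Hensel's lemma one coefficient at a time: the derivative at [g] is a nonzero constant, so each
    step is a linear correction. *)
Fixpoint hens n : fps K := if n is m.+1 then
  hens m - pfps ((H.[hens m] m.+1 / H0^`().[g]) *: 'X^(m.+1)) else pfps g%:P.

Lemma hens0 n : hens n 0%N = g.
Proof.
elim: n => [|n IH] /=; first by rewrite coefC.
by rewrite IH coefZ coefXn mulr0 subr0.
Qed.
Lemma horner_c0 (p : {poly fps K}) a : p.[a] 0%N = (map_poly fc0 p).[a 0%N].
Proof. by rewrite -[p.[a] 0%N]/(fc0 _) -horner_map. Qed.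

Lemma hensP n i : (i <= n)%N -> H.[hens n] i = 0.
Proof.
elim: n i => [|n IH] i.
  by rewrite leqn0 => /eqP ->; rewrite horner_c0 /= coefC; exact/eqP.
move=> hi; set c := H.[hens n] n.+1 / H0^`().[g].
have -> : hens n.+1 = hens n + pfps 'X^(n.+1) * pfps (- c)%:P.
  by rewrite [pfps 'X^(n.+1) * _]mulrC -rmorphM /= mul_polyC scaleNr rmorphN.
have [w ->] := horner_taylor2 H (hens n) (pfps 'X^(n.+1) * pfps (- c)%:P).
rewrite -[pfps 'X^(n.+1) * _ * _]mulrA exprMn -[_ * w]mulrA [pfps 'X^(n.+1) ^+ 2]expr2.
rewrite -2!mulrA !fcoefD !fcoefXnM; move: hi; rewrite leq_eqVlt => /orP [/eqP ->|hi].
  rewrite ltnn subnn fcoefCM horner_c0 hens0 -deriv_map /= addr0.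
  by rewrite mulNr /c divfK // subrr.
by rewrite hi IH // !addr0.
Qed.

Definition hensel_root : fps K := Fps (fun i => hens i i).
Lemma hens_stable n m i : (i <= n)%N -> hens (n + m) i = hens n i.
Proof.
move=> hi; elim: m => [|m IH]; first by rewrite addn0.
rewrite addnS /= IH coefZ coefXn.
by rewrite ltn_eqF ?mulr0 ?subr0 //; lia.
Qed.
Lemma hensel_rootP : H.[hensel_root] = 0 /\ hensel_root 0%N = g.
Proof.
split; last exact: (hens0 0).
apply/fpsP => n; rewrite fcoef0.
have : forall i, (i < n.+1)%N -> (hensel_root - hens n) i = 0.
  by move=> i; rewrite ltnS => hi; rewrite fcoefB /= -(subnKC hi) hens_stable ?subrr.
move/ford_split; set y := Fps _ => E.
have -> : hensel_root = hens n + pfps 'X^(n.+1) * y by rewrite -E addrC subrK.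
have [w ->] := horner_taylor2 H (hens n) (pfps 'X^(n.+1) * y).
rewrite -[pfps 'X^(n.+1) * _ * _]mulrA exprMn -[_ * w]mulrA [pfps 'X^(n.+1) ^+ 2]expr2.
by rewrite -2!mulrA !fcoefD !fcoefXnM ltnSn hensP // !addr0.
Qed.
End Hensel.

(** * Expansions at the twists of theta *)

Section Places.
Context (F : finFieldType) (R : realType) (C : Cinfty F R).
Local Notation q := #|F|.
Local Notation th := (theta C).
Local Notation fA := (map_poly (ofF C)).
Local Notation ptw k := (map_poly (@frn F R C k)).
Local Notation K := (ratfun F).

(* Expansion of the twist [p^(j)] in the local parameter [s = t - theta^(q^k)]. *)
Definition plc k j (p : {poly C}) : fps C := pfps (ptw j p \Po ('X + (frn k th)%:P)).
Fact plc_zmod k j : zmod_morphism (plc k j).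
Proof. by move=> x y; rewrite /plc !rmorphB. Qed.
HB.instance Definition _ k j := GRing.isZmodMorphism.Build _ _ (plc k j) (plc_zmod k j).
Fact plc_monoid k j : monoid_morphism (plc k j).
Proof. by split=> [|x y]; rewrite /plc ?rmorph1 // !rmorphM. Qed.
HB.instance Definition _ k j := GRing.isMonoidMorphism.Build _ _ (plc k j) (plc_monoid k j).
Lemma plc_c0 k j p : plc k j p 0%N = (ptw j p).[frn k th].
Proof. by rewrite /plc /= -horner_coef0 horner_comp !hornerE. Qed.
Lemma plc_inj k j : injective (plc k j).
Proof.
move=> x y /(@pfps_inj C) h; apply: (map_poly_inj (@frn F R C j)).
have : (ptw j x \Po ('X + (frn k th)%:P)) \Po ('X - (frn k th)%:P) =
       (ptw j y \Po ('X + (frn k th)%:P)) \Po ('X - (frn k th)%:P) by rewrite h.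
by rewrite -!comp_polyA !comp_polyD !comp_polyX !comp_polyC subrK !comp_polyXr.
Qed.
Lemma ptwk_ofF k p : ptw k (fA p) = fA p.
Proof. by rewrite -map_poly_comp; apply: eq_map_poly => c; apply: frn_ofF. Qed.
Lemma plc_fA k j a : plc k j (fA a) = tw k (plc 0 0 (fA a)).
Proof.
rewrite /plc !ptwk_ofF tw_pfps map_comp_poly ptwk_ofF rmorphD /= map_polyX map_polyC /=.
by rewrite frn0.
Qed.
Lemma plc_S k j p : plc k j.+1 p = plc k j (ptw 1 p).
Proof.
rewrite /plc -(addn1 j) -map_poly_comp; congr (pfps (_ \Po _)).
by apply: eq_map_poly => x; rewrite /= frnD.
Qed.

(** At [theta ^+ (q ^ k)] the twist of [p] by [j] is a power of the value of [p] at
    [theta ^ (q ^ (k - j))]. As [j] runs from 0 to [k.*2] this point passes through [theta]; only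
    the two ends of the window have to avoid the zeros of [p]. *)
Lemma far_places (p : {poly C}) : p != 0 -> exists k, [/\ (0 < k)%N, plc k 0 p 0%N != 0 &
  plc k k.*2 p 0%N != 0].
Proof.
move=> p0; apply: contrapT => h.
have inj1 : injective (fun k => frn k.+1 th).
  move=> m n; rewrite !frnE => /theta_expr_inj/eqP.
  by rewrite eqn_exp2l ?q_gt1 // => /eqP [].
have inj2 : injective (fun k => frin k.+1 th).
  move=> m n E; have := congr1 (frn (m.+1 + n.+1)) E.
  rewrite {1}addnC !frnD !frinK => /(inj1 n m); exact: esym.
have hbad k : root p (frn k.+1 th) || root p (frin k.+1 th).
  apply: contraT; rewrite negb_or => /andP [h1 h2]; case: h; exists k.+1; split=> //.
    rewrite plc_c0; have -> : ptw 0 p = p by apply: map_poly_id => x _; apply: frn0.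
    exact: h1.
  rewrite plc_c0 -addnn; have -> : (ptw (k.+1 + k.+1) p).[frn k.+1 th] = frn (k.+1 + k.+1) p.[frin k.+1 th].
    by rewrite -horner_map /= frnD frinK.
  by rewrite fmorph_eq0.
(* Every index below twice the size of [p] would give a root in one of two injective families, each
   with fewer than [size p] roots. *)
pose s1 := [seq frn k.+1 th | k <- [seq k <- iota 0 (size p).*2 | root p (frn k.+1 th)]].
pose s2 := [seq frin k.+1 th | k <- [seq k <- iota 0 (size p).*2 | ~~ root p (frn k.+1 th)]].
have l1 : (size s1 < size p)%N.
  apply: max_poly_roots => //; last by rewrite map_inj_uniq // filter_uniq // iota_uniq.
  by apply/allP => z /mapP [k]; rewrite mem_filter => /andP [hk _] ->.
have l2 : (size s2 < size p)%N.
  apply: max_poly_roots => //; last by rewrite map_inj_uniq // filter_uniq // iota_uniq.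
  apply/allP => z /mapP [k]; rewrite mem_filter => /andP [hk _] ->.
  by have := hbad k; rewrite (negPf hk).
have := count_predC (fun k => root p (frn k.+1 th)) (iota 0 (size p).*2).
rewrite size_iota; move: l1 l2; rewrite !size_map !size_filter /predC -/(count _ _).
set c1 := count _ _; set c2 := count _ _ => l1 l2 E.
have {}E : (c1 + c2 = (size p).*2)%N := E.
by move: l1 l2 E; rewrite -addnn; clearbody c1 c2; clear; lia.
Qed.

Lemma clear_denom (A : idomainType) (p : {poly {fraction A}}) : exists2 a : A, a != 0 &
  exists p0 : {poly A}, tofrac a *: p = map_poly (@tofrac A) p0.
Proof.
elim/poly_ind: p => [|p c [a a0 [p0 hp]]].
  by exists 1; [exact: oner_neq0|exists 0; rewrite scaler0 rmorph0].
have [n [d [d0 ->]]] := fracP c; exists (a * d); first exact: mulf_neq0.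
exists (d%:P * p0 * 'X + (a * n)%:P).
have E : tofrac (a * d) * (tofrac n / tofrac d) = tofrac (a * n) :> {fraction A}.
  by rewrite !rmorphM /= mulrACA divff ?mulr1 // tofrac_eq0.
rewrite rmorphD /= map_polyC /= -E scalerDr; congr (_ + _); last by rewrite -mul_polyC -polyCM.
rewrite !rmorphM /= map_polyX map_polyC /= -hp mul_polyC scalerA scalerAl.
by rewrite [tofrac d * _]mulrC.
Qed.
End Places.

(** * Cyclic vectors *)

Section Cyclic.
Context (A : idomainType) (n : nat).
Implicit Types (X : 'M[A]_n.+1) (p : {poly A}).

Lemma mulmx_det0r m k (B : 'M[A]_m) (M : 'M[A]_(m, k)) : \det B != 0 -> B *m M = 0 -> M = 0.
Proof.
move=> d0 h; have : \adj B *m (B *m M) = 0 by rewrite h mulmx0.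
rewrite mulmxA mul_adj_mx mul_scalar_mx => /matrixP E; apply/matrixP => i j.
by have := E i j; rewrite !mxE => /eqP; rewrite mulf_eq0 (negPf d0) => /eqP.
Qed.

Lemma horner_eigr X (w : 'cV[A]_n.+1) x p : X *m w = x *: w -> horner_mx X p *m w = p.[x] *: w.
Proof.
move=> hw; elim/poly_ind: p => [|p c IH]; first by rewrite rmorph0 mul0mx horner0 scale0r.
rewrite rmorphD rmorphM /= horner_mx_X horner_mx_C mulmxDl -mulmxE -mulmxA hw -scalemxAr IH.
by rewrite mul_scalar_mx scalerA -scalerDl hornerMXaddC mulrC.
Qed.
Lemma horner_eigl X (z : 'rV[A]_n.+1) x p : z *m X = x *: z -> z *m horner_mx X p = p.[x] *: z.
Proof.
move=> hz; elim/poly_ind: p => [|p c IH]; first by rewrite rmorph0 mulmx0 horner0 scale0r.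
rewrite rmorphD rmorphM /= horner_mx_X horner_mx_C mulmxDr -mulmxE mulmxA IH -scalemxAl hz.
by rewrite mul_mx_scalar scalerA -scalerDl hornerMXaddC.
Qed.
Lemma horner_intertwine X Y (B : 'M[A]_n.+1) p : B *m Y = X *m B ->
  B *m horner_mx Y p = horner_mx X p *m B.
Proof.
move=> h; elim/poly_ind: p => [|p c IH]; first by rewrite !rmorph0 mulmx0 mul0mx.
rewrite !rmorphD !rmorphM /= !horner_mx_X !horner_mx_C mulmxDr mulmxDl -!mulmxE mulmxA IH.
by rewrite -[_ *m B *m Y]mulmxA h mulmxA mul_mx_scalar mul_scalar_mx.
Qed.

(** The Krylov matrix of [u]; its determinant is nonzero exactly when [u] is a cyclic vector over
    the fraction field. *)
Definition Qm X (u : 'cV[A]_n.+1) : 'M[A]_n.+1 := \matrix_(i, j) (X ^+ j *m u) i 0.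
Lemma mulQm m X u (M : 'M[A]_(m, n.+1)) i j : (M *m Qm X u) i j = (M *m X ^+ j *m u) i 0.
Proof. by rewrite -mulmxA !mxE; apply: eq_bigr => k _; rewrite mxE. Qed.
Lemma horner_Qm X u p : (size p <= n.+1)%N ->
  horner_mx X p *m u = Qm X u *m \col_(j < n.+1) p`_j.
Proof.
move=> sp; have pE : p = \sum_(j < n.+1) p`_j *: 'X^j.
  apply/polyP => i; rewrite -[p in LHS](coefK p) coef_poly coef_sum.
  under eq_bigr => j _ do rewrite coefZ coefXn.
  have [ni|ni] := ltnP i n.+1; last first.
    rewrite big1 => [|j _]; first by case: ltnP => // h; have := leq_trans h sp; rewrite ltnNge ni.
    by rewrite gtn_eqF ?mulr0 // (leq_trans (ltn_ord j)).
  rewrite (bigD1 (Ordinal ni)) //= eqxx mulr1 big1 ?addr0.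
    by case: ltnP => // h; rewrite nth_default.
  move=> j ji; rewrite [i == j]eq_sym -[X in (X == i)]/(nat_of_ord j).
  by rewrite (_ : (j == i :> nat) = false) ?mulr0 //; apply: contraNF ji => /eqP h; apply/eqP/val_inj.
rewrite {1}pE rmorph_sum mulmx_suml; apply/colP => i; rewrite summxE !mxE; apply: eq_bigr => j _.
by rewrite -mul_polyC rmorphM /= horner_mx_C rmorphXn /= horner_mx_X -mulmxE mul_scalar_mx -scalemxAl !mxE mulrC.
Qed.

Context (X : 'M[A]_n.+1) (u : 'cV[A]_n.+1) (h : {poly A}).
Context (h_mon : h \is monic) (h_size : size h = n.+2) (hX0 : horner_mx X h = 0).

Lemma horner_mod p : horner_mx X p = horner_mx X (Pdiv.Ring.rmodp p h).
Proof.
by rewrite {1}(Pdiv.RingMonic.rdivp_eq h_mon p) rmorphD rmorphM /= hX0 mulr0 add0r.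
Qed.
Lemma size_mod p : (size (Pdiv.Ring.rmodp p h) <= n.+1)%N.
Proof. by rewrite -ltnS -h_size Pdiv.Ring.ltn_rmodp monic_neq0. Qed.

Lemma cyc_eval (z : 'rV[A]_n.+1) x R p : h.[R] = 0 -> z *m Qm X u = x *: \row_j R ^+ j ->
  z *m horner_mx X p *m u = (x * p.[R])%:M.
Proof.
move=> hR hz; rewrite horner_mod -mulmxA horner_Qm ?size_mod // mulmxA hz.
rewrite {2}(Pdiv.RingMonic.rdivp_eq h_mon p) hornerD hornerM hR mulr0 add0r.
rewrite (horner_coef_wide _ (size_mod p)); apply/matrixP => i j.
rewrite !ord1 !mxE eqxx mulr1n mulr_sumr; apply: eq_bigr => k _; rewrite !mxE; ring.
Qed.
Lemma cyc_eig (z : 'rV[A]_n.+1) x R : \det (Qm X u) != 0 -> h.[R] = 0 ->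
  z *m Qm X u = x *: \row_j R ^+ j -> z *m X = R *: z.
Proof.
move=> d0 hR hz; apply/eqP; rewrite -subr_eq0; apply/eqP/(mulmx_det0 d0); apply/rowP => j.
have E : (z *m X *m Qm X u) 0 j = x * R ^+ j.+1.
  rewrite mulQm -[z *m X *m _]mulmxA mulmxE -exprS.
  have := cyc_eval 'X^(j.+1) hR hz; rewrite rmorphXn /= horner_mx_X hornerXn => ->.
  by rewrite mxE eqxx mulr1n.
rewrite mulmxBl -scalemxAl hz [LHS]mxE E !mxE exprS; ring.
Qed.
End Cyclic.

(** * Values of the Frobenius eigenvectors at theta *)

Section ModuleValues.
Context (F : finFieldType) (R : realType) (C : Cinfty F R).
Local Notation q := #|F|.
Local Notation N := (@absC F R C).
Local Notation th := (theta C).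
Local Notation ptw k := (map_poly (@frn F R C k)).
Local Notation pm := (map_mx (@pfps C)).
Local Notation twm := (map_mx (@tw F R C 1)).
Local Notation ro1 := (q%:R ^+ q : R).
Local Notation fA := (map_poly (ofF C)).
Local Notation tm := (map_mx (horner_eval th)).

Definition kbM m n (A : 'M[C]_(m, n)) := forall i j, Kbar C (A i j).
Lemma kbM_mul m n k (A : 'M[C]_(m, n)) (B : 'M[C]_(n, k)) : kbM A -> kbM B -> kbM (A *m B).
Proof. by move=> hA hB i j; rewrite mxE; apply: Kbar_sum => l _; apply: KbarM. Qed.
Lemma kbM_add m n (A B : 'M[C]_(m, n)) : kbM A -> kbM B -> kbM (A + B).
Proof. by move=> hA hB i j; rewrite mxE; apply: KbarD. Qed.
Lemma kbM_scalar n a : Kbar C a -> kbM (a%:M : 'M[C]_n).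
Proof. by move=> ha i j; rewrite mxE; case: eqP => _; rewrite ?mulr1n // mulr0n; exact: Kbar0. Qed.
Lemma kbM_horner n (A : 'M[C]_n.+1) (p : {poly C}) : kbM A -> (forall i, Kbar C p`_i) -> kbM (horner_mx A p).
Proof.
move=> hA; elim/poly_ind: p => [|p c IH] hp.
  by move=> i j; rewrite rmorph0 mxE; exact: Kbar0.
rewrite rmorphD rmorphM /= horner_mx_X horner_mx_C; apply: kbM_add.
  apply: kbM_mul => //; apply: IH => i; have := hp i.+1.
  by rewrite coefD coefMX coefC /= addr0.
by apply: kbM_scalar; have := hp 0%N; rewrite coefD coefMX coefC /= add0r.
Qed.
Lemma Kbar_sign n : Kbar C ((-1) ^+ n).
Proof. by apply: KbarX; apply: KbarN; exact: Kbar1. Qed.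
Lemma kb_det n (A : 'M[C]_n) : kbM A -> Kbar C (\det A).
Proof.
by move=> hA; apply: Kbar_sum => s _; apply: KbarM; [exact: Kbar_sign|apply: Kbar_prod => i _].
Qed.
Lemma kbM_adj n (A : 'M[C]_n) : kbM A -> kbM (\adj A).
Proof.
move=> hA i j; rewrite mxE; apply: KbarM; first exact: Kbar_sign.
by apply: kb_det => k l; rewrite !mxE.
Qed.
Lemma Kbar_horner (p : {poly C}) x : (forall i, Kbar C p`_i) -> Kbar C x -> Kbar C p.[x].
Proof.
by move=> hp hx; rewrite horner_coef; apply: Kbar_sum => i _; apply: KbarM => //; apply: KbarX.
Qed.
Lemma Kbar_coefM (p p' : {poly C}) : (forall i, Kbar C p`_i) -> (forall i, Kbar C p'`_i) ->
  forall i, Kbar C (p * p')`_i.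
Proof. by move=> hp hp' i; rewrite coefM; apply: Kbar_sum => j _; apply: KbarM. Qed.
Lemma Kbar_XsubC x : Kbar C x -> forall i, Kbar C ('X - x%:P)`_i.
Proof.
move=> hx i; rewrite coefB coefX coefC; apply: KbarB.
  by case: eqP => _; [exact: Kbar1|exact: Kbar0].
by case: eqP => _ //; exact: Kbar0.
Qed.
Lemma Kbar_prodX (I : finType) (P : pred I) (f : I -> C) : (forall i, Kbar C (f i)) ->
  forall i, Kbar C (\prod_(k | P k) ('X - (f k)%:P))`_i.
Proof.
move=> hf; elim/big_ind: _ => [i|p p' hp hp'|k _]; [|exact: Kbar_coefM|exact: Kbar_XsubC].
by rewrite coef1; case: eqP => _; [exact: Kbar1|exact: Kbar0].
Qed.

Context (r' : nat).
Local Notation r := r'.+1.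
Context (phi : {poly F} -> {poly C}) (hphi : drinfeld_module r phi).
Local Notation Lat := (period_lattice phi).
Local Notation vrow := (vrow r phi).
Local Notation Bm := (Bm r phi).
Context (lam : C) (lam0 : lam != 0) (c : C) (c_free : A_free (fun j : 'I_r => c ^+ j)).
Context (X : 'M[{poly C}]_r) (X_Kbar : forall i j k, Kbar C (X i j)`_k).
Context (X_lam : forall n, Lat (c ^+ n * lam) /\
  vrow (c ^+ n.+1 * lam) = vrow (c ^+ n * lam) *m pm X).
Context (hA : {poly {poly F}}) (hA_mon : hA \is monic) (hA_size : size hA = r.+1).
Context (rt : 'I_r -> C) (k0 : 'I_r) (rt_inj : injective rt) (rt_k0 : rt k0 = c).
Context (rt_Kbar : forall k, Kbar C (rt k)).
Context (hA_split : map_poly (ofA C) hA = \prod_k ('X - (rt k)%:P)).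
Local Notation mu := (fun j : 'I_r => c ^+ j * lam).
Local Notation Y := (@Ups F R C r phi mu).

Lemma vrow_horner (p : {poly {poly F}}) n :
  vrow (c ^+ n * lam) *m pm (horner_mx X (map_poly fA p)) =
  vrow ((map_poly (ofA C) p).[c] * (c ^+ n * lam)).
Proof.
elim/poly_ind: p n => [|p a IH] n.
  have -> : pm (horner_mx X (map_poly fA 0)) = 0.
    by apply/matrixP => i j; rewrite !rmorph0 !mxE.
  by rewrite mulmx0 rmorph0 horner0 mul0r vrow0.
rewrite [p * 'X]mulrC !rmorphD !rmorphM /= !map_polyX !map_polyC /= horner_mx_X horner_mx_C.
rewrite mulmxDr -mulmxE mulmxA -(X_lam n).2 IH map_scalar_mx /=.
rewrite mul_mx_scalar -[pfps (fA a)]/(pF C a) -(vrowA hphi _ (X_lam n).1) -vrowD; congr vrow.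
by rewrite hornerD hornerM hornerX hornerC /= exprS; ring.
Qed.
Lemma dY : \det Y != 0.
Proof. by apply: (det_Ups_neq0 hphi) => [j|]; [exact: (X_lam j).1|exact: mu_free]. Qed.
Lemma hA_c : (map_poly (ofA C) hA).[c] = 0.
Proof. by rewrite hA_split -rt_k0; apply/eqP; apply: (root_prodX rt). Qed.
(** [hA] annihilates [c], hence all rows [vrow (c ^+ j * lam)], and these are independent by
    [dY]. *)
Lemma hX0 : horner_mx X (map_poly fA hA) = 0.
Proof.
have : Y *m pm (horner_mx X (map_poly fA hA)) = 0.
  apply/row_matrixP => j; rewrite row_mul row0.
  have -> : row j Y = vrow (c ^+ j * lam) by apply/rowP => l; rewrite !mxE.
  by rewrite vrow_horner hA_c mul0r vrow0.
move/(mulmx_det0r dY)/matrixP => E; apply/matrixP => i j.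
by have := E i j; rewrite !mxE -(rmorph0 (@pfps C)) => /(@pfps_inj C).
Qed.

Local Notation Xt := (tm X).
Lemma hXt : horner_mx Xt (map_poly (ofA C) hA) = 0.
Proof.
have := congr1 tm hX0; rewrite map_horner_mx map_mx0 => <-; congr horner_mx.
by rewrite -map_poly_comp; apply: eq_map_poly => a /=; rewrite /horner_eval -ofAE.
Qed.
Lemma vrow_bdd l : bdd ro1 (vrow lam 0 l).
Proof. by rewrite mxE; apply: agf_tw_bdd1. Qed.
Definition vD : 'rV[bser C]_r := \row_l mkb (vrow_bdd l).
Definition V : 'rV[C]_r := map_mx (@bev F R C) vD.
Lemma V_evm : evm (vrow lam) V.
Proof.
move=> i j; rewrite ord1; have := bevP (vD 0 j).
have -> : bs_val (vD 0 j) = vrow lam 0 j by rewrite /vD mxE.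
by rewrite [V 0 j]mxE.
Qed.
Lemma V_evmX n : evm (vrow (c ^+ n * lam)) (V *m Xt ^+ n).
Proof.
elim: n => [|n IH]; first by rewrite expr0 mul1r expr0 mulmx1; exact: V_evm.
by rewrite (X_lam n).2 exprSr -mulmxE mulmxA; apply: evmM => //; apply: evm_poly.
Qed.
Definition Yt : 'M[C]_r := \matrix_(j, l) (V *m Xt ^+ j) 0 l.
Lemma Yt_evm : evm Y Yt.
Proof. by move=> i j; rewrite mxE [Yt _ _]mxE; apply: V_evmX. Qed.
Lemma Yt_det : exists kap cO, [/\ Kbar C kap, kap != 0, evl th (Om C) cO & \det Yt * cO = kap].
Proof.
have [|kap [D [cO [h1 h2 h3 h4 h5]]]] := det_Ups_evl hphi (mu := mu) _ (mu_free lam0 c_free).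
  by move=> j; exact: (X_lam j).1.
exists kap, cO; split=> //; rewrite -h5; congr (_ * _).
exact: evl_unique (evm_det Yt_evm) h3.
Qed.
Lemma Yt_det0 : \det Yt != 0.
Proof.
have [kap [cO [_ k00 _ E]]] := Yt_det; apply: contra_neq k00 => h.
by rewrite -E h mul0r.
Qed.
Lemma Xt_Kbar : kbM Xt.
Proof. by move=> i j; rewrite mxE; apply: Kbar_horner => //; exact: Kbar_theta. Qed.

Lemma V_horner (p : {poly C}) : (size p <= r)%N -> V *m horner_mx Xt p = (\row_(j < r) p`_j) *m Yt.
Proof.
move=> sp; apply/rowP => l.
have := congr1 (fun M : 'cV[C]_r => (V *m M) 0 0) (horner_Qm Xt (delta_mx l 0) sp).
rewrite /= mulmxA -colE [LHS]mxE => ->; rewrite mulmxA !mxE; apply: eq_bigr => j _.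
by rewrite mulQm -colE !mxE mulrC.
Qed.

Definition Lc k : {poly C} := \prod_(l | l != k) ('X - (rt l)%:P).
Lemma Lc_mul k : ('X - (rt k)%:P) * Lc k = map_poly (ofA C) hA.
Proof. by rewrite hA_split (bigD1 k). Qed.
Lemma Lc_size k : size (Lc k) = r.
Proof.
have h : size (map_poly (ofA C) hA) = r.+1 by rewrite size_map_inj_poly ?rmorph0 //; exact: ofA_inj.
have m0 : Lc k != 0 by rewrite monic_neq0 ?monic_prod_XsubC.
by move: h; rewrite -(Lc_mul k) size_proper_mul ?size_XsubC /= => [[]|]; rewrite ?lead_coefXsubC ?mul1r ?lead_coef_eq0.
Qed.
Lemma Lc_root k l : l != k -> (Lc k).[rt l] = 0.
Proof. by move=> lk; rewrite /Lc (bigD1 l) //= hornerM !hornerE subrr mul0r. Qed.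
Lemma Lc_neq0 k : (Lc k).[rt k] != 0.
Proof.
rewrite horner_prod; apply/prodf_neq0 => l lk; rewrite !hornerE subr_eq0.
by apply: contra lk => /eqP/rt_inj ->.
Qed.
Lemma Lc_Kbar k i : Kbar C (Lc k)`_i. Proof. exact: Kbar_prodX. Qed.

Lemma V_Lc k : exists j, (V *m horner_mx Xt (Lc k)) 0 j != 0.
Proof.
apply: contrapT => h; have : V *m horner_mx Xt (Lc k) = 0.
  by apply/rowP => j; rewrite [RHS]mxE; apply: contrapT => /eqP hj; apply: h; exists j.
rewrite V_horner ?Lc_size // => /(mulmx_det0 Yt_det0)/rowP E.
have : lead_coef (Lc k) = 0 by rewrite lead_coefE Lc_size /=; have := E ord_max; rewrite !mxE.
have /monicP -> : Lc k \is monic by exact: monic_prod_XsubC.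
by move/eqP; rewrite oner_eq0.
Qed.

(** A column of the Lagrange product [Lc k] evaluated at [Xt] is an eigenvector for [rt k]; by
    [V_Lc] the column can be chosen so that [V] does not vanish on it. *)
Lemma eigenvectors : exists w : 'I_r -> 'cV[C]_r, [/\ forall k, kbM (w k),
  forall k, Xt *m w k = rt k *: w k & forall k, (V *m w k) 0 0 != 0].
Proof.
have [j hj] := choice V_Lc; exists (fun k => col (j k) (horner_mx Xt (Lc k))); split=> k.
- move=> i l; rewrite mxE; apply: kbM_horner; [exact: Xt_Kbar|exact: Lc_Kbar].
- rewrite colE mulmxA scalemxAl; congr (_ *m _).
  have := hXt; rewrite -(Lc_mul k) rmorphM rmorphB /= horner_mx_X horner_mx_C mulrBl => /eqP.
  by rewrite subr_eq0 => /eqP; rewrite -mulmxE mul_scalar_mx.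
- by rewrite colE mulmxA -colE mxE.
Qed.

Section WithVectors.
Context (w : 'I_r -> 'cV[C]_r) (w_Kbar : forall k, kbM (w k)).
Context (w_eig : forall k, Xt *m w k = rt k *: w k) (w_V : forall k, (V *m w k) 0 0 != 0).
Definition uv : 'cV[C]_r := \sum_k w k.
Lemma uv_Kbar : kbM uv.
Proof. by move=> i j; rewrite summxE; apply: Kbar_sum => k _; apply: w_Kbar. Qed.
Lemma horner_uv p : horner_mx Xt p *m uv = \sum_k p.[rt k] *: w k.
Proof. by rewrite mulmx_sumr; apply: eq_bigr => k _; apply: horner_eigr. Qed.
Lemma Lc_uv k : horner_mx Xt (Lc k) *m uv = (Lc k).[rt k] *: w k.
Proof.
rewrite horner_uv (bigD1 k) //= big1 ?addr0 // => l lk.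
by rewrite Lc_root // scale0r.
Qed.
Local Notation Vd := (Vandermonde r (\row_k rt k)).
Lemma Vd_det : \det Vd != 0.
Proof.
rewrite det_Vandermonde; apply/prodf_neq0 => i _; apply/prodf_neq0 => j ij.
rewrite !mxE subr_eq0; apply: contraTN ij => /eqP/rt_inj ->; by rewrite ltnn.
Qed.
Lemma Vd_Kbar : kbM Vd.
Proof. by move=> i j; rewrite !mxE; apply: KbarX. Qed.
(** Both factors on the left expand in the eigenvectors, and each expansion contributes a
    Vandermonde matrix; the values of [V] on the eigenvectors form the diagonal. *)
Lemma YQ : Yt *m Qm Xt uv = Vd *m diag_mx (\row_k (V *m w k) 0 0) *m Vd^T.
Proof.
apply/matrixP => i j; rewrite mulQm.
have -> : (Yt *m Xt ^+ j *m uv) i 0 = (V *m (horner_mx Xt 'X^(i + j) *m uv)) 0 0.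
  rewrite rmorphXn /= horner_mx_X exprD -mulmxE !mulmxA !mxE; apply: eq_bigr => k _; congr (_ * _).
  by rewrite !mxE; apply: eq_bigr => l _; rewrite mxE.
rewrite horner_uv mulmx_sumr summxE !mxE; apply: eq_bigr => k _.
rewrite -scalemxAr [LHS]mxE mul_mx_diag [X in _ = X * _]mxE ![Vd _ _]mxE ![Vd^T _ _]mxE ![(\row__ _) _ _]mxE ![Vd _ _]mxE ![(\row__ _) _ _]mxE.
rewrite hornerXn exprD; ring.
Qed.
Lemma Qt_det : \det (Qm Xt uv) != 0.
Proof.
have := congr1 determinant YQ; rewrite !det_mulmx det_tr det_diag => E.
have : \det Yt * \det (Qm Xt uv) != 0.
  rewrite E !mulf_neq0 ?Vd_det //; apply/prodf_neq0 => k _; rewrite mxE; exact: w_V.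
by rewrite mulf_eq0 negb_or => /andP [].
Qed.
Lemma Qt_Kbar : kbM (Qm Xt uv).
Proof.
move=> i j; rewrite mxE; apply: kbM_mul; last exact: uv_Kbar.
have -> : Xt ^+ j = horner_mx Xt 'X^j by rewrite rmorphXn /= horner_mx_X.
apply: kbM_horner; first exact: Xt_Kbar.
by move=> k; rewrite coefXn; case: eqP => _; [exact: Kbar1|exact: Kbar0].
Qed.

(** The value at [theta] of the eigenvector function of index [k], up to the algebraic factor [(Lc
    rt k).[rt k]] of [yvE]. *)
Definition yv k : C := (V *m horner_mx Xt (Lc k) *m uv) 0 0.
Lemma yvE k : yv k = (Lc k).[rt k] * (V *m w k) 0 0.
Proof. by rewrite /yv -mulmxA Lc_uv -scalemxAr mxE. Qed.
Lemma yv_neq0 k : yv k != 0. Proof. by rewrite yvE mulf_neq0 ?Lc_neq0. Qed.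
Lemma Lck_Kbar k : Kbar C (Lc k).[rt k]. Proof. by apply: Kbar_horner => //; exact: Lc_Kbar. Qed.

(** Determinants in [YQ] express the norm of the eigenvector values through [\det Yt], which the
    Legendre relation ties to [Om(theta)]. *)
Lemma yv_prod : exists kap cO, [/\ Kbar C kap, kap != 0, evl th (Om C) cO & \prod_k yv k * cO = kap].
Proof.
have [kap [cO [kK kn hO E]]] := Yt_det.
have D0 : \det Vd ^+ 2 != 0 by rewrite expf_neq0 // Vd_det.
exists (\prod_k (Lc k).[rt k] * (kap * \det (Qm Xt uv) / \det Vd ^+ 2)), cO; split=> //.
- apply: KbarM; first by apply: Kbar_prod => k _; exact: Lck_Kbar.
  apply: Kbar_div; last by apply: KbarX; apply: kb_det; exact: Vd_Kbar.
  by apply: KbarM => //; apply: kb_det; exact: Qt_Kbar.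
- rewrite !mulf_neq0 ?invr_eq0 ?Qt_det //; apply/prodf_neq0 => k _; exact: Lc_neq0.
- have := congr1 determinant YQ; rewrite !det_mulmx det_tr det_diag => E1.
  have E2 : kap * \det (Qm Xt uv) = \det Vd ^+ 2 * (\prod_k (V *m w k) 0 0) * cO.
    rewrite -E mulrAC E1 (eq_bigr (fun k => (V *m w k) 0 0)) => [|k _]; last by rewrite mxE.
    ring.
  rewrite (eq_bigr _ (fun k _ => yvE k)) big_split /= E2 -[LHS]mulrA; congr (_ * _).
  by rewrite -[\det Vd ^+ 2 * _ * _]mulrA [RHS]mulrAC divff // mul1r.
Qed.

Lemma V_span l : exists2 z : 'I_r -> C, (forall k, Kbar C (z k)) & V 0 l = \sum_k z k * yv k.
Proof.
pose M := Vd^T *m \adj (Qm Xt uv).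
exists (fun k => M k l / (\det (Qm Xt uv) * (Lc k).[rt k])).
  move=> k; apply: Kbar_div; last by apply: KbarM; [apply/kb_det/Qt_Kbar|exact: Lck_Kbar].
  apply: kbM_mul; last by apply/kbM_adj/Qt_Kbar.
  by move=> i j; rewrite mxE; apply: Vd_Kbar.
apply: (mulfI Qt_det).
have E1 : V *m Qm Xt uv = (\row_k (V *m w k) 0 0) *m Vd^T.
  apply/rowP => j; rewrite mulQm.
  have -> : Xt ^+ j = horner_mx Xt 'X^j by rewrite rmorphXn /= horner_mx_X.
  rewrite -mulmxA horner_uv mulmx_sumr summxE !mxE; apply: eq_bigr => k _.
  by rewrite -scalemxAr [LHS]mxE hornerXn mulrC !mxE.
have : V *m Qm Xt uv *m \adj (Qm Xt uv) = (\row_k (V *m w k) 0 0) *m M by rewrite E1 mulmxA.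
rewrite -mulmxA mul_mx_adj mul_mx_scalar => /rowP /(_ l); rewrite [LHS]mxE => ->.
rewrite mxE mulr_sumr; apply: eq_bigr => k _; rewrite mxE yvE mulrC.
by field; rewrite Qt_det Lc_neq0.
Qed.

Lemma gcol_eig : Xt *m gcol r phi = c *: gcol r phi.
Proof.
apply/eqP; rewrite -subr_eq0; apply/eqP/(mulmx_det0r Yt_det0); apply/colP => j.
have h n : (V *m Xt ^+ n) *m gcol r phi = (- (c ^+ n * lam))%:M.
  exact: (vrow_gcol hphi (X_lam n).1 (V_evmX n)).
have E n : \sum_l (V *m Xt ^+ n) 0 l * gcol r phi l 0 = - (c ^+ n * lam).
  by have := congr1 (fun M : 'M[C]_1 => M 0 0) (h n); rewrite !mxE eqxx mulr1n.
have R1 (M : 'cV[C]_r) : (Yt *m M) j 0 = (V *m Xt ^+ j *m M) 0 0.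
  by rewrite !mxE; apply: eq_bigr => l _; rewrite [Yt _ _]mxE.
rewrite R1 mulmxBr mulmxA -[V *m _ *m Xt]mulmxA mulmxE -exprSr -scalemxAr !h !mxE eqxx !mulr1n.
by rewrite exprS; ring.
Qed.
Lemma gcol_neq0 : gcol r phi != 0.
Proof.
apply/eqP => /matrixP /(_ ord_max 0); rewrite !mxE /=; apply/eqP.
exact: (dcoef_lead hphi).
Qed.
Lemma gcol_Kbar : kbM (gcol r phi).
Proof. by move=> i j; rewrite mxE; apply: (dcoef_Kbar hphi). Qed.

(** [gcol] is an eigenvector for [c = rt k0], hence an algebraic multiple of [w k0], and pairing it
    with [V] gives [- lam] by [vrow_gcol]. *)
Lemma lam_yv : exists ka, [/\ Kbar C ka, ka != 0 & lam = ka * yv k0].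
Proof.
pose Q := Qm Xt uv; pose z := (\det Q)^-1 *: (\adj Q *m gcol r phi).
have zK : kbM z.
  move=> i j; rewrite mxE; apply: KbarM; first by apply/KbarV/kb_det/Qt_Kbar.
  by apply: kbM_mul; [apply/kbM_adj/Qt_Kbar|exact: gcol_Kbar].
pose p := \poly_(j < r) (z (inord j) 0).
have pE : horner_mx Xt p *m uv = gcol r phi.
  rewrite horner_Qm ?size_poly //.
  have -> : \col_j p`_j = z by apply/colP => j; rewrite mxE coef_poly ltn_ord inord_val.
  by rewrite -scalemxAr mulmxA mul_mx_adj mul_scalar_mx scalerA mulVf ?Qt_det // scale1r.
have gE : gcol r phi = p.[c] *: w k0.
  have Lc0 : (Lc k0).[c] != 0 by rewrite -rt_k0 Lc_neq0.
  apply: (scalerI Lc0); rewrite -(horner_eigr _ gcol_eig) -{1}pE mulmxA mulmxE -rmorphM mulrC.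
  by rewrite rmorphM -mulmxE -mulmxA Lc_uv -scalemxAr (horner_eigr _ (w_eig k0)) rt_k0.
have V1 := vrow_gcol hphi (mu := lam) (V := V).
have /V1 : Lat lam by have := (X_lam 0).1; rewrite expr0 mul1r.
move=> /(_ V_evm) /(congr1 (fun M : 'M[C]_1 => M 0 0)); rewrite gE -scalemxAr !mxE eqxx mulr1n.
have -> : \sum_j V 0 j * w k0 j 0 = yv k0 / (Lc k0).[rt k0].
  by rewrite yvE [X in X / _]mulrC mulfK ?Lc_neq0 // mxE.
move=> E; have lE : lam = (- p.[c] / (Lc k0).[rt k0]) * yv k0.
  by apply: oppr_inj; rewrite -E; ring.
exists (- p.[c] / (Lc k0).[rt k0]); split=> //.
- apply: Kbar_div; last exact: Lck_Kbar.
  apply: KbarN; apply: Kbar_horner; last by rewrite -rt_k0.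
  by move=> i; rewrite coef_poly; case: ltnP => _; [exact: zK|exact: Kbar0].
- by apply: contraNneq lam0 => h; rewrite lE h mul0r.
Qed.
End WithVectors.
End ModuleValues.

(** * Frobenius eigenvectors as functions *)

Section Evaluation.
Context (F : finFieldType) (R : realType) (C : Cinfty F R) (g : C).
Local Notation K := (ratfun F).
Local Notation th := (theta C).
Local Notation fA := (map_poly (ofF C)).
Local Notation kp := (map_poly (ofK C)).
Local Notation Dx := {poly (bser C)}.

Definition EVA : {poly {poly F}} -> C := horner_eval g \o map_poly (ofA C).
HB.instance Definition _ := GRing.RMorphism.copy EVA (horner_eval g \o map_poly (ofA C)).
Definition EVD : Dx -> C := horner_eval g \o map_poly (@bev F R C).
HB.instance Definition _ := GRing.RMorphism.copy EVD (horner_eval g \o map_poly (@bev F R C)).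
Definition jP : {poly C} -> Dx := @polyC (bser C) \o @pbs F R C.
HB.instance Definition _ := GRing.RMorphism.copy jP (@polyC (bser C) \o @pbs F R C).
Definition jA : {poly {poly F}} -> Dx := map_poly (@pbs F R C \o fA).
HB.instance Definition _ := GRing.RMorphism.copy jA (map_poly (@pbs F R C \o fA)).
Definition btX : Dx -> Dx := map_poly (@btw F R C).
HB.instance Definition _ := GRing.RMorphism.copy btX (map_poly (@btw F R C)).

Lemma EVD_jA p : EVD (jA p) = EVA p.
Proof.
rewrite /EVD /EVA /jA /= -map_poly_comp; congr (_.[_]); apply: eq_map_poly => a /=.
by rewrite bev_pbs ofAE.
Qed.
Lemma EVD_jP p : EVD (jP p) = p.[th].
Proof. by rewrite /EVD /jP /= /horner_eval map_polyC hornerC /= bev_pbs. Qed.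
Lemma EVD_C a : EVD a%:P = bev a.
Proof. by rewrite /EVD /= /horner_eval map_polyC hornerC. Qed.
Lemma btX_jA p : btX (jA p) = jA p.
Proof.
rewrite /btX /jA -map_poly_comp; apply: eq_map_poly => a /=.
by rewrite btw_pbs ptw_ofF.
Qed.
Lemma btX_jP p : btX (jP p) = jP (map_poly (@frn F R C 1) p).
Proof. by rewrite /btX /jP /= map_polyC /= btw_pbs. Qed.
Lemma EVA_C a : EVA a%:P = ofA C a.
Proof. by rewrite /EVA /= /horner_eval map_polyC hornerC. Qed.

Context (h0 : {poly {poly F}}) (h0g : EVA h0 = 0).
Context (h0_irr : irreducible_poly (map_poly (@tofrac {poly F}) h0)).

Lemma kp_tofrac p : kp (map_poly (@tofrac {poly F}) p) = map_poly (ofA C) p.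
Proof. by rewrite -map_poly_comp; apply: eq_map_poly. Qed.
Lemma h0_root : root (kp (map_poly (@tofrac {poly F}) h0)) g.
Proof. by rewrite kp_tofrac; apply/eqP. Qed.
Lemma h0_neq0 : h0 != 0.
Proof. by apply: contraTneq (irredp_neq0 h0_irr) => ->; rewrite rmorph0 eqxx. Qed.

(** Irreducibility of [h0] over the fraction field turns vanishing at [g] into divisibility there;
    [s] clears the denominators of the quotient. *)
Lemma EVA_dvd p : EVA p = 0 -> exists2 s : {poly F}, s != 0 & exists w, s%:P * p = h0 * w.
Proof.
move=> hp; have : map_poly (@tofrac {poly F}) h0 %| map_poly (@tofrac {poly F}) p.
  have : ~~ coprimep (map_poly (@tofrac {poly F}) h0) (map_poly (@tofrac {poly F}) p).
    rewrite -(coprimep_map (ofK C)); apply/negP => /coprimep_root /(_ h0_root).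
    by rewrite kp_tofrac -[_.[_]]/(EVA p) hp eqxx.
  by rewrite irreducible_poly_coprime // negbK.
case/dvdpP => W E; have [a a0 [W0 hW]] := clear_denom W; exists a => //; exists W0.
apply: (map_inj_poly (@tofrac_inj {poly F}) (rmorph0 _)).
by rewrite !rmorphM /= map_polyC /= E mulrA mul_polyC hW mulrC.
Qed.

(** Congruence modulo [h0] up to a nonzero factor from [F[t]]. It is weak enough to be checked with
    polynomial coefficients, and strong enough both for evaluation at [g] and for divisibility over
    the fraction field. *)
Definition cong0 (x : Dx) := exists2 s : {poly F}, s != 0 & exists y, jA s%:P * x = jA h0 * y.
Lemma cong0D x y : cong0 x -> cong0 y -> cong0 (x + y).
Proof.
move=> [s s0 [x' hx]] [s' s'0 [y' hy]]; exists (s * s'); first exact: mulf_neq0.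
exists (jA s'%:P * x' + jA s%:P * y').
by rewrite polyCM rmorphM mulrDr mulrDr [jA h0 * (_ * x')]mulrCA -hx [jA h0 * (_ * y')]mulrCA -hy; ring.
Qed.
Lemma cong0M x y : cong0 y -> cong0 (x * y).
Proof. by move=> [s s0 [y' hy]]; exists s => //; exists (x * y'); rewrite mulrCA hy mulrCA. Qed.
Lemma cong0_0 : cong0 0.
Proof. by exists 1; [exact: oner_neq0|exists 0; rewrite !mulr0]. Qed.
Lemma cong0_sum (I : Type) (t : seq I) (P : pred I) (f : I -> Dx) :
  (forall i, P i -> cong0 (f i)) -> cong0 (\sum_(i <- t | P i) f i).
Proof. by move=> h; elim/big_ind: _ => //; [exact: cong0_0|exact: cong0D]. Qed.
Lemma cong0_EVD x : cong0 x -> EVD x = 0.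
Proof.
move=> [s s0 [y /(congr1 EVD)]]; rewrite !rmorphM /= !EVD_jA h0g mul0r => /eqP.
rewrite mulf_eq0 EVA_C -(rmorph0 (ofA C)) (inj_eq (@ofA_inj _ _ C)) (negPf s0) /=.
by rewrite rmorph0 => /eqP.
Qed.
Lemma cong0_dvd x : cong0 x -> map_poly (@tofrac (bser C) \o @pbs F R C \o fA) h0 %| map_poly (@tofrac (bser C)) x.
Proof.
move=> [s s0 [y /(congr1 (map_poly (@tofrac (bser C))))]]; rewrite !rmorphM /=.
rewrite /jA map_polyC map_polyC /= -map_poly_comp => E.
have : map_poly (@tofrac (bser C) \o @pbs F R C \o fA) h0 %| (tofrac (pbs (fA s)))%:P * map_poly (@tofrac (bser C)) x.
  by rewrite E dvdp_mulr.
rewrite mul_polyC dvdpZr // tofrac_eq0 -(rmorph0 (@pbs F R C)) (inj_eq (@pbs_inj F R C)).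
by rewrite map_poly_eq0.
Qed.

Lemma cong0_poly (L : {poly {poly {poly F}}}) n (X : 'M[Dx]_n.+1) :
  (forall i, EVA L`_i = 0) -> forall i j, cong0 (horner_mx X (map_poly jA L) i j).
Proof.
elim/poly_ind: L => [|L a IH] hL i j.
  by rewrite !rmorph0 mxE; exact: cong0_0.
rewrite !rmorphD !rmorphM /= map_polyX map_polyC /= horner_mx_X horner_mx_C mxE.
apply: cong0D.
  rewrite mxE; apply: cong0_sum => k _; rewrite mulrC; apply: cong0M; apply: IH => l.
  by have := hL l.+1; rewrite coefD coefMX coefC /= addr0.
have : cong0 (jA a).
  have [|s s0 [w hw]] := @EVA_dvd a; first by have := hL 0%N; rewrite coefD coefMX coefC /= add0r.
  by exists s => //; exists (jA w); rewrite -!rmorphM hw.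
by rewrite mxE => ha; case: eqP => _; rewrite ?mulr1n // mulr0n; exact: cong0_0.
Qed.
End Evaluation.

Section Substitution.
Lemma map_subst (A B : comNzRingType) (f : {rmorphism A -> B}) (p : {poly A}) (x : {poly A}) :
  (map_poly polyC (map_poly f p)).[map_poly f x] = map_poly f (map_poly polyC p).[x].
Proof.
rewrite -horner_map -!map_poly_comp; congr (_.[_]); apply: eq_map_poly => a /=.
by rewrite map_polyC.
Qed.
Lemma bezout_subst (E : fieldType) (a b p h x H : {poly E}) : a * p + b * h = 1 ->
  H %| (map_poly polyC h).[x] -> coprimep (map_poly polyC p).[x] H.
Proof.
move=> /(congr1 (fun p => (map_poly (@polyC E) p).[x])).
rewrite rmorphD !rmorphM rmorph1 hornerD !hornerM hornerC => E1 /dvdpP [z hz].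
rewrite hz mulrA in E1; apply/Bezout_eq1_coprimepP.
by exists ((map_poly (@polyC E) a).[x], (map_poly (@polyC E) b).[x] * z).
Qed.
Lemma dvdp_clear (A : comNzRingType) (E : fieldType) (f : {rmorphism A -> E}) (s : A) (p h w : {poly A}) :
  f s != 0 -> s%:P * p = h * w -> map_poly f h %| map_poly f p.
Proof.
move=> s0 /(congr1 (map_poly f)); rewrite !rmorphM /= map_polyC /= => E1.
have : map_poly f h %| (f s)%:P * map_poly f p by rewrite E1 dvdp_mulr.
by rewrite mul_polyC dvdpZr.
Qed.
End Substitution.

(** * Eigenfunctions modulo the minimal polynomial of a primitive element *)

Section ModuleFunctions.
Context (F : finFieldType) (R : realType) (C : Cinfty F R) (g : C).
Local Notation q := #|F|.
Local Notation K := (ratfun F).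
Local Notation th := (theta C).
Local Notation ptw k := (map_poly (@frn F R C k)).
Local Notation pm := (map_mx (@pfps C)).
Local Notation fA := (map_poly (ofF C)).
Local Notation tm := (map_mx (horner_eval th)).
Local Notation Dx := {poly (bser C)}.
Local Notation jP := (@jP F R C).
Local Notation jA := (@jA F R C).
Local Notation EVA := (EVA g).
Local Notation EVD := (EVD g).
Local Notation btX := (@btX F R C).
Context (h0 : {poly {poly F}}) (h0g : EVA h0 = 0).
Context (h0_irr : irreducible_poly (map_poly (@tofrac {poly F}) h0)).
Local Notation cong0 := (@cong0 F R C h0).
Context (r' : nat).
Local Notation r := r'.+1.
Context (phi : {poly F} -> {poly C}) (hphi : drinfeld_module r phi).
Local Notation Lat := (period_lattice phi).
Local Notation Bm := (Bm r phi).
Context (lam : C) (hlam : Lat lam).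
Context (X : 'M[{poly C}]_r) (XB : Bm *m map_mx (ptw 1) X = X *m Bm).
Context (hA : {poly {poly F}}) (hA_mon : hA \is monic) (hA_size : size hA = r.+1).
Context (hX : horner_mx X (map_poly fA hA) = 0).
Context (rt : 'I_r -> C) (rt_inj : injective rt).
Context (hA_split : map_poly (ofA C) hA = \prod_k ('X - (rt k)%:P)).
Context (u : 'cV[C]_r) (Qdet : \det (Qm (tm X) u) != 0).
Context (ro : 'I_r -> {poly {poly F}}) (ro_rt : forall k, EVA (ro k) = rt k).
Local Notation vD := (vD r' phi lam).

Definition uP : 'cV[{poly C}]_r := map_mx (@polyC C) u.
Definition uP1 : 'cV[{poly C}]_r := map_mx (ptw 1) uP.
Definition QP := Qm X uP.
Definition dP := \det QP.
Lemma map_Qm (A B : idomainType) (f : {rmorphism A -> B}) n (Y : 'M[A]_n.+1) (w : 'cV[A]_n.+1) :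
  map_mx f (Qm Y w) = Qm (map_mx f Y) (map_mx f w).
Proof.
apply/matrixP => i j; have E : map_mx f (Y ^+ j *m w) = map_mx f Y ^+ j *m map_mx f w.
  by rewrite map_mxM rmorphXn.
by rewrite [LHS]mxE [Qm Y w i j]mxE [RHS]mxE -E [RHS]mxE.
Qed.
Lemma tm_uP : tm uP = u.
Proof. by apply/matrixP => i j; rewrite !mxE /horner_eval hornerC. Qed.
Lemma dP_th : dP.[th] != 0.
Proof.
rewrite -[dP.[th]]/(horner_eval th dP) /dP -det_map_mx /= /QP (map_Qm (horner_eval th)).
by rewrite tm_uP.
Qed.
Lemma dP_neq0 : dP != 0.
Proof. by apply: contraNneq dP_th => ->; rewrite horner0. Qed.

Definition XD := map_mx jP X.
Definition uD := map_mx jP uP.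
Definition vDD := map_mx (@polyC (bser C)) vD.
Definition LA k : {poly {poly {poly F}}} := \prod_(l | l != k) ('X - (ro l)%:P).
Definition LD k := map_poly jA (LA k).
Definition MD : 'M[Dx]_r := \matrix_(l, k) (horner_mx XD (LD k) *m uD) l 0.
(** The function behind [yv k]: the conjugates [rt l] are replaced by the polynomials [ro l] in the
    variable [x], so that [EVD_eD] gives back the value at [t = theta], [x = g]. *)
Definition eD k : Dx := (vDD *m horner_mx XD (LD k) *m uD) 0 0.
Lemma eDE k : eD k = \sum_l (vD 0 l)%:P * MD l k.
Proof.
rewrite /eD -mulmxA mxE; apply: eq_bigr => l _.
by rewrite [MD l k]mxE [vDD 0 l]mxE.
Qed.

Lemma map_LA k : map_poly EVA (LA k) = Lc rt k.
Proof.
rewrite /LA /Lc rmorph_prod; apply: eq_bigr => l _.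
by rewrite /= map_polyXsubC /= ro_rt.
Qed.
Lemma map_LD k : map_poly EVD (LD k) = Lc rt k.
Proof.
rewrite /LD -map_poly_comp -map_LA; apply: eq_map_poly => a; exact: EVD_jA.
Qed.
Lemma EVD_XD : map_mx EVD XD = tm X.
Proof. by apply/matrixP => i j; rewrite !mxE EVD_jP. Qed.
Lemma EVD_uD : map_mx EVD uD = u.
Proof. by apply/matrixP => i j; rewrite !mxE EVD_jP hornerC. Qed.
Lemma EVD_vDD : map_mx EVD vDD = V r' phi lam.
Proof. by apply/rowP => j; rewrite [LHS]mxE [vDD 0 j]mxE EVD_C [RHS]mxE. Qed.
Lemma EVD_MD l k : EVD (MD l k) = (horner_mx (tm X) (Lc rt k) *m u) l 0.
Proof.
rewrite [MD l k]mxE -EVD_uD -EVD_XD -map_LD -map_horner_mx -map_mxM.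
by rewrite [in RHS]mxE.
Qed.
Lemma EVD_eD k : EVD (eD k) = (V r' phi lam *m horner_mx (tm X) (Lc rt k) *m u) 0 0.
Proof.
rewrite /eD -EVD_uD -EVD_XD -map_LD -map_horner_mx -EVD_vDD -!map_mxM.
by rewrite [in RHS]mxE.
Qed.

Lemma psi_exists : exists2 s0 : {poly F}, s0 != 0 & exists psi : 'I_r -> {poly {poly F}},
  forall k, EVA (psi k) * (Lc rt k).[rt k] = ofA C s0.
Proof.
have H k : exists ap : {poly F} * {poly {poly F}}, ap.1 != 0 /\ EVA ap.2 * (Lc rt k).[rt k] = ofA C ap.1.
  have E1 : EVA (LA k).[ro k] = (Lc rt k).[rt k] by rewrite -map_LA -ro_rt horner_map.
  have [|w E _] := @irr_bezout F R C _ (map_poly (@tofrac {poly F}) (LA k).[ro k]) _ h0_irr (h0_root h0g).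
    by rewrite kp_tofrac -[_.[g]]/(EVA _) E1 Lc_neq0.
  have [a a0 [psi hpsi]] := clear_denom w; exists (a, psi); split=> //=.
  rewrite kp_tofrac -[(map_poly (ofA C) _).[g]]/(EVA (LA k).[ro k]) E1 in E.
  have -> : EVA psi = ofA C a * (map_poly (ofK C) w).[g].
    by rewrite /EVA /= /horner_eval -kp_tofrac -hpsi map_polyZ hornerZ.
  by rewrite -mulrA E mulr1.
have [ap hap] := choice H; exists (\prod_k (ap k).1); first by apply/prodf_neq0 => k _; exact: (hap k).1.
exists (fun k => (\prod_(l | l != k) (ap l).1)%:P * (ap k).2) => k.
by rewrite rmorphM /= EVA_C -mulrA (hap k).2 -rmorphM /= [in RHS](bigD1 k) //= mulrC.
Qed.

(** Lagrange interpolation of [X ^ j] at the conjugates: after evaluation at [g] both sides have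
    degree below [r] and agree at [r] distinct points. *)
Lemma lagrange (s0 : {poly F}) (psi : 'I_r -> {poly {poly F}}) (j : 'I_r) :
  (forall k, EVA (psi k) * (Lc rt k).[rt k] = ofA C s0) -> forall i,
  EVA (\sum_k (psi k * ro k ^+ j)%:P * LA k - s0%:P%:P * 'X^j)`_i = 0.
Proof.
move=> hpsi i; rewrite -(coef_map EVA); set L := map_poly _ _.
have LE : L = \sum_k (EVA (psi k) * rt k ^+ j) *: Lc rt k - ofA C s0 *: 'X^j.
  rewrite /L rmorphB rmorph_sum rmorphM /= map_polyXn map_polyC /= EVA_C mul_polyC; congr (_ - _).
  apply: eq_bigr => k _.
  by rewrite rmorphM /= map_polyC /= map_LA mul_polyC rmorphM rmorphXn /= ro_rt.
suff -> : L = 0 by rewrite coef0.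
apply: (@roots_geq_poly_eq0 _ L [seq rt k | k <- enum 'I_r]).
- apply/allP => _ /mapP [k _ ->]; rewrite rootE LE hornerD hornerN horner_sum hornerZ hornerXn.
  rewrite (bigD1 k) //= big1 => [|l lk]; last by rewrite hornerZ Lc_root ?mulr0 // eq_sym.
  by rewrite hornerZ addr0 mulrAC hpsi subrr.
- by rewrite map_inj_uniq // enum_uniq.
- rewrite size_map size_enum_ord LE; apply: (leq_trans (size_polyD _ _)); rewrite size_polyN geq_max.
  apply/andP; split.
    apply: (leq_trans (size_sum _ _ _)); apply/bigmax_leqP => k _.
    by apply: (leq_trans (size_scale_leq _ _)); rewrite (Lc_size hA_size hA_split).
  by apply: (leq_trans (size_scale_leq _ _)); rewrite size_polyXn.
Qed.

Lemma cong0_mulr (M : 'M[Dx]_r) (w : 'cV[Dx]_r) l : (forall i j, cong0 (M i j)) -> cong0 ((M *m w) l 0).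
Proof. by move=> hM; rewrite mxE; apply: cong0_sum => k _; rewrite mulrC; apply: cong0M. Qed.

(** Interpolation recovers the columns of the Krylov matrix [QP] from the eigenfunction columns, and
    the adjugate of [QP] recovers the standard basis at the cost of [dP]. *)
Lemma MD_inverse_psi (s0 : {poly F}) (psi : 'I_r -> {poly {poly F}}) :
  (forall k, EVA (psi k) * (Lc rt k).[rt k] = ofA C s0) -> forall l l',
  cong0 ((MD *m \matrix_(k, l) \sum_(j < r) jA (psi k * ro k ^+ j) * jP (\adj QP j l)) l l'
    - (jA s0%:P * jP dP) *+ (l == l')).
Proof.
move=> hpsi l l'.
have H (j : 'I_r) : cong0 (\sum_k jA (psi k * ro k ^+ j) * MD l k - jA s0%:P * jP (QP l j)).
  have := cong0_mulr uD l (cong0_poly h0g h0_irr XD (lagrange j hpsi)).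
  congr cong0; rewrite rmorphB rmorph_sum rmorphM /= map_polyXn map_polyC /= rmorphB rmorph_sum.
  rewrite rmorphM /= rmorphXn /= horner_mx_X horner_mx_C -mulmxE mul_scalar_mx mulmxBl mulmx_suml.
  rewrite mxE summxE; congr (_ + _).
    apply: eq_bigr => k _; rewrite rmorphM /= map_polyC /= rmorphM /= horner_mx_C -mulmxE.
    by rewrite mul_scalar_mx -scalemxAl mxE [MD l k]mxE.
  rewrite mxE -scalemxAl mxE; congr (- (_ * _)).
  have -> : XD ^+ j *m uD = map_mx jP (X ^+ j *m uP) by rewrite map_mxM rmorphXn.
  by rewrite mxE /QP [Qm _ _ _ _]mxE.
have -> : (MD *m \matrix_(k, l) \sum_(j < r) jA (psi k * ro k ^+ j) * jP (\adj QP j l)) l l'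
    - (jA s0%:P * jP dP) *+ (l == l') =
    \sum_(j < r) jP (\adj QP j l') * (\sum_k jA (psi k * ro k ^+ j) * MD l k - jA s0%:P * jP (QP l j)).
  under [RHS]eq_bigr => j _ do rewrite mulrBr.
  rewrite sumrB; congr (_ - _).
    rewrite mxE; under eq_bigr => k _ do rewrite [X in _ * X]mxE mulr_sumr.
    rewrite exchange_big /=; apply: eq_bigr => j _; rewrite mulr_sumr; apply: eq_bigr => k _.
    by rewrite [LHS]mulrA [LHS]mulrC [MD l k * _]mulrC.
  have := congr1 (fun M : 'M[{poly C}]_r => jP (M l l')) (mul_mx_adj QP).
  rewrite /= !mxE rmorph_sum rmorphMn /= -/dP -mulrnAr => <-; rewrite mulr_sumr; apply: eq_bigr => j _.
  by rewrite rmorphM /=; ring.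
by apply: cong0_sum => j _; apply: cong0M.
Qed.

Lemma MD_inverse_poly : exists2 s0 : {poly F}, s0 != 0 & exists ND : 'M[{poly {poly C}}]_r,
  forall l l', cong0 ((MD *m map_mx (map_poly (@pbs F R C)) ND) l l'
    - map_poly (@pbs F R C) (map_poly fA s0%:P * dP%:P) *+ (l == l')).
Proof.
have [s0 s00 [psi hpsi]] := psi_exists; exists s0 => //.
exists (\matrix_(k, l) \sum_(j < r) map_poly fA (psi k * ro k ^+ j) * (\adj QP j l)%:P) => l l'.
have jAE a : map_poly (@pbs F R C) (map_poly fA a) = jA a by rewrite -map_poly_comp.
have jPE p : map_poly (@pbs F R C) p%:P = jP p by rewrite map_polyC.
have := MD_inverse_psi hpsi l l'; rewrite [map_poly _ (_ * _)]rmorphM /= jAE jPE.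
congr cong0; congr ((_ *m _) l l' - _); apply/matrixP => a b; rewrite !mxE rmorph_sum.
by apply: eq_bigr => j _; rewrite [RHS]rmorphM /= jAE jPE.
Qed.

(* [b] describes Frobenius on the cyclic vector: [d B u^(1) = b(X) u]. *)
Definition bt : {poly {poly C}} := \poly_(j < r) ((\adj QP *m (Bm *m uP1)) (inord j) 0).
Lemma bt_u : horner_mx X bt *m uP = dP *: (Bm *m uP1).
Proof.
rewrite horner_Qm ?size_poly // -[Qm X uP]/QP.
have -> : \col_j bt`_j = \adj QP *m (Bm *m uP1).
  by apply/colP => j; rewrite mxE coef_poly ltn_ord inord_val.
by rewrite mulmxA mul_mx_adj mul_scalar_mx.
Qed.
Definition btD k : Dx := (map_poly jP bt).[jA (ro k)].

Lemma vDE l : bs_val (vD 0 l) = vrow r phi lam 0 l.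
Proof. by rewrite /vD [(\row_l _) 0 l]mxE. Qed.
Lemma vD_tw : map_mx (@btw F R C) vD = vD *m map_mx (@pbs F R C) Bm.
Proof.
apply/rowP => l; apply: bs_inj; rewrite [in LHS]mxE /= vDE.
have /matrixP /(_ 0 l) H := vrow_B hphi hlam; rewrite [LHS]mxE [RHS]mxE in H.
rewrite H [in RHS]mxE rmorph_sum; apply: eq_bigr => k _.
by rewrite rmorphM /= vDE [(map_mx (@pbs F R C) Bm) k l]mxE [(pm Bm) k l]mxE.
Qed.

(** Commutation with [Bm] moves the twist onto the cyclic vector, where it acts as [bt] of the
    matrix. In the product with [LD k] the argument of [bt] may be replaced by [ro k], since [LD k]
    times [X - ro k] is congruent to [hA], which annihilates the matrix. *)
Lemma tau_e k : cong0 (jP dP * btX (eD k) - btD k * eD k).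
Proof.
pose XD1 := map_mx jP (map_mx (ptw 1) X); pose BD := map_mx jP Bm; pose uD1 := map_mx jP uP1.
have E1 : btX (eD k) = (vDD *m horner_mx XD (LD k) *m (BD *m uD1)) 0 0.
  have -> : btX (eD k) = (map_mx btX (vDD *m horner_mx XD (LD k) *m uD)) 0 0 by rewrite [RHS]mxE.
  rewrite !map_mxM map_horner_mx.
  have -> : map_mx btX XD = XD1 by apply/matrixP => i j; rewrite !mxE btX_jP.
  have -> : map_mx btX uD = uD1 by apply/matrixP => i j; rewrite !mxE btX_jP.
  have -> : map_poly btX (LD k) = LD k.
    by rewrite /LD -map_poly_comp; apply: eq_map_poly => a; apply: btX_jA.
  have -> : map_mx btX vDD = vDD *m BD.
    have /rowP E := vD_tw; apply/rowP => l; rewrite mxE [vDD 0 l]mxE /btX map_polyC /=.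
    have := E l; rewrite [LHS]mxE => ->; rewrite [in LHS]mxE [RHS]mxE rmorph_sum; apply: eq_bigr => i _.
    by rewrite [vDD 0 i]mxE [BD i l]mxE [(map_mx (@pbs F R C) Bm) i l]mxE rmorphM.
  have hB : BD *m XD1 = XD *m BD by rewrite -[LHS]map_mxM -[RHS]map_mxM XB.
  by rewrite -[_ *m BD *m _]mulmxA (horner_intertwine _ hB) !mulmxA.
have E2 : jP dP *: (BD *m uD1) = horner_mx XD (map_poly jP bt) *m uD.
  by have := congr1 (map_mx jP) bt_u; rewrite map_mxM map_horner_mx map_mxZ map_mxM; exact: esym.
have -> : jP dP * btX (eD k) = (vDD *m horner_mx XD (LD k * map_poly jP bt) *m uD) 0 0.
  rewrite E1 rmorphM /= -mulmxE -!mulmxA -E2 -!scalemxAr; by rewrite [RHS]mxE.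
have /factor_theorem [w hw] : root (map_poly jP bt - (btD k)%:P) (jA (ro k)).
  by rewrite rootE hornerD hornerN hornerC subrr.
have -> : map_poly jP bt = (btD k)%:P + w * ('X - (jA (ro k))%:P) by rewrite -hw addrC subrK.
have addE (A B : 'M[Dx]_1) : (A + B) 0 0 = A 0 0 + B 0 0 by rewrite mxE.
rewrite mulrDr rmorphD /= mulmxDr mulmxDl addE.
have -> : (vDD *m horner_mx XD (LD k * (btD k)%:P) *m uD) 0 0 = btD k * eD k.
  by rewrite rmorphM /= horner_mx_C -mulmxE mul_mx_scalar -scalemxAr -scalemxAl mxE.
rewrite addrAC subrr add0r -mulmxA mxE; apply: cong0_sum => l _; apply: cong0M.
apply: cong0_mulr => {l} i j.
have -> : LD k * (w * ('X - (jA (ro k))%:P)) = w * map_poly jA (\prod_l ('X - (ro l)%:P)).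
  rewrite (bigD1 k) //= rmorphM /= map_polyXsubC -/(LA k) -/(LD k); ring.
rewrite rmorphM /= -mulmxE mxE; apply: cong0_sum => l _; apply: cong0M.
have -> : map_poly jA (\prod_l ('X - (ro l)%:P)) =
    map_poly jA (\prod_l ('X - (ro l)%:P) - map_poly polyC hA) + map_poly jA (map_poly polyC hA).
  by rewrite -rmorphD subrK.
rewrite rmorphD /=.
have -> : horner_mx XD (map_poly jA (map_poly polyC hA)) = 0.
  have -> : map_poly jA (map_poly polyC hA) = map_poly jP (map_poly fA hA).
    rewrite -!map_poly_comp; apply: eq_map_poly => a /=.
    by rewrite /jA /jP /= map_polyC.
  by rewrite -map_horner_mx hX; apply/matrixP => a b; rewrite !mxE rmorph0.
rewrite addr0; apply: (cong0_poly h0g h0_irr) => n.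
rewrite -(coef_map EVA) rmorphB rmorph_prod /= -map_poly_comp.
have -> : \prod_l map_poly EVA ('X - (ro l)%:P) = map_poly (ofA C) hA.
  by rewrite hA_split; apply: eq_bigr => m _; rewrite map_polyXsubC /= ro_rt.
rewrite (eq_map_poly (g := ofA C)); last by move=> a; rewrite /= EVA_C.
by rewrite subrr coef0.
Qed.

Local Notation Phi := {fraction {poly C}}.
Definition btF k : {poly Phi} :=
  (map_poly polyC (map_poly (@tofrac {poly C}) bt)).[map_poly (@tofrac {poly C} \o fA) (ro k)].
Local Notation HF := (map_poly (kaf C) (map_poly (@tofrac {poly F}) h0)).
Lemma HFE (p : {poly {poly F}}) : map_poly (kaf C) (map_poly (@tofrac {poly F}) p) =
  map_poly (@tofrac {poly C} \o fA) p.
Proof. by rewrite -map_poly_comp; apply: eq_map_poly => a /=; rewrite kaf_tofrac. Qed.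

(** If [p] is the cofactor in [hA] of the common divisor, then [p] times [bt] annihilates the cyclic
    vector. Hence [p] annihilates the twisted cyclic vector, which is cyclic too, so a nonzero [p]
    cannot have degree below [r]. *)
Lemma bt_cop : coprimep (map_poly (@tofrac {poly C}) bt) (map_poly (@tofrac {poly C} \o fA) hA).
Proof.
pose tf := @tofrac {poly C}; pose bF := map_poly tf bt; pose hF := map_poly (tf \o fA) hA.
have hFE : hF = map_poly tf (map_poly fA hA) by rewrite /hF -map_poly_comp.
have shF : size hF = r.+1.
  by rewrite size_map_inj_poly ?rmorph0 //; exact: ofFf_inj.
have hF0 : hF != 0 by rewrite -size_poly_eq0 shF.
pose G := gcdp bF hF; pose p := hF %/ G.
have pG : p * G = hF by rewrite divpK // dvdp_gcdr.
have p0 : p != 0 by apply: contraNneq hF0 => h; rewrite -pG h mul0r.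
have G0 : G != 0 by apply: contraNneq hF0 => h; rewrite -pG h mulr0.
suff sp : (r < size p)%N.
  rewrite coprimep_def -/G eqn_leq; apply/andP; split; last by rewrite lt0n size_poly_eq0.
  have E := size_mul p0 G0; rewrite pG shF in E.
  case sG : (size G) E => [|[|n]] //; rewrite !addnS /= => [[E]].
  by move: sp; rewrite E ltnNge leq_addr.
rewrite ltnNge; apply: contraNN p0 => sp.
have : horner_mx (map_mx tf X) (p * bF) = 0.
  have -> : p * bF = (bF %/ G) * hF.
    by rewrite -{1}(divpK (dvdp_gcdl bF hF)) -/G mulrCA pG.
  by rewrite rmorphM /= hFE -map_horner_mx hX map_mx0 mulr0.
move/(congr1 (fun M => M *m map_mx tf uP)); rewrite mul0mx rmorphM /= -mulmxE -mulmxA.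
rewrite -map_horner_mx -map_mxM bt_u map_mxZ -scalemxAr map_mxM mulmxA => /eqP.
rewrite scaler_eq0 tofrac_eq0 (negPf dP_neq0) /= => /eqP.
have hB : map_mx tf Bm *m map_mx tf (map_mx (ptw 1) X) = map_mx tf X *m map_mx tf Bm.
  by rewrite -[LHS]map_mxM -[RHS]map_mxM XB.
rewrite -(horner_intertwine _ hB) -mulmxA => /mulmx_det0r.
rewrite det_map_mx tofrac_eq0 => /(_ (det_Bm_neq0 hphi)).
rewrite horner_Qm // => /mulmx_det0r.
have -> : \det (Qm (map_mx tf (map_mx (ptw 1) X)) (map_mx tf uP1)) = tf (ptw 1 dP).
  by rewrite -(map_Qm tf) det_map_mx /uP1 -(map_Qm (ptw 1)) det_map_mx.
rewrite tofrac_eq0 map_poly_eq0 => /(_ dP_neq0)/colP E.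
apply/eqP/polyP => i; rewrite coef0; have [ir|ri] := ltnP i r; last by rewrite nth_default // (leq_trans sp).
by have := E (Ordinal ir); rewrite !mxE.
Qed.

Lemma btF_cop k : coprimep (btF k) HF.
Proof.
have /Bezout_eq1_coprimepP [[a b] /= E] := bt_cop.
apply: (bezout_subst (h := map_poly (@tofrac {poly C} \o fA) hA) E).
have [|s s0 [w hw]] := @EVA_dvd F R C g h0 h0g h0_irr (map_poly polyC hA).[ro k].
  rewrite -horner_map /= -map_poly_comp (eq_map_poly (g := ofA C)); last by move=> x; rewrite /= EVA_C.
  by rewrite hA_split ro_rt; apply/eqP; apply: (root_prodX rt).
rewrite map_subst HFE; apply: (dvdp_clear (s := s) (w := w)) hw.
by rewrite tofrac_eq0 map_poly_eq0.
Qed.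
End ModuleFunctions.

(** * Orders of the Frobenius multipliers *)

Lemma scalemx_inj (A : idomainType) m n (a : A) (M M' : 'M[A]_(m, n)) : a != 0 ->
  a *: M = a *: M' -> M = M'.
Proof.
move=> a0 /matrixP h; apply/matrixP => i j; apply: (mulfI a0).
by have := h i j; rewrite !mxE.
Qed.

Lemma scale_step (A : comNzRingType) m n k (S T d b : A) (x : 'M[A]_(m, n)) (y : 'M[A]_(m, n))
    (B : 'M[A]_(n, k)) (z : 'M[A]_(m, k)) :
  S *: x = T *: y -> d *: (y *m B) = b *: z -> (S * d) *: (x *m B) = (T * b) *: z.
Proof.
move=> h1 h2; rewrite [S * d]mulrC -[LHS]scalerA scalemxAl h1 -scalemxAl scalerA [d * T]mulrC.
by rewrite -[LHS]scalerA h2 scalerA.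
Qed.
Lemma scale_chain (A : idomainType) m n (S T P d0 d2 b : A) (x y : 'M[A]_(m, n)) : P != 0 ->
  d0 * S = P * d2 -> T = b * P -> S *: x = T *: y -> d2 *: x = d0 *: (b *: y).
Proof.
move=> P0 h1 h2 h3; apply: (scalemx_inj P0); rewrite scalerA -h1 -scalerA h3 h2 !scalerA.
by congr (_ *: _); ring.
Qed.

Lemma cancel_rel (A : idomainType) (x a d U b g P Z : A) : x != 0 ->
  a * (d * (x * U)) = b * (x * g * P * Z) -> a * (d * U) = b * (g * P * Z).
Proof.
move=> x0 E; apply: (mulfI x0); have -> : x * (a * (d * U)) = a * (d * (x * U)) by ring.
by rewrite E; ring.
Qed.

Section Orders.
Context (F : finFieldType) (R : realType) (C : Cinfty F R).
Local Notation th := (theta C).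
Local Notation ptw k := (map_poly (@frn F R C k)).
Local Notation fA := (map_poly (ofF C)).
Local Notation tm := (map_mx (horner_eval th)).
Context (r' : nat).
Local Notation r := r'.+1.
Context (phi : {poly F} -> {poly C}) (hphi : drinfeld_module r phi).
Local Notation Bm := (Bm r phi).
Context (X : 'M[{poly C}]_r) (XB : Bm *m map_mx (ptw 1) X = X *m Bm).
Context (hA : {poly {poly F}}) (hA_mon : hA \is monic) (hA_size : size hA = r.+1).
Context (hX : horner_mx X (map_poly fA hA) = 0).
Context (rt : 'I_r -> C) (rt_inj : injective rt) (k0 : 'I_r).
Context (gcol_X : tm X *m gcol r phi = rt k0 *: gcol r phi).
Context (u : 'cV[C]_r) (Qdet : \det (Qm (tm X) u) != 0).
Context (Rr : 'I_r -> fps C) (Rr0 : forall k, Rr k 0%N = rt k).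
Context (Rr_root : forall k, (map_poly (@plc F R C 0 0 \o fA) hA).[Rr k] = 0).
Local Notation uP := (uP u).
Local Notation dP := (dP X u).
Local Notation bt := (bt phi X u).
Context (n : nat) (n0 : (0 < n)%N) (dn0 : @plc F R C n 0 dP 0%N != 0) (dn2 : @plc F R C n n.*2 dP 0%N != 0).
Local Notation pl j := (@plc F R C n j).
Local Notation c0m := (map_mx (@fc0 C)).

Definition Xj j := map_mx (pl j) X.
Definition Bj j := map_mx (pl j) Bm.
Definition uj j := map_mx (pl j) uP.
Definition Qj j := Qm (Xj j) (uj j).
Definition dj j : fps C := pl j dP.
Definition Rk k := tw n (Rr k).
Definition hj := map_poly (tw n \o @plc F R C 0 0 \o fA) hA.
Definition Wm : 'M[fps C]_r := \matrix_(k, i) Rk k ^+ i.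
(** Row [k] is a left eigenvector of the twisted matrix [Xj j] for the root [Rk k]: the powers of
    the roots, multiplied by the adjugate of the Krylov matrix. *)
Definition Zj j := Wm *m \adj (Qj j).
Definition zj j k := row k (Zj j).
Definition btj j := map_poly (pl j) bt.

Lemma QjE j : Qj j = map_mx (pl j) (QP X u).
Proof. by rewrite (map_Qm (@plc F R C n j)). Qed.
Lemma det_Qj j : \det (Qj j) = dj j.
Proof. by rewrite QjE det_map_mx. Qed.
Lemma dj_neq0 j : dj j != 0.
Proof.
by rewrite -(rmorph0 (@plc F R C n j)) (inj_eq (@plc_inj F R C n j)) (dP_neq0 Qdet).
Qed.
Lemma BjX j : Bj j *m Xj j.+1 = Xj j *m Bj j.
Proof.
rewrite /Xj /Bj -[RHS]map_mxM -XB map_mxM; congr (_ *m _).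
by apply/matrixP => i k; rewrite !mxE plc_S.
Qed.
Lemma hj_eq j : hj = map_poly (pl j) (map_poly fA hA).
Proof. by rewrite /hj -map_poly_comp; apply: eq_map_poly => a /=; exact/esym/plc_fA. Qed.
Lemma hj_mon : hj \is monic.
Proof. by rewrite (hj_eq 0); apply: monic_map; apply: monic_map. Qed.
Lemma hj_size : size hj = r.+1.
Proof.
rewrite (hj_eq 0) size_map_inj_poly ?rmorph0 //; last exact: plc_inj.
by rewrite size_map_inj_poly ?rmorph0 //; exact: map_poly_inj.
Qed.
Lemma hj_X j : horner_mx (Xj j) hj = 0.
Proof. by rewrite (hj_eq j) -map_horner_mx hX map_mx0. Qed.
Lemma hj_R k : hj.[Rk k] = 0.
Proof.
have := congr1 (tw n) (Rr_root k); rewrite rmorph0 -horner_map -map_poly_comp => <-.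
by [].
Qed.
Lemma zjQ j k : zj j k *m Qj j = dj j *: \row_i Rk k ^+ i.
Proof.
rewrite /zj -row_mul /Zj -mulmxA mul_adj_mx det_Qj mul_mx_scalar; apply/rowP => i.
by rewrite !mxE.
Qed.
Lemma zj_eval j k p : zj j k *m horner_mx (Xj j) p *m uj j = (dj j * p.[Rk k])%:M.
Proof. exact: (cyc_eval hj_mon hj_size (hj_X j) p (hj_R k) (zjQ j k)). Qed.
Lemma zj_eig j k : zj j k *m Xj j = Rk k *: zj j k.
Proof.
apply: (cyc_eig hj_mon hj_size (hj_X j) _ (hj_R k) (zjQ j k)).
by rewrite -/(Qj j) det_Qj dj_neq0.
Qed.
Lemma btj_u j : horner_mx (Xj j) (btj j) *m uj j = dj j *: (Bj j *m uj j.+1).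
Proof.
rewrite -map_horner_mx -map_mxM bt_u map_mxZ map_mxM; congr (_ *: (_ *m _)).
by apply/matrixP => i k; rewrite ![map_mx _ _ _ _]mxE plc_S.
Qed.
(** Multiplication by [Bj j] carries left eigenvectors of one twist to those of the next, for the
    same root; the multiplier is read off on the cyclic vector. *)
Lemma zjB j k : dj j.+1 *: (zj j k *m Bj j) = (btj j).[Rk k] *: zj j.+1 k.
Proof.
have Bu : zj j k *m Bj j *m uj j.+1 = ((btj j).[Rk k])%:M.
  have := congr1 (fun M => zj j k *m M) (btj_u j); rewrite /= mulmxA zj_eval -scalemxAr mulmxA.
  move=> /matrixP /(_ 0 0); rewrite [LHS]mxE [RHS]mxE eqxx mulr1n => /(mulfI (dj_neq0 j)) E.
  by apply/matrixP => a b; rewrite !ord1 -E [RHS]mxE eqxx mulr1n.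
have Be : zj j k *m Bj j *m Xj j.+1 = Rk k *: (zj j k *m Bj j).
  by rewrite -mulmxA BjX mulmxA zj_eig scalemxAl.
have BQ : zj j k *m Bj j *m Qj j.+1 = (btj j).[Rk k] *: \row_i Rk k ^+ i.
  apply/rowP => i; rewrite mulQm.
  have -> : Xj j.+1 ^+ i = horner_mx (Xj j.+1) 'X^i by rewrite rmorphXn /= horner_mx_X.
  rewrite (horner_eigl _ Be) hornerXn -scalemxAl Bu !mxE eqxx mulr1n mulrC //.
have dQ : \det (Qj j.+1) != 0 by rewrite det_Qj dj_neq0.
apply/eqP; rewrite -subr_eq0; apply/eqP/(mulmx_det0 dQ).
by rewrite mulmxBl -!scalemxAl BQ zjQ !scalerA mulrC subrr.
Qed.

Fixpoint PB m : 'M[fps C]_r := if m is m'.+1 then PB m' *m Bj m' else 1%:M.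
Lemma chain m k : (\prod_(j < m) dj j.+1) *: (zj 0 k *m PB m) = (\prod_(j < m) (btj j).[Rk k]) *: zj m k.
Proof.
elim: m => [|m IH]; first by rewrite !big_ord0 !scale1r mulmx1.
rewrite !big_ord_recr /= mulmxA; exact: scale_step IH (zjB m k).
Qed.
Lemma zju m k : (zj m k *m uj m) 0 0 = dj m.
Proof.
have := zj_eval m k 1; rewrite rmorph1 mulmx1 hornerC mulr1 => ->.
by rewrite mxE eqxx mulr1n.
Qed.

Local Notation m2 := (n.*2).
(** The product of the multipliers over the window with the factors [dj] removed, as [be_prod]
    shows. This form exhibits it as a power series, since [dj 0] is a unit at the place. *)
Definition be k : fps C := (dj 0)^-1 * (zj 0 k *m PB m2 *m uj m2) 0 0.
Lemma d0_unit : dj 0 \is a GRing.unit. Proof. exact: funit_coef0. Qed.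
Lemma prod_shift m : dj 0 * \prod_(j < m) dj j.+1 = (\prod_(j < m) dj j) * dj m.
Proof.
by transitivity (\prod_(j < m.+1) dj j); [rewrite big_ord_recl|rewrite big_ord_recr].
Qed.
Lemma be_prod k : \prod_(j < m2) (btj j).[Rk k] = be k * \prod_(j < m2) dj j.
Proof.
have := congr1 (fun M => (M *m uj m2) 0 0) (chain m2 k).
have scE a (A : 'M[fps C]_1) : (a *: A) 0 0 = a * A 0 0 by rewrite mxE.
rewrite /= -!scalemxAl !scE zju => E.
apply: (mulIf (dj_neq0 m2)); rewrite -E /be -[RHS]mulrA -prod_shift mulrA.
by rewrite [_^-1 * _]mulrC mulrVK ?d0_unit // mulrC.
Qed.
Lemma be_mx : dj m2 *: (Zj 0 *m PB m2) = dj 0 *: (diag_mx (\row_k be k) *m Zj m2).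
Proof.
have P0 : \prod_(j < m2) dj j != 0 by apply/prodf_neq0 => j _; exact: dj_neq0.
apply/row_matrixP => k.
have rowZ a (M : 'M[fps C]_r) : row k (a *: M) = a *: row k M by apply/rowP => l; rewrite !mxE.
rewrite !rowZ row_mul.
have -> : row k (diag_mx (\row_k be k) *m Zj m2) = be k *: zj m2 k.
  by apply/rowP => l; rewrite mul_diag_mx !mxE.
exact: (scale_chain P0 (prod_shift m2) (be_prod k) (chain m2 k)).
Qed.

Lemma c0_Rk k : Rk k 0%N = frn n (rt k). Proof. by rewrite /Rk /tw fmapE Rr0. Qed.
Lemma c0_Wm : fc0 (\det Wm) != 0.
Proof.
rewrite -det_map_mx -det_tr.
have -> : (c0m Wm)^T = Vandermonde r (\row_k frn n (rt k)).
  apply/matrixP => i j; rewrite !mxE rmorphXn; congr (_ ^+ _).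
  exact: c0_Rk.
rewrite det_Vandermonde; apply/prodf_neq0 => i _; apply/prodf_neq0 => j ij.
rewrite !mxE subr_eq0; apply: contraTN ij => /eqP/fmorph_inj/rt_inj ->; by rewrite ltnn.
Qed.
Lemma c0_Zj j : dj j 0%N != 0 -> fc0 (\det (Zj j)) != 0.
Proof.
move=> hd; rewrite /Zj det_mulmx rmorphM mulf_neq0 ?c0_Wm //=.
have : fc0 (\det (\adj (Qj j)) * \det (Qj j)) != 0.
  rewrite -det_mulmx mul_adj_mx det_scalar det_Qj rmorphXn expf_neq0 //.
by rewrite rmorphM mulf_eq0 negb_or => /andP [].
Qed.
Lemma det_Bj j : exists2 a : C, a != 0 &
  \det (Bj j) = pfps (a *: ('X + (frn n th - frn j.+1 th)%:P)).
Proof.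
exists (frn j ((-1) ^+ r' * frn 1 (dcoef phi r)^-1)).
  apply: expf_neq0; apply: mulf_neq0; first by rewrite expf_neq0 // oppr_eq0 oner_eq0.
  by apply: expf_neq0; rewrite invr_eq0; exact: (dcoef_lead hphi).
rewrite /Bj det_map_mx (det_Bm hphi) /= /plc map_polyZ /= comp_polyZ map_polyXsubC /= -frnD addn1.
by rewrite comp_polyB comp_polyX comp_polyC rmorphB /= addrA.
Qed.
Lemma frn_th_inj i j : frn i th = frn j th -> i = j.
Proof. by rewrite !frnE => /theta_expr_inj/eqP; rewrite eqn_exp2l ?q_gt1 // => /eqP. Qed.
Lemma det_Bj0 j : j.+1 != n -> \det (Bj j) 0%N != 0.
Proof.
move=> jn; have [a a0 ->] := det_Bj j.
rewrite /= coefZ coefD coefX coefC /= add0r mulf_neq0 // subr_eq0.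
by apply: contra jn => /eqP/frn_th_inj ->.
Qed.
(** Among the twists in the window only the one with [j.+1 = n] has a determinant vanishing at
    [theta ^+ (q ^ n)], and it vanishes there to order 1. *)
Lemma det_PB : exists2 U : fps C, U 0%N != 0 & \det (PB m2) = pfps 'X * U.
Proof.
have E m : \det (PB m) = \prod_(j < m) \det (Bj j).
  elim: m => [|m IH]; first by rewrite det1 big_ord0.
  by rewrite /= det_mulmx IH big_ord_recr.
have h : (n.-1 < m2)%N by rewrite -addnn; lia.
have [a a0 ha] := det_Bj n.-1; rewrite prednK // subrr addr0 in ha.
exists (pfps a%:P * \prod_(j < m2 | j != Ordinal h) \det (Bj j)).
  rewrite -[_ 0%N]/(fc0 _) rmorphM rmorph_prod mulf_neq0 //=; first by rewrite /fc0 /= coefC.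
  apply/prodf_neq0 => j jh; apply: det_Bj0; apply: contra jh => /eqP jn.
  by apply/eqP/val_inj/succn_inj; rewrite /= (prednK n0).
by rewrite E (bigD1 (Ordinal h)) //= ha -mul_polyC rmorphM mulrA [pfps 'X * _]mulrC.
Qed.

Lemma plc_diag p : @plc F R C n n p 0%N = frn n p.[th].
Proof. by rewrite plc_c0 -horner_map. Qed.
Lemma B0_th : tm (B0 r phi) *m gcol r phi = 0.
Proof.
apply/colP => i; have /matrixP /(_ i 0) := B0_gcol hphi.
rewrite -map_mxM [LHS]mxE [RHS]mxE => E.
have {}E : (B0 r phi *m map_mx (@polyC C) (gcol r phi)) i 0 = if (i == 0 :> nat) then 'X - th%:P else 0.
  by apply: (@pfps_inj C); rewrite E; case: ifP => _; rewrite ?rmorph0.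
have E2 : (tm (B0 r phi *m map_mx (@polyC C) (gcol r phi))) i 0 = 0.
  by rewrite mxE E /horner_eval; case: ifP => _; rewrite ?horner0 // hornerXsubC subrr.
rewrite [RHS]mxE; apply: etrans E2; rewrite map_mxM; congr ((_ *m _) i 0).
by apply/matrixP => a b; rewrite [RHS]mxE /= /horner_eval [(map_mx (@polyC C) _) a b]mxE hornerC.
Qed.
(** Starts from the twist of [gcol], which spans the kernel where the window crosses [theta] and is
    an eigenvector for [rt k0]; the later factors are invertible at the place and transport it. *)
Lemma eta_exists m : exists2 eta : 'cV[C]_r, eta != 0 & c0m (PB (n + m)) *m eta = 0 /\
  c0m (Xj (n + m)) *m eta = frn n (rt k0) *: eta.
Proof.
elim: m => [|m [eta eta0 [h1 h2]]].
  exists (map_mx (@frn F R C n) (gcol r phi)).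
    by apply: contraNneq (gcol_neq0 hphi) => h; apply/eqP; apply: (map_mx_inj (f := @frn F R C n)); rewrite h map_mx0.
  rewrite addn0; split.
    rewrite -(prednK n0) /= (prednK n0) map_mxM -mulmxA.
    have -> : c0m (Bj n.-1) = map_mx (@frn F R C n) (tm (B0 r phi)).
      apply/matrixP => i j; rewrite ![map_mx _ _ i j]mxE /fc0 -plc_S prednK // plc_diag //.
    by rewrite -map_mxM B0_th map_mx0 mulmx0.
  have -> : c0m (Xj n) = map_mx (@frn F R C n) (tm X).
    by apply/matrixP => i j; rewrite ![map_mx _ _ i j]mxE /fc0 plc_diag.
  by rewrite -map_mxM gcol_X map_mxZ.
have dB : c0m (Bj (n + m)) \in unitmx.
  by rewrite unitmxE unitfE det_map_mx; apply: det_Bj0; rewrite -addnS eq_sym; lia.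
exists (invmx (c0m (Bj (n + m))) *m eta).
  by apply: contraNneq eta0 => h; rewrite -(mulKVmx dB eta) h mulmx0.
rewrite addnS /=; split; first by rewrite map_mxM -mulmxA mulKVmx.
apply: (can_inj (mulKmx dB)); rewrite mulmxA -map_mxM BjX map_mxM -mulmxA mulKVmx // h2.
by rewrite -scalemxAr mulKVmx.
Qed.

Lemma c0_rel (a b : fps C) (A P D Z : 'M[fps C]_r) : a *: (A *m P) = b *: (D *m Z) ->
  fc0 a *: (c0m A *m c0m P) = fc0 b *: (c0m D *m c0m Z).
Proof. by move/(congr1 c0m); rewrite !map_mxZ !map_mxM. Qed.

Lemma c0_diag (b : 'I_r -> fps C) (w : 'cV[C]_r) k :
  (c0m (diag_mx (\row_k b k)) *m w) k 0 = fc0 (b k) * w k 0.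
Proof. by rewrite map_diag_mx mul_diag_mx [LHS]mxE; congr (_ * _); rewrite !mxE. Qed.
Lemma det_rel (a b : fps C) (A P Z : 'M[fps C]_r) (d : 'I_r -> fps C) :
  a *: (A *m P) = b *: (diag_mx (\row_k d k) *m Z) ->
  a ^+ r * (\det A * \det P) = b ^+ r * (d k0 * \prod_(k | k != k0) d k * \det Z).
Proof.
move/(congr1 determinant); rewrite !detZ !det_mulmx det_diag (bigD1 k0) //= mxE => ->.
by do 3!congr (_ * _); apply: eq_bigr => k _; rewrite mxE.
Qed.

(** In the eigenbasis given by [Zj], the kernel vector of [eta_exists] has only its coordinate [k0]
    nonzero, because the eigenvalues are distinct; so the diagonal entry [be k0] vanishes at the
    place. *)
Lemma be_k0 : be k0 0%N = 0.
Proof.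
have [eta eta0 []] := eta_exists n; rewrite addnn => h1 h2.
pose Z2 := c0m (Zj m2).
have Zeta : forall k, be k 0%N * (Z2 *m eta) k 0 = 0.
  move=> k; have d00 : fc0 (dj 0) != 0 by exact: dn0.
  have E := c0_rel be_mx.
  have E2 : fc0 (dj 0) *: (c0m (diag_mx (\row_k be k)) *m (Z2 *m eta)) = 0.
    by rewrite mulmxA scalemxAl -E -scalemxAl -mulmxA h1 mulmx0 scaler0.
  have /matrixP /(_ k 0) := E2; rewrite [LHS]mxE [RHS]mxE => /eqP.
  rewrite mulf_eq0 (negPf d00) /= => /eqP E3; apply: etrans E3.
  exact: esym (c0_diag be _ k).
have Zeig k : (frn n (rt k) - frn n (rt k0)) * (Z2 *m eta) k 0 = 0.
  have E : Z2 *m c0m (Xj m2) = diag_mx (\row_k frn n (rt k)) *m Z2.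
    apply/row_matrixP => l; rewrite row_mul.
    have -> : row l Z2 = c0m (zj m2 l) by apply/rowP => a; rewrite !mxE.
    rewrite -map_mxM zj_eig map_mxZ /=; apply/rowP => a.
    by rewrite mul_diag_mx !mxE Rr0.
  have := congr1 (fun M => (M *m eta) k 0) E; rewrite /= -!mulmxA h2 -scalemxAr mul_diag_mx.
  rewrite [LHS]mxE [RHS]mxE [in X in _ = X * _]mxE => E1.
  by rewrite mulrBl -E1 subrr.
have Z0 : Z2 *m eta != 0.
  apply: contraNneq eta0; move/mulmx_det0r => -> //.
  by rewrite det_map_mx; apply: c0_Zj.
have /eqP := Zeta k0; rewrite mulf_eq0 => /orP [/eqP //|/eqP h]; case/eqP: Z0; apply/colP => k.
rewrite [RHS]mxE; have [-> //|kk] := eqVneq k k0.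
have /eqP := Zeig k; rewrite mulf_eq0 subr_eq0 => /orP [/eqP/fmorph_inj/rt_inj|/eqP //].
by move=> E; rewrite E eqxx in kk.
Qed.

(** By [det_PB] the product of all [be k] has order exactly 1 at the place, and [be_k0] tells which
    factor takes it. *)
Lemma place_orders : exists be : 'I_r -> fps C, [/\
  forall k, \prod_(j < n.*2) (map_poly (pl j) bt).[tw n (Rr k)] = be k * \prod_(j < n.*2) pl j dP,
  forall k, k != k0 -> be k 0%N != 0 & exists2 g, be k0 = pfps 'X * g & g 0%N != 0].
Proof.
exists be.
have [U U0 hU] := det_PB.
have E := det_rel be_mx.
have hk0 : be k0 = pfps 'X * Fps (fun i => be k0 (i + 1)%N).
  by rewrite -{1}(expr1 'X); apply: ford_split => -[|//] _; exact: be_k0.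
set g := Fps _ in hk0.
rewrite hk0 hU in E.
have {}E : dj m2 ^+ r * (\det (Zj 0) * U) =
    dj 0 ^+ r * ((g * \prod_(k | k != k0) be k) * \det (Zj m2)).
  have X0 : pfps 'X != 0 :> fps C.
    by rewrite -(rmorph0 (@pfps C)) (inj_eq (@pfps_inj C)) polyX_eq0.
  exact: cancel_rel X0 E.
have H : fc0 (g * \prod_(k | k != k0) be k) != 0.
  have : fc0 (dj m2 ^+ r * (\det (Zj 0) * U)) != 0.
    by rewrite !rmorphM rmorphXn !mulf_neq0 ?expf_neq0 ?c0_Zj.
  by rewrite E rmorphM rmorphM !mulf_eq0 !negb_or => /andP [_ /andP []].
rewrite rmorphM rmorph_prod mulf_eq0 negb_or in H; case/andP: H => g0 /prodf_neq0 hk.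
split; [exact: be_prod| |by exists g].
by move=> k kk; have := hk k kk.
Qed.
End Orders.

(** * Isomorphism classes of the Frobenius multipliers *)

Section CMData.
Context (F : finFieldType) (R : realType) (C : Cinfty F R).
Local Notation th := (theta C).
Local Notation fA := (map_poly (ofF C)).
Local Notation ptw k := (map_poly (@frn F R C k)).
Local Notation tm := (map_mx (horner_eval th)).
Local Notation Phi := {fraction {poly C}}.

(* A complex multiplication [X] on the Frobenius module of [phi], with its minimal polynomial
   [hA], the conjugates [rt] of its eigenvalue on the differential, and a cyclic vector [u]. *)
Record cm_data r' (phi : {poly F} -> {poly C}) (lam : C) (X : 'M[{poly C}]_r'.+1)
    (hA : {poly {poly F}}) (rt : 'I_r'.+1 -> C) (k0 : 'I_r'.+1) (u : 'cV[C]_r'.+1) : Prop := CMData {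
  cd_phi : drinfeld_module r'.+1 phi;
  cd_lat : period_lattice phi lam;
  cd_XB : Bm r'.+1 phi *m map_mx (ptw 1) X = X *m Bm r'.+1 phi;
  cd_mon : hA \is monic;
  cd_size : size hA = r'.+2;
  cd_hX : horner_mx X (map_poly fA hA) = 0;
  cd_inj : injective rt;
  cd_split : map_poly (ofA C) hA = \prod_k ('X - (rt k)%:P);
  cd_gcol : tm X *m gcol r'.+1 phi = rt k0 *: gcol r'.+1 phi;
  cd_Q : \det (Qm (tm X) u) != 0;
  cd_XK : forall i j k, Kbar C (X i j)`_k;
  cd_u : kbM u;
  cd_rt : forall k, Kbar C (rt k)
}.

Lemma c0_plc a : fc0 (@plc F R C 0 0 (fA a)) = ofA C a.
Proof. by rewrite /fc0 plc_c0 ptwk_ofF frn0 -ofAE. Qed.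
Lemma map_c0_plc p : map_poly (@fc0 C) (map_poly (@plc F R C 0 0 \o fA) p) = map_poly (ofA C) p.
Proof. by rewrite -map_poly_comp; apply: eq_map_poly => a; apply: c0_plc. Qed.
Lemma sep_deriv (p : {poly C}) x : separable_poly p -> root p x -> p^`().[x] != 0.
Proof. by rewrite separable_poly.unlock => /coprimep_root h /h. Qed.

Lemma hensel_fA p x : separable_poly (map_poly (ofA C) p) -> root (map_poly (ofA C) p) x ->
  exists T : fps C, (map_poly (@plc F R C 0 0 \o fA) p).[T] = 0 /\ T 0%N = x.
Proof.
move=> sp px; have [||h1 h2] := @hensel_rootP C (map_poly (@plc F R C 0 0 \o fA) p) x.
- by rewrite map_c0_plc.
- by rewrite map_c0_plc; apply: sep_deriv.
- by exists (hensel_root (map_poly (@plc F R C 0 0 \o fA) p) x).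
Qed.
Lemma hensel_uniq p (T T' : fps C) : separable_poly (map_poly (ofA C) p) ->
  (map_poly (@plc F R C 0 0 \o fA) p).[T] = 0 -> (map_poly (@plc F R C 0 0 \o fA) p).[T'] = 0 ->
  T 0%N = T' 0%N -> T = T'.
Proof.
pose P := map_poly (@plc F R C 0 0 \o fA) p; rewrite -/P => sp hT hT' E.
have [w] := horner_taylor2 P T (T' - T); rewrite [T + _]addrC subrK hT hT' add0r.
have -> : (T' - T) * P^`().[T] + (T' - T) ^+ 2 * w = (T' - T) * (P^`().[T] + (T' - T) * w) by ring.
move/esym/eqP; rewrite mulf_eq0 => /orP [|/eqP h]; first by rewrite subr_eq0 => /eqP.
have := congr1 (@fc0 C) h; rewrite rmorphD rmorphM rmorphB rmorph0 /= {2 3}/fc0 E subrr mul0r addr0.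
rewrite /fc0 horner_c0 -deriv_map map_c0_plc => /eqP; apply: contraTeq => _; apply: sep_deriv => //.
by rewrite rootE -map_c0_plc -horner_c0 hT.
Qed.

Lemma plc_inj_comp n j : injective (@tofrac (fps C) \o @plc F R C n j).
Proof. by move=> x y /tofrac_inj/plc_inj. Qed.
(** Expansion at the place of the twist of a rational function, poles included. *)
Definition Lam n j : Phi -> {fraction (fps C)} := flift (@plc_inj_comp n j).
HB.instance Definition _ n j := GRing.RMorphism.copy (Lam n j) (flift (@plc_inj_comp n j)).
Lemma Lam_tofrac n j p : Lam n j (tofrac p) = tofrac (plc n j p).
Proof. exact: flift_tofrac. Qed.
Lemma Lam_taf n j x : Lam n j (taf x) = Lam n j.+1 x.
Proof.
have [a [b [b0 ->]]] := fracP x.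
by rewrite !fmorph_div /= !taf_tofrac !Lam_tofrac !plc_S.
Qed.
(** Also substitutes for the variable [x] the root of [h0] lifted from a conjugate of the primitive
    element; different conjugates give the different elements of the Galois group. *)
Definition ThX n j (T : fps C) : {poly Phi} -> {fraction (fps C)} :=
  horner_eval (tofrac (tw n T)) \o map_poly (Lam n j).
HB.instance Definition _ n j T :=
  GRing.RMorphism.copy (ThX n j T) (horner_eval (tofrac (tw n T)) \o map_poly (Lam n j)).
Lemma ThXM n j T a b : ThX n j T (a * b) = ThX n j T a * ThX n j T b.
Proof. exact: rmorphM. Qed.
Lemma ThXD n j T a b : ThX n j T (a + b) = ThX n j T a + ThX n j T b.
Proof. exact: rmorphD. Qed.
Lemma ThXB n j T a b : ThX n j T (a - b) = ThX n j T a - ThX n j T b.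
Proof. exact: rmorphB. Qed.
Lemma ThX1 n j T : ThX n j T 1 = 1.
Proof. exact: rmorph1. Qed.
Lemma ThX_tau n j T p : ThX n j T (taX (@taf F R C) p) = ThX n j.+1 T p.
Proof.
rewrite /ThX /= /horner_eval /taX -map_poly_comp; congr (_.[_]); apply: eq_map_poly => x.
exact: Lam_taf.
Qed.
Lemma ThX_fA n j T p : ThX n j T (map_poly (@tofrac {poly C} \o fA) p) =
  tofrac (tw n (map_poly (@plc F R C 0 0 \o fA) p).[T]).
Proof.
rewrite /ThX /= /horner_eval -horner_map -(horner_map (@tofrac (fps C))) /= -!map_poly_comp.
by congr (_.[_]); apply: eq_map_poly => a /=; rewrite Lam_tofrac plc_fA.
Qed.
Lemma map_horner2 (A B : comNzRingType) (f : {rmorphism A -> B}) (P x : {poly A}) y :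
  (map_poly f (map_poly polyC P).[x]).[y] = (map_poly f P).[(map_poly f x).[y]].
Proof.
elim/poly_ind: P => [|P c IH]; first by rewrite !rmorph0 !horner0 rmorph0 horner0.
rewrite rmorphD rmorphM /= map_polyX map_polyC /= hornerMXaddC rmorphD rmorphM /= map_polyC /=.
by rewrite hornerD hornerM hornerC IH rmorphD rmorphM /= map_polyX map_polyC /= hornerMXaddC.
Qed.
Lemma ThX_bt n j T (b : {poly {poly C}}) ro :
  ThX n j T (map_poly polyC (map_poly (@tofrac {poly C}) b)).[map_poly (@tofrac {poly C} \o fA) ro] =
  tofrac (map_poly (plc n j) b).[tw n (map_poly (@plc F R C 0 0 \o fA) ro).[T]].
Proof.
rewrite {1}/ThX /= /horner_eval map_horner2 -[X in (map_poly _ _).[X]]/(ThX n j T _) ThX_fA.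
rewrite -(horner_map (@tofrac (fps C))) -!map_poly_comp /=; congr (_.[_]).
by apply: eq_map_poly => a /=; rewrite Lam_tofrac.
Qed.
Lemma ThX_C n j T (a : {poly C}) : ThX n j T (tofrac a)%:P = tofrac (plc n j a).
Proof. by rewrite /ThX /= /horner_eval map_polyC hornerC /= Lam_tofrac. Qed.

Lemma frac_cross (A B : comNzRingType) (f : {rmorphism A -> B}) x y G G' a0 b0 a2 b2 :
  x * f b2 = f a2 -> y * f b0 = f a0 -> x * f G = f G' * y -> f (G * (a2 * b0)) = f (G' * (a0 * b2)).
Proof.
move=> h2 h0 E; rewrite !rmorphM -h2 -h0.
have -> : f G * (x * f b2 * f b0) = x * f G * (f b2 * f b0) by ring.
by rewrite E; ring.
Qed.
Lemma pX_order (a b : fps C) m m' : a 0%N != 0 -> b 0%N != 0 -> pfps 'X^m * a = pfps 'X^m' * b -> m = m'.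
Proof.
move=> a0 b0 E; case: (ltngtP m m') => // h.
  have := congr1 (fun f : fps C => f m) E; rewrite !fcoefXnM ltnn subnn h => /eqP.
  by rewrite (negPf a0).
have := congr1 (fun f : fps C => f m') E; rewrite !fcoefXnM ltnn subnn h => /esym/eqP.
by rewrite (negPf b0).
Qed.

Context (n : nat) (r' : 'I_n -> nat) (phi : 'I_n -> {poly F} -> {poly C}) (lam : 'I_n -> C).
Context (X : forall i, 'M[{poly C}]_((r' i).+1)) (hA : 'I_n -> {poly {poly F}}).
Context (rt : forall i, 'I_(r' i).+1 -> C) (k0 : forall i, 'I_(r' i).+1).
Context (u : forall i, 'cV[C]_((r' i).+1)).
Context (cmd : forall i, cm_data (phi i) (lam i) (X i) (hA i) (@rt i) (k0 i) (u i)).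
Context (S : finType) (ga : S -> C) (s0 : S) (h0 : {poly {poly F}}).
Context (h0_root : forall s, EVA (ga s) h0 = 0).
Context (h0_irr : irreducible_poly (map_poly (@tofrac {poly F}) h0)).
Context (h0_sep : separable_poly (map_poly (@tofrac {poly F}) h0)).
Context (ro : forall i, 'I_(r' i).+1 -> {poly {poly F}}).
Context (ro_rt : forall i (k : 'I_(r' i).+1), EVA (ga s0) (@ro i k) = @rt i k).
Local Notation Lt := {i : 'I_n & 'I_(r' i).+1}.
Local Notation HF := (map_poly (kaf C) (map_poly (@tofrac {poly F}) h0)).
Local Notation dPi i := (dP (X i) (u i)).
Local Notation bti i := (bt (phi i) (X i) (u i)).

(** The letter [None] stands for the constant 1 and pads words to a common length. *)
Definition bL (x : option Lt) : {poly Phi} :=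
  if x is Some y then (tofrac (dPi (tag y)))^-1%:P *
    btF (phi (tag y)) (X (tag y)) (u (tag y)) (@ro (tag y)) (tagged y) else 1.
Definition lw s (x : option Lt) : bool :=
  if x is Some y then EVA (ga s) (ro (tagged y)) == rt (k0 (tag y)) else false.

Lemma prod_seqX (I : finType) (f : I -> C) :
  \prod_k ('X - (f k)%:P) = \prod_(y <- [seq f k | k <- enum I]) ('X - y%:P).
Proof. by rewrite big_map big_enum. Qed.
Lemma h0_sepC : separable_poly (map_poly (ofA C) h0).
Proof. by rewrite -(kp_tofrac C) separable_map. Qed.
Lemma hA_sepC i : separable_poly (map_poly (ofA C) (hA i)).
Proof.
rewrite (cd_split (cmd i)) prod_seqX.
by rewrite separable_prod_XsubC map_inj_uniq ?enum_uniq //; exact: cd_inj (cmd i).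
Qed.

Lemma bL_cop x : coprimep (bL x) HF.
Proof.
case: x => [y|] /=; last exact: coprime1p.
have di := cmd (tag y).
rewrite mul_polyC coprimepZl; last by rewrite invr_eq0 tofrac_eq0 (dP_neq0 (cd_Q di)).
apply: (btF_cop (h0_root s0) h0_irr (cd_phi di) (cd_XB di) (cd_size di) (cd_hX di) (cd_split di) (cd_Q di)).
exact: ro_rt.
Qed.

Local Notation pf0 := (map_poly (@plc F R C 0 0 \o fA)).
(** The polynomial [ro k] at the lifted root is a root of [hA i] over power series; by uniqueness in
    Hensel's lemma its constant term identifies it with a conjugate. *)
Lemma letter_place s i (k : 'I_(r' i).+1) (T : fps C) : (map_poly (@plc F R C 0 0 \o fA) h0).[T] = 0 ->
  T 0%N = ga s -> forall Rr : 'I_(r' i).+1 -> fps C,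
  (forall k, (map_poly (@plc F R C 0 0 \o fA) (hA i)).[Rr k] = 0 /\ Rr k 0%N = rt k) ->
  exists2 k', EVA (ga s) (ro k) = rt k' & (map_poly (@plc F R C 0 0 \o fA) (ro k)).[T] = Rr k'.
Proof.
move=> hT T0 Rr hRr.
have [|a a0 [w hw]] := @EVA_dvd F R C (ga s0) h0 (h0_root s0) h0_irr (map_poly polyC (hA i)).[ro k].
  rewrite -horner_map /= -map_poly_comp (eq_map_poly (g := ofA C)); last by move=> x; rewrite /= EVA_C.
  by rewrite (cd_split (cmd i)) ro_rt; apply/eqP; apply: (root_prodX (@rt i)).
have E1 : (pf0 (hA i)).[(pf0 (ro k)).[T]] = 0.
  rewrite -map_horner2; have := congr1 (fun p => (pf0 p).[T]) hw; rewrite /= !rmorphM !hornerM /= hT mul0r.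
  rewrite map_polyC hornerC /= => /eqP; rewrite mulf_eq0 => /orP [|/eqP //].
  rewrite -(rmorph0 (@plc F R C 0 0)) (inj_eq (@plc_inj F R C 0 0)) map_poly_eq0 (negPf a0) //.
have c0E : (pf0 (ro k)).[T] 0%N = EVA (ga s) (ro k) by rewrite horner_c0 map_c0_plc T0.
have : root (map_poly (ofA C) (hA i)) (EVA (ga s) (ro k)).
  by rewrite rootE -map_c0_plc -c0E -horner_c0 E1.
rewrite (cd_split (cmd i)) prod_seqX.
rewrite root_prod_XsubC => /mapP [k' _ E2]; exists k' => //.
by apply: (hensel_uniq (hA_sepC i)) => //; [exact: (hRr k').1|rewrite c0E E2 (hRr k').2].
Qed.

(** Multiplying the congruence over the twists in a window telescopes [p] to its two ends, where it
    is a unit. So both products of multipliers have the same order at the place, and by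
    [place_orders] each letter contributes exactly its weight at [s]. *)
Lemma ord_eq (J : finType) (m m' : J -> option Lt) (p : {poly Phi}) : coprimep p HF ->
  HF %| taX (@taf F R C) p * \prod_j bL (m j) - (\prod_j bL (m' j)) * p ->
  forall s, (\sum_j lw s (m j) = \sum_j lw s (m' j))%N.
Proof.
move=> pcop pdiv s.
have [T [hT T0]] : exists T : fps C, (map_poly (@plc F R C 0 0 \o fA) h0).[T] = 0 /\ T 0%N = ga s.
  apply: hensel_fA; first exact: h0_sepC.
  by rewrite rootE -[_.[_]]/(EVA (ga s) h0) h0_root.
have HR i : exists Rr : 'I_(r' i).+1 -> fps C, forall k,
    (map_poly (@plc F R C 0 0 \o fA) (hA i)).[Rr k] = 0 /\ Rr k 0%N = rt k.
  have H k : exists f : fps C, (pf0 (hA i)).[f] = 0 /\ f 0%N = @rt i k.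
    apply: hensel_fA; first exact: hA_sepC.
    by rewrite (cd_split (cmd i)); apply: (root_prodX (@rt i)).
  by have [Rr hRr] := boolp.choice H; exists Rr.
have /Bezout_eq1_coprimepP [[p' chi] /= bez] := pcop.
have [D1 D10 [q1 hq1]] := clear_denom p; have [D2 D20 [q2 hq2]] := clear_denom p'.
(* One polynomial collects all denominators, so that a single choice of window makes them units at
   both ends. *)
pose DD := (\prod_i dPi i) * (D1 * D2).
have DD0 : DD != 0.
  rewrite !mulf_neq0 //; apply/prodf_neq0 => i _; exact: (dP_neq0 (cd_Q (cmd i))).
have [k [k_gt0 hk0 hk2]] := far_places DD0.
have fac j (e : {poly C}) : (exists e', DD = e * e') -> plc k j DD 0%N != 0 -> plc k j e 0%N != 0.
  move=> [e' ->]; rewrite rmorphM -[_ 0%N]/(fc0 _) rmorphM mulf_eq0 negb_or.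
  by case/andP.
have dfac i : exists e', DD = dPi i * e' by eexists; rewrite /DD (bigD1 i) //= -!mulrA.
have D1fac : exists e', DD = D1 * e' by eexists; rewrite /DD mulrCA.
have D2fac : exists e', DD = D2 * e' by eexists; rewrite /DD [D1 * _]mulrC mulrCA.
have letter (x : option Lt) : exists2 be : fps C, \prod_(j < k.*2) ThX k j T (bL x) = tofrac be &
    exists2 g : fps C, be = pfps 'X^(lw s x) * g & g 0%N != 0.
  case: x => [[i l]|] /=; last first.
    exists 1; first by rewrite big1 ?rmorph1 // => j _; rewrite rmorph1.
    by exists 1; [rewrite expr0 rmorph1 mulr1|rewrite fcoef1 oner_neq0].
  have [Rr hRr] := HR i; have di := cmd i.
  have [k' hk' hRk'] := letter_place l hT T0 hRr.
  have [be [hbe hu [g hg g0]]] := place_orders (cd_phi di) (cd_XB di) (cd_mon di) (cd_size di)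
    (cd_hX di) (cd_inj di) (cd_gcol di) (cd_Q di) (fun k => (hRr k).2) (fun k => (hRr k).1) k_gt0
    (fac _ _ (dfac i) hk0) (fac _ _ (dfac i) hk2).
  exists (be k').
    have P0 : tofrac (\prod_(j < k.*2) plc k j (dPi i)) != 0 :> {fraction (fps C)}.
      rewrite tofrac_eq0; apply/prodf_neq0 => j _.
      by rewrite -(rmorph0 (plc k j)) (inj_eq (@plc_inj F R C k j)) (dP_neq0 (cd_Q di)).
    apply: (mulIf P0); rewrite -rmorphM -hbe !rmorph_prod -big_split; apply: eq_bigr => j _ /=.
    rewrite ThXM /btF ThX_bt hRk' mulrAC.
    have -> : ThX k j T (tofrac (dPi i))^-1%:P = (tofrac (plc k j (dPi i)))^-1.
      rewrite /ThX /= /horner_eval map_polyC hornerC /=.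
      exact: etrans (fmorphV _ _) (congr1 _ (Lam_tofrac _ _ _)).
    rewrite mulVf ?mul1r // tofrac_eq0 -(rmorph0 (plc k j)) (inj_eq (@plc_inj F R C k j)).
    by rewrite (dP_neq0 (cd_Q di)).
  rewrite hk' (inj_eq (cd_inj di)); case: eqP => [->|/eqP kk].
    by exists g; rewrite // expr1.
  by exists (be k'); [rewrite expr0 rmorph1 mul1r|exact: hu].
have L2 x : exists g : fps C, g 0%N != 0 /\
    \prod_(j < k.*2) ThX k j T (bL x) = tofrac (pfps 'X^(lw s x) * g).
  by have [be -> [g -> g0]] := letter x; exists g.
have [G hG] := boolp.choice L2.
have word (w : J -> option Lt) : exists2 g : fps C, g 0%N != 0 &
    \prod_(j < k.*2) ThX k j T (\prod_i bL (w i)) = tofrac (pfps 'X^(\sum_i lw s (w i)) * g).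
  exists (\prod_i G (w i)).
    by rewrite -[_ 0%N]/(fc0 _) rmorph_prod; apply/prodf_neq0 => i _; exact: (hG (w i)).1.
  rewrite (eq_bigr (fun j => \prod_i ThX k (j : 'I__) T (bL (w i)))); last by move=> j _; rewrite rmorph_prod.
  rewrite exchange_big (eq_bigr _ (fun i _ => (hG (w i)).2)) -rmorph_prod; congr tofrac.
  by rewrite big_split /= -rmorph_prod /= expr_sum.
have ThH j : ThX k j T HF = 0 by rewrite HFE ThX_fA hT rmorph0 tofrac0.
have step j : ThX k j.+1 T p * ThX k j T (\prod_i bL (m i)) = ThX k j T (\prod_i bL (m' i)) * ThX k j T p.
  have /dvdpP [w hw] := pdiv; have := congr1 (ThX k j T) hw.
  rewrite ThXM ThH mulr0 ThXB !ThXM => /eqP; rewrite subr_eq0 => /eqP.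
  by rewrite ThX_tau.
have tele t : ThX k t T p * \prod_(j < t) ThX k j T (\prod_i bL (m i)) =
    (\prod_(j < t) ThX k j T (\prod_i bL (m' i))) * ThX k 0 T p.
  elim: t => [|t IH]; first by rewrite !big_ord0 mulr1 mul1r.
  rewrite !big_ord_recr /= [_ * ThX k t T _]mulrC mulrA step -mulrA IH.
  by rewrite mulrA [ThX k t T _ * _]mulrC.
have pol j (v : {poly {poly C}}) : ThX k j T (map_poly (@tofrac {poly C}) v) =
    tofrac (map_poly (plc k j) v).[tw k T].
  rewrite /ThX /= /horner_eval -(horner_map (@tofrac (fps C))) -!map_poly_comp /=; congr (_.[_]).
  by apply: eq_map_poly => a /=; rewrite Lam_tofrac.
(* The inverse of [p] modulo [h0] has an integral expansion up to the same denominators, so [p] has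
   neither zero nor pole at the ends of the window. *)
have un j : plc k j DD 0%N != 0 -> exists a b : fps C, [/\ a 0%N != 0, b 0%N != 0 &
    ThX k j T p * tofrac b = tofrac a].
  move=> hj; have d1 := fac j _ D1fac hj; have d2 := fac j _ D2fac hj.
  have E1 := congr1 (ThX k j T) hq1; rewrite -mul_polyC ThXM ThX_C pol in E1.
  have E2 := congr1 (ThX k j T) hq2; rewrite -mul_polyC ThXM ThX_C pol in E2.
  have E3 := congr1 (ThX k j T) bez; rewrite ThXD !ThXM ThH mulr0 addr0 ThX1 in E3.
  exists (map_poly (plc k j) q1).[tw k T], (plc k j D1); split=> //; last by rewrite mulrC.
  have E4 : (map_poly (plc k j) q1).[tw k T] * (map_poly (plc k j) q2).[tw k T] = plc k j D1 * plc k j D2.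
    apply: (@tofrac_inj (fps C)); rewrite !rmorphM /= -E1 -E2 mulrACA.
    by rewrite [ThX k j T p * _]mulrC E3 mulr1.
  have : fc0 ((map_poly (plc k j) q1).[tw k T] * (map_poly (plc k j) q2).[tw k T]) != 0.
    by rewrite E4 rmorphM mulf_neq0.
  by rewrite rmorphM mulf_eq0 negb_or => /andP [].
have [a0 [b0 [a00 b00 h00]]] := un 0%N hk0; have [a2 [b2 [a20 b20 h22]]] := un _ hk2.
have [g g0 hg] := word m; have [g' g'0 hg'] := word m'.
have := tele k.*2; rewrite hg hg' => E.
apply: (@pX_order (g * (a2 * b0)) (g' * (a0 * b2))).
- by rewrite -[_ 0%N]/(fc0 _) !rmorphM !mulf_neq0.
- by rewrite -[_ 0%N]/(fc0 _) !rmorphM !mulf_neq0.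
- by rewrite [LHS]mulrA [RHS]mulrA; apply: (@tofrac_inj (fps C)); apply: (frac_cross h22 h00 E).
Qed.
End CMData.

(** * Relations between products of eigenvectors *)

(** For square matrices a one-sided inverse up to a scalar is two-sided; the enumeration of [X]
    transports this to arbitrary index types. *)
Lemma finfun_mulVC (X : finType) (K : fieldType) (A B : X -> X -> K) (s : K) : s != 0 ->
  (forall z w, \sum_x A z x * B x w = s *+ (z == w)) ->
  forall x y, \sum_z B x z * A z y = s *+ (x == y).
Proof.
move=> s0 h x y.
pose MA : 'M[K]_#|X| := \matrix_(i, j) A (enum_val i) (enum_val j).
pose MB : 'M[K]_#|X| := s^-1 *: \matrix_(i, j) B (enum_val i) (enum_val j).
have AB : MA *m MB = 1%:M.
  apply/matrixP => i j; rewrite !mxE.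
  transitivity (s^-1 * \sum_x A (enum_val i) x * B x (enum_val j)).
    rewrite mulr_sumr (reindex _ (onW_bij _ (@enum_val_bij X))) /=.
    by apply: eq_bigr => k _; rewrite !mxE mulrCA.
  by rewrite h (inj_eq enum_val_inj); case: eqP => _; rewrite ?mulr0n ?mulr0 // !mulr1n mulVf.
have := congr1 (fun M : 'M[K]_#|X| => s * M (enum_rank x) (enum_rank y)) (mulmx1C AB).
rewrite !mxE (inj_eq enum_rank_inj) => E.
transitivity (s * (x == y)%:R); last by case: eqP; rewrite ?mulr0 ?mulr1.
rewrite -E mulr_sumr (reindex _ (onW_bij _ (@enum_val_bij X))) /=.
by apply: eq_bigr => k _; rewrite !mxE !enum_rankK mulrA mulrA mulfV // mul1r.
Qed.

Lemma finfun_det (X : finType) (K : fieldType) (A B : X -> X -> K) :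
  (forall z w, \sum_x A z x * B x w = (z == w)%:R) ->
  \det (\matrix_(i < #|X|, j < #|X|) A (enum_val i) (enum_val j)) != 0.
Proof.
move=> h; rewrite -unitfE -[_ \is a _]/(_ \in unitmx).
pose MB : 'M[K]_#|X| := \matrix_(i, j) B (enum_val i) (enum_val j).
suff : (\matrix_(i < #|X|, j < #|X|) A (enum_val i) (enum_val j)) *m MB = 1%:M by case/mulmx1_unit.
apply/matrixP => i j; rewrite !mxE -(inj_eq enum_val_inj) -h.
rewrite [RHS](reindex _ (onW_bij _ (@enum_val_bij X))) /=.
by apply: eq_bigr => k _; rewrite !mxE.
Qed.

Lemma words_distr (A : comNzRingType) (X : finType) l (f : 'I_l -> X -> A) :
  \prod_j \sum_x f j x = \sum_(w : {ffun 'I_l -> X}) \prod_j f j (w j).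
Proof. exact: bigA_distr_bigA. Qed.

Lemma words_delta (A : comNzRingType) (X : finType) l (s : A) (z w : {ffun 'I_l -> X}) :
  \prod_j (s *+ (z j == w j)) = s ^+ l *+ (z == w).
Proof.
case: eqP => [->|zw]; first by rewrite (eq_bigr (fun=> s)) ?prodr_const ?card_ord // => j _; rewrite eqxx.
have /existsP [j hj] : [exists j, z j != w j].
  rewrite -negb_forall; apply/negP => /forallP h; apply: zw; apply/ffunP => j; exact/eqP.
by rewrite (bigD1 j) //= (negPf hj) mul0r.
Qed.

Lemma mulrBB (A : comNzRingType) (x1 x2 y1 y2 : A) : x2 * y2 - x1 * y1 = x2 * (y2 - y1) + y1 * (x2 - x1).
Proof. ring. Qed.

Lemma rmorph_prod2 (A B D : comNzRingType) (f : {rmorphism A -> B}) (h : {rmorphism B -> D})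
  (J : finType) (x : J -> A) : h (f (\prod_j x j)) = \prod_j h (f (x j)).
Proof. by rewrite !rmorph_prod. Qed.

Lemma rmorph_prodM (A B D : comNzRingType) (f : {rmorphism A -> D}) (h : {rmorphism B -> D})
  (J : finType) (x : J -> A) (y : J -> B) : f (\prod_j x j) * h (\prod_j y j) = \prod_j (f (x j) * h (y j)).
Proof. by rewrite !rmorph_prod big_split. Qed.

Lemma twist_rearrange (A B : comNzRingType) (f : {rmorphism A -> B}) d t b x b' :
  b' * f d = f b -> f d * (f t - b' * f x) = f (d * t - b * x).
Proof. by move=> h; rewrite rmorphB !rmorphM -h; ring. Qed.

Lemma dvdp_prod_cong (E : fieldType) (H : {poly E}) (J : finType) (f g : J -> {poly E}) :
  (forall j, H %| f j - g j) -> H %| \prod_j f j - \prod_j g j.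
Proof.
move=> h; elim/big_ind2: _ => [|x1 x2 y1 y2 hx hy|j _]; first by rewrite subrr.
  by rewrite mulrBB dvdp_add // dvdp_mull.
exact: h.
Qed.

(** * Tensor powers of a system of eigenfunctions *)

Section Letters.
Context (F : finFieldType) (R : realType) (C : Cinfty F R).
Local Notation q := #|F|.
Local Notation th := (theta C).
Local Notation fA := (map_poly (ofF C)).
Local Notation Phi := {fraction {poly C}}.
Local Notation Dx := {poly (bser C)}.
Local Notation jP := (@jP F R C).
Local Notation btX := (@btX F R C).
Local Notation pX := (map_poly (@pbs F R C)).
Local Notation tofp := (map_poly (@tofrac (bser C))).
Local Notation ipX := (map_poly (@ips F R C)).
Context (g : C) (h0 : {poly {poly F}}) (h0g : EVA g h0 = 0).
Context (h0_irr : irreducible_poly (map_poly (@tofrac {poly F}) h0)).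
Local Notation cong0 := (@cong0 F R C h0).
Local Notation HF := (map_poly (kaf C) (map_poly (@tofrac {poly F}) h0)).
Local Notation Hb := (map_poly (@tofrac (bser C) \o @pbs F R C \o fA) h0).
Local Notation EV := (EVD g).
Context (X : finType) (v : X -> bser C) (M : X -> X -> Dx) (N : X -> X -> {poly {poly C}}).
Context (e : X -> Dx) (B : X -> X -> {poly C}) (s : {poly {poly C}}).
Context (eE : forall x, e x = \sum_z (v z)%:P * M z x).
Context (MN : forall z w, cong0 (\sum_x M z x * pX (N x w) - pX s *+ (z == w))).
Context (s_neq0 : EV (pX s) != 0).
Context (vB : forall z, btw (v z) = \sum_w pbs (B z w) * v w).
Context (B_Kbar : forall z w k, Kbar C (B z w)`_k).
Context (B_inv : forall m, exists Bi : X -> X -> C, forall z w,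
  \sum_x (B z x).[frin m th] * Bi x w = (z == w)%:R).
Context (M_Kbar : forall z x, Kbar C (EV (M z x))).
Context (d : X -> {poly C}) (d_neq0 : forall x, d x != 0) (bD : X -> Dx) (bF : X -> {poly Phi}).
Context (tau_letter : forall x, cong0 (jP (d x) * btX (e x) - bD x * e x)).
Context (bFD : forall x, ipX (bF x) * tofp (jP (d x)) = tofp (bD x)).
Context (bF_cop : forall x, coprimep (bF x) HF).
Context (l : nat).
Local Notation W := {ffun 'I_l -> X}.
Implicit Types (m w z : W).
Local Notation vw := (fun w : W => \prod_j v (w j)).
Local Notation ew := (fun w : W => \prod_j e (w j)).

(** Words of length [l] index the tensor power of the system, whose matrix is a product of entries
    of [B]. Repeating commutative monomials is harmless and keeps the difference system explicit. *)
Lemma words_abp (rho : W -> C) : (forall w, Kbar C (rho w)) -> \sum_w rho w * bev (vw w) = 0 ->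
  exists P : W -> {poly C}, \sum_w pbs (P w) * vw w = 0 /\ forall w, (P w).[th] = rho w.
Proof.
move=> rK rel; have [rn|r0] := boolp.pselect (exists w, rho w != 0); last first.
  exists (fun=> 0); split; first by apply: big1 => w _; rewrite rmorph0 mul0r.
  move=> w; rewrite horner0; apply/esym/eqP/negPn/negP => h; apply: r0; by exists w.
pose Bw (i j : 'I_#|{: W}|) := \prod_k B ((enum_val i : W) k) ((enum_val j : W) k).
have sumE (G : zmodType) (f : W -> G) : \sum_w f w = \sum_(i < #|{: W}|) f (enum_val i).
  by rewrite (reindex _ (onW_bij _ (@enum_val_bij {: W}))).
have BwE i j : (\matrix_(i, j) Bw i j) i j = Bw i j by rewrite mxE.
have [|i|i|i|k|i|||P [PK hP Pth]] := @abp F R C #|{: W}| (\matrix_(i, j) Bw i j)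
  (fun i => bs_val (vw (enum_val i))) (fun i => bev (vw (enum_val i))) (fun i => rho (enum_val i)).
- move=> i j k; rewrite BwE /Bw; elim/big_rec: _ k => [|a p _ IH] k.
    by rewrite coef1; case: eqP => _; [exact: Kbar1|exact: Kbar0].
  by rewrite coefM; apply: Kbar_sum => t _; apply: KbarM => //; exact: B_Kbar.
- rewrite -[LHS]/(bs_val (btw _)) rmorph_prod (eq_bigr _ (fun j _ => vB _)) words_distr sumE rmorph_sum.
  apply: eq_bigr => j _; rewrite BwE.
  transitivity (bs_val (pbs (Bw i j) * vw (enum_val j))); last exact: rmorphM.
  by congr bs_val; rewrite big_split /=; congr (_ * _); rewrite /Bw rmorph_prod.
- have [M0 hM] := bserP (vw (enum_val i)); exists M0; apply: nb_radius hM; first exact: ler0n.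
  exact: ltW (ro1_gt F R).
- exact: bevP.
- have [Bi hBi] := B_inv k.
  have -> : map_mx (horner_eval (frin k th)) (\matrix_(i, j) Bw i j) =
    \matrix_(i, j) ((fun z w : W => \prod_t (B (z t) (w t)).[frin k th]) (enum_val i) (enum_val j)).
    by apply/matrixP => i j; rewrite !mxE /Bw -[LHS]/(horner_eval _ _) rmorph_prod.
  apply: (@finfun_det _ _ (fun z w : W => \prod_t (B (z t) (w t)).[frin k th])
    (fun z w : W => \prod_t Bi (z t) (w t))) => z w.
  transitivity (\prod_t \sum_x (B (z t) x).[frin k th] * Bi x (w t)).
    by rewrite words_distr; apply: eq_bigr => x _; rewrite big_split.
  by rewrite (eq_bigr _ (fun t _ => hBi _ _)) (words_delta 1) expr1n.
- exact: rK.
- by case: rn => w hw; exists (enum_rank w); rewrite enum_rankK.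
- by rewrite -[RHS]rel [RHS]sumE.
exists (fun w => P (enum_rank w)); split; last by move=> w; rewrite Pth enum_rankK.
have E0 : bs_val (0 : bser C) = 0 by exact: rmorph0.
apply: bs_inj; rewrite E0 -[RHS]hP sumE rmorph_sum; apply: eq_bigr => i _; rewrite enum_valK.
exact: rmorphM.
Qed.

Lemma e_inv (w : X) : cong0 (\sum_x pX (N x w) * e x - pX s * (v w)%:P).
Proof.
have -> : \sum_x pX (N x w) * e x - pX s * (v w)%:P =
    \sum_z (v z)%:P * (\sum_x M z x * pX (N x w) - pX s *+ (z == w)).
  transitivity (\sum_z (v z)%:P * \sum_x M z x * pX (N x w) - \sum_z (v z)%:P * (pX s *+ (z == w))).
    congr (_ - _).
      rewrite (eq_bigr (fun x => \sum_z (v z)%:P * (M z x * pX (N x w)))); last first.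
        by move=> x _; rewrite eE mulr_sumr; apply: eq_bigr => z _; rewrite mulrC mulrA.
      by rewrite exchange_big; apply: eq_bigr => z _; rewrite mulr_sumr.
    rewrite (bigD1 w) //= eqxx mulr1n big1 ?addr0 1?mulrC // => z /negPf ->.
    by rewrite mulr0n mulr0.
  by rewrite -sumrB; apply: eq_bigr => z _; rewrite mulrBr.
by apply: cong0_sum => z _; apply: cong0M.
Qed.

Lemma cong0_prod (J : finType) (f f' : J -> Dx) :
  (forall j, cong0 (f j - f' j)) -> cong0 (\prod_j f j - \prod_j f' j).
Proof.
move=> h; elim/big_ind2: _ => [|x1 x2 y1 y2 hx hy|j _]; first by rewrite subrr; apply: cong0_0.
  by rewrite mulrBB; apply: cong0D; apply: cong0M.
exact: h.
Qed.

(** The relation [P] rewritten in words of eigenfunctions, by inverting [M] letter by letter; each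
    letter leaves a factor [s]. *)
Definition cword (P : W -> {poly C}) (m : W) : {poly {poly C}} :=
  \sum_w (P w)%:P * \prod_j N (m j) (w j).

Lemma cword_relation P : \sum_w pbs (P w) * vw w = 0 -> cong0 (\sum_m pX (cword P m) * ew m).
Proof.
move=> hP.
have -> : \sum_m pX (cword P m) * ew m =
    \sum_w (pbs (P w))%:P * (\prod_j \sum_x pX (N x (w j)) * e x - pX s ^+ l * (vw w)%:P).
  transitivity (\sum_w (pbs (P w))%:P * \prod_j \sum_x pX (N x (w j)) * e x -
      pX s ^+ l * (\sum_w pbs (P w) * vw w)%:P).
    rewrite hP polyC0 mulr0 subr0.
    rewrite (eq_bigr (fun m : W => \sum_w (pbs (P w))%:P * \prod_j (pX (N (m j) (w j)) * e (m j)))).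
      by rewrite exchange_big; apply: eq_bigr => w _; rewrite -mulr_sumr words_distr.
    move=> m _; rewrite /cword rmorph_sum mulr_suml; apply: eq_bigr => w _.
    by rewrite rmorphM rmorph_prod /= map_polyC -mulrA -big_split.
  rewrite rmorph_sum mulr_sumr -sumrB; apply: eq_bigr => w _.
  by rewrite mulrBr rmorphM /= mulrCA.
apply: cong0_sum => w _; apply: cong0M.
have -> : pX s ^+ l * (vw w)%:P = \prod_j (pX s * (v (w j))%:P).
  by rewrite big_split /= prodr_const card_ord rmorph_prod.
by apply: cong0_prod => j; apply: e_inv.
Qed.

Lemma NM_EV x y : \sum_z EV (pX (N x z)) * EV (M z y) = EV (pX s) *+ (x == y).
Proof.
have hyp (z w : X) : \sum_x EV (M z x) * EV (pX (N x w)) = EV (pX s) *+ (z == w).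
  have := cong0_EVD h0g (MN z w); rewrite rmorphB rmorph_sum rmorphMn /= => /eqP.
  by rewrite subr_eq0 => /eqP <-; apply: eq_bigr => t _; rewrite rmorphM.
exact: (finfun_mulVC s_neq0 hyp x y).
Qed.

(** If the values of [P] at [theta] come from a relation [a] between eigenvector values, the
    rewriting at the point gives back [a], up to the factor [s] of each letter. *)
Lemma cword_EV P (a : W -> C) m :
  (forall w, (P w).[th] = \sum_m a m * \prod_j EV (M (w j) (m j))) ->
  EV (pX (cword P m)) = EV (pX s) ^+ l * a m.
Proof.
move=> hP.
have -> : EV (pX (cword P m)) = \sum_w (P w).[th] * \prod_j EV (pX (N (m j) (w j))).
  rewrite /cword !rmorph_sum; apply: eq_bigr => w _.
  by rewrite !rmorphM !rmorph_prod /= map_polyC EVD_C bev_pbs.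
transitivity (\sum_m' a m' * \prod_j \sum_z EV (pX (N (m j) z)) * EV (M z (m' j))).
  under eq_bigr => w _ do rewrite hP mulr_suml.
  rewrite exchange_big; apply: eq_bigr => m' _; rewrite words_distr mulr_sumr.
  by apply: eq_bigr => w _; rewrite -mulrA -big_split /=; congr (_ * _); apply: eq_bigr => j _; rewrite mulrC.
rewrite (bigD1 m) //= [X in _ + X]big1 ?addr0; last first.
  move=> m' mm; rewrite (eq_bigr _ (fun j _ => NM_EV _ _)) words_delta.
  by rewrite eq_sym (negPf mm) mulr0n mulr0.
by rewrite (eq_bigr _ (fun j _ => NM_EV _ _)) words_delta eqxx mulr1n mulrC.
Qed.

Lemma ipX_HF : ipX HF = Hb.
Proof. by rewrite HFE -map_poly_comp; apply: eq_map_poly => a /=; rewrite ips_tofrac. Qed.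
Lemma ipX_tofrac p : ipX (map_poly (@tofrac {poly C}) p) = tofp (pX p).
Proof. by rewrite -!map_poly_comp; apply: eq_map_poly => a /=; rewrite ips_tofrac. Qed.
Lemma tasX_Hb : map_poly (@tas F R C) Hb = Hb.
Proof.
by rewrite -map_poly_comp; apply: eq_map_poly => a /=; rewrite tas_tofrac btw_pbs ptw_ofF.
Qed.
Lemma tasX_ipX p : map_poly (@tas F R C) (ipX p) = ipX (taX (@taf F R C) p).
Proof. by rewrite /taX -!map_poly_comp; apply: eq_map_poly => a /=; rewrite tas_ips. Qed.
Lemma tasX_tofp p : map_poly (@tas F R C) (tofp p) = tofp (btX p).
Proof. by rewrite /btX -!map_poly_comp; apply: eq_map_poly => a /=; rewrite tas_tofrac. Qed.

Lemma letter_tau x : Hb %| tofp (btX (e x)) - ipX (bF x) * tofp (e x).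
Proof.
have d0 : tofrac (pbs (d x)) != 0 :> {fraction (bser C)}.
  by rewrite tofrac_eq0 -(rmorph0 (@pbs F R C)) (inj_eq (@pbs_inj F R C)).
have dE : tofp (jP (d x)) = (tofrac (pbs (d x)))%:P by rewrite map_polyC.
rewrite -(dvdpZr _ _ d0) -mul_polyC -dE.
rewrite (twist_rearrange (f := tofp) _ _ (bFD x)).
exact: cong0_dvd.
Qed.

Definition word_rel (c : W -> {poly Phi}) := Hb %| \sum_m ipX (c m) * tofp (ew m).

(** Frobenius multiplies the word [m] by the product of the multipliers of its letters, so word
    relations form a module of the kind treated by [relation_split]. *)
Lemma word_rel_tau c : word_rel c -> word_rel (fun m => taX (@taf F R C) (c m) * \prod_j bF (m j)).
Proof.
rewrite /word_rel => h; have : map_poly (@tas F R C) Hb %| map_poly (@tas F R C) (\sum_m ipX (c m) * tofp (ew m)).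
  by rewrite dvdp_map.
rewrite tasX_Hb rmorph_sum => h1.
rewrite -(dvdp_subr _ h1) -sumrB; apply: (big_ind (fun p => Hb %| p)) => [|x y|m _]; first exact: dvdp0.
  exact: dvdp_add.
rewrite [X in X - _]rmorphM /= tasX_ipX tasX_tofp [ipX (_ * _)]rmorphM /= -mulrA -mulrBr dvdp_mull //.
have -> : tofp (btX (\prod_j e (m j))) = \prod_j tofp (btX (e (m j))) by exact: rmorph_prod2.
have -> : ipX (\prod_j bF (m j)) * tofp (\prod_j e (m j)) = \prod_j (ipX (bF (m j)) * tofp (e (m j))).
  exact: rmorph_prodM.
by apply: dvdp_prod_cong => j; apply: letter_tau.
Qed.

(** Lift the numerical relation to functions, rewrite it in eigenfunctions, keep the classes
    selected by [T], and evaluate at the point again. *)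
Lemma word_split (a : W -> C) (T : pred W) : (forall m, Kbar C (a m)) ->
  (forall m m' p, coprimep p HF -> HF %| taX (@taf F R C) p * \prod_j bF (m j) - (\prod_j bF (m' j)) * p ->
     T m = T m') ->
  \sum_m a m * \prod_j EV (e (m j)) = 0 -> \sum_(m | T m) a m * \prod_j EV (e (m j)) = 0.
Proof.
move=> aK T_cl rel.
have EVe x : EV (e x) = \sum_z bev (v z) * EV (M z x).
  by rewrite eE rmorph_sum; apply: eq_bigr => z _; rewrite rmorphM /= EVD_C.
have EVew m : \prod_j EV (e (m j)) = \sum_w bev (vw w) * \prod_j EV (M (w j) (m j)).
  rewrite (eq_bigr _ (fun j _ => EVe _)) words_distr; apply: eq_bigr => w _.
  by rewrite big_split /= rmorph_prod.
pose rho w := \sum_m a m * \prod_j EV (M (w j) (m j)).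
have [w||P [hP Pth]] := @words_abp rho.
- apply: Kbar_sum => m _; apply: KbarM => //; elim/big_rec: _ => [|j p _ IH]; first exact: Kbar1.
  exact: KbarM.
- rewrite -[RHS]rel (eq_bigr _ (fun m _ => congr1 _ (EVew m))).
  transitivity (\sum_w \sum_m a m * (bev (vw w) * \prod_j EV (M (w j) (m j)))).
    by apply: eq_bigr => w _; rewrite mulr_suml; apply: eq_bigr => m _; rewrite -mulrA [_ * bev _]mulrC.
  by rewrite exchange_big; apply: eq_bigr => m _; rewrite mulr_sumr.
have R1 : word_rel (fun m => map_poly (@tofrac {poly C}) (cword P m)).
  rewrite /word_rel (eq_bigr (fun m => tofp (pX (cword P m) * ew m))); last first.
    by move=> m _; rewrite ipX_tofrac [RHS]rmorphM.
  by rewrite -rmorph_sum; apply: cong0_dvd; apply: cword_relation.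
have R2 : word_rel (fun m => if T m then map_poly (@tofrac {poly C}) (cword P m) else 0).
  apply: (@relation_split _ _ _ _ (@taf_kaf F R C) (@taf_fixed F R C) _ h0_irr W
    (fun m => \prod_j bF (m j)) _ word_rel _ _ _ _ T T_cl _ R1).
  - by move=> m; elim/big_rec: _ => [|j p _ IH]; [exact: coprime1p|rewrite coprimepMl bF_cop].
  - move=> c c' h h'; rewrite /word_rel (eq_bigr (fun m => ipX (c m) * tofp (ew m) + ipX (c' m) * tofp (ew m))).
      by rewrite big_split dvdp_add.
    by move=> m _; rewrite rmorphD mulrDl.
  - move=> b c h; rewrite /word_rel (eq_bigr (fun m => ipX b * (ipX (c m) * tofp (ew m)))).
      by rewrite -mulr_sumr dvdp_mull.
    by move=> m _; rewrite rmorphM -mulrA.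
  - exact: word_rel_tau.
  - move=> c h; rewrite /word_rel; apply: (big_ind (fun p => Hb %| p)) => [|x y|m _]; first exact: dvdp0.
      exact: dvdp_add.
    by apply: dvdp_mulr; rewrite -ipX_HF dvdp_map; exact: h.
have R3 : Hb %| tofp (\sum_(m | T m) pX (cword P m) * ew m).
  rewrite big_mkcond rmorph_sum; move: R2; rewrite /word_rel; congr (Hb %| _).
  apply: eq_bigr => m _; case: (T m); last by rewrite !rmorph0 mul0r.
  by rewrite ipX_tofrac [RHS]rmorphM.
have := bev_dvd (h0_neq0 h0_irr) h0g R3; rewrite -[_.[g]]/(EV _) rmorph_sum.
rewrite (eq_bigr (fun m => EV (pX s) ^+ l * (a m * \prod_j EV (e (m j))))); last first.
  by move=> m _; rewrite rmorphM rmorph_prod /= (cword_EV m Pth) mulrA.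
by rewrite -mulr_sumr => /eqP; rewrite mulf_eq0 expf_eq0 (negPf s_neq0) andbF => /eqP.
Qed.

End Letters.

Lemma big_option (A : nmodType) (X : finType) (f : option X -> A) :
  \sum_x f x = f None + \sum_x f (Some x).
Proof.
rewrite (bigD1 None) //=; congr (_ + _); rewrite (reindex_omap Some id) => [|[x|] //].
by apply: eq_bigl => x; rewrite /= eqxx.
Qed.

(** * Direct sums of blocks with one trivial letter *)

Section Blocks.
Context (n : nat) (r' : 'I_n -> nat).
Local Notation Lt := {i : 'I_n & 'I_(r' i).+1}.
Local Notation lt i k := (Some (Tagged (fun i => 'I_(r' i).+1) (k : 'I_(r' i).+1))).

Lemma big_Lt (A : nmodType) (f : Lt -> A) :
  \sum_x f x = \sum_i \sum_(k < (r' i).+1) f (Tagged (fun i => 'I_(r' i).+1) k).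
Proof.
rewrite (sig_big_dep (fun=> true) (fun _ _ => true) (fun i k => f (Tagged (fun i => 'I_(r' i).+1) k))) /=.
by apply: eq_bigr => -[].
Qed.

(** When the tags agree, [inord] transports the first index to the type of the second and avoids a
    dependent cast. *)
Definition blk (A : nmodType) (a : forall i, 'I_(r' i).+1 -> 'I_(r' i).+1 -> A) (a0 : A)
    (z x : option Lt) : A :=
  match z, x with
  | Some z, Some x => if tag z == tag x then a (tag x) (inord (tagged z)) (tagged x) else 0
  | None, None => a0
  | _, _ => 0
  end.

Lemma blkE (A : nmodType) a a0 i (k l : 'I_(r' i).+1) : @blk A a a0 (lt i k) (lt i l) = a i k l.
Proof. by rewrite /blk /= eqxx inord_val. Qed.
Lemma blk_neq (A : nmodType) a a0 i j (k : 'I_(r' i).+1) (l : 'I_(r' j).+1) : i != j ->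
  @blk A a a0 (lt i k) (lt j l) = 0.
Proof. by rewrite /blk /= => /negPf ->. Qed.

Lemma lt_eq i (k l : 'I_(r' i).+1) : (lt i k == lt i l :> option Lt) = (k == l).
Proof.
apply/eqP/eqP => [/Some_inj E|-> //].
by have := congr1 (fun z : Lt => inord (tagged z) : 'I_(r' i).+1) E; rewrite /= !inord_val.
Qed.
Lemma lt_neq i j (k : 'I_(r' i).+1) (l : 'I_(r' j).+1) : i != j -> (lt i k == lt j l :> option Lt) = false.
Proof. by move=> ij; apply/eqP => /Some_inj /(congr1 tag) /= E; rewrite E eqxx in ij. Qed.

Lemma blk_row (A : nzRingType) (B : nmodType) a a0 (h : A -> option Lt -> B) i (k : 'I_(r' i).+1) :
  (forall x, h 0 x = 0) ->
  \sum_x h (@blk A a a0 (lt i k) x) x = \sum_l h (a i k l) (lt i l).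
Proof.
move=> h0; rewrite big_option /= h0 add0r big_Lt (bigD1 i) //= [X in _ + X]big1 ?addr0.
  by apply: eq_bigr => l _; rewrite eqxx inord_val.
by move=> j ij; apply: big1 => l _; rewrite eq_sym (negPf ij) h0.
Qed.
Lemma blk_row0 (A : nzRingType) (B : nmodType) a a0 (h : A -> option Lt -> B) :
  (forall x, h 0 x = 0) -> \sum_x h (@blk A a a0 None x) x = h a0 None.
Proof. by move=> h0; rewrite big_option /= big1 ?addr0. Qed.
Lemma blk_col (A : nzRingType) (B : nmodType) a a0 (h : A -> option Lt -> B) i (k : 'I_(r' i).+1) :
  (forall x, h 0 x = 0) ->
  \sum_x h (@blk A a a0 x (lt i k)) x = \sum_l h (a i l k) (lt i l).
Proof.
move=> h0; rewrite big_option /= h0 add0r big_Lt (bigD1 i) //= [X in _ + X]big1 ?addr0.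
  by apply: eq_bigr => l _; rewrite eqxx inord_val.
by move=> j ij; apply: big1 => l _; rewrite (negPf ij) h0.
Qed.
Lemma blk_col0 (A : nzRingType) (B : nmodType) a a0 (h : A -> option Lt -> B) :
  (forall x, h 0 x = 0) -> \sum_x h (@blk A a a0 x None) x = h a0 None.
Proof. by move=> h0; rewrite big_option /= big1 ?addr0. Qed.
End Blocks.

Lemma Bm_Kbar (F : finFieldType) (R : realType) (C : Cinfty F R) r (phi : {poly F} -> {poly C}) :
  drinfeld_module r phi -> forall i j k, Kbar C (Bm r phi i j)`_k.
Proof.
move=> hphi i j k; rewrite mxE coef_map; apply: Kbar_frn; rewrite mxE; case: ifP => _; last first.
  by case: (_ == _); rewrite /= ?coef0 ?coef1; [case: (_ == _); [exact: Kbar1|exact: Kbar0]|exact: Kbar0].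
rewrite coefZ coefB coefMn coefX coefC; apply: KbarM; first exact/KbarV/(dcoef_Kbar hphi).
apply: KbarD; first by case: (_ == _); case: (_ == _); rewrite ?mul0rn; try exact: Kbar0; exact: Kbar1.
by apply: KbarN; case: ifP => _; [exact: dcoef_Kbar hphi _|exact: Kbar0].
Qed.

Lemma frac_subst (A0 A B D E : comNzRingType) (fa : {rmorphism A0 -> A}) (tf : {rmorphism A -> B})
  (i : {rmorphism B -> E}) (pb : {rmorphism A -> D}) (tg : {rmorphism D -> E}) (b : {poly A}) (x : {poly A0}) :
  (forall a, i (tf a) = tg (pb a)) ->
  map_poly i (map_poly polyC (map_poly tf b)).[map_poly (tf \o fa) x] =
  map_poly tg (map_poly (polyC \o pb) b).[map_poly (pb \o fa) x].
Proof.
move=> h.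
have E1 : map_poly i (map_poly tf b) = map_poly tg (map_poly pb b).
  by rewrite -!map_poly_comp; apply: eq_map_poly.
have E2 : map_poly i (map_poly (tf \o fa) x) = map_poly tg (map_poly (pb \o fa) x).
  by rewrite -!map_poly_comp; apply: eq_map_poly => a; apply: h.
by rewrite -map_subst E1 E2 map_subst [map_poly (polyC \o pb) b]map_poly_comp.
Qed.

Lemma dchoice (I : Type) (T : I -> Type) (P : forall i, T i -> Prop) :
  (forall i, exists x, P i x) -> exists f : forall i, T i, forall i, P i (f i).
Proof. by move=> h; exists (fun i => projT1 (cid (h i))) => i; exact: projT2 (cid (h i)). Qed.

(** * Monomials in the eigenvector values of all modules *)

Section CMWords.
Context (F : finFieldType) (R : realType) (C : Cinfty F R).
Local Notation th := (theta C).
Local Notation fA := (map_poly (ofF C)).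
Local Notation tm := (map_mx (horner_eval th)).
Local Notation Phi := {fraction {poly C}}.
Local Notation Dx := {poly (bser C)}.
Local Notation pX := (map_poly (@pbs F R C)).
Local Notation tofp := (map_poly (@tofrac (bser C))).
Local Notation ipX := (map_poly (@ips F R C)).
Context (n : nat) (r' : 'I_n -> nat) (phi : 'I_n -> {poly F} -> {poly C}) (lam : 'I_n -> C).
Context (X : forall i, 'M[{poly C}]_((r' i).+1)) (hA : 'I_n -> {poly {poly F}}).
Context (rt : forall i, 'I_(r' i).+1 -> C) (k0 : forall i, 'I_(r' i).+1).
Context (u : forall i, 'cV[C]_((r' i).+1)).
Context (cmd : forall i, cm_data (phi i) (lam i) (X i) (hA i) (@rt i) (k0 i) (u i)).
Context (S : finType) (ga : S -> C) (s0 : S) (h0 : {poly {poly F}}).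
Context (h0_root : forall s, EVA (ga s) h0 = 0).
Context (h0_irr : irreducible_poly (map_poly (@tofrac {poly F}) h0)).
Context (h0_sep : separable_poly (map_poly (@tofrac {poly F}) h0)).
Context (ro : forall i, 'I_(r' i).+1 -> {poly {poly F}}).
Context (ro_rt : forall i (k : 'I_(r' i).+1), EVA (ga s0) (@ro i k) = @rt i k).
Local Notation Lt := {i : 'I_n & 'I_(r' i).+1}.
Local Notation lt i k := (Some (Tagged (fun i => 'I_(r' i).+1) (k : 'I_(r' i).+1))).
Local Notation g := (ga s0).
Local Notation cong0 := (@cong0 F R C h0).
Local Notation bLx := (bL phi X u ro).
Local Notation yl i k := ((V (r' i) (phi i) (lam i) *m horner_mx (tm (X i)) (Lc (@rt i) k) *m u i) 0 0).

Definition yL (x : option Lt) : C := if x is Some y then yl (tag y) (tagged y) else 1.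
Let vL (x : option Lt) : bser C :=
  if x is Some y then vD (r' (tag y)) (phi (tag y)) (lam (tag y)) 0 (tagged y) else 1.
Let eL (x : option Lt) : Dx :=
  if x is Some y then eD (phi (tag y)) (lam (tag y)) (X (tag y)) (u (tag y)) (@ro (tag y)) (tagged y) else 1.
Let dL (x : option Lt) : {poly C} := if x is Some y then dP (X (tag y)) (u (tag y)) else 1.
Let bDL (x : option Lt) : Dx :=
  if x is Some y then btD (phi (tag y)) (X (tag y)) (u (tag y)) (@ro (tag y)) (tagged y) else 1.
Local Notation Ma := (fun i k l => MD (X i) (u i) (@ro i) k l).
Local Notation Ba := (fun i k l => Bm (r' i).+1 (phi i) l k).
Let ML := blk Ma 1.
Let BL := blk Ba 1.

Lemma EVD_pX_const x (p : {poly F}) (d : {poly C}) :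
  EVD x (pX (map_poly fA p%:P * d%:P)) = ofA C p * d.[th].
Proof. by rewrite map_polyC /= -polyCM map_polyC /= EVD_C bev_pbs hornerM ofAE. Qed.

Lemma ips_btF i k : ipX (btF (phi i) (X i) (u i) (@ro i) k) = tofp (btD (phi i) (X i) (u i) (@ro i) k).
Proof.
rewrite /btF /btD /jP /jA.
exact: (frac_subst fA (tf := @tofrac {poly C}) (i := @ips F R C) (pb := @pbs F R C)
  (tg := @tofrac (bser C)) _ _ (@ips_tofrac F R C)).
Qed.

Lemma letter_words_split l (a : {ffun 'I_l -> option Lt} -> C) (T : pred {ffun 'I_l -> option Lt}) :
  (forall m, Kbar C (a m)) ->
  (forall m m' : {ffun 'I_l -> option Lt},
    (forall s, \sum_j lw rt k0 ga ro s (m j) = \sum_j lw rt k0 ga ro s (m' j))%N -> T m = T m') ->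
  \sum_m a m * \prod_j yL (m j) = 0 -> \sum_(m | T m) a m * \prod_j yL (m j) = 0.
Proof.
move=> aK hT rel.
have /dchoice [s0_ hN] : forall i, exists s0, s0 != 0 /\ exists ND : 'M[{poly {poly C}}]_((r' i).+1),
   forall l l', cong0 ((MD (X i) (u i) (@ro i) *m map_mx pX ND) l l'
    - pX (map_poly fA s0%:P * (dP (X i) (u i))%:P) *+ (l == l')).
  move=> i; have di := cmd i.
  have [t t0 h] := MD_inverse_poly (h0_root s0) h0_irr (X i) (cd_size di) (cd_inj di) (cd_split di) (u i) (@ro_rt i).
  by exists t.
have /dchoice [sN hsN] : forall i, exists p : {poly {poly C}} * 'M[{poly {poly C}}]_((r' i).+1),
   EVD g (pX p.1) != 0 /\
   forall l l', cong0 (\sum_k MD (X i) (u i) (@ro i) l k * pX (p.2 k l') - pX p.1 *+ (l == l')).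
  move=> i; have [t0 [ND hND]] := hN i; exists (map_poly fA (s0_ i)%:P * (dP (X i) (u i))%:P, ND); split=> /=.
    rewrite EVD_pX_const mulf_neq0 //; last exact: dP_th (cd_Q (cmd i)).
    by move: t0; apply: contra => /eqP E; apply/eqP/(@ofA_inj F R C); rewrite E /ofA tofrac0 rmorph0.
  move=> a1 a2; have := hND a1 a2; congr cong0; congr (_ - _); rewrite mxE.
  by apply: eq_bigr => k _; rewrite [X in _ * X]mxE.
pose s := \prod_i (sN i).1.
have sE i : s = (\prod_(j | j != i) (sN j).1) * (sN i).1 by rewrite /s (bigD1 i) //= mulrC.
pose N := blk (fun i k l => (\prod_(j | j != i) (sN j).1) * (sN i).2 k l) s.
have pX0 : pX 0 = 0 by exact: rmorph0.
have yE x : yL x = EVD g (eL x).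
  case: x => [[i k]|] /=; last by rewrite rmorph1.
  have di := cmd i; by rewrite (EVD_eD (phi i) (lam i) (X i) (u i) (@ro_rt i)).
rewrite (eq_bigr (fun m : {ffun 'I_l -> option Lt} => a m * \prod_j EVD g (eL (m j)))); last first.
  by move=> m _; congr (_ * _); apply: eq_bigr => j _.
have rel' : \sum_m a m * \prod_j EVD g (eL (m j)) = 0.
  by rewrite -[RHS]rel; apply: eq_bigr => m _; congr (_ * _); apply: eq_bigr => j _.
move: rel'; apply: (@word_split F R C g h0 (h0_root s0) h0_irr _ vL ML N eL BL s _ _ _ _ _ _ _ dL _ bDL bLx) => //.
- case=> [[i k]|].
    transitivity (\sum_l (vL (lt i l))%:P * MD (X i) (u i) (@ro i) l k); first exact: eDE.
    exact: (esym (@blk_col n r' Dx Dx Ma 1 (fun c z => (vL z)%:P * c) i k (fun x => mulr0 _))).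
  rewrite [RHS](@blk_col0 n r' Dx Dx Ma 1 (fun c z => (vL z)%:P * c) (fun x => mulr0 _)).
  by rewrite /= mulr1.
- case=> [[i k]|] w.
    rewrite [X in cong0 (X - _)](@blk_row n r' Dx Dx Ma 1 (fun c x => c * pX (N x w)) i k (fun x => mul0r _)).
    case: w => [[j l']|]; last first.
      rewrite big1 => [|x _]; last by rewrite /N /= pX0 mulr0.
      by rewrite mulr0n subr0; apply: cong0_0.
    have [E|ij] := eqVneq i j; last first.
      rewrite big1 => [|x _]; last by rewrite /N blk_neq // pX0 mulr0.
      by rewrite lt_neq // mulr0n subr0; apply: cong0_0.
    subst j; rewrite lt_eq.
    have -> : \sum_l MD (X i) (u i) (@ro i) k l * pX (N (lt i l) (lt i l')) - pX s *+ (k == l') =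
      pX (\prod_(j | j != i) (sN j).1) *
       (\sum_l MD (X i) (u i) (@ro i) k l * pX ((sN i).2 l l') - pX (sN i).1 *+ (k == l')).
      rewrite mulrBr mulrnAr -[pX _ * pX (sN i).1]rmorphM -(sE i) mulr_sumr; congr (_ - _).
      by apply: eq_bigr => t _; rewrite /N blkE [pX (_ * _)]rmorphM mulrCA.
    by apply: cong0M; exact: (hsN i).2.
  rewrite [X in cong0 (X - _)](@blk_row0 n r' Dx Dx Ma 1 (fun c x => c * pX (N x w)) (fun x => mul0r _)).
  case: w => [w|]; first by rewrite /N /= pX0 mulr0 mulr0n subr0; apply: cong0_0.
  by rewrite /N /= mul1r ?eqxx mulr1n subrr; apply: cong0_0.
- rewrite /s !rmorph_prod; apply/prodf_neq0 => i _; exact: (hsN i).1.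
- have H0 z : pbs (0 : {poly C}) * vL z = 0 by rewrite rmorph0 mul0r.
  case=> [[i k]|]; last first.
    rewrite [RHS](@blk_row0 n r' {poly C} (bser C) Ba 1 (fun c z => pbs c * vL z) H0).
    by rewrite /= !rmorph1 mul1r.
  rewrite [RHS](@blk_row n r' {poly C} (bser C) Ba 1 (fun c z => pbs c * vL z) i k H0).
  have := congr1 (fun M : 'rV_((r' i).+1) => M 0 k) (vD_tw (cd_phi (cmd i)) (cd_lat (cmd i))).
  rewrite [LHS]mxE [RHS]mxE => E; apply: etrans E _; apply: eq_bigr => j _.
  by rewrite [map_mx _ _ _ _]mxE mulrC.
- case=> [[i k]|] [[j l']|] t; rewrite /BL /blk /=; try (by rewrite coef0; apply: Kbar0).
    by case: eqP => _; [exact: Bm_Kbar (cd_phi (cmd j)) _ _ _|rewrite coef0; apply: Kbar0].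
  by rewrite coef1; case: eqP => _; [apply: Kbar1|apply: Kbar0].
- move=> t; pose Bt i : 'M[C]_((r' i).+1) := \matrix_(k, l) (Bm (r' i).+1 (phi i) l k).[frin t th].
  have Bu i : Bt i \in unitmx.
    have -> : Bt i = (map_mx (horner_eval (frin t th)) (Bm (r' i).+1 (phi i)))^T.
      by apply/matrixP => a1 a2; rewrite [LHS]mxE [RHS]mxE [RHS]mxE.
    rewrite unitmxE det_tr det_map_mx unitfE (det_Bm (cd_phi (cmd i))) /= /horner_eval hornerZ hornerXsubC.
    rewrite mulf_neq0 //; last first.
      rewrite subr_eq0; apply/eqP => E; have := @frn_theta_inj F R C 0%N (t + 1)%N.
      by rewrite /= frn0 frnD -E frinK addn1 => /(_ erefl).
    rewrite mulf_neq0 ?signr_eq0 // fmorph_eq0 invr_eq0; exact: dcoef_lead (cd_phi (cmd i)).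
  exists (blk (fun i k l => invmx (Bt i) k l) 1) => z w.
  have H0 x : (0 : {poly C}).[frin t th] * blk (fun i k l => invmx (Bt i) k l) 1 x w = 0 by rewrite horner0 mul0r.
  case: z => [[i k]|].
    rewrite [LHS](@blk_row n r' {poly C} C Ba 1 (fun c x => c.[frin t th] * blk (fun i k l => invmx (Bt i) k l) 1 x w) i k H0).
    case: w {H0} => [[j l']|]; last by rewrite big1 // => x _; rewrite mulr0.
    have [E|ij] := eqVneq i j; last first.
      by rewrite lt_neq // big1 // => x _; rewrite blk_neq // mulr0.
    subst j; rewrite lt_eq.
    have := congr1 (fun M : 'M[C]_((r' i).+1) => M k l') (mulmxV (Bu i)).
    rewrite [LHS]mxE [RHS]mxE => <-; apply: eq_bigr => x _; rewrite blkE; congr (_ * _).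
    by rewrite [RHS]mxE.
  rewrite [LHS](@blk_row0 n r' {poly C} C Ba 1 (fun c x => c.[frin t th] * blk (fun i k l => invmx (Bt i) k l) 1 x w) H0).
  by case: w {H0} => [w|]; rewrite /= ?mulr0 // -polyC1 hornerC mul1r.
- case=> [[i k]|] [[j l']|]; rewrite /ML /blk /=; try (by rewrite rmorph0; apply: Kbar0).
    case: eqP => _; last by rewrite rmorph0; apply: Kbar0.
    have dj := cmd j; rewrite (EVD_MD (X j) (u j) (@ro_rt j)).
    apply: kbM_mul (cd_u dj) _ _; apply: kbM_horner => [a1 a2|t].
      by rewrite mxE; apply: Kbar_horner; try exact: Kbar_theta; move=> t; exact: (cd_XK dj a1 a2 t).
    exact: Lc_Kbar (cd_rt dj) _ _.
  by rewrite rmorph1; apply: Kbar1.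
- by case=> [[i k]|] /=; [exact: dP_neq0 (cd_Q (cmd i))|exact: oner_neq0].
- case=> [[i k]|] /=; last by rewrite !rmorph1 mul1r subrr; apply: cong0_0.
  have di := cmd i; exact: (tau_e (h0_root s0) h0_irr (cd_phi di) (cd_lat di) (cd_XB di) (cd_hX di) (cd_split di) (u i) (@ro_rt i) k).
- case=> [[i k]|] /=; last by rewrite !rmorph1 mul1r.
  have d0 : tofrac (pbs (dP (X i) (u i))) != 0 :> {fraction (bser C)}.
    by rewrite tofrac_eq0 -(rmorph0 (@pbs F R C)) (inj_eq (@pbs_inj F R C)) (dP_neq0 (cd_Q (cmd i))).
  have -> : tofp (jP (dP (X i) (u i))) = (tofrac (pbs (dP (X i) (u i))))%:P by rewrite map_polyC.
  rewrite [ipX _]rmorphM /= ips_btF map_polyC /= mulrAC -polyCM.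
  have -> : ips (tofrac (dP (X i) (u i)))^-1 = (tofrac (pbs (dP (X i) (u i))))^-1.
    exact: etrans (fmorphV _ _) (congr1 _ (ips_tofrac _)).
  by rewrite mulVf // mul1r.
- by move=> x; exact: (bL_cop cmd h0_root h0_irr ro_rt).
- move=> m m' p cp hp; apply: hT; exact: (ord_eq cmd h0_root h0_irr h0_sep ro_rt cp hp).
Qed.

(** Keeping only the words with the same weights as [ms i0] isolates a single term, and no
    eigenvector value is zero. *)
Lemma letter_words_free l (I : finType) (ms : I -> {ffun 'I_l -> option Lt}) (a : I -> C) :
  (forall x, yL x != 0) -> (forall i, Kbar C (a i)) ->
  (forall i j, (forall s, \sum_t lw rt k0 ga ro s (ms i t) = \sum_t lw rt k0 ga ro s (ms j t))%N -> i = j) ->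
  \sum_i a i * \prod_j yL (ms i j) = 0 -> forall i, a i = 0.
Proof.
move=> y0 aK inj rel i0.
pose T (m : {ffun 'I_l -> option Lt}) :=
  [forall s, \sum_j lw rt k0 ga ro s (m j) == \sum_j lw rt k0 ga ro s (ms i0 j)]%N.
pose a' m := \sum_(i | ms i == m) a i.
have tot (P : pred {ffun 'I_l -> option Lt}) : \sum_(m | P m) a' m * \prod_j yL (m j) =
    \sum_(i | P (ms i)) a i * \prod_j yL (ms i j).
  rewrite (partition_big ms P) //; apply: eq_bigr => m Pm; rewrite mulr_suml.
  apply: eq_big => [i|i /eqP -> //]; by case: eqP => [->|]; rewrite ?Pm ?andbF.
have h : \sum_(m | T m) a' m * \prod_j yL (m j) = 0.
  apply: letter_words_split => [m|m m' hm|]; first exact: Kbar_sum.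
    by apply: eq_forallb => s; rewrite hm.
  by rewrite (tot predT).
have := h; rewrite (tot T) (bigD1 i0) /=; last by apply/forallP => s.
rewrite [X in _ + X]big1 ?addr0 => [|i /andP [/forallP Ti /eqP ii0]]; last first.
  by case: ii0; apply: inj => s; exact/eqP.
have p0 : \prod_j yL (ms i0 j) != 0 by apply/prodf_neq0 => j _; apply: y0.
by move=> /eqP; rewrite mulf_eq0 (negPf p0) orbF => /eqP.
Qed.
End CMWords.

(** A monomial of degree at most [D] is spelled as a word of length [D], with [None] in the
    remaining places; relations of mixed degree thus become homogeneous. *)
Lemma word_of_exponents (X : finType) (f : X -> nat) D : (\sum_x f x <= D)%N ->
  exists w : {ffun 'I_D -> option X},
    (forall (A : comNzRingType) (G : option X -> A), G None = 1 ->
       \prod_j G (w j) = \prod_x G (Some x) ^+ f x) /\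
    (forall G : option X -> nat, G None = 0%N -> (\sum_j G (w j) = \sum_x G (Some x) * f x)%N).
Proof.
move=> hD.
pose s := flatten [seq nseq (f x) (Some x) | x <- enum X] ++ nseq (D - \sum_x f x) None.
have ss : size s = D.
  rewrite size_cat size_flatten size_nseq /shape -map_comp sumnE big_map big_enum /=.
  by under eq_bigr => x _ do rewrite size_nseq; rewrite subnKC.
exists [ffun j : 'I_D => nth None s j]; split=> [A G G0|G G0].
  transitivity (\prod_(z <- s) G z).
    by rewrite (big_nth None) ss big_mkord; apply: eq_bigr => j _; rewrite ffunE.
  rewrite big_cat big_flatten big_map big_enum /= big_nseq G0 iter_mulr_1 expr1n mulr1.
  by apply: eq_bigr => x _; rewrite big_nseq iter_mulr_1.
transitivity (\sum_(z <- s) G z)%N.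
  by rewrite (big_nth None) ss big_mkord; apply: eq_bigr => j _; rewrite ffunE.
rewrite big_cat big_flatten big_map big_enum /= big_nseq G0 iter_addn_0 mul0n addn0.
by apply: eq_bigr => x _; rewrite big_nseq iter_addn_0.
Qed.

Lemma comp_scaleX_inj (E : fieldType) (be : E) : be != 0 -> injective (comp_poly (be *: 'X)).
Proof.
move=> be0 p q /(congr1 (fun p => p \Po (be^-1 *: 'X))); rewrite /= -!comp_polyA.
have -> : (be *: 'X) \Po (be^-1 *: 'X) = 'X :> {poly E}.
  by rewrite comp_polyZ comp_polyX scalerA mulfV // scale1r.
by rewrite !comp_polyXr.
Qed.

Lemma scale_roots (E : fieldType) r (be : E) (a z : 'I_r -> E) : be != 0 ->
  'X^r - \sum_j a j *: 'X^j = \prod_k ('X - (z k)%:P) ->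
  'X^r - \sum_j (a j * be ^+ (r - j)) *: 'X^j = \prod_k ('X - (be * z k)%:P).
Proof.
move=> be0 h; apply: (comp_scaleX_inj be0).
have -> : comp_poly (be *: 'X) (\prod_k ('X - (be * z k)%:P)) = be ^+ r *: \prod_k ('X - (z k)%:P).
  rewrite rmorph_prod /= (eq_bigr (fun k => be%:P * ('X - (z k)%:P))).
    by rewrite big_split /= prodr_const card_ord -polyC_exp mul_polyC.
  by move=> k _; rewrite comp_polyB comp_polyX comp_polyC polyCM mulrBr !mul_polyC.
rewrite -h comp_polyB comp_Xn_poly exprZn scalerBr; congr (_ - _).
rewrite raddf_sum /= scaler_sumr; apply: eq_bigr => j _.
rewrite comp_polyZ comp_Xn_poly exprZn !scalerA; congr (_ *: _).
by rewrite -mulrA -exprD subnK 1?mulrC // (ltnW (ltn_ord j)).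
Qed.

Lemma irreducible_polyZ (E : fieldType) (c : E) (p : {poly E}) : c != 0 ->
  irreducible_poly p -> irreducible_poly (c *: p).
Proof.
move=> c0 [s h]; split; first by rewrite size_scale.
move=> q q1; rewrite dvdpZr // => /(h q q1) e; apply: eqp_trans e _; rewrite eqp_sym; exact: eqp_scale.
Qed.

Section Subfields.
Context (C : fieldType) (L : set C) (hL : is_subfield L).
Lemma sf1 : L 1. Proof. by case: hL => h _ _; exact: set_mem h. Qed.
Lemma sfB x y : L x -> L y -> L (x - y).
Proof. by case: hL => _ h _ /mem_set hx /mem_set hy; exact: set_mem (h _ _ hx hy). Qed.
Lemma sf_div x y : L x -> L y -> L (x / y).
Proof. by case: hL => _ _ h /mem_set hx /mem_set hy; exact: set_mem (h _ _ hx hy). Qed.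
Lemma sf0 : L 0. Proof. by have := sfB sf1 sf1; rewrite subrr. Qed.
Lemma sfN x : L x -> L (- x). Proof. by move=> h; have := sfB sf0 h; rewrite sub0r. Qed.
Lemma sfD x y : L x -> L y -> L (x + y). Proof. by move=> hx /sfN hy; have := sfB hx hy; rewrite opprK. Qed.
Lemma sfV x : L x -> L x^-1. Proof. by move=> h; have := sf_div sf1 h; rewrite mul1r. Qed.
Lemma sfM x y : L x -> L y -> L (x * y). Proof. by move=> hx /sfV hy; have := sf_div hx hy; rewrite invrK. Qed.
Lemma sf_sum (I : Type) (s : seq I) (P : pred I) (f : I -> C) : (forall i, P i -> L (f i)) -> L (\sum_(i <- s | P i) f i).
Proof. by move=> h; elim/big_ind: _ => //; [exact: sf0|exact: sfD]. Qed.
Lemma sf_prod (I : Type) (s : seq I) (P : pred I) (f : I -> C) : (forall i, P i -> L (f i)) -> L (\prod_(i <- s | P i) f i).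
Proof. by move=> h; elim/big_ind: _ => //; [exact: sf1|exact: sfM]. Qed.
Lemma sf_horner (p : {poly C}) x : (forall i, L p`_i) -> L x -> L p.[x].
Proof.
move=> hp hx; rewrite horner_coef; apply: sf_sum => i _; apply: sfM => //.
by elim: (i : nat) => [|j IH]; [rewrite expr0; exact: sf1|rewrite exprS; exact: sfM].
Qed.
End Subfields.

Lemma field_adjoin_subfield (C : fieldType) (k S : set C) : is_subfield (field_adjoin k S).
Proof.
split=> [|x y|x y]; first by apply: mem_set => M [hM _]; exact: sf1 hM.
  by move=> /set_mem hx /set_mem hy; apply: mem_set => M [hM sM]; exact: (sfB hM (hx M (conj hM sM)) (hy M (conj hM sM))).
by move=> /set_mem hx /set_mem hy; apply: mem_set => M [hM sM]; exact: (sf_div hM (hx M (conj hM sM)) (hy M (conj hM sM))).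
Qed.

(** * Eigenvector systems attached to CM modules *)

Section EigenSystem.
Context (F : finFieldType) (R : realType) (C : Cinfty F R).
Local Notation th := (theta C).
Local Notation tm := (map_mx (horner_eval th)).
Local Notation K := (ratfun F).
Local Notation kp := (map_poly (ofK C)).

(** The element [w j] and the [c ^+ k * lam] are too many for the rank, so [w j] is a
    [K]-combination of the latter; complex multiplication acts on [V] through [X] at [theta]. *)
Lemma V_lattice r' phi (lam c : C) (X : 'M[{poly C}]_r'.+1) (w : 'I_r'.+1 -> C) :
  drinfeld_module r'.+1 phi -> lam != 0 -> A_free (fun j : 'I_r'.+1 => c ^+ j) ->
  (forall i j k, Kbar C (X i j)`_k) ->
  (forall n, period_lattice phi (c ^+ n * lam) /\
     vrow r'.+1 phi (c ^+ n.+1 * lam) = vrow r'.+1 phi (c ^+ n * lam) *m map_mx (@pfps C) X) ->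
  A_basis (period_lattice phi) w ->
  forall j, exists2 M : 'M[C]_r'.+1, kbM M & V r' phi (w j) = V r' phi lam *m M.
Proof.
move=> hphi lam0 c_free XK X_lam [wL w_free w_span] j.
have Vc n : V r' phi (c ^+ n * lam) = V r' phi lam *m tm X ^+ n.
  elim: n => [|n IH]; first by rewrite expr0 mul1r mulmx1.
  have -> : tm X ^+ n.+1 = tm X ^+ n *m tm X by rewrite exprSr.
  rewrite mulmxA -IH.
  by apply: evm_unique (V_evm _ _) _; rewrite (X_lam n).2; apply: evmM (V_evm _ _) (evm_poly X).
have Va a mu : period_lattice phi mu -> V r' phi (ofA C a * mu) = ofA C a *: V r' phi mu.
  move=> hmu; apply: evm_unique (V_evm _ _) _; rewrite (vrowA hphi a hmu) => i l.
  rewrite [X in evl _ X _]mxE [X in evl _ _ X]mxE; apply: evlM; last exact: V_evm.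
  by rewrite ofAE; exact: evl_poly.
have VD mu nu : V r' phi (mu + nu) = V r' phi mu + V r' phi nu.
  apply: evm_unique (V_evm _ _) _; rewrite vrowD => i l.
  by rewrite [X in evl _ X _]mxE [X in evl _ _ X]mxE; apply: evlD; exact: V_evm.
have V0 : V r' phi 0 = 0.
  by apply: (addrI (V r' phi 0)); rewrite -VD !addr0.
pose b (t : 'I_r'.+2) := if unlift ord0 t is Some k then c ^+ k * lam else w j.
have nf : ~ A_free b.
  move=> fb; have := @free_card F R C r'.+1 r'.+2 w b fb; rewrite ltnn => /(_ _)/negP; apply=> //.
  move=> t; have Lt : period_lattice phi (b t) by rewrite /b; case: unliftP => [k _|_]; [exact: (X_lam k).1|].
  by have [a ->] := w_span _ Lt; exists (fun k => tofrac (a k)).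
have [a [ha [t at0]]] : exists a, \sum_t ofA C (a t) * b t = 0 /\ exists t, a t != 0.
  apply: contrapT => hn; apply: nf => a ha t; apply/eqP; apply: contrapT => /negP at0.
  by apply: hn; exists a; split=> //; exists t.
have {}ha : ofA C (a ord0) * w j + \sum_k ofA C (a (lift ord0 k)) * (c ^+ k * lam) = 0.
  have hb0 : b ord0 = w j by rewrite /b unlift_none.
  have hb k : b (lift ord0 k) = c ^+ k * lam by rewrite /b liftK.
  by rewrite -[RHS]ha [RHS]big_ord_recl hb0; congr (_ + _); apply: eq_bigr => k _; rewrite hb.
have a0 : ofA C (a ord0) != 0.
  apply/eqP => E0; rewrite E0 mul0r add0r in ha.
  have /c_free hz : \sum_(k < r'.+1) ofA C (a (lift ord0 k)) * c ^+ k = 0.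
    apply: (mulIf lam0); rewrite mul0r -[RHS]ha mulr_suml; apply: eq_bigr => k _; by rewrite mulrA.
  case: (unliftP ord0 t) at0 => [k ->|->]; first by rewrite hz eqxx.
  by move/eqP; apply; apply: (@ofA_inj F R C); rewrite E0 /ofA tofrac0 rmorph0.
pose z (k : 'I_r'.+1) := - (ofA C (a ord0))^-1 * ofA C (a (lift ord0 k)).
have zK k : Kbar C (z k) by apply: KbarM; [apply: KbarN; apply: KbarV|]; exact: Kbar_ofA.
exists (horner_mx (tm X) (\sum_k z k *: 'X^k)).
  apply: kbM_horner => [i l|i]; first by rewrite mxE; apply: Kbar_horner => //; exact: Kbar_theta.
  rewrite coef_sum; apply: Kbar_sum => k _; rewrite coefZ coefXn; apply: KbarM => //.
  by case: (_ == _); [exact: Kbar1|exact: Kbar0].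
have -> : horner_mx (tm X) (\sum_k z k *: 'X^k) = \sum_k z k *: tm X ^+ k.
  by rewrite linear_sum; apply: eq_bigr => k _; rewrite linearZ /= rmorphXn /= horner_mx_X.
have := congr1 (V r' phi) ha; rewrite V0 VD (big_morph _ VD V0) Va // => E.
apply: (scalerI a0); apply/eqP; rewrite -subr_eq0 -E; apply/eqP; congr (_ + _).
rewrite mulmx_sumr scaler_sumr -sumrN; apply: eq_bigr => k _.
rewrite (Va _ _ (X_lam k).1) Vc -scalemxAr scalerA -scaleNr; congr (_ *: _).
by rewrite /z mulrA mulrN mulfV // mulN1r opprK.
Qed.

Context (n : nat) (r' : 'I_n -> nat) (phi : 'I_n -> {poly F} -> {poly C}) (lam : 'I_n -> C).
Local Notation Lt := {i : 'I_n & 'I_(r' i).+1}.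

(* Eigenvectors [y] at the points of the CM types, with the only multiplicative relations being
   those between their norms [\prod_k y i k]. *)
Record eigen_system (y : forall i, 'I_(r' i).+1 -> C) (k0 : forall i, 'I_(r' i).+1) : Prop := EigenSystem {
  es_free : forall D (I : finType) (f : I -> Lt -> nat) (a : I -> C),
    (forall i, Kbar C (a i)) -> (forall i, \sum_x f i x <= D)%N ->
    (forall i j (N : 'I_n -> int), \sum_t N t = 0 ->
       (forall t (k : 'I_(r' t).+1), (f i (Tagged _ k))%:Z - (f j (Tagged _ k))%:Z = N t) -> i = j) ->
    \sum_i a i * \prod_x y (tag x) (tagged x) ^+ f i x = 0 -> forall i, a i = 0;
  es_neq0 : forall i k, y i k != 0;
  es_prod : forall i, exists kap cO, [/\ Kbar C kap, kap != 0, evl th (Om C) cO & \prod_k y i k * cO = kap];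
  es_lam : forall i, exists ka, [/\ Kbar C ka, ka != 0 & lam i = ka * y i (k0 i)];
  es_yV : forall i k, exists z, (forall l, Kbar C (z l)) /\ y i k = \sum_l V (r' i) (phi i) (lam i) 0 l * z l;
  es_Vy : forall i (w : 'I_(r' i).+1 -> C), A_basis (period_lattice (phi i)) w -> forall j l,
    exists z, (forall k, Kbar C (z k)) /\ V (r' i) (phi i) (w j) 0 l = \sum_k z k * y i k
}.

Context (phi_dr : forall i, drinfeld_module (r' i).+1 (phi i)).
Context (phi_CM : forall i, is_CM (r' i).+1 (phi i)).
Context (phi_gal : forall i, galois_over_K (endo_field (phi i))).
Context (phi_disj : forall i j, i != j -> endo_field (phi i) `&` endo_field (phi j) = Kset C).
Context (lamL : forall i, period_lattice (phi i) (lam i)) (lam0 : forall i, lam i != 0).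

Lemma inK_endo i c x : endo_field (phi i) c -> inK c x -> endo_field (phi i) x.
Proof.
move=> hc [p ->]; have [sL KL _] := phi_gal i; apply: (sf_horner sL) => // j.
by rewrite coef_map; apply: KL; exists p`_j.
Qed.

Lemma eigen_system_exists : exists y k0, eigen_system y k0.
Proof.
have /dchoice [c0 hc0] := fun i => cm_generator (phi_dr i) (phi_CM i) (phi_gal i).
have /dchoice [d hd] : forall i, exists d : ('I_(r' i).+1 -> {poly F}) * {poly K} * ('I_(r' i).+1 -> C) * 'I_(r' i).+1,
  [/\ d.1.1.2 = 'X^((r' i).+1) - \sum_j tofrac (d.1.1.1 j) *: 'X^j, irreducible_poly d.1.1.2, separable_poly d.1.1.2,
     kp d.1.1.2 = \prod_k ('X - (d.1.2 k)%:P) & d.1.2 d.2 = c0 i /\ forall k, endo_field (phi i) (d.1.2 k)].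
  move=> i; have [hE hg _] := hc0 i.
  have [a [h [rt [k [[_ e] hi hs hp hr]]]]] := galois_roots (ltn0Sn _) (phi_gal i) hg (endo_End hE).
  by exists (a, h, rt, k).
pose rt0 i := (d i).1.2; pose k0 i := (d i).2.
have rt0E i : rt0 i (k0 i) = c0 i by case: (hd i) => _ _ _ _ [].
have [||||||hga [g0 [hga_irr _ [S [ga [s0 [P [hga_sep hga_root _ P_rt P_wt]]]]]]]] :=
  @compositum F R C n (fun i => (r' i).+1) c0 (fun i => (d i).1.1.2) rt0 k0.
- by move=> i; case: (hd i).
- by move=> i; case: (hd i).
- by move=> i; case: (hd i).
- exact: rt0E.
- by move=> i k; case: (hc0 i) => _ _ h; apply: h; case: (hd i) => _ _ _ _ [_ h]; exact: h.
- move=> i j x ij hi hj; have : Kset C x; last by case=> v _ <-; exists v.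
  rewrite -(phi_disj ij); split; [apply: inK_endo hi|apply: inK_endo hj]; apply: endo_End.
    by case: (hc0 i).
  by case: (hc0 j).
have /dchoice [q hq] : forall x : Lt, exists q : {poly F} * {poly {poly F}},
    q.1 != 0 /\ tofrac q.1 *: P (tag x) (tagged x) = map_poly (@tofrac {poly F}) q.2.
  by move=> x; have [a a0 [p hp]] := clear_denom (P (tag x) (tagged x)); exists (a, p).
(* A common denominator of the polynomials expressing the conjugates in the primitive element. All
   roots are scaled by it, and by the factor of [cm_matrix], so that [ro] has coefficients in
   [F[t]]. *)
pose b := \prod_x (q x).1.
have b0 : b != 0 by apply/prodf_neq0 => x _; case: (hq x).
pose ro0 x := (\prod_(x' | x' != x) (q x').1)%:P * (q x).2.
have ro0E x : map_poly (@tofrac {poly F}) (ro0 x) = tofrac b *: P (tag x) (tagged x).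
  rewrite /ro0 rmorphM /= map_polyC -(hq x).2 mul_polyC scalerA -rmorphM; congr (tofrac _ *: _).
  by rewrite mulrC /b [RHS](bigD1 x).
have [ah ah0 [h0 hh0]] := clear_denom hga.
have tf0 (a : {poly F}) : a != 0 -> tofrac a != 0 :> K by move=> h; rewrite tofrac_eq0.
have h0_irr : irreducible_poly (map_poly (@tofrac {poly F}) h0).
  by rewrite -hh0; apply: irreducible_polyZ => //; apply: tf0.
have h0_sep : separable_poly (map_poly (@tofrac {poly F}) h0).
  by rewrite -hh0 (eqp_separable (eqp_scale _ (tf0 _ ah0))).
have EVAE s p : EVA (ga s) p = (kp (map_poly (@tofrac {poly F}) p)).[ga s] by rewrite kp_tofrac.
have h0_root s : EVA (ga s) h0 = 0.
  by rewrite EVAE -hh0 map_polyZ hornerZ; have /eqP -> := hga_root s; rewrite mulr0.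
have ofA0 (a : {poly F}) : a != 0 -> ofA C a != 0 by move=> h; rewrite fmorph_eq0 tf0.
have ro0V s i (k : 'I_(r' i).+1) : EVA (ga s) (ro0 (Tagged _ k)) = ofA C b * (kp (P i k)).[ga s].
  by rewrite EVAE ro0E map_polyZ hornerZ.
have /dchoice [pX hpX] : forall i, exists pX : {poly F} * 'M[{poly C}]_((r' i).+1), [/\ pX.1 != 0,
  forall l j k, Kbar C (pX.2 l j)`_k, Bm (r' i).+1 (phi i) *m map_mx (map_poly (@frn F R C 1)) pX.2 = pX.2 *m Bm (r' i).+1 (phi i),
  A_free (fun j : 'I_(r' i).+1 => (ofA C pX.1 * (ofA C b * c0 i)) ^+ j) &
  forall m, period_lattice (phi i) ((ofA C pX.1 * (ofA C b * c0 i)) ^+ m * lam i) /\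
   vrow (r' i).+1 (phi i) ((ofA C pX.1 * (ofA C b * c0 i)) ^+ m.+1 * lam i) =
   vrow (r' i).+1 (phi i) ((ofA C pX.1 * (ofA C b * c0 i)) ^+ m * lam i) *m map_mx (@pfps C) pX.2].
  move=> i; have [hE hg _] := hc0 i; have hg' := generator_scale b0 hg; have [fr [a ha]] := hg'.
  have [p [X [p0 XK XB XL]]] := cm_matrix (phi_dr i) (lamL i) (EndA (phi_dr i) b hE) (lam0 i) ha fr.
  by exists (p, X); split=> //; case: (generator_scale p0 hg').
pose X i := (pX i).2; pose be i := (pX i).1 * b.
pose c i := ofA C (pX i).1 * (ofA C b * c0 i).
have be0 i : ofA C (be i) != 0 by apply: ofA0; rewrite mulf_neq0 //; case: (hpX i).
have ofAM (x y : {poly F}) : ofA C (x * y) = ofA C x * ofA C y by exact: rmorphM.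
pose rt i (k : 'I_(r' i).+1) := ofA C (be i) * rt0 i k.
have rt_k0 i : rt i (k0 i) = c i by rewrite /rt /c rt0E /be ofAM mulrA.
pose ro i (k : 'I_(r' i).+1) := (pX i).1%:P * ro0 (Tagged _ k).
have roV s i k : EVA (ga s) (ro i k) = ofA C (be i) * (kp (P i k)).[ga s].
  by rewrite /ro rmorphM /= EVA_C ro0V mulrA /be ofAM.
have ro_rt i k : EVA (ga s0) (ro i k) = rt i k by rewrite roV P_rt.
pose hA i : {poly {poly F}} := 'X^((r' i).+1) - \sum_j ((d i).1.1.1 j * be i ^+ ((r' i).+1 - j)) *: 'X^j.
have hA_split i : map_poly (ofA C) (hA i) = \prod_k ('X - (rt i k)%:P).
  case: (hd i) => eh _ _ hp _; rewrite -(scale_roots (a := fun j => ofA C ((d i).1.1.1 j)) (be0 i)); last first.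
    rewrite -[RHS]hp eh rmorphB /= map_polyXn rmorph_sum; congr (_ - _).
    by apply: eq_bigr => j _; rewrite /= map_polyZ map_polyXn.
  rewrite /hA rmorphB /= map_polyXn rmorph_sum; congr (_ - _).
  apply: eq_bigr => j _; rewrite /= map_polyZ map_polyXn; congr (_ *: _).
  by rewrite rmorphM rmorphXn.
have rt0_inj i : injective (rt0 i).
  case: (hd i) => _ _ hs hp _; have : separable_poly (kp (d i).1.1.2) by rewrite separable_map.
  by rewrite hp prod_seqX separable_prod_XsubC => h; apply/injectiveP.
have rt_inj i : injective (rt i) by move=> k l /(mulfI (be0 i)) /rt0_inj.
have rt_K i k : Kbar C (rt i k).
  apply: KbarM; first exact: Kbar_ofA.
  case: (hd i) => _ hi _ hp _; exists (d i).1.1.2; first exact: irredp_neq0 hi.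
  by rewrite hp; exact: root_prodX.
have hA_size i : size (hA i) = (r' i).+2.
  rewrite -(size_map_inj_poly (@ofA_inj F R C)) ?rmorph0 // hA_split prod_seqX size_prod_XsubC.
  by rewrite size_map size_enum_ord.
have hA_mon i : hA i \is monic.
  rewrite monicE; apply/eqP; apply: (@ofA_inj F R C).
  have := lead_coef_map_inj (@ofA_inj F R C) (rmorph0 _) (hA i); rewrite hA_split => <-.
  by rewrite (monicP (monic_prod_XsubC _ _ _)) [RHS]rmorph1.
have /dchoice [w hw] : forall i, exists w : 'I_(r' i).+1 -> 'cV[C]_((r' i).+1), [/\ forall k, kbM (w k),
    forall k, tm (X i) *m w k = rt i k *: w k & forall k, (V (r' i) (phi i) (lam i) *m w k) 0 0 != 0].
  move=> i; case: (hpX i) => p0 XK XB fr XL.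
  exact: (eigenvectors (phi_dr i) (lam0 i) fr XK XL (hA_size i) (rt_k0 i) (rt_K i) (hA_split i)).
have cmd i : cm_data (phi i) (lam i) (X i) (hA i) (rt i) (k0 i) (uv (w i)).
  case: (hpX i) => p0 XK XB fr XL; case: (hw i) => wK weig wV; split=> //.
  - exact: (hX0 (phi_dr i) (lam0 i) fr XL (rt_k0 i) (hA_split i)).
  - by rewrite rt_k0; exact: (gcol_eig (phi_dr i) (lam0 i) fr XL).
  - exact: (Qt_det (rt_inj i) weig wV).
  - exact: uv_Kbar.
pose y i := yv (phi i) (lam i) (X i) (rt i) (w i).
have y0 i k : y i k != 0 by case: (hw i) => _ weig wV; exact: yv_neq0.
exists y, k0; split=> //.
- move=> D I f a aK fD finj rel.
  have /dchoice [ms hms] := fun i => word_of_exponents (fD i).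
  have lwE s i (k : 'I_(r' i).+1) : lw rt k0 ga ro s (Some (Tagged _ k)) = ((kp (P i k)).[ga s] == c0 i).
    by rewrite /lw /= roV /rt rt0E (inj_eq (mulfI (be0 i))).
  apply: (@letter_words_free F R C n r' phi lam X hA rt k0 (fun i => uv (w i)) cmd S ga s0 h0
     h0_root h0_irr h0_sep ro ro_rt D I ms a) => //.
  + by case=> [[i k]|] /=; [exact: y0|exact: oner_neq0].
  + move=> i j hs.
    (* Equal weights at every element of the Galois group are exactly the hypothesis of [P_wt] for
       the exponent differences, which are therefore constant on each block. *)
    pose Nw t (k : 'I_(r' t).+1) := (f i (Tagged _ k))%:Z - (f j (Tagged _ k))%:Z.
    have hN s : \sum_t \sum_(k < (r' t).+1) (if (kp (P t k)).[ga s] == c0 t then Nw t k else 0) = 0.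
      pose G x : nat := lw rt k0 ga ro s x.
      have E1 i' : (\sum_t lw rt k0 ga ro s (ms i' t) = \sum_x G (Some x) * f i' x)%N := (hms i').2 G erefl.
      have := hs s; rewrite !E1 => /(congr1 (fun m : nat => m%:Z)) E.
      have sE i' : (\sum_x G (Some x) * f i' x)%N%:Z =
          \sum_t \sum_(k < (r' t).+1) (if (kp (P t k)).[ga s] == c0 t then (f i' (Tagged _ k))%:Z else 0).
        rewrite -[LHS]/(Posz _) (big_morph Posz PoszD (erefl _)) big_Lt; apply: eq_bigr => t _; apply: eq_bigr => k _.
        by rewrite /G lwE; case: (_ == _); rewrite ?mul1n ?mul0n.
      rewrite !sE in E; pose A i' : int := \sum_t \sum_(k < (r' t).+1)
        (if (kp (P t k)).[ga s] == c0 t then (f i' (Tagged _ k))%:Z else 0).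
      have EA : A i = A j by exact: E.
      (* The constants of the blocks add up to 0: at [s0] each block contributes only its letter
         [k0 t]. *)
      transitivity (A i - A j); last by rewrite EA subrr.
      rewrite /A -sumrB; apply: eq_bigr => t _; rewrite -sumrB; apply: eq_bigr => k _.
      by rewrite /Nw; case: (_ == _); rewrite ?subr0.
    apply: (finj i j (fun t => Nw t (k0 t))) => [|t k]; last exact: (P_wt _ hN).
    have := hN s0; rewrite (eq_bigr (fun t => Nw t (k0 t))) // => t _.
    rewrite (bigD1 (k0 t)) //= P_rt rt0E eqxx big1 ?addr0 // => k kk.
    by rewrite P_rt -rt0E (inj_eq (@rt0_inj t)) (negPf kk).
  + rewrite -[RHS]rel; apply: eq_bigr => i _; congr (_ * _).
    by rewrite ((hms i).1 C (yL phi lam X rt (fun i => uv (w i)))).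
- move=> i; case: (hpX i) => p0 XK XB fr XL; case: (hw i) => wK weig wV.
  exact: (yv_prod (phi_dr i) (lam0 i) fr XK XL (@rt_inj i) (rt_K i) wK weig wV).
- move=> i; case: (hpX i) => p0 XK XB fr XL; case: (hw i) => wK weig wV.
  exact: (lam_yv (phi_dr i) (lam0 i) fr XK XL (@rt_inj i) (rt_k0 i) (rt_K i) wK weig wV).
- move=> i k; case: (hpX i) => p0 XK XB fr XL; case: (hw i) => wK weig wV.
  exists (fun l => (horner_mx (tm (X i)) (Lc (rt i) k) *m uv (w i)) l 0); split.
    move=> l; apply: kbM_mul (uv_Kbar wK) _ _; apply: kbM_horner => [a1 a2|t].
      by rewrite mxE; apply: Kbar_horner => //; exact: Kbar_theta.
    exact: Lc_Kbar (rt_K i) _ _.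
  by rewrite /y /yv -mulmxA [LHS]mxE.
- move=> i v hv j l; case: (hpX i) => p0 XK XB fr XL; case: (hw i) => wK weig wV.
  have [M MK ->] := V_lattice (phi_dr i) (lam0 i) fr XK XL hv j.
  have /boolp.choice [z hz] : forall t, exists z, (forall k, Kbar C (z k)) /\
      V (r' i) (phi i) (lam i) 0 t = \sum_k z k * y i k.
    by move=> t; have [z zK hz] := V_span XK (@rt_inj i) (rt_K i) wK weig wV t; exists z.
  exists (fun k => \sum_t z t k * M t l); split.
    by move=> k; apply: Kbar_sum => t _; apply: KbarM; [exact: (hz t).1|exact: MK].
  rewrite [LHS]mxE (eq_bigr (fun t => \sum_k z t k * M t l * y i k)); last first.
    by move=> t _; rewrite (hz t).2 mulr_suml; apply: eq_bigr => k _; rewrite mulrAC.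
  by rewrite exchange_big; apply: eq_bigr => k _; rewrite mulr_suml.
Qed.
End EigenSystem.

(** * Transcendence degrees *)

(** Reads a multivariate polynomial as a finite family of distinct exponent vectors with
    coefficients. *)
Lemma alg_independentP (C : fieldType) (k : C -> Prop) d (b : 'I_d -> C) :
  (forall (I : finType) (m : I -> 'I_d -> nat) (a : I -> C), (forall i j, m i =1 m j -> i = j) ->
     (forall i, k (a i)) -> \sum_i a i * \prod_t b t ^+ m i t = 0 -> forall i, a i = 0) ->
  alg_independent k b.
Proof.
move=> h p pk E; apply/mpoly.mpolyP => m; rewrite mpoly.mcoeff0.
pose T := mpoly.mpoly_multinom__canonical__eqtype_Equality d; pose s : seq T := mpoly.msupp p.
have [mp|mp] := boolP ((m : T) \in s); last exact: (mpoly.memN_msupp_eq0 mp).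
have H : forall i : 'I_(size s), mpoly.mcoeff (nth (m : T) s i) p = 0.
  apply: (h _ (fun (i : 'I_(size s)) t => mpoly.fun_of_multinom (nth (m : T) s i) t)).
  - move=> i j e; apply: val_inj; apply/eqP.
    rewrite -(nth_uniq (m : T) (ltn_ord i) (ltn_ord j) (mpoly.msupp_uniq p)).
    by apply/eqP/mpoly.mnmP => t; exact: e.
  - by move=> i; exact: pk.
  - by rewrite -[RHS]E mpoly.mevalE (big_nth (m : T)) big_mkord.
have ms : (index (m : T) s < size s)%N by rewrite index_mem.
have e := nth_index (m : T) mp.
exact: (eq_trans (congr1 (fun z => mpoly.mcoeff z p) (esym e)) (H (Ordinal ms))).
Qed.

Section FieldAdjoin.
Context (C : fieldType) (k S : set C).
Lemma adjoin_base x : k x -> field_adjoin k S x.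
Proof. by move=> h M [_ sM]; apply: sM; left. Qed.
Lemma adjoin_gen x : S x -> field_adjoin k S x.
Proof. by move=> h M [_ sM]; apply: sM; right. Qed.
Lemma algebraic_self L x : is_subfield L -> L x -> algebraic_over L (x : C).
Proof.
move=> sL Lx; exists ('X - x%:P); split; rewrite ?polyXsubC_eq0 ?root_XsubC // => i.
rewrite coefB coefX coefC; apply: (sfB sL); first by case: (_ == _); [exact: sf1|exact: sf0].
by case: (_ == _); [|exact: sf0].
Qed.
End FieldAdjoin.

Lemma prod_Lt (A : comNzRingType) n (r' : 'I_n -> nat) (f : {i : 'I_n & 'I_(r' i).+1} -> A) :
  \prod_x f x = \prod_i \prod_(k < (r' i).+1) f (Tagged (fun i => 'I_(r' i).+1) k).
Proof.
rewrite (sig_big_dep (fun=> true) (fun _ _ => true) (fun i k => f (Tagged (fun i => 'I_(r' i).+1) k))) /=.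
by apply: eq_bigr => -[].
Qed.

Lemma eigen_solve (E : fieldType) (y p c q : E) : p != 0 -> c != 0 -> q != 0 ->
  y = y * p * c * (q / (q * c)) / p.
Proof. by move=> p0 c0 q0; field; rewrite p0 c0 q0. Qed.

Section Trdeg.
Context (F : finFieldType) (R : realType) (C : Cinfty F R).
Local Notation th := (theta C).
Context (n : nat) (n_gt0 : (0 < n)%N) (r' : 'I_n -> nat) (phi : 'I_n -> {poly F} -> {poly C}).
Context (phi_dr : forall i, drinfeld_module (r' i).+1 (phi i)).
Context (phi_CM : forall i, is_CM (r' i).+1 (phi i)).
Context (phi_gal : forall i, galois_over_K (endo_field (phi i))).
Context (phi_disj : forall i j, i != j -> endo_field (phi i) `&` endo_field (phi j) = Kset C).
Local Notation Lt := {i : 'I_n & 'I_(r' i).+1}.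
Let i0 : 'I_n := Ordinal n_gt0.

Lemma V_qp i mu : V (r' i) (phi i) mu = \row_l qp (r' i).+1 (phi i) l.+1 mu.
Proof.
apply: evm_unique (V_evm _ _) _ => j l; rewrite [X in evl _ X _]mxE [X in evl _ _ X]mxE.
exact: agf_evl.
Qed.

Lemma period_lambda i mu : period_lattice (phi i) mu ->
  \sum_l V (r' i) (phi i) mu 0 l * dcoef (phi i) l.+1 = - mu.
Proof.
move=> hmu; have := congr1 (fun M : 'M[C]_1 => M 0 0) (vrow_gcol (phi_dr i) hmu (V_evm _ _)).
rewrite [RHS]mxE mulr1n => <-; rewrite [RHS]mxE; apply: eq_bigr => l _; congr (_ * _).
by rewrite [RHS]mxE.
Qed.

Lemma period_entry0 i (w : 'I_(r' i).+1 -> C) j : period_matrix (phi i) w j ord0 = - w j.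
Proof. by rewrite mxE. Qed.
Lemma period_entryS i (w : 'I_(r' i).+1 -> C) j (k l : 'I_(r' i).+1) : (k = l.+1 :> nat) ->
  period_matrix (phi i) w j k = V (r' i) (phi i) (w j) 0 l.
Proof. by move=> E; rewrite mxE E /= V_qp mxE (quasi_periodicE (phi_dr i)). Qed.

(** The transcendence basis keeps all letters of block [i0] and drops the letter [k0 i] from every
    other block: the norms coincide up to algebraic factors, so each further block brings one
    relation. *)
Lemma card_Lt_basis (k0 : forall i, 'I_(r' i).+1) :
  (\sum_i (r' i).+1 - (n - 1))%N = #|[pred x : Lt | (tag x == i0) || (tagged x != k0 (tag x))]|.
Proof.
have -> : #|[pred x : Lt | (tag x == i0) || (tagged x != k0 (tag x))]| =
    (\sum_i \sum_(k < (r' i).+1) ((i == i0) || (k != k0 i)))%N.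
  rewrite -sum1_card big_mkcond /=.
  rewrite (sig_big_dep (fun=> true) (fun _ _ => true) (fun i k => nat_of_bool ((i == i0) || (k != k0 i)))) /=.
  by apply: eq_bigr => x _; rewrite inE /=; case: ifP.
have E1 : (\sum_i (r' i).+1 = n + \sum_i r' i)%N.
  rewrite (eq_bigr (fun i => 1 + r' i)%N) // big_split /= sum1_card card_ord //.
have E2 : (\sum_(i < n) (i == i0) = 1)%N by rewrite (bigD1 i0) //= ?eqxx big1 // => i /negPf ->.
transitivity (\sum_i ((i == i0) + r' i))%N; first by rewrite E1 big_split /= E2; lia.
apply: eq_bigr => i _; have [->|ii0] := eqVneq i i0.
  by rewrite [RHS](eq_bigr (fun=> 1%N)) ?sum1_card ?card_ord ?add1n // => k _; rewrite ?eqxx.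
rewrite [RHS](bigD1 (k0 i)) //= eqxx /= !add0n [RHS](eq_bigr (fun=> 1%N)) => [|k kk]; last by rewrite kk.
by have := sum1_card 'I_(r' i).+1; rewrite (bigD1 (k0 i)) //= card_ord add1n => -[h]; exact: esym h.
Qed.

Lemma period_matrix_trdeg (w : forall i, 'I_(r' i).+1 -> C) :
  (forall i, A_basis (period_lattice (phi i)) (w i)) ->
  has_trdeg (Kbar C) (field_adjoin (Kbar C) [set x | exists i j k, x = period_matrix (phi i) (w i) j k])
    (\sum_i (r' i).+1 - (n - 1))%N.
Proof.
move=> hw.
have wL i j : period_lattice (phi i) (w i j) by case: (hw i).
have w0 i : w i ord0 != 0.
  apply/eqP => E; case: (hw i) => _ fr _.
  have := fr (fun j => (j == ord0)%:R) _ ord0; rewrite eqxx => h.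
  suff /h/eqP : \sum_j ofA C (j == ord0)%:R * w i j = 0 by rewrite oner_eq0.
  rewrite (bigD1 ord0) //= E mulr0 add0r big1 // => j /negPf ->.
  by rewrite /ofA tofrac0 rmorph0 mul0r.
have [y [k0 es]] := eigen_system_exists phi_dr phi_CM phi_gal phi_disj (fun i => wL i ord0) w0.
rewrite (card_Lt_basis k0).
set B := [pred x : Lt | _].
pose b (t : 'I_#|B|) := y (tag (enum_val t)) (tagged (enum_val t)).
set ents := [set x | _]; set L := field_adjoin _ ents.
have sL : is_subfield L := field_adjoin_subfield _ _.
have KL x : Kbar C x -> L x by apply: adjoin_base.
have entL i j k : L (period_matrix (phi i) (w i) j k) by apply: adjoin_gen; exists i, j, k.
have VL i l : L (V (r' i) (phi i) (w i ord0) 0 l).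
  have [lr|lr] := ltnP l.+1 (r' i).+1.
    by rewrite -(@period_entryS i (w i) ord0 (Ordinal lr)).
  have -> : l = ord_max by apply: val_inj; apply/eqP; rewrite eqn_leq -ltnS ltn_ord.
  have VLs m : (m < r' i)%N -> forall m' : 'I_(r' i).+1, m' = m :> nat -> L (V (r' i) (phi i) (w i ord0) 0 m').
    move=> mr m' E; have mr' : (m'.+1 < (r' i).+1)%N by rewrite E.
    by rewrite -(@period_entryS i (w i) ord0 (Ordinal mr')).
  (* The period matrix stops at the twist [r' i]; the value of the last twist follows from the
     period itself, because the leading coefficient of [phi i] is nonzero. *)
  have := period_lambda (wL i ord0); rewrite big_ord_recr /=.
  have g0 := dcoef_lead (phi_dr i).
  move/(canRL (addKr _)) => E.
  rewrite -[V _ _ _ 0 ord_max](mulfK g0) E; apply: (sf_div sL); last by apply: KL; exact: dcoef_Kbar (phi_dr i) _.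
  apply: (sfD sL); last by rewrite -(period_entry0 (w i)).
  apply: (sfN sL).
  apply: (sf_sum sL) => m _; apply: (sfM sL); first exact: (VLs m).
  by apply: KL; exact: dcoef_Kbar (phi_dr i) _.
have yL i k : L (y i k).
  have [z [zK ->]] := es_yV es k; apply: (sf_sum sL) => l _; apply: (sfM sL) => //; exact: KL.
exists b; split.
- by move=> t; exact: yL.
- apply: alg_independentP => I m a minj aK E.
  pose f i (x : Lt) := (\sum_(t | enum_val t == x) m i t)%N.
  have fE i t : f i (enum_val t) = m i t.
    by rewrite /f (big_pred1 t) // => t'; rewrite (inj_eq enum_val_inj).
  have fN i x : ~~ B x -> f i x = 0%N.
    by move=> Bx; rewrite /f big_pred0 // => t; apply: contraNF Bx => /eqP <-; exact: (enum_valP t).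
  apply: (es_free es (D := \sum_i \sum_x f i x) (f := f)) => // [i|i j N N0 hN|].
  + by rewrite (bigD1 i) //= leq_addr.
  (* The dropped letter of block [t] has exponent 0 in both monomials, so the constant of that block
     is 0; the sum condition then settles block [i0]. *)
  + have Nz t : t != i0 -> N t = 0.
      move=> tt; rewrite -(hN t (k0 t)) !fN ?subr0 //; by rewrite /B /= eqxx orbF.
    have Nz' t : N t = 0.
      have [->|/Nz //] := eqVneq t i0.
      by move: N0; rewrite (bigD1 i0) //= big1 ?addr0.
    apply: minj => t; rewrite -!fE; case: (enum_val t) => u k.
    by apply/eqP; have := hN u k; rewrite Nz' => /eqP; rewrite subr_eq0.
  + rewrite -[RHS]E; apply: eq_bigr => i _; congr (_ * _).
    rewrite [RHS](partition_big enum_val predT) //=; apply: eq_bigr => x _.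
    by rewrite /f -prodrXr; apply: eq_bigr => t /eqP <-.
have sL' : is_subfield (field_adjoin (Kbar C) (range b)) := field_adjoin_subfield _ _.
have KL' x : Kbar C x -> field_adjoin (Kbar C) (range b) x by apply: adjoin_base.
set L' := field_adjoin (Kbar C) (range b) in sL' KL' *.
have yB x : B x -> L' (y (tag x) (tagged x)).
  by move=> Bx; apply: adjoin_gen; exists (enum_rank_in Bx x) => //; rewrite /b enum_rankK_in.
have yB' i (k : 'I_(r' i).+1) : (i == i0) || (k != k0 i) -> L' (y i k).
  exact: (yB (Tagged (fun i => 'I_(r' i).+1) k)).
have yL' i k : L' (y i k).
  have [|] := boolP ((i == i0) || (k != k0 i)); first exact: yB'.
  rewrite negb_or negbK => /andP [_ /eqP ->].
  (* The dropped letter is recovered by comparing the norm of its block with the norm of block [i0],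
     both algebraic multiples of the inverse of [Om(theta)]. *)
  have [kap [cO [kK kn eO E]]] := es_prod es i; have [kap' [cO' [kK' kn' eO' E']]] := es_prod es i0.
  have EO : cO' = cO by exact: evl_unique eO' eO.
  rewrite EO (bigD1 (k0 i)) //= in E' E.
  have p0 : \prod_(k < (r' i).+1 | k != k0 i) y i k != 0 by apply/prodf_neq0 => t _; exact: es_neq0 es _ _.
  have -> : y i (k0 i) = kap * ((\prod_k y i0 k) / kap') / \prod_(k < (r' i).+1 | k != k0 i) y i k.
    rewrite -E -E'; have c0 : cO != 0 by apply: contraNneq kn => c0; rewrite -E c0 mulr0.
    have q0 : \prod_k y i0 k != 0 by apply/prodf_neq0 => t _; exact: es_neq0 es _ _.
    exact: eigen_solve.
  apply: (sf_div sL').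
    apply: (sfM sL'); first exact: KL'.
    apply: (sf_div sL'); last exact: KL'.
    by apply: (sf_prod sL') => t _; apply: yB'; rewrite eqxx.
  by apply: (sf_prod sL') => t tk; apply: yB'; rewrite tk orbT.
have VL' i j l : L' (V (r' i) (phi i) (w i j) 0 l).
  have [z [zK ->]] := es_Vy es (hw i) j l; apply: (sf_sum sL') => t _; apply: (sfM sL') => //; exact: KL'.
move=> x Lx; apply: algebraic_self => //; apply: (smallest_sub sL') Lx => {}x [/KL' //|[i [j [k ->]]]].
have [->|k00] := eqVneq k ord0.
  rewrite period_entry0 -(period_lambda (wL i j)); apply: (sf_sum sL') => l _; apply: (sfM sL') => //.
  by apply: KL'; exact: dcoef_Kbar (phi_dr i) _.
have kp : (k.-1.+1 = k)%N by rewrite prednK // lt0n; apply: contraNneq k00 => E; apply/eqP; exact: val_inj.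
have kl : (k.-1 < (r' i).+1)%N by rewrite ltnW // kp.
by rewrite (@period_entryS i (w i) j k (Ordinal kl)) //=.
Qed.

Lemma carlitz_ratio_trdeg (pi_tilde : C) (lambda : 'I_n -> C) : (forall i, 0 < r' i)%N ->
  is_carlitz_period pi_tilde ->
  (forall i, period_lattice (phi i) (lambda i) /\ lambda i != 0) ->
  has_trdeg (Kbar C) (field_adjoin (Kbar C) (range (fun i => lambda i / pi_tilde))) n.
Proof.
move=> r_gt0 hpi hl.
have [y [k0 es]] := eigen_system_exists phi_dr phi_CM phi_gal phi_disj (fun i => (hl i).1) (fun i => (hl i).2).
exists (fun i => lambda i / pi_tilde); split.
- by move=> i; apply: adjoin_gen; exists i.
- apply: alg_independentP => I m a minj aK E.
  have /dchoice [ka hka] := es_lam es.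
  have [kap [cO [kK kn eO EO]]] := es_prod es i0.
  have [v hv Epi] := Om_pi hpi eO.
  pose Y0 := \prod_k y i0 k.
  have Y00 : Y0 != 0 by apply/prodf_neq0 => t _; exact: es_neq0 es _ _.
  have q1 : (1 < #|F|)%N := q_gt1 F.
  have v0 : v != 0.
    apply/eqP => v0; move: hv; rewrite v0 expr0n subn_eq0 leqNgt q1 /= => /eqP.
    by rewrite eq_sym oppr_eq0 (negPf (theta_neq0 C)).
  have vK : Kbar C v.
    exists ('X^(#|F| - 1) + (tofrac 'X)%:P); first by rewrite -size_poly_eq0 size_addl size_polyXn // size_polyC; case: (_ != _); rewrite ?ltnS ?subn_gt0.
    by rewrite rootE rmorphD /= map_polyXn map_polyC hornerD hornerXn hornerC hv addNr.
  have cO0 : cO != 0 by apply: contraNneq kn => c0; rewrite -EO c0 mulr0.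
  pose ep t := ka t * kap / - v ^+ #|F|.
  have vq : - v ^+ #|F| != 0 by rewrite oppr_eq0 expf_neq0.
  have epK t : Kbar C (ep t).
    apply: KbarM; first by apply: KbarM => //; case: (hka t).
    by apply: KbarV; apply: KbarN; apply: KbarX.
  have ep0 t : ep t != 0 by rewrite !mulf_neq0 ?invr_eq0 //; case: (hka t).
  have pi0 : pi_tilde != 0 by apply: contraNneq vq => p0; rewrite -Epi p0 mul0r.
  (* Both [pi_tilde] and the norm [Y0] of block [i0] are algebraic multiples of the inverse of
     [Om(theta)]. *)
  have lE t : lambda t / pi_tilde = ep t * (y t (k0 t) / Y0).
    case: (hka t) => _ _ ->; rewrite /ep -Epi -EO -/Y0.
    by move: Y00 cO0 pi0; move: Y0 => Q Q0 c0 p0; field; rewrite Q0 c0 p0.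
  pose Di i := (\sum_t m i t)%N; pose D := (\sum_i Di i)%N.
  have DiD i : (Di i <= D)%N by rewrite /D (bigD1 i) //= leq_addr.
  (* After multiplication by [Y0 ^+ D] the powers of [Y0] in the denominators turn into [D - Di i]
     extra copies of every letter of block [i0]. *)
  pose e i t := if t == i0 then (D - Di i)%N else 0%N.
  pose f i (x : Lt) := ((if tagged x == k0 (tag x) then m i (tag x) else 0) + e i (tag x))%N.
  have fP i : \prod_x y (tag x) (tagged x) ^+ f i x = (\prod_t y t (k0 t) ^+ m i t) * Y0 ^+ (D - Di i).
    rewrite prod_Lt /=; under eq_bigr => t _ do under eq_bigr => k _ do rewrite /f /= exprD.
    under eq_bigr => t _ do rewrite big_split /=.
    rewrite big_split /=; congr (_ * _).
      apply: eq_bigr => t _; rewrite (bigD1 (k0 t)) //= eqxx big1 ?mulr1 // => k /negPf ->.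
      by rewrite expr0.
    rewrite (bigD1 i0) //= [X in _ * X]big1 ?mulr1 => [|t /negPf tt]; last first.
      by apply: big1 => k _; rewrite /e tt expr0.
    by rewrite /e eqxx prodrXl.
  pose a' i := a i * \prod_t ep t ^+ m i t.
  have pn i : \prod_t ep t ^+ m i t != 0 by apply/prodf_neq0 => t _; rewrite expf_neq0.
  suff a'0 i : a' i = 0.
    by move=> i; apply/eqP; have /eqP := a'0 i; rewrite mulf_eq0 (negPf (pn i)) orbF.
  move: i; apply: (es_free es (D := \sum_i \sum_x f i x) (f := f)) => [i|i|i j N N0 hN|].
  + apply: KbarM => //; elim/big_rec: _ => [|t z _ hz]; first exact: Kbar1.
    by apply: KbarM => //; apply: KbarX.
  + by rewrite (bigD1 i) //= leq_addr.
  + apply: minj => t.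
    (* Rank at least 2 provides a second letter in the block; its exponent contains only the extra
       copies, so comparison with [k0 t] isolates [m i t]. *)
    have [k hk] : exists k, k != k0 t.
      have : (0 < #|predC1 (k0 t)|)%N by rewrite cardC1 card_ord; exact: r_gt0.
      by case/card_gt0P => k; rewrite inE; exists k.
    have := hN t k; have := hN t (k0 t); rewrite /f /= eqxx (negPf hk) add0n => <- E2.
    by move: (e i t) (e j t) E2 => x z; lia.
  + rewrite -[RHS](mulr0 (Y0 ^+ D)) -[X in _ = _ * X]E mulr_sumr; apply: eq_bigr => i _.
    rewrite fP /a' [X in _ = _ * (_ * X)](eq_bigr (fun t => (ep t * (y t (k0 t) / Y0)) ^+ m i t)) => [|t _]; last by rewrite lE.
    have -> : \prod_t (ep t * (y t (k0 t) / Y0)) ^+ m i t =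
        (\prod_t ep t ^+ m i t) * (\prod_t y t (k0 t) ^+ m i t) * (Y0 ^+ Di i)^-1.
      rewrite -exprVn -prodrXr -!big_split /=; apply: eq_bigr => t _.
      by rewrite !exprMn mulrA.
    rewrite -[in RHS](subnK (DiD i)) exprD.
    have : Y0 ^+ Di i != 0 by rewrite expf_neq0.
    by move: (Y0 ^+ Di i) (Y0 ^+ (D - Di i)) => Q1 Q2 Q0; field.
- by move=> x Lx; apply: algebraic_self Lx; exact: field_adjoin_subfield.
Qed.
End Trdeg.

Theorem theorem4p3 (F : finFieldType) (R : realType) (C : Cinfty F R)
    (n : nat) (n_gt0 : (0 < n)%N) (r : 'I_n -> nat)
    (r_ge2 : forall i, (2 <= r i)%N)
    (phi : 'I_n -> {poly F} -> {poly C})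
    (phi_drinfeld : forall i, drinfeld_module (r i) (phi i))
    (phi_CM : forall i, is_CM (r i) (phi i))
    (phi_galois : forall i, galois_over_K (endo_field (phi i)))
    (phi_disjoint : forall i j, i != j ->
       endo_field (phi i) `&` endo_field (phi j) = Kset C) :
  (forall w : forall i, 'I_(r i) -> C,
     (forall i, A_basis (period_lattice (phi i)) (w i)) ->
     has_trdeg (Kbar C)
       (field_adjoin (Kbar C)
          [set x | exists i j k, x = period_matrix (phi i) (w i) j k])
       (\sum_i r i - (n - 1))%N) /\
  (forall (pi_tilde : C) (lambda : 'I_n -> C),
     is_carlitz_period pi_tilde ->
     (forall i, period_lattice (phi i) (lambda i) /\ lambda i != 0) ->
     has_trdeg (Kbar C)
       (field_adjoin (Kbar C) (range (fun i => lambda i / pi_tilde)))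
       n).
Proof.
have [r' hr] : exists r', r = fun i => (r' i).+1.
  by exists (fun i => (r i).-1); apply: funext => i; rewrite prednK // ltnW.
subst r; split=> [w hw|p lambda hp hl].
  exact: (period_matrix_trdeg n_gt0 phi_drinfeld phi_CM phi_galois phi_disjoint hw).
exact: (carlitz_ratio_trdeg n_gt0 phi_drinfeld phi_CM phi_galois phi_disjoint r_ge2 hp hl).
Qed.
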